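(* Assume that there exists an oracle-polynomial-time algorithm for the problem Approx-Conic-Dual that, for any $n\in\mathbb{N}$ and $\varepsilon>0$, performs at most $\mathcal{T}_o(n,\varepsilon)$ oracle calls and $\mathcal{T}_a(n,\varepsilon)$ arithmetic operations, and let $\tau(n)$ be (a bound on) the size of the $\varepsilon$-approximate conic Farkas certificate returned. Let $K=\{x\in\mathbb{R}^n: Mx\ge0\}$ with $M\in\mathbb{R}^{m\times n}$, whose $i$-th row is $m_i^\top$. Then: (i) Given a polyhedral conic separation oracle for $K_1=\{x\in\mathbb{R}^n: Mx\ge0,\ m_1^\top x>0\}$, the strong conic feasibility problem can be solved using $O(n)\cdot\mathcal{T}_o(n,\delta_M/O(n))$ oracle calls and $O(n)\cdot\mathcal{T}_a(n,\delta_M/O(n))+O(n^3)\cdot\mathcal{T}_o(n,\delta_M/O(n))+O(n^3\tau(n)\log\log(1/\delta_M))$ arithmetic operations. (ii) Given $c\in\mathbb{R}^n$ and a polyhedral conic separation oracle for $K_c=\{x\in\mathbb{R}^n: Mx\ge0,\ -c^\top x>0\}$, the conic validity problem can be solved using $O(n)\cdot\mathcal{T}_o(n,\delta_M/O(n))$ oracle calls and $O(n)\cdot\mathcal{T}_a(n,\delta_M/O(n))+O(n^3)\cdot\mathcal{T}_o(n,\delta_M/O(n))+O((n^5+n^3\tau(n))\log\log(1/\delta_M))$ arithmetic operations. (iii) Given $c,d\in\mathbb{R}^n$, $y^{(d)}\in\mathbb{R}^m_{\ge0}$ with $d=M^\top y^{(d)}$, $I=\mathrm{supp}(y^{(d)})$,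 $|I|\le n$, and polyhedral conic separation oracles for the two cones $K_{-d}=\{x\in\mathbb{R}^n: Mx\ge0,\ d^\top x>0\}$ and $K_I^{=}=\{x\in\mathbb{R}^n: Mx\ge0,\ M_Ix=0\}$, the conic minimum-ratio problem can be solved using $O(n)\cdot\mathcal{T}_o(n,\delta_M/O(n))$ oracle calls and $O(n)\cdot\mathcal{T}_a(n,\delta_M/O(n))+O(n^3)\cdot\mathcal{T}_o(n,\delta_M/O(n))+O((n^5+n^3\tau(n))\log\log(1/\delta_M))$ arithmetic operations.
   Context: Norms $\|\cdot\|$ are Euclidean. $M_I$ is the submatrix of rows indexed by $I$. Condition number: $\delta_M$ is the largest value such that for every linearly independent set $\{m_i:i\in I\}$ of rows of $M$ and every $\lambda\in\mathbb{R}^I$, $\|\sum_{i\in I}\lambda_im_i\|\ge\delta_M\max_{i\in I}|\lambda_i|\|m_i\|$. It is not known to the algorithms. Cone: a convex set closed under multiplication by positive scalars (possibly empty or not closed). Conic separation oracle for a cone $K\subseteq\mathbb{R}^n$: on input $\bar x\in\mathbb{R}^n$ it either states $\bar x\in K$ or, if $\bar x\notin K$, outputs $v\in\mathbb{R}^n\setminus\{0\}$ with $v^\top\bar x\le0$ and $v^\top x\ge0$ for all $x\in K$. Approx-Conic-Dual. Input: a cone $K\subseteq\mathbb{R}^n$ given by a conic separation oracle, and $\varepsilon>0$. Output: either a point $x\in K$, or an $\varepsilon$-approximate conic Farkas certificate: a set $\{m_j:j\in J\}$ of vectors returned by the oracle with multipliers $\lambda\in\mathbb{R}^J_{>0}$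 such that $\|\sum_{j\in J}\lambda_jm_j\|<\varepsilon$ and $\sum_{j\in J}\lambda_j\|m_j\|_1\ge1$. Its size is $|J|$, assumed bounded by $\tau(n)$. It is assumed that $\mathcal{T}_o(n,\varepsilon)=g_o(n)\log^{\nu_o}(n/\varepsilon)$ and $\mathcal{T}_a(n,\varepsilon)=g_a(n)\log^{\nu_a}(n/\varepsilon)$ for some functions $g_o,g_a$ and constants $\nu_o,\nu_a\ge1$. Polyhedral conic separation oracle for a cone $\{x: M_Tx\ge0,\ M_Sx>0\}$: given $\bar x$, it either states that $\bar x$ is in the cone, or returns a row $v=m_i$ with $v^\top\bar x<0$ if $i\in T$, or $v^\top\bar x\le0$ if $i\in S$ (revealing whether the row is in $S$ or $T$). The strict constraint ($m_1$, $-c$, or $d$) is known explicitly. Equations $M_Ix=0$ are viewed as the inequalities $M_Ix\ge 0$, $-M_Ix\ge0$. Vectors $y\in\mathbb{R}^m$ are represented by a list of $\mathrm{poly}(n)$ rows $m_i$ and the corresponding coefficients, all other entries being zero. Strong conic feasibility problem: ($m_1$ is given) find $x\in K$ with $m_1^\top x>0$, or $y\in\mathbb{R}^m_{\ge0}$ with $y_1=1$ and $M^\top y=0$. Conic validity problem: given $c\in\mathbb{R}^n$, find $\bar x\in K$ with $c^\top\bar x<0$, or $y\in\mathbb{R}^m_{\ge0}$ with $M^\top y=c$. Conic minimum-ratio problem: given $c,d\in\mathbb{R}^n$ and $y^{(d)}$ as in (iii) (certifying $d^\top x\ge0$ on $K$), let $\gamma^*=\max\{\gamma\in\mathbb{R}:(c-\gamma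 d)^\top x\ge0\ \forall x\in K\}=\min\{c^\top x/d^\top x: x\in K,\ d^\top x>0\}$. Required output: (optimality) if $\gamma^*$ is finite, return $\gamma^*$, $x^*\in K$ with $(c-\gamma^*d)^\top x^*=0$, $d^\top x^*>0$, and $y\in\mathbb{R}^m_{\ge0}$ with $M^\top y=c-\gamma^*d$; (infeasibility) if $d^\top x=0$ for all $x\in K$, return $y\in\mathbb{R}^m_{\ge0}$ with $M^\top y=-d$; (unboundedness) if the problem is unbounded, return $\bar x\in K$ with $d^\top\bar x>0$ and $x\in K$ with $c^\top x<0$, $d^\top x=0$. Computation model: real RAM with unit-cost $+,-,\times,/$ and comparisons. $\delta_M/O(n)$ means $\delta_M$ divided by a quantity that is $O(n)$. In $O$-bounds, logarithmic factors are understood asymptotically, i.e. as at least $1$. *)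

(* Defs.v *)
From mathcomp Require Import all_boot all_order all_algebra.
From mathcomp Require Import all_classical all_reals all_analysis.

Set Implicit Arguments.
Unset Strict Implicit.
Unset Printing Implicit Defensive.

Import Order.TTheory GRing.Theory Num.Theory.

Local Open Scope classical_set_scope.
Local Open Scope ring_scope.

(* Vectors of R^n are row vectors: y *m M is (M^T y)^T, and row i M is m_i^T.
   The norm `| _ | of the library on matrices is the sup norm, hence enorm. *)

Definition dot (R : realType) (n : nat) (u v : 'rV[R]_n) : R :=
  \sum_(i < n) u 0 i * v 0 i.

Definition enorm (R : realType) (n : nat) (u : 'rV[R]_n) : R :=
  Num.sqrt (\sum_(i < n) u 0 i ^+ 2).

Definition norm1 (R : realType) (n : nat) (u : 'rV[R]_n) : R :=
  \sum_(i < n) `|u 0 i|.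

Definition nonneg_vec (R : realType) (n : nat) (u : 'rV[R]_n) : Prop :=
  forall i, 0 <= u 0 i.

(* The bound d <= 1 follows from the other condition (take #|I| = 1) as soon as
   M has a nonzero row; it only makes cond_number M equal to 1, rather than
   undefined, when all rows of M are zero. *)
Definition cond_number (R : realType) (m n : nat) (M : 'M[R]_(m, n)) : R :=
  sup [set d : R | d <= 1 /\
    forall (I : {set 'I_m}) (lam : 'I_m -> R),
      row_free (rowsub (fun k : 'I_#|I| => enum_val k) M) ->
      d * \big[Num.max/0]_(i in I) (`|lam i| * enorm (row i M))
        <= enorm (\sum_(i in I) lam i *: row i M)].

(** ** Cones and separation oracles *)

Definition is_cone (R : realType) (n : nat) (K : set 'rV[R]_n) : Prop :=
  convex_set (K : set (convex_lmodType 'rV[R]_n)) /\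
  (forall x (t : R), K x -> 0 < t -> K (t *: x)).

Definition conic_oracle (R : realType) (n : nat) (K : set 'rV[R]_n)
    (o : 'rV[R]_n -> option 'rV[R]_n) : Prop :=
  forall xbar, match o xbar return Prop with
  | None => K xbar
  | Some v => ~ K xbar /\
      [/\ v != 0, dot v xbar <= 0 & forall x, K x -> 0 <= dot v x]
  end.

Definition poly_cone (R : realType) (p q n : nat)
    (MT : 'M[R]_(p, n)) (MS : 'M[R]_(q, n)) : set 'rV[R]_n :=
  [set x | (forall i, 0 <= dot (row i MT) x) /\
           (forall j, 0 < dot (row j MS) x)].

Definition poly_oracle (R : realType) (p q n : nat)
    (MT : 'M[R]_(p, n)) (MS : 'M[R]_(q, n))
    (o : 'rV[R]_n -> option ('I_p + 'I_q)) : Prop :=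
  forall xbar, match o xbar return Prop with
  | None => poly_cone MT MS xbar
  | Some (inl i) => dot (row i MT) xbar < 0
  | Some (inr j) => dot (row j MS) xbar <= 0
  end.

(** ** Real RAM with oracles

   Programs of a while language over unboundedly many natural-number arrays and
   real arrays, both of unbounded length. Every evaluation of +, -, *, / or of
   a comparison, on reals or on indices, costs one arithmetic operation (t in total); data
   movement is free. Each loop iteration evaluates at least one comparison, so
   the number of instructions is at most t + 1 up to a program-dependent factor.
   Subtraction of indices is truncated, and division by zero yields zero. *)

Variant iop := IAdd | ISub | IMul.
Inductive iexp :=
  | ICst of nat
  | IGet of nat & iexp
  | IBin of iop & iexp & iexp.

Variant rop := RAdd | RSub | RMul | RDiv.
Inductive rexp :=
  | RCst of nat
  | RGet of nat & iexp
  | RBin of rop & rexp & rexp.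

Inductive bexp :=
  | BLeI of iexp & iexp
  | BLeR of rexp & rexp
  | BNot of bexp
  | BAnd of bexp & bexp.

(* [Query k x f v] submits to oracle number k the vector stored in real array x;
   the answer is written to cell 0 of index array f and to real array v. *)
Inductive cmd :=
  | Skip
  | ISet of nat & iexp & iexp
  | RSet of nat & iexp & rexp
  | Seq of cmd & cmd
  | If of bexp & cmd & cmd
  | While of bexp & cmd
  | Query of nat & nat & nat & nat.

Record state (R : realType) := State {
  imem : nat -> nat -> nat;
  rmem : nat -> nat -> R }.

Definition upd (T : Type) (mem : nat -> nat -> T) (a i : nat) (x : T) :
    nat -> nat -> T :=
  fun b j => if (b == a) && (j == i) then x else mem b j.

Definition iop_sem (o : iop) : nat -> nat -> nat :=
  match o with IAdd => addn | ISub => subn | IMul => muln end.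

Definition rop_sem (R : realType) (o : rop) (x y : R) : R :=
  match o with
  | RAdd => x + y | RSub => x - y | RMul => x * y | RDiv => x / y
  end.

Fixpoint ieval (R : realType) (s : state R) (e : iexp) : nat :=
  match e with
  | ICst k => k
  | IGet a i => imem s a (ieval s i)
  | IBin o e1 e2 => iop_sem o (ieval s e1) (ieval s e2)
  end.

Fixpoint reval (R : realType) (s : state R) (e : rexp) : R :=
  match e with
  | RCst k => k%:R
  | RGet a i => rmem s a (ieval s i)
  | RBin o e1 e2 => rop_sem o (reval s e1) (reval s e2)
  end.

Fixpoint beval (R : realType) (s : state R) (b : bexp) : bool :=
  match b with
  | BLeI e1 e2 => (ieval s e1 <= ieval s e2)%N
  | BLeR e1 e2 => reval s e1 <= reval s e2
  | BNot b1 => ~~ beval s b1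
  | BAnd b1 b2 => beval s b1 && beval s b2
  end.

Fixpoint icost (e : iexp) : nat :=
  match e with
  | ICst _ => 0
  | IGet _ i => icost i
  | IBin _ e1 e2 => (icost e1 + icost e2).+1
  end.

Fixpoint rcost (e : rexp) : nat :=
  match e with
  | RCst _ => 0
  | RGet _ i => icost i
  | RBin _ e1 e2 => (rcost e1 + rcost e2).+1
  end.

Fixpoint bcost (b : bexp) : nat :=
  match b with
  | BLeI e1 e2 => (icost e1 + icost e2).+1
  | BLeR e1 e2 => (rcost e1 + rcost e2).+1
  | BNot b1 => bcost b1
  | BAnd b1 b2 => bcost b1 + bcost b2
  end.

(* None: the queried point is in the cone. Some (b, v): separating vector v,
   with b = true iff v comes from a strict inequality (polyhedral oracles). *)
Definition answer (R : realType) (n : nat) := option (bool * 'rV[R]_n)%type.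

Definition vec_at (R : realType) (s : state R) (n a off : nat) : 'rV[R]_n :=
  \row_(j < n) rmem s a (off + j).

Definition answer_code (R : realType) (n : nat) (r : answer R n) : nat :=
  match r with None => 0 | Some (false, _) => 1 | Some (true, _) => 2 end.

Definition put_answer (R : realType) (n : nat) (s : state R) (f v : nat)
    (r : answer R n) : state R :=
  State (upd (imem s) f 0 (answer_code r))
    (match r with
     | None => rmem s
     | Some (_, w) => fun a i =>
         if (a == v) then
           (if insub i is Some j then w 0 j else rmem s a i)
         else rmem s a i
     end).

(* [exec orc c s s' t l]: from s, with oracle number k answering as orc k, the
   program c terminates in s', after t arithmetic operations and after having
   received the list l of oracle answers. *)
Inductive exec (R : realType) (n : nat) (orc : nat -> 'rV[R]_n -> answer R n) :
    cmd -> state R -> state R -> nat -> seq (answer R n) -> Prop :=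
  | ExecSkip s : exec orc Skip s s 0 [::]
  | ExecISet a i e s :
      exec orc (ISet a i e) s
        (State (upd (imem s) a (ieval s i) (ieval s e)) (rmem s))
        (icost i + icost e) [::]
  | ExecRSet a i e s :
      exec orc (RSet a i e) s
        (State (imem s) (upd (rmem s) a (ieval s i) (reval s e)))
        (icost i + rcost e) [::]
  | ExecSeq c1 c2 s s1 s2 t1 t2 l1 l2 :
      exec orc c1 s s1 t1 l1 -> exec orc c2 s1 s2 t2 l2 ->
      exec orc (Seq c1 c2) s s2 (t1 + t2) (l1 ++ l2)
  | ExecIf b c1 c2 s s' t l :
      exec orc (if beval s b then c1 else c2) s s' t l ->
      exec orc (If b c1 c2) s s' (bcost b + t) l
  | ExecWhileF b c s :
      beval s b = false -> exec orc (While b c) s s (bcost b) [::]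
  | ExecWhileT b c s s1 s2 t1 t2 l1 l2 :
      beval s b = true ->
      exec orc c s s1 t1 l1 -> exec orc (While b c) s1 s2 t2 l2 ->
      exec orc (While b c) s s2 (bcost b + t1 + t2) (l1 ++ l2)
  | ExecQuery k x f v s :
      exec orc (Query k x f v) s
        (put_answer s f v (orc k (vec_at s n x 0)))
        0 [:: orc k (vec_at s n x 0)].

Definition runs_within (R : realType) (n : nat)
    (orc : nat -> 'rV[R]_n -> answer R n) (c : cmd) (s : state R)
    (calls ops : R) (post : state R -> seq (answer R n) -> Prop) : Prop :=
  exists s' t l, [/\ exec orc c s s' t l,
    (size l)%:R <= calls, t%:R <= ops & post s' l].

Definition answers_of_conic (R : realType) (n : nat)
    (o : 'rV[R]_n -> option 'rV[R]_n) : 'rV[R]_n -> answer R n :=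
  fun x => omap (pair false) (o x).

Definition answers_of_poly (R : realType) (p q n : nat)
    (MT : 'M[R]_(p, n)) (MS : 'M[R]_(q, n))
    (o : 'rV[R]_n -> option ('I_p + 'I_q)) : 'rV[R]_n -> answer R n :=
  fun x => omap (fun r => match r with
                          | inl i => (false, row i MT)
                          | inr j => (true, row j MS)
                          end) (o x).

(** ** Running time bounds *)

(* Logarithmic factors are read as at least 1. *)
Definition lg (R : realType) (x : R) : R := Num.max 1 (ln x).

Definition loglog_inv (R : realType) (x : R) : R := lg (ln x^-1).

Definition cost_fun (R : realType) (g : nat -> R) (nu : R) (n : nat) (eps : R) :
    R :=
  g n * (lg (n%:R / eps)) `^ nu.

Definition poly_bounded (R : realType) (g : nat -> R) : Prop :=
  exists C k : nat, forall n, (0 < n)%N -> g n <= C%:R * n%:R ^+ k.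

(* O(n) * T(n, delta / O(n)) *)
Definition calls_bound (R : realType) (C : nat) (To : nat -> R -> R)
    (n : nat) (delta : R) : R :=
  C%:R * n%:R * To n (delta / (C%:R * n%:R)).

(* O(n) * T_a(n, delta / O(n)) + O(n^3) * T_o(n, delta / O(n))
   + O(w * log log (1 / delta)) *)
Definition ops_bound (R : realType) (C : nat) (To Ta : nat -> R -> R)
    (w n : nat) (delta : R) : R :=
  C%:R * n%:R * Ta n (delta / (C%:R * n%:R)) +
  C%:R * n%:R ^+ 3 * To n (delta / (C%:R * n%:R)) +
  C%:R * w%:R * loglog_inv delta.

(** ** The computational problems

   Memory layout. Index array 0: cell 0 holds n on input and the kind of output
   on output; cell 1 holds the length N of a list of vectors with coefficients.
   The list itself: the j-th vector is in real array 2 from cell j * n on, and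
   its coefficient in cell j of real array 3. All other memory is arbitrary
   on input. *)

Definition list_len (R : realType) (s : state R) : nat := imem s 0 1.
Definition list_vec (R : realType) (s : state R) (n j : nat) : 'rV[R]_n :=
  vec_at s n 2 (j * n).
Definition list_coef (R : realType) (s : state R) (j : nat) : R := rmem s 3 j.

Definition represents (R : realType) (m n : nat) (M : 'M[R]_(m, n))
    (s : state R) (y : 'rV[R]_m) : Prop :=
  exists f : 'I_(list_len s) -> 'I_m,
    [/\ injective f,
        forall j, row (f j) M = list_vec s n j,
        forall j, y 0 (f j) = list_coef s j
      & forall i, i \notin codom f -> y 0 i = 0].

(* The program A solves Approx-Conic-Dual (input: n and, in cell 0 of real
   array 0, eps). *)
Definition solves_approx_conic_dual (R : realType) (A : cmd)
    (To Ta : nat -> R -> R) (tau : nat -> nat) : Prop :=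
  forall (n : nat) (K : set 'rV[R]_n) (o : 'rV[R]_n -> option 'rV[R]_n)
    (eps : R) (s : state R),
    (0 < n)%N -> is_cone K -> conic_oracle K o -> 0 < eps ->
    imem s 0 0 = n -> rmem s 0 0 = eps ->
    runs_within (fun _ => answers_of_conic o) A s (To n eps) (Ta n eps)
      (fun s' l =>
         (imem s' 0 0 = 0%N /\ K (vec_at s' n 0 0)) \/
         (imem s' 0 0 = 1%N /\
          [/\ (list_len s' <= tau n)%N,
              forall j, (j < list_len s')%N ->
                Some (false, list_vec s' n j) \in l /\ 0 < list_coef s' j,
              enorm (\sum_(j < list_len s') list_coef s' j *: list_vec s' n j)
                < eps
            & 1 <= \sum_(j < list_len s')
                     list_coef s' j * norm1 (list_vec s' n j)])).

Definition polyhedral_cone (R : realType) (m n : nat) (M : 'M[R]_(m, n)) :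
    set 'rV[R]_n :=
  [set x | forall i, 0 <= dot (row i M) x].

Definition solves_strong_feasibility (R : realType) (B : cmd) (C k : nat)
    (To Ta : nat -> R -> R) (tau : nat -> nat) : Prop :=
  forall (m n : nat) (M : 'M[R]_(m.+1, n))
    (o : 'rV[R]_n -> option ('I_m.+1 + 'I_1)) (s : state R),
    let K := polyhedral_cone M in
    let m1 := row ord0 M in
    let delta := cond_number M in
    (0 < n)%N -> poly_oracle M m1 o ->
    imem s 0 0 = n -> vec_at s n 0 0 = m1 ->
    runs_within (fun _ => answers_of_poly M m1 o) B s
      (calls_bound C To n delta)
      (ops_bound C To Ta (n ^ 3 * tau n) n delta)
      (fun s' _ =>
         let x := vec_at s' n 0 0 in
         (imem s' 0 0 = 0%N /\ K x /\ 0 < dot m1 x) \/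
         (imem s' 0 0 = 1%N /\ (list_len s' <= C * n ^ k)%N /\
          exists y, [/\ represents M s' y, nonneg_vec y, y 0 ord0 = 1
                      & y *m M = 0])).

Definition solves_validity (R : realType) (B : cmd) (C k : nat)
    (To Ta : nat -> R -> R) (tau : nat -> nat) : Prop :=
  forall (m n : nat) (M : 'M[R]_(m, n)) (c : 'rV[R]_n)
    (o : 'rV[R]_n -> option ('I_m + 'I_1)) (s : state R),
    let K := polyhedral_cone M in
    let delta := cond_number M in
    (0 < n)%N -> poly_oracle M (- c) o ->
    imem s 0 0 = n -> vec_at s n 0 0 = c ->
    runs_within (fun _ => answers_of_poly M (- c) o) B s
      (calls_bound C To n delta)
      (ops_bound C To Ta (n ^ 5 + n ^ 3 * tau n) n delta)
      (fun s' _ =>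
         let x := vec_at s' n 0 0 in
         (imem s' 0 0 = 0%N /\ K x /\ dot c x < 0) \/
         (imem s' 0 0 = 1%N /\ (list_len s' <= C * n ^ k)%N /\
          exists y, [/\ represents M s' y, nonneg_vec y & y *m M = c])).

Definition is_min_ratio (R : realType) (n : nat) (K : set 'rV[R]_n)
    (c d : 'rV[R]_n) (gamma : R) : Prop :=
  let G := [set g : R | forall x, K x -> 0 <= dot (c - g *: d) x] in
  G gamma /\ forall g, G g -> g <= gamma.

Definition ratio_unbounded (R : realType) (n : nat) (K : set 'rV[R]_n)
    (c d : 'rV[R]_n) : Prop :=
  (exists x, K x /\ 0 < dot d x) /\
  forall g : R, exists x, [/\ K x, 0 < dot d x & dot c x / dot d x < g].

(* Output of the minimum-ratio problem: gamma in cell 0 of real array 4, points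
   in real arrays 0 and 1. *)
Definition min_ratio_output (R : realType) (m n : nat) (M : 'M[R]_(m, n))
    (c d : 'rV[R]_n) (bound : nat) (s : state R) : Prop :=
  let K := polyhedral_cone M in
  let x0 := vec_at s n 0 0 in
  let x1 := vec_at s n 1 0 in
  [/\ forall gamma, is_min_ratio K c d gamma ->
        [/\ imem s 0 0 = 0%N, rmem s 4 0 = gamma,
            [/\ K x0, dot (c - gamma *: d) x0 = 0 & 0 < dot d x0],
            (list_len s <= bound)%N
          & exists y, [/\ represents M s y, nonneg_vec y
                        & y *m M = c - gamma *: d]],
      (forall x, K x -> dot d x = 0) ->
        [/\ imem s 0 0 = 1%N, (list_len s <= bound)%N
          & exists y, [/\ represents M s y, nonneg_vec y & y *m M = - d]]
    & ratio_unbounded K c d ->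
        [/\ imem s 0 0 = 2%N,
            K x0 /\ 0 < dot d x0
          & [/\ K x1, dot c x1 < 0 & dot d x1 = 0]]].

Definition supp (R : realType) (m : nat) (y : 'rV[R]_m) : {set 'I_m} :=
  [set i | y 0 i != 0]%SET.

(* Rows of the system M x >= 0, M_I x = 0, each equation giving two rows. *)
Definition eq_rows (R : realType) (m n : nat) (M : 'M[R]_(m, n))
    (I : {set 'I_m}) : 'M[R]_(m + (#|I| + #|I|), n) :=
  let MI := rowsub (fun k : 'I_#|I| => enum_val k) M in
  col_mx M (col_mx MI (- MI)).

(* Oracle 0 is for the cone with d x > 0, oracle 1 for the cone with M_I x = 0;
   input vectors c and d are in real arrays 0 and 1, and y^(d) is in the list. *)
Definition solves_min_ratio (R : realType) (B : cmd) (C k : nat)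
    (To Ta : nat -> R -> R) (tau : nat -> nat) : Prop :=
  forall (m n : nat) (M : 'M[R]_(m, n)) (c d : 'rV[R]_n) (yd : 'rV[R]_m)
    (o_d : 'rV[R]_n -> option ('I_m + 'I_1))
    (o_eq : 'rV[R]_n ->
            option ('I_(m + (#|supp yd| + #|supp yd|)) + 'I_0))
    (s : state R),
    let delta := cond_number M in
    let noS : 'M[R]_(0, n) := 0 in
    (0 < n)%N -> nonneg_vec yd -> d = yd *m M -> (#|supp yd| <= n)%N ->
    poly_oracle M d o_d -> poly_oracle (eq_rows M (supp yd)) noS o_eq ->
    imem s 0 0 = n -> vec_at s n 0 0 = c -> vec_at s n 1 0 = d ->
    list_len s = #|supp yd| -> represents M s yd ->
    runs_within
      (fun i => if i is 0%N then answers_of_poly M d o_d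
                else answers_of_poly (eq_rows M (supp yd)) noS o_eq)
      B s
      (calls_bound C To n delta)
      (ops_bound C To Ta (n ^ 5 + n ^ 3 * tau n) n delta)
      (fun s' _ => min_ratio_output M c d (C * n ^ k) s').

(* Submission.v *)
(* A is always run on the empty cone: every query is answered by some vector, and
   the points of K met on the way are kept aside (they improve gamma, or solve the
   problem), so that A must return an approximate certificate. The certificate of
   level k is a combination, of norm < eps, of rows of M and of -(c - gamma d), all
   projected orthogonally to the k rows m*_0, ..., m*_(k-1) chosen at the previous
   levels; its heaviest row becomes m*_k. After at most n levels the projection of
   c - gamma d vanishes, i.e. c - gamma d is a combination of the m*_l, and going
   back through the levels corrects the sign of one coefficient at a time: a
   negative coefficient of m*_k is compensated by a multiple of the k-th
   certificate. For this the certificate has to be turned into an exact relation: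
   if eps << delta / n^2, the definition of delta_M forces the part of it that a
   conic Caratheodory reduction cannot cancel to have small coefficients, so that
   m*_k keeps a positive one. Since delta is unknown, eps is squared until
   the computation succeeds: log(n / eps) doubles at each phase, so the total cost
   is dominated by the last one and there are O(log log(1/delta)) phases. *)

Require Import Defs.
From mathcomp Require Import all_boot all_order all_algebra.
From mathcomp Require Import all_classical all_reals all_analysis.
From mathcomp Require Import zify ring lra.

Set Implicit Arguments.
Unset Strict Implicit.
Unset Printing Implicit Defensive.

Import Order.TTheory GRing.Theory Num.Theory.

Local Open Scope ring_scope.

Notation "'$' a" := (IGet a (ICst 0)) (at level 1, a at level 0).
Notation "e1 +i e2" := (IBin IAdd e1 e2) (at level 50, left associativity).
Notation "e1 -i e2" := (IBin ISub e1 e2) (at level 50, left associativity).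
Notation "e1 *i e2" := (IBin IMul e1 e2) (at level 40, left associativity).
Notation "e1 +r e2" := (RBin RAdd e1 e2) (at level 50, left associativity).
Notation "e1 -r e2" := (RBin RSub e1 e2) (at level 50, left associativity).
Notation "e1 *r e2" := (RBin RMul e1 e2) (at level 40, left associativity).
Notation "e1 /r e2" := (RBin RDiv e1 e2) (at level 40, left associativity).
Notation "c1 ;; c2" := (Seq c1 c2) (at level 100, right associativity).

(** [A] is only promised to work with a fixed oracle, so the answers must be a function of the
    queried point: cuts use the gamma of the start of the level or the ratio of the point itself,
    never the gamma reached meanwhile. Since gamma may drop once a level is complete, the level is
    stored as an affine function of gamma; the excess of the ratios of its cuts over gamma is
    charged to the rows of [d], whose multipliers grow as gamma drops. Two ways of making relations
    exact coexist because of their costs. Trimming takes n^4 operations per level, n^5 per phase,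
    too much for (i). There, d = 0 and -c is the row m_1, so a certificate consists of projected
    rows, and a single change of basis makes it exact. In (ii) and (iii) the vector c - gamma d need
    not be a row, delta_M says nothing about it, and trimming waits for the ascent, where it has
    been replaced by rows. What remains of order n^4 in (i) is absorbed by n^3 tau(n), because
    tau(n) > n. No step relies on eps being small: residuals and signs are tested, and a failure
    only leads to a smaller eps. *)

Definition ilt (e1 e2 : iexp) : bexp := BNot (BLeI e2 e1).
Definition rlt (e1 e2 : rexp) : bexp := BNot (BLeR e2 e1).
Definition ieqb (e1 e2 : iexp) : bexp := BAnd (BLeI e1 e2) (BLeI e2 e1).

Definition incr (v : nat) : cmd := ISet v (ICst 0) ($v +i ICst 1).

Definition For (v : nat) (e : iexp) (body : cmd) : cmd :=
  ISet v (ICst 0) (ICst 0) ;; While (ilt $v e) (body ;; incr v).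

Definition VSet (v : nat) (e : iexp) (dst : nat) (off : iexp) (re : rexp) :=
  For v e (RSet dst off re).

Definition VSum (v : nat) (e : iexp) (dst : nat) (re : rexp) :=
  RSet dst (ICst 0) (RCst 0) ;;
  For v e (RSet dst (ICst 0) (RGet dst (ICst 0) +r re)).

Fixpoint ireads (e : iexp) : seq nat :=
  match e with
  | ICst _ => [::]
  | IGet a i => a :: ireads i
  | IBin _ e1 e2 => ireads e1 ++ ireads e2
  end.

Fixpoint iw (c : cmd) : seq nat :=
  match c with
  | ISet a _ _ => [:: a]
  | Seq c1 c2 | If _ c1 c2 => iw c1 ++ iw c2
  | While _ c1 => iw c1
  | Query _ _ f _ => [:: f]
  | _ => [::]
  end.

Fixpoint rw (c : cmd) : seq nat :=
  match c with
  | RSet a _ _ => [:: a]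
  | Seq c1 c2 | If _ c1 c2 => rw c1 ++ rw c2
  | While _ c1 => rw c1
  | Query _ _ _ v => [:: v]
  | _ => [::]
  end.

(** * A program logic with costs for the while language *)

Section WP.
Variables (R : realType) (n : nat) (orc : nat -> 'rV[R]_n -> answer R n).
Implicit Types (s : state R) (c : cmd).

Definition setI s a i x : state R := State (upd (imem s) a i x) (rmem s).

Definition fill (mem : nat -> nat -> R) (dst o N : nat) (F : nat -> R) :
    nat -> nat -> R :=
  fun b i => if b == dst then
    (if (o <= i < o + N)%N then F (i - o)%N else mem b i) else mem b i.

(** One terminating execution is exhibited, which is what [runs_within] asks for; [Q] also sees the
    numbers of operations and of oracle calls, so that costs are derived along with the functional
    part. *)
Definition wp c s (Q : state R -> nat -> nat -> Prop) : Prop :=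
  exists s' t l, exec orc c s s' t l /\ Q s' t (size l).

Lemma wp_conseq c s (Q1 Q2 : state R -> nat -> nat -> Prop) :
  wp c s Q1 -> (forall s' t q, Q1 s' t q -> Q2 s' t q) -> wp c s Q2.
Proof. by move=> [s' [t [l [H1 H2]]]] H; exists s', t, l; split=> //; apply: H. Qed.

Lemma wp_skip s (Q : state R -> nat -> nat -> Prop) : Q s 0%N 0%N -> wp Skip s Q.
Proof. by move=> H; exists s, 0%N, [::]; split=> //; constructor. Qed.

Lemma wp_iset a i e s (Q : state R -> nat -> nat -> Prop) :
  Q (setI s a (ieval s i) (ieval s e)) (icost i + icost e)%N 0%N -> wp (ISet a i e) s Q.
Proof. by move=> H; eexists; eexists; exists [::]; split; [constructor | exact: H]. Qed.

Lemma wp_rset a i e s (Q : state R -> nat -> nat -> Prop) :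
  Q (State (imem s) (upd (rmem s) a (ieval s i) (reval s e))) (icost i + rcost e)%N 0%N ->
  wp (RSet a i e) s Q.
Proof. by move=> H; eexists; eexists; exists [::]; split; [constructor | exact: H]. Qed.

Lemma wp_seq c1 c2 s (Q : state R -> nat -> nat -> Prop) :
  wp c1 s (fun s1 t1 q1 => wp c2 s1 (fun s2 t2 q2 => Q s2 (t1 + t2)%N (q1 + q2)%N)) ->
  wp (c1 ;; c2) s Q.
Proof.
move=> [s1 [t1 [l1 [H1 [s2 [t2 [l2 [H2 H]]]]]]]].
exists s2, (t1 + t2)%N, (l1 ++ l2); rewrite size_cat; split=> //.
exact: ExecSeq H1 H2.
Qed.

Lemma wp_if b c1 c2 s (Q : state R -> nat -> nat -> Prop) :
  wp (if beval s b then c1 else c2) s (fun s' t q => Q s' (bcost b + t)%N q) ->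
  wp (If b c1 c2) s Q.
Proof.
move=> [s1 [t1 [l1 [H1 H2]]]]; exists s1, (bcost b + t1)%N, l1; split=> //.
by constructor.
Qed.

Lemma wp_query k x f v s (Q : state R -> nat -> nat -> Prop) :
  Q (put_answer s f v (orc k (vec_at s n x 0))) 0%N 1%N -> wp (Query k x f v) s Q.
Proof. by move=> H; eexists; eexists; eexists; split; [constructor | exact: H]. Qed.

(** Frame condition: [li] and [lr] contain the arrays that may have been written. They are usually
    lists of numerals, so that membership is decided by computation. *)
Definition agree (li lr : seq nat) s s' : Prop :=
  (forall a, a \notin li -> imem s' a = imem s a) /\
  (forall a, a \notin lr -> rmem s' a = rmem s a).

Lemma agree_trans l1 r1 l2 r2 s1 s2 s3 :
  agree l1 r1 s1 s2 -> agree l2 r2 s2 s3 -> agree (l1 ++ l2) (r1 ++ r2) s1 s3.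
Proof.
move=> [H1 H2] [H3 H4]; split=> a; rewrite mem_cat negb_or => /andP[Ha Hb].
  by rewrite H3 // H1.
by rewrite H4 // H2.
Qed.

Lemma agree_sub l1 r1 l2 r2 s s' :
  agree l1 r1 s s' -> {subset l1 <= l2} -> {subset r1 <= r2} -> agree l2 r2 s s'.
Proof.
move=> [H1 H2] Hl Hr; split=> a Ha; [apply: H1 | apply: H2];
  apply: contra Ha; [exact: Hl | exact: Hr].
Qed.

(** The written arrays are read off the text of the program, so that frame conditions come for free
    with every execution. *)
Lemma exec_agree c s s' t l : exec orc c s s' t l -> agree (iw c) (rw c) s s'.
Proof.
elim=> {c s s' t l} /=.
- by move=> s; split.
- move=> a i e s; split=> // b; rewrite inE => Hb.
  by apply/funext => j; rewrite /= /upd (negbTE Hb).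
- move=> a i e s; split=> // b; rewrite inE => Hb.
  by apply/funext => j; rewrite /= /upd (negbTE Hb).
- by move=> c1 c2 s s1 s2 t1 t2 l1 l2 _ H1 _ H2; apply: agree_trans H1 H2.
- move=> b c1 c2 s s' t l _; case: (beval s b) => H; apply: (agree_sub H);
    move=> a /= Ha; rewrite mem_cat Ha ?orbT //.
- by move=> b c s _; split.
- move=> b c s s1 s2 t1 t2 l1 l2 _ _ H1 _ H2.
  by apply: (agree_sub (agree_trans H1 H2)) => a; rewrite mem_cat orbb.
- move=> k x f v s; split=> b; rewrite inE => Hb /=.
    by apply/funext => j; rewrite /upd (negbTE Hb).
  by case: (orc _ _) => [[? w]|] //; rewrite (negbTE Hb).
Qed.

Lemma wp_agree c s (Q1 Q2 : state R -> nat -> nat -> Prop) :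
  wp c s Q1 ->
  (forall s' t q, agree (iw c) (rw c) s s' -> Q1 s' t q -> Q2 s' t q) -> wp c s Q2.
Proof.
move=> [s' [t [l [H1 H2]]]] H; exists s', t, l; split=> //; apply: H => //.
exact: exec_agree H1.
Qed.

Lemma ieval_agree e s s' : (forall a, a \in ireads e -> imem s' a = imem s a) ->
  ieval s' e = ieval s e.
Proof.
elim: e => //= [a i IH|o e1 IH1 e2 IH2] H.
  by rewrite IH ?H ?mem_head // => b Hb; apply: H; rewrite inE Hb orbT.
by rewrite IH1 ?IH2 // => b Hb; apply: H; rewrite mem_cat Hb ?orbT.
Qed.

(** The test is evaluated [N + 1] times, whence the final [icost e + 1]. The body must leave the
    counter at [i], the increment being the only instruction meant to move it. *)
Lemma wp_for_gen (Inv : nat -> state R -> Prop) N T q v e body s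
    (Q : state R -> nat -> nat -> Prop) :
  Inv 0%N (setI s v 0 0) ->
  (forall i s1, (i <= N)%N -> Inv i s1 -> ieval s1 e = N /\ imem s1 v 0 = i) ->
  (forall i s1, (i < N)%N -> Inv i s1 ->
    wp body s1 (fun s2 t l => [/\ (t <= T)%N, (l <= q)%N, imem s2 v 0 = i
       & Inv i.+1 (setI s2 v 0 i.+1)])) ->
  (forall s2 t l, (t <= N * (T + icost e + 2) + icost e + 1)%N -> (l <= N * q)%N ->
     Inv N s2 -> Q s2 t l) ->
  wp (For v e body) s Q.
Proof.
move=> H0 Hev Hb HQ.
suff: forall k i s1, (i + k = N)%N -> Inv i s1 ->
    wp (While (ilt $v e) (body ;; incr v)) s1
      (fun s2 t l => [/\ (t <= k * (T + icost e + 2) + icost e + 1)%N,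
                         (l <= k * q)%N & Inv N s2]).
  move=> H; have [s2 [t [l [He [Ht Hl Hi]]]]] := H N 0%N (setI s v 0 0) (add0n _) H0.
  exists s2, (0 + t)%N, ([::] ++ l); split; last exact: HQ.
  exact: (ExecSeq (ExecISet orc v (ICst 0) (ICst 0) s) He).
elim=> [|k IH] i s1 Hik Hi.
  have EN : i = N by lia.
  have [Hv Hvi] := Hev i s1 (leq_trans (leq_addr _ _) (eq_leq Hik)) Hi.
  exists s1, (bcost (ilt $v e)), [::]; split.
    by apply: ExecWhileF; rewrite /= Hv Hvi; apply/negbTE; rewrite negbK; lia.
  by split=> //=; [lia | rewrite -EN].
have iN : (i < N)%N by lia.
have [Hv Hvi] := Hev i s1 (ltnW iN) Hi.
have [s2 [t [l [He [Ht Hl Hi2 Hi3]]]]] := Hb i s1 iN Hi.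
have [|s3 [t3 [l3 [He3 [Ht3 Hl3 Hi4]]]]] := IH i.+1 (setI s2 v 0 i.+1) _ Hi3; first by lia.
exists s3, (bcost (ilt $v e) + (t + 1) + t3)%N, ((l ++ [::]) ++ l3); split.
  apply: ExecWhileT He3.
    by rewrite /= Hv Hvi -ltnNge.
  apply: (ExecSeq He); have := ExecISet orc v (ICst 0) ($v +i ICst 1) s2.
  by rewrite /= Hi2 addn1.
split=> //=; first by rewrite mulSn; lia.
by rewrite cats0 size_cat mulSn; lia.
Qed.

(** The frame condition of the body travels with the invariant, so that [Inv] only has to describe
    what the loop changes. *)
Lemma wp_for (Inv : nat -> state R -> Prop) N T v e body s
    (Q : state R -> nat -> nat -> Prop) :
  ieval s e = N ->
  (v \notin iw body) && all (fun a => a \notin v :: iw body) (ireads e) ->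
  Inv 0%N (setI s v 0 0) ->
  (forall i s1, (i < N)%N -> agree (v :: iw body) (rw body) s s1 -> imem s1 v 0 = i ->
    Inv i s1 ->
    wp body s1 (fun s2 t l => [/\ (t <= T)%N, l = 0%N
       & Inv i.+1 (setI s2 v 0 i.+1)])) ->
  (forall s2 t, (t <= N * (T + icost e + 2) + icost e + 1)%N ->
     agree (v :: iw body) (rw body) s s2 -> imem s2 v 0 = N ->
     Inv N s2 -> Q s2 t 0%N) ->
  wp (For v e body) s Q.
Proof.
move=> HN /andP[Hvb /allP Hre] H0 Hb HQ.
have Hsv : forall s' k, agree (v :: iw body) (rw body) s s' ->
    agree (v :: iw body) (rw body) s (setI s' v 0 k).
  move=> s' k [A1 A2]; split=> a Ha; last exact: A2.
  rewrite -(A1 _ Ha); apply/funext => j; rewrite /= /upd.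
  by move: Ha; rewrite inE negb_or => /andP[/negbTE->].
have Hag0 : agree (v :: iw body) (rw body) s s by split.
apply: (@wp_for_gen (fun i s1 => [/\ agree (v :: iw body) (rw body) s s1,
   imem s1 v 0 = i & Inv i s1]) N T 0).
- by split=> //; [exact: Hsv | rewrite /= /upd !eqxx].
- move=> i s1 _ [[A1 _] A2 _]; split=> //; rewrite -HN; apply: ieval_agree => a Ha.
  by rewrite A1 //; apply: Hre.
- move=> i s1 iN [A1 A2 A3]; apply: wp_agree (Hb i s1 iN A1 A2 A3) _.
  move=> s' t q Hag [B1 -> B3]; split=> //.
    by case: Hag => -> //.
  split=> //; last by rewrite /= /upd !eqxx.
  apply: Hsv; apply: (agree_sub (agree_trans A1 Hag)) => a.
    by rewrite mem_cat !inE => /orP[->|->]; rewrite ?orbT.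
  by rewrite mem_cat orbb.
- move=> s2 t l Ht; rewrite muln0 leqn0 => /eqP-> [A1 A2 A3]; exact: HQ.
Qed.

(** The final state of such a loop is known exactly, so no invariant has to be supplied. The value
    of [re] is checked in the state where the first [j] cells are already written, which allows [re]
    to read [dst] itself. *)
Lemma wp_vset F o N v e dst off re s (Q : state R -> nat -> nat -> Prop) :
  ieval s e = N -> v \notin ireads e ->
  (forall j, (j < N)%N ->
    let s1 := State (upd (imem s) v 0 j) (fill (rmem s) dst o j F) in
    ieval s1 off = (o + j)%N /\ reval s1 re = F j) ->
  (forall t, (t <= N * (icost e + icost off + rcost re + 2) + icost e + 1)%N ->
    Q (State (upd (imem s) v 0 N) (fill (rmem s) dst o N F)) t 0%N) ->
  wp (VSet v e dst off re) s Q.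
Proof.
move=> HN Hv HF HQ.
have upds : forall (j k : nat), upd (upd (imem s) v 0 j) v 0 k = upd (imem s) v 0 k.
  by move=> j k; apply/funext => a; apply/funext => i; rewrite /upd; case: (_ && _).
apply: (@wp_for_gen (fun i s1 =>
   s1 = State (upd (imem s) v 0 i) (fill (rmem s) dst o i F)) N (icost off + rcost re) 0).
- rewrite /setI; congr State; apply/funext => a; apply/funext => i; rewrite /fill.
  case: ifP => // _; rewrite addn0; case: ifP => // /andP[H1 H2]; exfalso; lia.
- move=> i s1 _ ->; split; last by rewrite /= /upd !eqxx.
  rewrite -HN; apply: ieval_agree => a Ha; apply/funext => j; rewrite /= /upd.
  by case: eqP => // E; rewrite -E Ha in Hv.
- move=> i s1 iN ->; apply: wp_rset; have [Ho Hr] := HF i iN; split=> //.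
    by rewrite /= /upd !eqxx.
  rewrite Ho Hr /setI /= upds; congr State; apply/funext => a; apply/funext => j.
  rewrite /upd /fill; case: eqP => //= _; case: eqP => [->|/eqP ne].
    by rewrite leq_addr addnS ltnS leqnn /= addKn.
  by case: ifP => H1; case: ifP => H2 //; exfalso; lia.
- move=> s2 t l Ht; rewrite muln0 leqn0 => /eqP-> ->; apply: HQ.
  apply: leq_trans Ht _; lia.
Qed.

Lemma wp_vsum F N v e dst re s (Q : state R -> nat -> nat -> Prop) :
  ieval s e = N -> v \notin ireads e ->
  (forall j x, (j < N)%N ->
     reval (State (upd (imem s) v 0 j) (upd (rmem s) dst 0 x)) re = F j) ->
  (forall t, (t <= N * (icost e + rcost re + 3) + icost e + 1)%N ->
     Q (State (upd (imem s) v 0 N) (upd (rmem s) dst 0 (\sum_(j < N) F j))) t 0%N) ->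
  wp (VSum v e dst re) s Q.
Proof.
move=> HN Hv HF HQ.
have upds : forall T (m : nat -> nat -> T) a (j k : T), upd (upd m a 0 j) a 0 k = upd m a 0 k.
  by move=> T m b j k; apply/funext => a; apply/funext => i; rewrite /upd; case: (_ && _).
apply: wp_seq; apply: wp_rset => /=.
apply: (@wp_for_gen (fun i s1 =>
   s1 = State (upd (imem s) v 0 i) (upd (rmem s) dst 0 (\sum_(j < i) F j))) N (rcost re + 1) 0).
- by rewrite big_ord0.
- move=> i s1 _ ->; split; last by rewrite /= /upd !eqxx.
  rewrite -HN; apply: ieval_agree => a Ha; apply/funext => j; rewrite /= /upd.
  by case: eqP => // E; rewrite -E Ha in Hv.
- move=> i s1 iN ->; apply: wp_rset; split=> //=.
  + by rewrite add0n addn1.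
  + by rewrite /upd !eqxx.
  rewrite HF // /setI /= !upds; congr State; congr upd.
  by rewrite big_ord_recr /= /upd !eqxx.
- move=> s2 t l Ht; rewrite muln0 leqn0 => /eqP-> ->.
  by rewrite !add0n; apply: HQ; apply: leq_trans Ht _; lia.
Qed.

End WP.

(** * Inner products and norms *)

Section Vec.
Variables (R : realType).

Section DotLemmas.
Variable n : nat.
Implicit Types u v w : 'rV[R]_n.

Lemma dotC u v : dot u v = dot v u.
Proof. by apply: eq_bigr => i _; rewrite mulrC. Qed.

Lemma dotDl u v w : dot (u + v) w = dot u w + dot v w.
Proof. by rewrite /dot -big_split; apply: eq_bigr => i _; rewrite mxE mulrDl. Qed.

Lemma dotZl a u v : dot (a *: u) v = a * dot u v.
Proof. by rewrite /dot mulr_sumr; apply: eq_bigr => i _; rewrite mxE mulrA. Qed.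

Lemma dotNl u v : dot (- u) v = - dot u v.
Proof. by rewrite -scaleN1r dotZl mulN1r. Qed.

Lemma dotBl u v w : dot (u - v) w = dot u w - dot v w.
Proof. by rewrite dotDl dotNl. Qed.

Lemma dot0l u : dot 0 u = 0.
Proof. by rewrite -(scale0r 0) dotZl mul0r. Qed.

Lemma dotDr u v w : dot w (u + v) = dot w u + dot w v.
Proof. by rewrite dotC dotDl !(dotC w). Qed.

Lemma dotZr a u v : dot v (a *: u) = a * dot v u.
Proof. by rewrite dotC dotZl dotC. Qed.

Lemma dotNr u v : dot v (- u) = - dot v u.
Proof. by rewrite dotC dotNl dotC. Qed.

Lemma dotBr u v w : dot w (u - v) = dot w u - dot w v.
Proof. by rewrite dotDr dotNr. Qed.

Lemma dot0r u : dot u 0 = 0.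
Proof. by rewrite dotC dot0l. Qed.

Lemma dot_suml (I : Type) (r : seq I) (p : pred I) (F : I -> 'rV[R]_n) v :
  dot (\sum_(i <- r | p i) F i) v = \sum_(i <- r | p i) dot (F i) v.
Proof.
by elim/big_rec2: _ => [|i x y _ <-]; [rewrite dot0l | rewrite dotDl].
Qed.

Lemma dot_sumr (I : Type) (r : seq I) (p : pred I) (F : I -> 'rV[R]_n) v :
  dot v (\sum_(i <- r | p i) F i) = \sum_(i <- r | p i) dot v (F i).
Proof. by rewrite dotC dot_suml; apply: eq_bigr => i _; rewrite dotC. Qed.

Lemma dotvv_ge0 u : 0 <= dot u u.
Proof. by apply: sumr_ge0 => i _; rewrite -expr2 sqr_ge0. Qed.

Lemma dotvv_eq0 u : (dot u u == 0) = (u == 0).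
Proof.
apply/eqP/eqP => [|->]; last exact: dot0l.
move/psumr_eq0P => H; apply/rowP => i; rewrite mxE.
have /eqP := H (fun i _ => (sqr_ge0 (u 0 i)) : 0 <= u 0 i * u 0 i) i isT.
by rewrite mulf_eq0 orbb => /eqP.
Qed.

Lemma dotvv_gt0 u : u != 0 -> 0 < dot u u.
Proof. by rewrite lt_def dotvv_ge0 dotvv_eq0 andbT. Qed.

Lemma enormE u : enorm u = Num.sqrt (dot u u).
Proof. by congr Num.sqrt; apply: eq_bigr => i _; rewrite expr2. Qed.

Lemma enorm_ge0 u : 0 <= enorm u.
Proof. exact: sqrtr_ge0. Qed.

Lemma enorm_gt0 u : u != 0 -> 0 < enorm u.
Proof. by move=> H; rewrite enormE sqrtr_gt0 dotvv_gt0. Qed.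

Lemma enorm0 : enorm (0 : 'rV[R]_n) = 0.
Proof. by rewrite enormE dot0l sqrtr0. Qed.

Lemma enormZ a u : enorm (a *: u) = `|a| * enorm u.
Proof.
by rewrite !enormE dotZl dotZr mulrA -expr2 sqrtrM ?sqr_ge0 // sqrtr_sqr.
Qed.

Lemma le_enorm u v : dot u u <= dot v v -> enorm u <= enorm v.
Proof. by move=> H; rewrite !enormE ler_wsqrtr. Qed.

Lemma norm1N u : norm1 (- u) = norm1 u.
Proof. by apply: eq_bigr => i _; rewrite mxE normrN. Qed.

Lemma norm10 : norm1 (0 : 'rV[R]_n) = 0.
Proof. by rewrite /norm1 big1 // => i _; rewrite mxE normr0. Qed.

Lemma norm1D u v : norm1 (u + v) <= norm1 u + norm1 v.
Proof. by rewrite /norm1 -big_split; apply: ler_sum => i _; rewrite mxE ler_normD. Qed.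

Lemma norm1Z a u : norm1 (a *: u) = `|a| * norm1 u.
Proof. by rewrite /norm1 mulr_sumr; apply: eq_bigr => i _; rewrite mxE normrM. Qed.

Lemma norm1_sum (I : Type) (r : seq I) (p : pred I) (F : I -> 'rV[R]_n) :
  norm1 (\sum_(i <- r | p i) F i) <= \sum_(i <- r | p i) norm1 (F i).
Proof.
elim/big_rec2: _ => [|i x y _ H]; first by rewrite norm10.
by apply: le_trans (norm1D _ _) _; rewrite lerD2l.
Qed.

Lemma norm1_enorm u : norm1 u <= n%:R * enorm u.
Proof.
rewrite mulr_natl -[X in _ *+ X]card_ord -sumr_const; apply: ler_sum => i _.
rewrite -sqrtr_sqr /enorm ler_wsqrtr // (bigD1 i) //= lerDl.
by apply: sumr_ge0 => j _; exact: sqr_ge0.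
Qed.

End DotLemmas.

(** The matrix of the products between the two families is the identity of size [r], and its rank is
    at most the dimension. *)
Lemma dual_size N r (g v : nat -> 'rV[R]_N) :
  (forall k l, (k < r)%N -> (l < r)%N -> dot (g k) (v l) = (k == l)%:R) -> (r <= N)%N.
Proof.
move=> H.
pose G := \matrix_(i < r) g i; pose V := \matrix_(i < r) v i.
have GV : G *m V^T = 1%:M.
  apply/matrixP => i j; rewrite !mxE -[RHS](H i j) //.
  by apply: eq_bigr => k _; rewrite !mxE.
have := mulmx_max_rank G V^T; rewrite GV mxrank1; apply: leq_trans; exact: leqnn.
Qed.

(** * Orthogonal projections *)

Section Proj.
Variable n : nat.
Implicit Types (q st : nat -> 'rV[R]_n) (x y : 'rV[R]_n) (k l : nat).

(** Successive subtraction, as in the modified Gram-Schmidt process: it is an orthogonal projection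
    only when the [q l] are orthogonal, which [gs] provides. *)
Fixpoint proj q k x : 'rV[R]_n :=
  if k is k'.+1 then
    let y := proj q k' x in y - (dot y (q k') / dot (q k') (q k')) *: q k'
  else x.

Lemma eq_proj q q' k x : (forall l, (l < k)%N -> q l = q' l) -> proj q k x = proj q' k x.
Proof.
elim: k => //= k IH H; rewrite IH ?H // => l Hl; apply: H; exact: ltnW.
Qed.

Lemma projD q k x y : proj q k (x + y) = proj q k x + proj q k y.
Proof.
elim: k => //= k ->; rewrite dotDl mulrDl scalerDl opprD.
by rewrite addrACA.
Qed.

Lemma projZ q k a x : proj q k (a *: x) = a *: proj q k x.
Proof. by elim: k => //= k ->; rewrite dotZl scalerBr scalerA mulrA. Qed.

Lemma proj0 q k : proj q k 0 = 0.
Proof. by elim: k => //= k ->; rewrite dot0l mul0r scale0r subrr. Qed.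

Lemma projN q k x : proj q k (- x) = - proj q k x.
Proof. by rewrite -scaleN1r projZ scaleN1r. Qed.

Lemma projB q k x y : proj q k (x - y) = proj q k x - proj q k y.
Proof. by rewrite projD projN. Qed.

Lemma proj_sum q k (I : Type) (r : seq I) (p : pred I) (F : I -> 'rV[R]_n) :
  proj q k (\sum_(i <- r | p i) F i) = \sum_(i <- r | p i) proj q k (F i).
Proof. by elim/big_rec2: _ => [|i x y _ <-]; [rewrite proj0 | rewrite projD]. Qed.

(* [q] is the Gram-Schmidt orthogonalization of [st]. *)
Definition gs q st k := forall l, (l < k)%N -> q l = proj q l (st l) /\ q l != 0.

Variables (q st : nat -> 'rV[R]_n).

Lemma gsW k l : (l <= k)%N -> gs q st k -> gs q st l.
Proof. by move=> Hl H i Hi; apply: H; exact: leq_trans Hi Hl. Qed.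

Lemma proj_orth k : gs q st k -> forall x l, (l < k)%N -> dot (proj q k x) (q l) = 0.
Proof.
elim: k => // k IH H x l; rewrite ltnS leq_eqVlt => /orP[/eqP->|Hl] /=.
  have [_ H0] := H k (ltnSn k).
  by rewrite dotBl dotZl divfK ?subrr // dotvv_eq0.
rewrite dotBl dotZl IH //; last exact: gsW H.
have [-> _] := H k (ltnSn k).
by rewrite IH // ?mulr0 ?subr0 //; exact: gsW H.
Qed.

Lemma proj_fix k y : (forall l, (l < k)%N -> dot y (q l) = 0) -> proj q k y = y.
Proof.
elim: k => //= k IH H; rewrite IH; last by move=> l Hl; apply: H; exact: ltnW.
by rewrite H // mul0r scale0r subr0.
Qed.

Lemma proj_idem k x : gs q st k -> proj q k (proj q k x) = proj q k x.
Proof. by move=> H; apply: proj_fix => l Hl; rewrite proj_orth. Qed.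

(** Self-adjointness is what allows a query [x] to be answered by testing its projection against
    unprojected rows. *)
Lemma proj_adj k : gs q st k -> forall x y, dot (proj q k x) y = dot x (proj q k y).
Proof.
elim: k => // k IH H x y /=; have Hk := gsW (leqnSn k) H.
have [Eq _] := H k (ltnSn k).
have Pq : proj q k (q k) = q k by rewrite Eq proj_idem.
rewrite dotBl dotBr dotZl dotZr !IH // Pq (dotC (q k) y).
by ring.
Qed.

Lemma proj_st k l : gs q st k -> (l < k)%N -> proj q k (st l) = 0.
Proof.
elim: k => // k IH H; rewrite ltnS leq_eqVlt => /orP[/eqP->|Hl] /=.
  have [E H0] := H k (ltnSn k); rewrite -E divff ?dotvv_eq0 // scale1r subrr //.
by rewrite IH //; [rewrite dot0l mul0r scale0r subrr | exact: gsW H].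
Qed.

Lemma proj_span k x : gs q st k ->
  exists b : nat -> R, proj q k x = x - \sum_(l < k) b l *: st l.
Proof.
elim: k x => [|k IH] x H; first by exists (fun=> 0); rewrite big_ord0 subr0.
have Hk := gsW (leqnSn k) H; have [b1 E1] := IH x Hk; have [b2 E2] := IH (st k) Hk.
have [Eq _] := H k (ltnSn k).
pose t := dot (proj q k x) (q k) / dot (q k) (q k).
exists (fun l => if l == k then t else b1 l - t * b2 l).
rewrite big_ord_recr /= eqxx -/t.
rewrite (eq_bigr (fun l : 'I_k => b1 l *: st l - t *: (b2 l *: st l))); last first.
  by move=> l _; rewrite ltn_eqF // scalerBl scalerA.
rewrite sumrB -scaler_sumr E1 Eq E2; rewrite scalerBr !opprD !opprK -!addrA.
by congr (_ + _); congr (_ + _); rewrite addrC.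
Qed.

Lemma gs_free k (b : nat -> R) : gs q st k ->
  \sum_(l < k) b l *: st l = 0 -> forall l, (l < k)%N -> b l = 0.
Proof.
elim: k => // k IH H; rewrite big_ord_recr /= => E.
have Hk := gsW (leqnSn k) H; have [Eq H0] := H k (ltnSn k).
have bk : b k = 0.
  have : dot (\sum_(l < k) b l *: st l + b k *: st k) (q k) = 0 by rewrite E dot0l.
  rewrite dotDl dot_suml big1 ?add0r; last first.
    by move=> l _; rewrite dotZl Eq -proj_adj // proj_st // dot0l mulr0.
  have Eqq : dot (st k) (q k) = dot (q k) (q k).
    by rewrite Eq -[in LHS](proj_idem (st k) Hk) -[in LHS](proj_adj Hk).
  by rewrite dotZl Eqq => /eqP; rewrite mulf_eq0 dotvv_eq0 (negbTE H0) orbF => /eqP.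
move=> l; rewrite ltnS leq_eqVlt => /orP[/eqP->//|Hl].
by apply: IH => //; move: E; rewrite bk scale0r addr0.
Qed.

Lemma gs_size k : gs q st k -> (k <= n)%N.
Proof.
move=> H; apply: (@dual_size n k (fun l => (dot (q l) (q l))^-1 *: q l) q) => i j Hi Hj.
rewrite dotZl; have [->|ne] := eqVneq i j.
  by rewrite mulVf // dotvv_eq0; case: (H j Hj).
have Ho : forall i j, (j < k)%N -> (i < j)%N -> dot (q i) (q j) = 0.
  move=> i' j' Hj' Hij; have [-> _] := H j' Hj'; rewrite dotC proj_orth //.
  exact: gsW (ltnW Hj') H.
case: (ltngtP i j) ne => // Hij _; first by rewrite (Ho i j) // mulr0.
by rewrite (dotC (q i) (q j)) (Ho j i) // mulr0.
Qed.

Lemma enorm_proj k x : gs q st k -> enorm (proj q k x) <= enorm x.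
Proof.
move=> H; apply: le_enorm.
have -> : dot x x = dot (proj q k x) (proj q k x)
                    + dot (x - proj q k x) (x - proj q k x).
  have E : dot (proj q k x) (proj q k x) = dot x (proj q k x).
    by rewrite proj_adj // proj_idem.
  by rewrite !dotBl !dotBr (dotC (proj q k x) x) E; ring.
by rewrite lerDl dotvv_ge0.
Qed.

End Proj.

(** * Consequences of the definition of the condition number *)

Definition rowset m n (M : 'M[R]_(m, n)) : 'rV[R]_n -> Prop :=
  fun v => exists i, v = row i M.

(* Only the vectors selected by [p] are rows: the others are eliminated vectors,
   on which independence is used but nothing is estimated. *)
Definition lower_bounded n (delta : R) (rows : 'rV[R]_n -> Prop) : Prop :=
  forall r (u : nat -> 'rV[R]_n) (a : nat -> R) (p : pred nat),
    (forall i, (i < r)%N -> p i -> rows (u i)) ->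
    (forall b : nat -> R, (forall i, ~~ p i -> b i = 0) ->
       \sum_(i < r) b i *: u i = 0 -> forall i, (i < r)%N -> b i = 0) ->
    (forall i, ~~ p i -> a i = 0) ->
    forall i, (i < r)%N ->
      delta * (`|a i| * enorm (u i)) <= enorm (\sum_(j < r) a j *: u j).

Definition cond_set m n (M : 'M[R]_(m, n)) := [set d : R | d <= 1 /\
    forall (I : {set 'I_m}) (lam : 'I_m -> R),
      row_free (rowsub (fun k : 'I_#|I| => enum_val k) M) ->
      d * \big[Num.max/0]_(i in I) (`|lam i| * enorm (row i M))
        <= enorm (\sum_(i in I) lam i *: row i M)]%classic.

Lemma sum_enum_val m n (M : 'M[R]_(m, n)) (I : {set 'I_m}) (lam : 'I_m -> R) :
  \sum_(i in I) lam i *: row i M =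
  (\row_(k < #|I|) lam (enum_val k)) *m rowsub (fun k : 'I_#|I| => enum_val k) M.
Proof.
apply/rowP => j; rewrite summxE mxE big_enum_val /=.
by apply: eq_bigr => k _; rewrite !mxE.
Qed.

(** A pseudo-inverse recovers the coefficients of a combination of independent rows, so they are
    bounded by a constant times its norm. There are finitely many sets [I]; summing the constants
    [c I] replaces a maximum, and the summand 1 in [K] yields [d <= 1]. *)
Lemma cond_set_pos m n (M : 'M[R]_(m, n)) : exists2 d, 0 < d & cond_set M d.
Proof.
pose A I := rowsub (fun k : 'I_#|I| => enum_val k) M.
pose c (I : {set 'I_m}) := \sum_(i < n) \sum_(k < #|I|) `|pinvmx (A I) i k|.
pose e := \sum_(i < m) enorm (row i M).
pose K := 1 + (\sum_I c I) * e.
have c0 I : 0 <= c I by do 2![apply: sumr_ge0 => ? _].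
have e0 : 0 <= e by apply: sumr_ge0 => i _; apply: enorm_ge0.
have K0 : 0 < K by apply: lt_le_trans ltr01 _; rewrite /K lerDl mulr_ge0 // sumr_ge0.
exists K^-1; first by rewrite invr_gt0.
split; first by rewrite invf_le1 // /K lerDl mulr_ge0 // sumr_ge0.
move=> I lam Hf.
set x := enorm _; have x0 : 0 <= x := enorm_ge0 _.
rewrite mulrC ler_pdivrMr //; apply: bigmax_le => [|i iI]; first by rewrite mulr_ge0 // ltW.
have : \row_(k < #|I|) lam (enum_val k) =
    (\sum_(i in I) lam i *: row i M) *m pinvmx (A I).
  by rewrite sum_enum_val -mulmxA mulmxVp // mulmx1.
move/rowP/(_ (enum_rank_in iI i)); rewrite !mxE enum_rankK_in // => El.
have Hl : `|lam i| <= x * c I.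
  rewrite El /c mulr_sumr; apply: le_trans (ler_norm_sum _ _ _) _; apply: ler_sum => j _.
  rewrite normrM; apply: ler_pM => //.
    rewrite -sqrtr_sqr /x /enorm ler_wsqrtr // (bigD1 j) //= lerDl.
    by apply: sumr_ge0 => k _; exact: sqr_ge0.
  by rewrite (bigD1 (enum_rank_in iI i)) //= lerDl sumr_ge0.
apply: (@le_trans _ _ ((x * c I) * e)).
  apply: ler_pM => //; first exact: enorm_ge0.
  by rewrite /e (bigD1 i) //= lerDl sumr_ge0 // => j _; apply: enorm_ge0.
rewrite -mulrA ler_wpM2l // /K -[leLHS]add0r lerD // ler_wpM2r //.
by rewrite (bigD1 I) //= lerDl sumr_ge0.
Qed.

Lemma cond_set_sup m n (M : 'M[R]_(m, n)) : has_sup (cond_set M).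
Proof.
split; last by exists 1 => d [].
by have [d _ Hd] := cond_set_pos M; exists d.
Qed.

Lemma cond_number_gt0 m n (M : 'M[R]_(m, n)) : 0 < cond_number M.
Proof.
have [d d0 Hd] := cond_set_pos M; apply: lt_le_trans d0 _.
by apply: ub_le_sup => //; case: (cond_set_sup M).
Qed.

Lemma cond_number_le1 m n (M : 'M[R]_(m, n)) : cond_number M <= 1.
Proof. by apply: ge_sup; [case: (cond_set_sup M) | move=> d []]. Qed.

(** The inequality defining [cond_set] is closed in [d], so the supremum satisfies it too; weight 0
    is set aside in order to divide by it. *)
Lemma cond_number_max m n (M : 'M[R]_(m, n)) (I : {set 'I_m}) (lam : 'I_m -> R) i :
  row_free (rowsub (fun k : 'I_#|I| => enum_val k) M) -> i \in I ->
  cond_number M * (`|lam i| * enorm (row i M)) <= enorm (\sum_(i in I) lam i *: row i M).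
Proof.
move=> Hf iI; set y := _ * enorm _; set x := enorm _.
have y0 : 0 <= y by rewrite mulr_ge0 // enorm_ge0.
have H d : cond_set M d -> d * y <= x.
  case=> d1 Hd; have [d0|d0] := ler0P d.
    by apply: le_trans (enorm_ge0 _); rewrite mulr_le0_ge0.
  apply: le_trans (Hd I lam Hf); rewrite ler_pM2l //.
  exact: (le_bigmax_cond _ (fun i => `|lam i| * enorm (row i M)) iI).
have [->|yn0] := eqVneq y 0; first by rewrite mulr0 enorm_ge0.
have y1 : 0 < y by rewrite lt_def yn0.
rewrite -ler_pdivlMr //; apply: ge_sup; first by case: (cond_set_sup M).
by move=> d Hd; rewrite ler_pdivlMr //; apply: H.
Qed.

(** [cond_number] ranges over sets of row indices, [lower_bounded] over families of vectors, and
    rows may repeat. Independence makes the selected vectors distinct, so the indices chosen for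
    them form a set to which the definition applies. *)
Lemma cond_number_lower_bounded m n (M : 'M[R]_(m, n)) :
  lower_bounded (cond_number M) (rowset M).
Proof.
move=> r u a p Hu Hfree Ha i0 Hi0.
have [pi0|pi0] := boolP (p i0); last by rewrite Ha // normr0 mul0r mulr0 enorm_ge0.
pose P := [pred i : 'I_r | p i].
have [j0 _] := Hu i0 Hi0 pi0.
have /choice[f Hf] : forall i : 'I_r, exists j : 'I_m, P i -> u i = row j M.
  move=> i.
  have [Hp|Hp] := boolP (P i); last by exists j0.
  by have [j Hj] := Hu i (ltn_ord i) Hp; exists j.
have finj : {in P &, injective f}.
  move=> i j Pi Pj E; apply/eqP/negPn/negP => ne.
  (* Two equal selected vectors would satisfy the relation with coefficients 1 and -1. *)
  pose b (k : nat) : R := if k == i then 1 else if k == j then -1 else 0.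
  have : b i = 0.
    apply: (Hfree b) => // [k Hk|].
      rewrite /b; case: eqP => [E1|_]; first by rewrite E1 [p i]Pi in Hk.
      by case: eqP => // E1; rewrite E1 [p j]Pj in Hk.
    rewrite (bigD1 i) //= (bigD1 j) 1?eq_sym //= big1 => [|k /andP[k1 k2]]; last first.
      have k1' : (k == i :> nat) = false by apply: negbTE.
      have k2' : (k == j :> nat) = false by apply: negbTE.
      by rewrite /b k1' k2' scale0r.
    have ne' : (j == i :> nat) = false by rewrite eq_sym; apply: negbTE.
    by rewrite /b eqxx ne' eqxx !Hf // E addr0 scaleN1r scale1r subrr.
  by rewrite /b eqxx => /eqP; rewrite oner_eq0.
pose I := [set f i | i in P].
pose lam j := \sum_(i | P i && (f i == j)) a i.
have Elam i : P i -> lam (f i) = a i.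
  move=> Pi; rewrite /lam (bigD1 i) /=; last by rewrite eqxx andbT.
  rewrite big1 ?addr0 // => j /andP[/andP[Pj /eqP E] ne].
  by rewrite (finj j i Pj Pi E) eqxx in ne.
have Esum (b : 'I_m -> R) :
    \sum_(j in I) b j *: row j M = \sum_(i < r) (if p i then b (f i) else 0) *: u i.
  rewrite big_imset //= [RHS](bigID P) /= [X in _ + X]big1 ?addr0; last first.
    by move=> i /negbTE->; rewrite scale0r.
  by apply: eq_bigr => i Pi; rewrite [p i]Pi Hf.
have HI : row_free (rowsub (fun k : 'I_#|I| => enum_val k) M).
  rewrite -kermx_eq0; apply/eqP/row_matrixP => k; rewrite row0.
  set v := row k _.
  have Hv : v *m rowsub (fun k : 'I_#|I| => enum_val k) M = 0.
    by rewrite -row_mul mulmx_ker row0.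
  pose b j := if [pick k : 'I_#|I| | enum_val k == j] is Some k then v 0 k else 0.
  have Eb k1 : b (enum_val k1) = v 0 k1.
    rewrite /b; case: pickP => [k2 /eqP/enum_val_inj->//|/(_ k1)].
    by rewrite eqxx.
  have Hb : \sum_(j in I) b j *: row j M = 0.
    rewrite sum_enum_val -Hv; congr (_ *m _); apply/rowP => k1; by rewrite mxE Eb.
  apply/rowP => k1; rewrite [RHS]mxE -Eb.
  have /imsetP[i Pi ->] := enum_valP k1.
  pose bb (k : nat) : R := if insub k is Some i then if p k then b (f i) else 0 else 0.
  have -> : b (f i) = bb i by rewrite /bb insubT //= => H; rewrite [p i]Pi; congr (b (f _)); apply: val_inj.
  apply: Hfree => // [k2 Hk2|].
    by rewrite /bb; case: insubP => // ? _ _; rewrite (negbTE Hk2).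
  rewrite -[RHS]Hb Esum; apply: eq_bigr => k2 _; congr (_ *: _).
  by rewrite /bb insubT //= => H; congr (if _ then b (f _) else _); apply: val_inj.
have := cond_number_max lam HI (imset_f f (pi0 : Ordinal Hi0 \in P)).
rewrite Elam // -Hf // Esum; set A := \sum_(i < r) _.
have -> // : A = \sum_(j < r) a j *: u j.
apply: eq_bigr => i _; case: ifP => Hp; first by rewrite Elam.
by rewrite Ha ?Hp.
Qed.

(* Passing to the orthogonal complement of a set of rows does not decrease the
   condition number: the coefficients of the eliminated rows are left free. *)
Lemma proj_lower_bounded n delta (rows : 'rV[R]_n -> Prop) q st k :
  gs q st k -> (forall l, (l < k)%N -> rows (st l)) -> 0 <= delta ->
  lower_bounded delta rows ->
  lower_bounded delta (fun v => exists2 m, rows m & v = proj q k m \/ v = - proj q k m).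
Proof.
move=> Hgs Hst Hd HL r v a p Hv Hfree Ha i Hi.
have [pi|pi] := boolP (p i); last by rewrite Ha // normr0 mul0r mulr0 enorm_ge0.
have /choice[u Hu] : forall j, exists us : 'rV[R]_n * R,
    (j < r)%N -> p j -> [/\ rows us.1, `|us.2| = 1 & v j = us.2 *: proj q k us.1].
  move=> j; have [Hj|Hj] := ltnP j r; last by exists (0, 0).
  have [pj|pj] := boolP (p j); last by exists (0, 0).
  have [m Hm [->|->]] := Hv j Hj pj; [exists (m, 1) | exists (m, -1)] => _ _ /=; split=> //.
  - by rewrite normr1.
  - by rewrite scale1r.
  - by rewrite normrN1.
  - by rewrite scaleN1r.
have Ev (b : nat -> R) : (forall j, ~~ p j -> b j = 0) ->
    \sum_(j < r) b j *: v j = proj q k (\sum_(j < r) (b j * (u j).2) *: (u j).1).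
  move=> Hb; rewrite proj_sum; apply: eq_bigr => j _; rewrite projZ.
  have [pj|pj] := boolP (p j); last by rewrite Hb // mul0r !scale0r.
  by have [_ _ ->] := Hu j (ltn_ord j) pj; rewrite scalerA.
have [b Eb] := proj_span (\sum_(j < r) (a j * (u j).2) *: (u j).1) Hgs.
(* The projected combination equals a combination of the [k] rows [st] followed by the [r]
   unprojected rows. This longer family is independent as well, and only coefficients of its second
   block are estimated. *)
pose w j := if (j < k)%N then st j else (u (j - k)%N).1.
pose cf (b a : nat -> R) j := if (j < k)%N then b j else a (j - k)%N * (u (j - k)%N).2.
pose pp := [pred j | (j < k)%N || p (j - k)%N].
have Ew b' a' : \sum_(j < k + r) cf b' a' j *: w j =
    \sum_(l < k) b' l *: st l + \sum_(j < r) (a' j * (u j).2) *: (u j).1.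
  rewrite big_split_ord /=; congr (_ + _); apply: eq_bigr => j _; rewrite /cf /w.
    by rewrite /= ltn_ord.
  by rewrite /= ltnNge leq_addr /= addKn.
have us j : (j < r)%N -> p j -> (u j).2 * (u j).2 = 1.
  move=> Hj pj; have [_ H _] := Hu j Hj pj.
  by rewrite -expr2 -[LHS]ger0_norm ?sqr_ge0 // normrX H expr1n.
have := HL (k + r)%N w (cf (fun l => - b l) a) pp _ _ _ (k + i)%N.
have -> : enorm (w (k + i)%N) = enorm (u i).1 by rewrite /w ltnNge leq_addr /= addKn.
rewrite Ew Ev // Eb (eq_bigr (fun l : 'I_k => - (b l *: st l))); last first.
  by move=> l _; rewrite scaleNr.
rewrite sumrN [_ - _]addrC => H; apply: le_trans (H _ _ _ _) => {H}.
- rewrite /cf ltnNge leq_addr /= addKn normrM; have [_ -> ->] := Hu i Hi pi.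
  rewrite mulr1 ler_wpM2l // ler_wpM2l // enormZ; have [_ -> _] := Hu i Hi pi.
  by rewrite mul1r (enorm_proj _ Hgs).
- move=> j Hj; rewrite /= /w; case: ltnP => [Hjk _|Hjk /= pj]; first exact: Hst.
  by have [] := Hu (j - k)%N _ pj => //; rewrite ltn_subLR.
- move=> b' Hb' E.
  pose b1 j := b' (k + j)%N * (u j).2.
  have Ecf j : (j < k + r)%N -> b' j = cf b' b1 j.
    move=> Hj; rewrite /cf; case: ltnP => // Hjk; rewrite /b1 subnKC //.
    have [pj|pj] := boolP (p (j - k)%N); last first.
      by rewrite Hb' ?mul0r //= negb_or -leqNgt Hjk.
    by rewrite -mulrA us ?mulr1 // ltn_subLR.
  have Hb1 j : ~~ p j -> b1 j = 0.
    by move=> pj; rewrite /b1 Hb' ?mul0r //= ltnNge leq_addr /= addKn.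
  rewrite (eq_bigr (fun j : 'I_(k + r) => cf b' b1 j *: w j)) in E; last first.
    by move=> j _; rewrite -Ecf.
  rewrite Ew in E.
  have b10 : forall j, (j < r)%N -> b1 j = 0.
    apply: Hfree => //; rewrite Ev //; have := congr1 (proj q k) E.
    rewrite proj0 projD [X in X + _]proj_sum big1 ?add0r // => l _.
    by rewrite projZ (proj_st Hgs) // scaler0.
  have E2 : \sum_(l < k) b' l *: st l = 0.
    move: E; rewrite [X in _ + X]big1 ?addr0 // => j _.
    by rewrite b10 // mul0r scale0r.
  move=> j Hj; rewrite Ecf // /cf; case: ltnP => Hjk; first exact: (gs_free Hgs E2).
  by rewrite b10 ?mul0r // ltn_subLR.
- move=> j; rewrite negb_or -leqNgt => /andP[Hjk pj].
  by rewrite /cf ltnNge Hjk /= Ha // mul0r.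
- by rewrite ltn_add2l.
Qed.

End Vec.

(** * Conic Caratheodory reduction with a dual basis *)

Section Caratheodory.
Variables (R : realType) (N : nat).
Implicit Types (w g : nat -> 'rV[R]_N) (a b z : nat -> R) (idx : nat -> nat).

Definition mix (r : nat) a (v : nat -> 'rV[R]_N) : 'rV[R]_N := \sum_(k < r) a k *: v k.

Lemma eq_mix r a a' v v' : (forall k, (k < r)%N -> a k = a' k) ->
  (forall k, (k < r)%N -> v k = v' k) -> mix r a v = mix r a' v'.
Proof. by move=> H1 H2; apply: eq_bigr => k _; rewrite H1 // H2. Qed.

Lemma mixS r a v : mix r.+1 a v = mix r a v + a r *: v r.
Proof. exact: big_ord_recr. Qed.

Lemma mixD r a a' v : mix r (fun k => a k + a' k) v = mix r a v + mix r a' v.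
Proof. by rewrite /mix -big_split; apply: eq_bigr => k _; rewrite scalerDl. Qed.

Lemma mixZ r t a v : mix r (fun k => t * a k) v = t *: mix r a v.
Proof. by rewrite /mix scaler_sumr; apply: eq_bigr => k _; rewrite scalerA. Qed.

Lemma mixB r a a' v : mix r (fun k => a k - a' k) v = mix r a v - mix r a' v.
Proof. by rewrite /mix -sumrB; apply: eq_bigr => k _; rewrite scalerBl. Qed.

Lemma mix_split r a v kk : (kk < r)%N ->
  mix r a v = a kk *: v kk + \sum_(k < r | k != kk :> nat) a k *: v k.
Proof. by move=> Hk; rewrite /mix (bigD1 (Ordinal Hk)). Qed.

Lemma mix0 r a v : (forall k, (k < r)%N -> a k = 0) -> mix r a v = 0.
Proof. by move=> H; rewrite /mix big1 // => k _; rewrite H // scale0r. Qed.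

(* State of the reduction of [mix i b w] to a combination of a linearly
   independent subfamily [w (idx k)], [k < r]. The vectors [g k] form a family
   dual to it and spanning the same space. *)
Record cara w b (i r : nat) idx a g : Prop := Cara {
  cara_lt : forall k, (k < r)%N -> (idx k < i)%N;
  cara_pos : forall k, (k < r)%N -> 0 < b (idx k);
  cara_ge0 : forall k, (k < r)%N -> 0 <= a k;
  cara_dual : forall k l, (k < r)%N -> (l < r)%N -> dot (g k) (w (idx l)) = (k == l)%:R;
  cara_orth : forall x, (forall k, (k < r)%N -> dot (g k) x = 0) ->
                forall k, (k < r)%N -> dot (w (idx k)) x = 0;
  cara_sum : mix r a (fun k => w (idx k)) = mix i b w }.

Lemma cara_size w b i r idx a g : cara w b i r idx a g -> (r <= N)%N.
Proof. by case=> _ _ _ H _ _; apply: dual_size H. Qed.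

Lemma dot_mix g w r idx z k :
  (forall k l, (k < r)%N -> (l < r)%N -> dot (g k) (w (idx l)) = (k == l)%:R) ->
  (k < r)%N -> dot (g k) (mix r z (fun k => w (idx k))) = z k.
Proof.
move=> H Hk; rewrite /mix dot_sumr (bigD1 (Ordinal Hk)) //= big1 ?addr0.
  by rewrite dotZr H // eqxx mulr1.
by move=> l ne; rewrite dotZr H // (_ : (k == l) = false) ?mulr0 // eq_sym; apply: negbTE.
Qed.

Lemma cara_free w b i r idx a g z : cara w b i r idx a g ->
  mix r z (fun k => w (idx k)) = 0 -> forall k, (k < r)%N -> z k = 0.
Proof.
by case=> _ _ _ H _ _ E k Hk; rewrite -(dot_mix z H Hk) E dot0r.
Qed.

Lemma cara_inj w b i r idx a g k l : cara w b i r idx a g ->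
  (k < r)%N -> (l < r)%N -> w (idx k) = w (idx l) -> k = l.
Proof.
case=> _ _ _ H _ _ Hk Hl E; apply/eqP; move: (H k l Hk Hl); rewrite -E H // eqxx.
by case: eqP => // _ /eqP; rewrite oner_eq0.
Qed.

Lemma cara0 w b idx a g : cara w b 0 0 idx a g.
Proof. by split=> //; rewrite /mix !big_ord0. Qed.

Lemma cara_skip w b i r idx a g : cara w b i r idx a g -> 0 <= b i -> ~~ (0 < b i) ->
  cara w b i.+1 r idx a g.
Proof.
case=> H1 H2 H3 H4 H5 H6 b0 b1; split=> // [k Hk|]; first exact: leqW (H1 k Hk).
by rewrite mixS H6 (_ : b i = 0) ?scale0r ?addr0 //; apply/eqP; rewrite eq_le b0 leNgt b1.
Qed.

Section Insert.
Variables (w : nat -> 'rV[R]_N) (b : nat -> R) (i r : nat) (idx : nat -> nat).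
Variables (a : nat -> R) (g : nat -> 'rV[R]_N).
Hypothesis H : cara w b i r idx a g.
Hypothesis bi : 0 < b i.
Variables (z : nat -> R) (rho : 'rV[R]_N).
Hypothesis Hz : forall k, (k < r)%N -> z k = dot (g k) (w i).
Hypothesis Hrho : rho = w i - mix r z (fun k => w (idx k)).

Lemma cara_rho_orth k : (k < r)%N -> dot (w (idx k)) rho = 0.
Proof.
apply: (cara_orth H) => l Hl; rewrite Hrho dotBr (dot_mix z (cara_dual H) Hl).
by rewrite Hz // subrr.
Qed.

(** [rho] is orthogonal to the kept vectors, so its multiple [g' r] is dual to [w i] and vanishes on
    the others; subtracting [z k] times it from [g k] restores duality. *)
Lemma cara_add idx' a' g' : rho != 0 ->
  (forall k, (k < r)%N -> idx' k = idx k) -> idx' r = i ->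
  (forall k, (k < r)%N -> a' k = a k) -> a' r = b i ->
  g' r = (dot rho rho)^-1 *: rho ->
  (forall k, (k < r)%N -> g' k = g k - z k *: g' r) ->
  cara w b i.+1 r.+1 idx' a' g'.
Proof.
move=> rho0 I1 I2 A1 A2 G1 G2.
have nn0 : dot rho rho != 0 by rewrite dotvv_eq0.
have rw0 : dot rho (w i) = dot rho rho.
  rewrite [X in dot _ X = _](_ : w i = rho + mix r z (fun k => w (idx k))); last first.
    by rewrite Hrho subrK.
  rewrite dotDr [X in _ + X](_ : _ = 0) ?addr0 // /mix dot_sumr big1 // => k _.
  by rewrite dotZr dotC cara_rho_orth // mulr0.
have gr_w l : (l < r)%N -> dot (g' r) (w (idx l)) = 0.
  by move=> Hl; rewrite G1 dotZl dotC cara_rho_orth // mulr0.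
have gr_wi : dot (g' r) (w i) = 1 by rewrite G1 dotZl rw0 mulVf.
split.
- by move=> k; rewrite ltnS leq_eqVlt => /orP[/eqP->|Hk]; rewrite ?I2 ?I1 // ltnS ltnW // (cara_lt H).
- by move=> k; rewrite ltnS leq_eqVlt => /orP[/eqP->|Hk]; rewrite ?I2 ?I1 // (cara_pos H).
- by move=> k; rewrite ltnS leq_eqVlt => /orP[/eqP->|Hk]; rewrite ?A2 ?A1 ?(cara_ge0 H) // ltW.
- move=> k l; rewrite ltnS leq_eqVlt => /orP[/eqP->|Hk];
    rewrite ltnS leq_eqVlt => /orP[/eqP->|Hl].
  + by rewrite I2 gr_wi eqxx.
  + by rewrite I1 // gr_w // gtn_eqF.
  + by rewrite I2 G2 // dotBl dotZl gr_wi mulr1 Hz // subrr ltn_eqF.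
  + by rewrite I1 // G2 // dotBl dotZl gr_w // mulr0 subr0 (cara_dual H).
- move=> x Hx.
  have gx k : (k < r)%N -> dot (g k) x = 0.
    move=> Hk; have := Hx k (leqW Hk).
    by rewrite G2 // dotBl dotZl Hx // mulr0 subr0.
  have rx : dot rho x = 0.
    have := Hx r (ltnSn r); rewrite G1 dotZl => /eqP.
    by rewrite mulf_eq0 invr_eq0 (negbTE nn0) => /eqP.
  move=> k; rewrite ltnS leq_eqVlt => /orP[/eqP->|Hk]; last by rewrite I1 // (cara_orth H).
  rewrite I2 (_ : w i = rho + mix r z (fun k => w (idx k))); last by rewrite Hrho subrK.
  rewrite dotDl rx add0r /mix dot_suml big1 // => l _.
  by rewrite dotZl (cara_orth H) // mulr0.
- rewrite !mixS A2 I2 -(cara_sum H); congr (_ + _); apply: eq_mix => k Hk; rewrite ?A1 //.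
  by rewrite I1.
Qed.

Hypothesis rho0 : rho = 0.

Lemma cara_wi : w i = mix r z (fun k => w (idx k)).
Proof. by apply/eqP; rewrite -subr_eq0 -Hrho rho0. Qed.

Lemma cara_move a' :
  (forall k, (k < r)%N -> a' k = a k + b i * z k) ->
  (forall k, (k < r)%N -> 0 <= a' k) ->
  cara w b i.+1 r idx a' g.
Proof.
move=> A1 A2; case: (H) => H1 H2 H3 H4 H5 H6; split=> // [k Hk|]; first exact: leqW (H1 k Hk).
rewrite mixS -H6 cara_wi -mixZ -mixD; exact: eq_mix.
Qed.

(** Pivot step: a share [s] of the weight [b i] is moved along [w i = mix r z] until the coefficient
    of [kk] vanishes; [i] then takes its place with the remaining weight [b i - s]. *)
Lemma cara_swap s kk idx' a' g' : (kk < r)%N -> z kk != 0 ->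
  0 <= s -> s <= b i ->
  (forall k, (k < r)%N -> 0 <= a k + s * z k) -> a kk + s * z kk = 0 ->
  (forall k, (k < r)%N -> k != kk -> a' k = a k + s * z k) -> a' kk = b i - s ->
  (forall k, (k < r)%N -> k != kk -> idx' k = idx k) -> idx' kk = i ->
  g' kk = (z kk)^-1 *: g kk ->
  (forall k, (k < r)%N -> k != kk -> g' k = g k - z k *: g' kk) ->
  cara w b i.+1 r idx' a' g'.
Proof.
move=> Hkk zk s0 sb P1 P2 A1 A2 I1 I2 G1 G2.
have gz k : (k < r)%N -> dot (g k) (w i) = z k by move=> Hk; rewrite Hz.
have D := cara_dual H.
split.
- move=> k Hk; have [->|ne] := eqVneq k kk; first by rewrite I2.
  by rewrite I1 //; exact: leqW (cara_lt H Hk).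
- move=> k Hk; have [->|ne] := eqVneq k kk; first by rewrite I2.
  by rewrite I1 // (cara_pos H).
- move=> k Hk; have [->|ne] := eqVneq k kk; first by rewrite A2 subr_ge0.
  by rewrite A1 // P1.
- move=> k l Hk Hl; have [->|ne] := eqVneq k kk; have [->|ne'] := eqVneq l kk.
  + by rewrite I2 G1 dotZl gz // mulVf // eqxx.
  + by rewrite I1 // G1 dotZl D // eq_sym (negbTE ne') mulr0.
  + by rewrite I2 G2 // dotBl dotZl G1 dotZl !gz // mulVf // mulr1 subrr (negbTE ne).
  + rewrite I1 // G2 // dotBl dotZl G1 dotZl !D // (_ : (kk == l) = false) ?mulr0 ?subr0 //.
    by rewrite eq_sym; apply: negbTE.
- move=> x Hx.
  have gx k : (k < r)%N -> dot (g k) x = 0.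
    have Hgk : dot (g kk) x = 0.
      have := Hx kk Hkk; rewrite G1 dotZl => /eqP.
      by rewrite mulf_eq0 invr_eq0 (negbTE zk) => /eqP.
    move=> Hk; have [->//|ne] := eqVneq k kk.
    by have := Hx k Hk; rewrite G2 // dotBl dotZl Hx // mulr0 subr0.
  have wx := cara_orth H gx.
  move=> k Hk; have [->|ne] := eqVneq k kk; last by rewrite I1 // wx.
  rewrite I2 cara_wi /mix dot_suml big1 // => l _.
  by rewrite dotZl wx // mulr0.
- have E : mix r (fun k => a k + s * z k) (fun k => w (idx k)) + (b i - s) *: w i
           = mix i.+1 b w.
    rewrite mixS mixD mixZ -cara_wi (cara_sum H) scalerBl -addrA; congr (_ + _).
    by rewrite addrC subrK.
  rewrite -E (mix_split _ _ Hkk) A2 I2 [in RHS](mix_split _ _ Hkk) P2 scale0r add0r addrC.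
  congr (_ + _); apply: eq_bigr => k ne; rewrite A1 // I1 //.
Qed.

End Insert.

(** * Removing a small residual from a conic combination *)

(* [small_coefs] is the form in which the lower bounds are used: a conic
   combination of an independent subfamily has small coefficients if its value
   is small. *)
Definition small_coefs (delta : R) (cnt : nat) w : Prop :=
  forall r idx a, (forall k, (k < r)%N -> (idx k < cnt)%N) ->
    (forall z, mix r z (fun k => w (idx k)) = 0 -> forall k, (k < r)%N -> z k = 0) ->
    forall k, (k < r)%N ->
      delta * (`|a k| * enorm (w (idx k))) <= enorm (mix r a (fun k => w (idx k))).

(** The reduced combination has the same value as the full one, so subtracting [phi] times it scales
    the value by [1 - phi]. What an item loses is [phi] times a coefficient of an independent
    family, hence controlled by [phi] times the norm of the value, which is exactly the amount by
    which this norm drops. *)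
Lemma trim_step (delta : R) (cnt : nat) w B B' r idx a g phi :
  small_coefs delta cnt w -> 0 <= delta ->
  cara w B cnt r idx a g -> 0 <= phi <= 1 ->
  (forall i, (i < cnt)%N -> 0 <= B i) ->
  (forall k, (k < r)%N -> phi * a k <= B (idx k)) ->
  (forall k, (k < r)%N -> B' (idx k) = B (idx k) - phi * a k) ->
  (forall i, (forall k, (k < r)%N -> idx k != i) -> B' i = B i) ->
  [/\ mix cnt B' w = (1 - phi) *: mix cnt B w,
      forall i, (i < cnt)%N -> 0 <= B' i <= B i
    & forall i, (i < cnt)%N ->
        delta * (enorm (w i) * (B i - B' i)) <= phi * enorm (mix cnt B w)].
Proof.
move=> Hs d0 HC /andP[p0 p1] HB Hle E1 E2.
have idx_inj k l : (k < r)%N -> (l < r)%N -> idx k = idx l -> k = l.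
  by move=> Hk Hl E; apply: (cara_inj HC) => //; rewrite E.
have cases i : (exists2 k, (k < r)%N & idx k = i) \/ (forall k, (k < r)%N -> idx k != i).
  have [/existsP[k /eqP E]|/existsPn Hn] := boolP [exists k : 'I_r, idx k == i].
    by left; exists k.
  by right => k Hk; exact: (Hn (Ordinal Hk)).
split.
- have Ei i : (i < cnt)%N -> B i - B' i = \sum_(k < r | idx k == i) phi * a k.
    move=> Hi; have [[k Hk E]|Hn] := cases i.
      rewrite (bigD1 (Ordinal Hk)) /=; last by rewrite E.
      rewrite big1 ?addr0; first by rewrite -E E1 // opprB addrC subrK.
      move=> l /andP[/eqP El ne]; exfalso; move/negP: ne; apply; apply/eqP/val_inj.
      by apply: idx_inj => //=; rewrite El E.
    rewrite E2 // subrr big1 // => k /eqP E; have := Hn k (ltn_ord k).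
    by rewrite E eqxx.
  have <- : mix cnt B w - mix cnt (fun i => B i - B' i) w = mix cnt B' w.
    by rewrite mixB opprB addrC subrK.
  rewrite scalerBl scale1r; congr (_ - _).
  rewrite -(cara_sum HC) -mixZ /mix.
  under eq_bigr => i _ do rewrite Ei // scaler_suml.
  rewrite (exchange_big_dep xpredT) //=; apply: eq_bigr => k _.
  have Hk := cara_lt HC (ltn_ord k).
  rewrite (bigD1 (Ordinal Hk)) ?eqxx //= big1 ?addr0 // => i /andP[/eqP E] /eqP; case.
  exact: val_inj.
- move=> i Hi; have [[k Hk <-]|Hn] := cases i; last by rewrite E2 // HB //=.
  rewrite E1 // subr_ge0 Hle //= lerBlDr lerDl.
  by rewrite mulr_ge0 // (cara_ge0 HC).
- move=> i Hi; have [[k Hk <-]|Hn] := cases i; last first.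
    by rewrite E2 // subrr !mulr0 mulr_ge0 // enorm_ge0.
  rewrite E1 // opprB addrC subrK.
  rewrite [leLHS](_ : _ = phi * (delta * (`|a k| * enorm (w (idx k))))).
    rewrite ler_wpM2l // -(cara_sum HC); apply: Hs => //.
      by move=> l; exact: (cara_lt HC).
    by move=> z Hz; exact: (cara_free HC Hz).
  by rewrite ger0_norm ?(cara_ge0 HC) //; ring.
Qed.

End Caratheodory.

(** * Exact relations from approximate ones *)

Section Exact.
Variables (R : realType) (n : nat).

Definition lo (x : 'rV[R]_n.+1) : 'rV[R]_n := \row_(j < n) x 0 (widen_ord (leqnSn n) j).

Lemma lo_mix r a (v : nat -> 'rV[R]_n.+1) : lo (mix r a v) = mix r a (fun k => lo (v k)).
Proof.
apply/rowP => j; rewrite mxE !summxE; apply: eq_bigr => k _.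
by rewrite !mxE.
Qed.

Lemma top_mix r a (v : nat -> 'rV[R]_n.+1) :
  (mix r a v) 0 ord_max = \sum_(k < r) a k * v k 0 ord_max.
Proof. by rewrite summxE; apply: eq_bigr => k _; rewrite mxE. Qed.

Lemma lo_top_eq0 (x : 'rV[R]_n.+1) : lo x = 0 -> x 0 ord_max = 0 -> x = 0.
Proof.
move=> H1 H2; apply/rowP => j; rewrite mxE.
have [Hj|Hj] := ltnP j n.
  have /rowP/(_ (Ordinal Hj)) := H1; rewrite !mxE => <-; congr (x 0 _); exact: val_inj.
by rewrite -H2; congr (x 0 _); apply: val_inj => /=; have := ltn_ord j; lia.
Qed.

Definition etop : 'rV[R]_n.+1 := delta_mx 0 ord_max.

Lemma lo_etop : lo etop = 0.
Proof.
apply/rowP => j; rewrite !mxE eqxx /=; case: eqP => // E.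
by have := congr1 val E; rewrite /= => E'; have := ltn_ord j; rewrite E' ltnn.
Qed.

Lemma top_etop : etop 0 ord_max = 1.
Proof. by rewrite mxE !eqxx. Qed.

(* A linear relation with small value among the lifted vectors is close to an
   exact relation with nonnegative coefficients when delta is a lower bound for
   the vectors involved. Otherwise one of the coefficients of the exact relation
   is negative, and moving along it eliminates one vector without decreasing the
   last coordinate, which contradicts [delta]. *)
Lemma exact_relation (delta : R) (w : nat -> 'rV[R]_n.+1) b cnt r idx a g
    (vecs : 'rV[R]_n -> Prop) :
  0 < delta -> lower_bounded delta vecs ->
  cara w b cnt r idx a g ->
  (forall i, (i < cnt)%N -> vecs (lo (w i)) /\ w i 0 ord_max = norm1 (lo (w i))) ->
  n.+1%:R * n%:R * enorm (lo (mix cnt b w)) < delta ->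
  1 <= (mix cnt b w) 0 ord_max ->
  let z k := dot (g k) etop in
  etop = mix r z (fun k => w (idx k)) /\ forall k, (k < r)%N -> 0 <= z k.
Proof.
move=> d0 HL HC Hw Hsmall Htop z.
pose v k := lo (w (idx k)); pose u := lo (mix cnt b w).
have Hv k : (k < r)%N -> vecs (v k) /\ w (idx k) 0 ord_max = norm1 (v k).
  by move=> Hk; apply: Hw; exact: (cara_lt HC).
have rn := cara_size HC.
(* There are [r <= n + 1] terms, and each 1-norm is at most [n] times the Euclidean norm: this is
   the factor [n.+1 * n] in the hypothesis of smallness. *)
have key (a' : nat -> R) (p : pred nat) :
    (forall b : nat -> R, (forall i, ~~ p i -> b i = 0) ->
       \sum_(i < r) b i *: v i = 0 -> forall i, (i < r)%N -> b i = 0) ->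
    (forall i, ~~ p i -> a' i = 0) -> (forall k, (k < r)%N -> 0 <= a' k) ->
    mix r a' v = u -> \sum_(k < r) a' k * w (idx k) 0 ord_max < 1.
  move=> Hfree Hp Ha' Eu.
  have H k : (k < r)%N -> delta * (a' k * enorm (v k)) <= enorm u.
    move=> Hk; rewrite -(ger0_norm (Ha' k Hk)) -Eu.
    by apply: (HL r v a' p) => // i Hi _; case: (Hv i Hi).
  rewrite -(ltr_pM2l d0) mulr1; apply: le_lt_trans Hsmall; rewrite mulr_sumr.
  apply: (@le_trans _ _ (\sum_(k < r) n%:R * enorm u)).
    apply: ler_sum => k _; have [_ ->] := Hv k (ltn_ord k).
    apply: (@le_trans _ _ (n%:R * (delta * (a' k * enorm (v k))))); last first.
      by rewrite ler_wpM2l // H.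
    rewrite [leRHS](_ : _ = delta * (a' k * (n%:R * enorm (v k)))); last by ring.
    by rewrite ler_pM2l // ler_wpM2l ?Ha' // norm1_enorm.
  rewrite sumr_const card_ord -(mulr_natl (_ * _)) mulrA -/u ler_wpM2r ?enorm_ge0 //.
  by rewrite ler_wpM2r // ler_nat.
have Elo a' : lo (mix r a' (fun k => w (idx k))) = mix r a' v by rewrite lo_mix.
have Eu : mix r a v = u by rewrite -Elo (cara_sum HC).
have Htop' : 1 <= \sum_(k < r) a k * w (idx k) 0 ord_max.
  by move: Htop; rewrite -(cara_sum HC) top_mix.
have uniq_z a' : mix r a' v = 0 ->
    mix r a' (fun k => w (idx k)) = (\sum_(k < r) a' k * w (idx k) 0 ord_max) *: etop.
  move=> E; apply/eqP; rewrite -subr_eq0; apply/eqP/lo_top_eq0.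
    by apply/rowP => j; have /rowP/(_ j) := Elo a'; rewrite E; have /rowP/(_ j) := lo_etop;
       rewrite !mxE => -> ->; rewrite mulr0 subr0.
  by rewrite mxE [X in _ + X]mxE [X in _ - X]mxE top_etop mulr1 top_mix subrr.
(* If the lower parts were independent, [delta] would force the 1-norm mass of [a] below 1. *)
have [bb Hb [k0 Hk0 bk0]] : exists2 bb : nat -> R, mix r bb v = 0 &
    exists2 k, (k < r)%N & bb k != 0.
  apply: contrapT => Hn; have : \sum_(k < r) a k * w (idx k) 0 ord_max < 1.
    apply: (key a predT) => //; last by move=> k Hk; exact: (cara_ge0 HC).
    move=> bb _ E i Hi; apply/eqP; apply/negPn/negP => ne; by apply: Hn; exists bb => //; exists i.
  by rewrite ltNge Htop'.
have s0 : \sum_(k < r) bb k * w (idx k) 0 ord_max != 0.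
  apply: contra bk0 => /eqP s0; apply/eqP.
  by apply: (cara_free HC) => //; rewrite uniq_z // s0 scale0r.
(* Rescaled to last coordinate 1, the relation [bb] expresses [etop] in the kept vectors, and
   duality identifies its coefficients with [z]. *)
have Ez : etop = mix r z (fun k => w (idx k)).
  pose t := (\sum_(k < r) bb k * w (idx k) 0 ord_max)^-1.
  have E : etop = mix r (fun k => t * bb k) (fun k => w (idx k)).
    by rewrite mixZ uniq_z // scalerA mulVf // scale1r.
  by rewrite {1}E; apply: eq_mix => // k Hk; rewrite /z E (dot_mix _ (cara_dual HC)).
split=> //.
have Ezv : mix r z v = 0 by rewrite -Elo -Ez lo_etop.
have Ez1 : \sum_(k < r) z k * w (idx k) 0 ord_max = 1.
  by rewrite -(top_mix r z (fun k => w (idx k))) -Ez top_etop.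
move=> k1 Hk1; rewrite leNgt; apply/negP => zk1.
pose P := [pred k : 'I_r | z k < 0].
have Pk1 : P (Ordinal Hk1) by [].
case: (arg_minP (fun k : 'I_r => a k / - z k) Pk1) => i0 Pi0 Hmin.
pose tau := a i0 / - z i0.
have tau0 : 0 <= tau by rewrite divr_ge0 ?(cara_ge0 HC) // oppr_ge0 ltW.
pose a' (k : nat) := if k == i0 :> nat then 0 else a k + tau * z k.
have Ea' k : (k < r)%N -> a' k = a k + tau * z k.
  move=> Hk; rewrite /a'; case: eqP => // ->; rewrite /tau invrN mulrN mulNr divfK ?subrr //.
  by rewrite lt_eqF.
have : \sum_(k < r) a' k * w (idx k) 0 ord_max < 1.
  apply: (key a' [pred k : nat | k != i0 :> nat]).
  - move=> bb' Hbb' E.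
    have E2 := uniq_z bb' E.
    set s := \sum_(k < r) _ in E2.
    have E3 : mix r (fun k => bb' k - s * z k) (fun k => w (idx k)) = 0.
      by rewrite mixB mixZ E2 -Ez subrr.
    have H3 := cara_free HC E3.
    have sz : s = 0.
      have := H3 i0 (ltn_ord i0); rewrite Hbb' /= ?eqxx // sub0r => /eqP.
      rewrite oppr_eq0 mulf_eq0 => /orP[/eqP//|/eqP E4].
      by move: Pi0; rewrite /= E4 ltxx.
    by move=> i Hi; have := H3 i Hi; rewrite sz mul0r subr0.
  - by move=> i; rewrite /= negbK => /eqP->; rewrite /a' eqxx.
  - move=> k Hk; rewrite Ea' //; have [zk|zk] := leP 0 (z k).
      by rewrite addr_ge0 ?(cara_ge0 HC) // mulr_ge0.
    have := Hmin (Ordinal Hk) zk; rewrite /= -/tau ler_pdivlMr ?oppr_gt0 //.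
    by rewrite mulrN => Hle; rewrite -[X in _ + X]opprK subr_ge0.
  - by rewrite -Eu (eq_mix Ea' (fun k _ => erefl (v k))) mixD mixZ Ezv scaler0 addr0.
apply/negP; rewrite -leNgt; apply: le_trans Htop' _.
have -> : \sum_(k < r) a' k * w (idx k) 0 ord_max = \sum_(k < r) a k * w (idx k) 0 ord_max
    + tau * \sum_(k < r) z k * w (idx k) 0 ord_max.
  by rewrite mulr_sumr -big_split; apply: eq_bigr => k _; rewrite Ea' // mulrDl mulrA.
by rewrite Ez1 mulr1 lerDl.
Qed.

End Exact.

(** * Vectors stored in memory *)

Section VecMem.
Variables (R : realType) (n : nat) (orc : nat -> 'rV[R]_n -> answer R n).
Implicit Types (s : state R).

Lemma vec_at_ext N s s' a a' o o' :
  (forall j, (j < N)%N -> rmem s a (o + j) = rmem s' a' (o' + j)) ->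
  vec_at s N a o = vec_at s' N a' o'.
Proof. by move=> H; apply/rowP => j; rewrite !mxE H. Qed.

Lemma vec_at_eq N s s' a o : rmem s a = rmem s' a -> vec_at s N a o = vec_at s' N a o.
Proof. by move=> H; apply: vec_at_ext => j _; rewrite H. Qed.

Lemma vec_fill N im (m : nat -> nat -> R) dst o F :
  vec_at (State im (fill m dst o N F)) N dst o = \row_(j < N) F j.
Proof.
by apply/rowP => j; rewrite !mxE /= /fill eqxx leq_addr ltn_add2l ltn_ord addKn.
Qed.

Lemma dot_vec N s s' a o a' o' :
  dot (vec_at s N a o) (vec_at s' N a' o') =
  \sum_(j < N) rmem s a (o + j) * rmem s' a' (o' + j).
Proof. by apply: eq_bigr => j _; rewrite !mxE. Qed.

Lemma wp_agreeS c s li lr (Q1 : state R -> nat -> nat -> Prop) :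
  all (mem li) (iw c) && all (mem lr) (rw c) -> wp orc c s Q1 ->
  wp orc c s (fun s' t q => agree li lr s s' /\ Q1 s' t q).
Proof.
move=> /andP[/allP H1 /allP H2] H; apply: wp_agree H _ => s' t q Hag HQ; split=> //.
by apply: agree_sub Hag _ _.
Qed.

End VecMem.

(** Turns reads in the later state of an [agree] hypothesis into reads in the earlier one; [isT]
    suffices because the side condition computes. *)
Ltac fr H := repeat match type of H with agree _ _ ?s1 ?s2 =>
  match goal with
  | |- context [rmem s2 ?a] => rewrite (proj2 H a isT)
  | |- context [imem s2 ?a] => rewrite (proj1 H a isT)
  end end.

Ltac ev := rewrite /= /upd /fill /=.

(** * Programs *)

(* Memory map. Index arrays: 1, 2, 28 hold n, n + 1, 2n + 2; 3 to 8, 20, 32, 41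
   are loop counters; 11 is the current level of the descent; 12 is its status
   (0 running, 1 solved, 2 a point of K with d x <= 0 was found, 3 eps is too
   large); 13 is the status of the current run of A, which logged 14 queries, of
   kinds 15 (0 for a row, 1 for a cut by c - gamma d); 16 to 18 are the numbers of
   items before and after CARA and the kept items; 21 and 22 give for each level
   the number of rows and the starred row; 23 is the number of rows of the
   solution, 24 that of the representation of d; 29 and 30 are the modes (is d
   given by rows, are the certificates made exact by linear algebra).
   Real arrays: 5 and 6 are the input and output of PROJ, 7 and 8 the orthogonal
   directions and their squared norms; 10 and 11 hold the items of CARA and their
   weights, 12 a dual basis of the kept ones, 16 the new weights; 19 to 21 log the
   gamma, the rows and the projected rows of the queries; 23 and 24 are c and d,
   25 and 26 the rows and coefficients of d, 32 the current gamma, attained at 33;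
   34 is the point found with status 2; 35 is eps; 36 holds the rows of the
   levels, with coefficients 37 - gamma 38, against the multiple 39 of
   c - gamma d; 41 and 42 are the rows and coefficients of the solution, 43 to 45
   the vectors, coefficients and signs of a relation used to correct it. *)
Definition PROJ : cmd :=
  VSet 3 $1 6 $3 (RGet 5 $3) ;;
  For 4 $10
    (VSum 3 $1 9 (RGet 6 $3 *r RGet 7 ($4 *i $1 +i $3)) ;;
     VSet 3 $1 6 $3 (RGet 6 $3 -r (RGet 9 (ICst 0) /r RGet 8 $4) *r RGet 7 ($4 *i $1 +i $3))).

Section Project.
Variables (R : realType) (n : nat) (orc : nat -> 'rV[R]_n -> answer R n).
Implicit Types (s : state R).

Definition qv s l := vec_at s n 7 (l * n).

Lemma PROJ_spec s k :
  imem s 1 0 = n -> imem s 10 0 = k -> (k <= n)%N ->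
  (forall l, (l < k)%N -> rmem s 8 l = dot (qv s l) (qv s l)) ->
  wp orc PROJ s (fun s' t q => agree [:: 3; 4] [:: 6; 9] s s' /\
    [/\ (t <= 40 * (n.+1 * n.+1))%N, q = 0%N
      & vec_at s' n 6 0 = proj (qv s) k (vec_at s n 5 0)]).
Proof.
move=> Hn Hk kn HQ; apply: wp_agreeS => //.
apply: wp_seq; apply: (@wp_vset _ _ _ (rmem s 5) 0 n) => //= t1 Ht1.
set s1 := State _ _.
apply: (@wp_for _ _ _ (fun l st => vec_at st n 6 0 = proj (qv s) l (vec_at s n 5 0)) k
          (24 * n.+1)) => //=.
- rewrite vec_fill; apply/rowP => j; by rewrite !mxE.
- move=> l s2 Hl Ag Hl2 IH.
  have En : imem s2 1 0 = n by fr Ag.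
  apply: wp_seq; apply: (@wp_vsum _ _ _ (fun j => rmem s2 6 j * rmem s 7 (l * n + j)) n) => //=.
    by move=> j x Hj; ev; rewrite Hl2 En; fr Ag.
  move=> t2 Ht2.
  apply: (@wp_vset _ _ _ (fun j => rmem s2 6 j
     - (dot (vec_at s2 n 6 0) (qv s l) / dot (qv s l) (qv s l)) * rmem s 7 (l * n + j)) 0 n) => //=.
    move=> j Hj; ev; rewrite Hl2 En; split=> //; rewrite -(HQ l Hl) dot_vec; fr Ag; ev.
    by rewrite add0n ltnn.
  move=> t3 Ht3; split; [lia|by []|].
  rewrite vec_fill -IH; apply/rowP => j; by rewrite !mxE.
- move=> s2 t2 Ht2 Ag Hk2 IH; split=> //.
  have: (k * (24 * n.+1 + 0 + 2) <= n * (24 * n.+1 + 0 + 2))%N by rewrite leq_mul2r kn orbT.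
  nia.
Qed.

End Project.

(* CARA inserts the items one at a time, keeping the ones of positive weight
   independent: a dual basis makes each insertion a pivot step. *)
Definition ZLOOP : cmd :=
  For 5 $17 (VSum 3 $2 9 (RGet 12 ($5 *i $2 +i $3) *r RGet 10 ($20 *i $2 +i $3)) ;;
             RSet 13 $5 (RGet 9 (ICst 0))).

Definition RLOOP : cmd :=
  For 5 $17 (VSet 3 $2 14 $3
    (RGet 14 $3 -r RGet 13 $5 *r RGet 10 (IGet 18 $5 *i $2 +i $3))).

Definition GUPD : cmd :=
  For 5 $17 (If (ieqb $5 $19) Skip
    (VSet 3 $2 12 ($5 *i $2 +i $3)
       (RGet 12 ($5 *i $2 +i $3) -r RGet 13 $5 *r RGet 12 ($19 *i $2 +i $3)))).

Definition MINLOOP : cmd :=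
  For 5 $17 (If (BAnd (rlt (RGet 13 $5) (RCst 0))
                  (rlt (RGet 16 $5) (RGet 17 (ICst 0) *r (RCst 0 -r RGet 13 $5))))
    (RSet 17 (ICst 0) (RGet 16 $5 /r (RCst 0 -r RGet 13 $5)) ;; ISet 19 (ICst 0) $5) Skip).

Definition INDEP : cmd :=
  VSet 3 $2 12 ($17 *i $2 +i $3) (RGet 14 $3 /r RGet 15 (ICst 0)) ;;
  ISet 19 (ICst 0) $17 ;; GUPD ;;
  ISet 18 $17 $20 ;; RSet 16 $17 (RGet 11 $20) ;; incr 17.

Definition SWAP : cmd :=
  RSet 16 $19 (RGet 11 $20 -r RGet 17 (ICst 0)) ;; ISet 18 $19 $20 ;;
  RSet 9 (ICst 0) (RGet 13 $19) ;;
  VSet 3 $2 12 ($19 *i $2 +i $3) (RGet 12 ($19 *i $2 +i $3) /r RGet 9 (ICst 0)) ;;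
  GUPD.

Definition DEP : cmd :=
  RSet 17 (ICst 0) (RGet 11 $20) ;; ISet 19 (ICst 0) $17 ;; MINLOOP ;;
  VSet 5 $17 16 $5 (RGet 16 $5 +r RGet 17 (ICst 0) *r RGet 13 $5) ;;
  If (ilt $19 $17) SWAP Skip.

Definition INSERT : cmd :=
  If (rlt (RCst 0) (RGet 11 $20))
    (ZLOOP ;; VSet 3 $2 14 $3 (RGet 10 ($20 *i $2 +i $3)) ;; RLOOP ;;
     VSum 3 $2 15 (RGet 14 $3 *r RGet 14 $3) ;;
     If (BLeR (RGet 15 (ICst 0)) (RCst 0)) DEP INDEP)
    Skip.

Definition CARA : cmd := ISet 17 (ICst 0) (ICst 0) ;; For 20 $16 INSERT.

Section Cara.
Variables (R : realType) (n : nat) (orc : nat -> 'rV[R]_n -> answer R n).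
Implicit Types (s : state R).

Definition wv s i := vec_at s n.+1 10 (i * n.+1).
Definition gv s k := vec_at s n.+1 12 (k * n.+1).

Lemma fill_row (m : nat -> nat -> R) a k l N F j : (j < N)%N ->
  fill m a (k * N) N F a (l * N + j) = if l == k then F j else m a (l * N + j)%N.
Proof.
move=> Hj; rewrite /fill eqxx; have [->|ne] := eqVneq l k.
  by rewrite leq_addr ltn_add2l Hj addKn.
case: ifP => // /andP[H1 H2]; exfalso; move/eqP: ne; apply; nia.
Qed.

Lemma vec_fill_row im (m : nat -> nat -> R) a k l N F :
  vec_at (State im (fill m a (k * N) N F)) N a (l * N) =
  if l == k then \row_(j < N) F j else vec_at (State im m) N a (l * N).
Proof.
by apply/rowP => j; rewrite mxE /= fill_row //; case: ifP => _; rewrite mxE.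
Qed.

Lemma ZLOOP_spec s i r : imem s 2 0 = n.+1 -> imem s 17 0 = r -> imem s 20 0 = i ->
  (r <= n.+1)%N ->
  wp orc ZLOOP s (fun s' t q => agree [:: 3; 5] [:: 9; 13] s s' /\
    [/\ (t <= 40 * (n.+1 * n.+1))%N, q = 0%N
      & forall k, (k < r)%N -> rmem s' 13 k = dot (gv s k) (wv s i)]).
Proof.
move=> Hn Hr Hi rn; apply: wp_agreeS => //.
apply: (@wp_for _ _ _ (fun l st => forall k, (k < l)%N ->
   rmem st 13 k = dot (gv s k) (wv s i)) r (20 * n.+1)) => //=.
- move=> l s2 Hl Ag Hl2 IH.
  have En : imem s2 2 0 = n.+1 by fr Ag.
  have Ei : imem s2 20 0 = i by fr Ag.
  apply: wp_seq; apply: (@wp_vsum _ _ _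
     (fun j => rmem s 12 (l * n.+1 + j) * rmem s 10 (i * n.+1 + j)) n.+1) => //=.
    by move=> j x Hj; ev; rewrite Hl2 En Ei; fr Ag.
  move=> t2 Ht2; apply: wp_rset; split; [ev; lia|by []|].
  move=> k; ev; rewrite Hl2 ltnS leq_eqVlt => /orP[/eqP->|Hk].
    by rewrite eqxx /gv /wv dot_vec.
  by rewrite ltn_eqF // IH.
- move=> s2 t2 Ht2 Ag Hk2 IH; split=> //; clear -Ht2 rn; nia.
Qed.

Lemma RLOOP_spec s r : imem s 2 0 = n.+1 -> imem s 17 0 = r -> (r <= n.+1)%N ->
  wp orc RLOOP s (fun s' t q => agree [:: 3; 5] [:: 14] s s' /\
    [/\ (t <= 40 * (n.+1 * n.+1))%N, q = 0%N
      & vec_at s' n.+1 14 0 = vec_at s n.+1 14 0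
          - mix r (rmem s 13) (fun k => wv s (imem s 18 k))]).
Proof.
move=> Hn Hr rn; apply: wp_agreeS => //.
apply: (@wp_for _ _ _ (fun l st => vec_at st n.+1 14 0 = vec_at s n.+1 14 0
          - mix l (rmem s 13) (fun k => wv s (imem s 18 k))) r (20 * n.+1)) => //=.
- by rewrite /mix big_ord0 subr0.
- move=> l s2 Hl Ag Hl2 IH.
  have En : imem s2 2 0 = n.+1 by fr Ag.
  apply: (@wp_vset _ _ _ (fun j => rmem s2 14 j
     - rmem s 13 l * rmem s 10 (imem s 18 l * n.+1 + j)) 0 n.+1) => //=.
    move=> j Hj; ev; rewrite Hl2 En; split=> //; fr Ag.
    by rewrite add0n ltnn.
  move=> t2 Ht2; split; [lia|by []|].
  rewrite mixS opprD addrA -IH vec_fill; apply/rowP => j; by rewrite !mxE.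
- move=> s2 t2 Ht2 Ag Hk2 IH; split=> //; clear -Ht2 rn; nia.
Qed.

Lemma GUPD_spec s r p : imem s 2 0 = n.+1 -> imem s 17 0 = r -> imem s 19 0 = p ->
  (r <= n.+1)%N ->
  wp orc GUPD s (fun s' t q => agree [:: 3; 5] [:: 12] s s' /\
    [/\ (t <= 40 * (n.+1 * n.+1))%N, q = 0%N, gv s' p = gv s p
      & forall k, (k < r)%N -> k != p -> gv s' k = gv s k - rmem s 13 k *: gv s p]).
Proof.
move=> Hn Hr Hp rn; apply: wp_agreeS => //.
apply: (@wp_for _ _ _ (fun l st => [/\ gv st p = gv s p,
   (forall k, (k < l)%N -> k != p -> gv st k = gv s k - rmem s 13 k *: gv s p)
   & forall k, (l <= k)%N -> gv st k = gv s k]) r (30 * n.+1)) => //=.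
- move=> l s2 Hl Ag Hl2 [I1 I2 I3].
  have En : imem s2 2 0 = n.+1 by fr Ag.
  have Ep : imem s2 19 0 = p by fr Ag.
  apply: wp_if => /=; rewrite Hl2 Ep -eqn_leq.
  have [E|ne] := eqVneq l p.
    apply: wp_skip; split; [lia|by []|split=> //] => k Hk; last exact: I3 (ltnW Hk).
    by move=> kp; apply: I2 => //; rewrite ltn_neqAle -ltnS Hk andbT E.
  apply: (@wp_vset _ _ _ (fun j => rmem s2 12 (l * n.+1 + j)
     - rmem s 13 l * rmem s2 12 (p * n.+1 + j)) (l * n.+1) n.+1) => //=.
    move=> j Hj; ev; rewrite Hl2 En Ep; split=> //; fr Ag.
    rewrite ltnn andbF; case: ifP => // /andP[H1 H2]; exfalso; move/eqP: ne; apply; nia.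
  move=> t2 Ht2; split; [lia|by []|].
  have E k : gv (State (upd (imem s2) 3 0 n.+1) (fill (rmem s2) 12 (l * n.+1) n.+1
        (fun j => rmem s2 12 (l * n.+1 + j)%N - rmem s 13 l * rmem s2 12 (p * n.+1 + j)%N))) k
      = if k == l then gv s2 l - rmem s 13 l *: gv s2 p else gv s2 k.
    rewrite /gv vec_fill_row; case: eqP => // _.
    by apply/rowP => j; rewrite !mxE.
  split; first by apply: etrans (E p) _; rewrite eq_sym (negbTE ne).
  + move=> k; rewrite ltnS leq_eqVlt => Hk kp; apply: etrans (E k) _.
    case/orP: Hk kp => [/eqP->|Hk] kp; first by rewrite eqxx I3 // I1.
    by rewrite ltn_eqF // I2.
  + by move=> k Hk; apply: etrans (E k) _; rewrite gtn_eqF // I3 // ltnW.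
- move=> s2 t2 Ht2 Ag Hk2 [I1 I2 I3]; split=> //; clear -Ht2 rn; nia.
Qed.

(** The index [r] is a sentinel: no coefficient blocks the move, and the whole weight [b] can be
    shifted. *)
Lemma MINLOOP_spec s r b : imem s 17 0 = r -> rmem s 17 0 = b -> imem s 19 0 = r ->
  0 <= b -> (forall k, (k < r)%N -> 0 <= rmem s 16 k) ->
  wp orc MINLOOP s (fun s' t q => agree [:: 5; 19] [:: 17] s s' /\
    [/\ (t <= 30 * r + 30)%N, q = 0%N &
      let S := rmem s' 17 0 in let kk := imem s' 19 0 in
      [/\ 0 <= S, S <= b, forall k, (k < r)%N -> 0 <= rmem s 16 k + S * rmem s 13 k
        & (kk = r /\ S = b) \/
          [/\ (kk < r)%N, rmem s 13 kk != 0 & rmem s 16 kk + S * rmem s 13 kk = 0]]]).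
Proof.
move=> Hr Hb Hkk b0 Ha; apply: wp_agreeS => //.
apply: (@wp_for _ _ _ (fun l st => 
      let S := rmem st 17 0 in let kk := imem st 19 0 in
      [/\ 0 <= S, S <= b, forall k, (k < l)%N -> 0 <= rmem s 16 k + S * rmem s 13 k
        & (kk = r /\ S = b) \/
          [/\ (kk < r)%N, rmem s 13 kk != 0 & rmem s 16 kk + S * rmem s 13 kk = 0]]) r 10) => //=.
- by rewrite Hb; split=> //; left.
- move=> l s2 Hl Ag Hl2 [I1 I2 I3 I4].
  apply: wp_if => /=; rewrite Hl2; fr Ag; rewrite -!ltNge sub0r.
  have a0 := Ha l Hl.
  case: ifP => [/andP[zn Hlt]|Hc].
    have z0 : rmem s 13 l != 0 by rewrite lt_eqF.
    apply: wp_seq; apply: wp_rset; apply: wp_iset; split=> //.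
    ev; rewrite Hl2; fr Ag; rewrite sub0r.
    set S := rmem s2 17 0 in I1 I2 I3 I4 Hlt *; set zl := rmem s 13 l in zn Hlt z0 *.
    have nz : 0 < - zl by rewrite oppr_gt0.
    set S' := _ / _; have S'0 : 0 <= S' by rewrite divr_ge0 // ltW.
    have S'S : S' <= S by rewrite ler_pdivrMr // ltW.
    have E : rmem s 16 l + S' * zl = 0.
      by rewrite /S' invrN mulrN mulNr divfK // subrr.
    split=> //; [exact: le_trans I2 | | by right].
    move=> k; rewrite ltnS leq_eqVlt => /orP[/eqP->|Hk]; first by rewrite E.
    have [zk|zk] := leP 0 (rmem s 13 k).
      by apply: addr_ge0; [apply: Ha; exact: ltn_trans Hk Hl|exact: mulr_ge0].
    by apply: le_trans (I3 k Hk) _; rewrite lerD2l ler_wnM2r // ltW.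
  apply: wp_skip; split=> //; split=> // k; rewrite ltnS leq_eqVlt => /orP[/eqP->|Hk]; last exact: I3.
  have [zk|zk] := leP 0 (rmem s 13 l); first by rewrite addr_ge0 ?mulr_ge0.
  move: Hc; rewrite zk /= mulrN => /negbT; rewrite -leNgt => H.
  by rewrite -[X in _ + X]opprK subr_ge0.
- move=> s2 t2 Ht2 Ag Hk2 I; split=> //; lia.
Qed.

End Cara.

Section CaraInsert.
Variables (R : realType) (n : nat) (orc : nat -> 'rV[R]_n -> answer R n).
Implicit Types (s : state R).

Notation wv := (@wv R n).
Notation gv := (@gv R n).

Definition caraS s i :=
  cara (wv s) (rmem s 11) i (imem s 17 0) (imem s 18) (rmem s 16) (gv s).

Lemma wv_eq s s' : rmem s' 10 = rmem s 10 -> wv s' = wv s.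
Proof. by move=> E; apply/funext => i; apply: vec_at_eq. Qed.

Lemma gv_eq s s' : rmem s' 12 = rmem s 12 -> gv s' = gv s.
Proof. by move=> E; apply/funext => i; apply: vec_at_eq. Qed.

Lemma caraS_eq s s' i : imem s' 17 = imem s 17 -> imem s' 18 = imem s 18 ->
  rmem s' 10 = rmem s 10 -> rmem s' 11 = rmem s 11 -> rmem s' 12 = rmem s 12 ->
  rmem s' 16 = rmem s 16 -> caraS s i -> caraS s' i.
Proof.
by move=> E1 E2 E3 E4 E5 E6; rewrite /caraS E1 E2 E4 E6 (wv_eq E3) (gv_eq E5).
Qed.

Lemma INDEP_spec s i (rho := wv s i - mix (imem s 17 0) (rmem s 13) (fun k => wv s (imem s 18 k))) :
  imem s 2 0 = n.+1 -> imem s 20 0 = i -> 0 < rmem s 11 i -> caraS s i ->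
  (forall k, (k < imem s 17 0)%N -> rmem s 13 k = dot (gv s k) (wv s i)) ->
  vec_at s n.+1 14 0 = rho -> rmem s 15 0 = dot rho rho -> rho != 0 ->
  wp orc INDEP s (fun s' t q => agree [:: 3; 5; 17; 18; 19] [:: 12; 16] s s' /\
    [/\ (t <= 100 * (n.+1 * n.+1))%N, q = 0%N & caraS s' i.+1]).
Proof.
move=> Hn Hi Hb HC HZ Hrho HNN rho0; apply: wp_agreeS => //.
have rn := cara_size HC; set r := imem s 17 0 in HZ rho Hrho HNN rho0 rn.
have Hr : imem s 17 0 = r by [].
apply: wp_seq; apply: (@wp_vset _ _ _ (fun j => rmem s 14 j / rmem s 15 0) (r * n.+1) n.+1) => //=.
  by move=> j Hj; ev; rewrite Hn Hr.
move=> t1 Ht1; apply: wp_seq; apply: wp_iset; set s1 := setI _ _ _ _.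
have Hg1 k : gv s1 k = if k == r then (dot rho rho)^-1 *: rho else gv s k.
  rewrite /gv [LHS]vec_fill_row; case: eqP => // _.
  by rewrite -HNN -Hrho; apply/rowP => j; rewrite !mxE mulrC.
apply: wp_seq; apply: wp_conseq (@GUPD_spec _ _ orc s1 r r _ _ _ _) _ => //.
move=> s2 t2 q2 [Ag [Ht2 -> G1 G2]].
apply: wp_seq; apply: wp_iset; apply: wp_seq; apply: wp_rset; apply: wp_iset.
have E17 : imem s2 17 0 = r by fr Ag.
have E20 : imem s2 20 0 = i by fr Ag.
split; [ev; lia|by []|].
rewrite /caraS; ev; rewrite E17 E20 addn1.
have -> : wv (setI (State (imem (setI s2 18 r i))
    (upd (rmem s2) 16 r (rmem s2 11 i))) 17 0 r.+1) = wv s.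
  by apply: wv_eq; ev; fr Ag.
rewrite [rmem s2 11](_ : _ = rmem s 11); last by fr Ag.
apply: (cara_add HC Hb (z := rmem s 13) (rho := rho)) => //.
- by move=> k Hk; rewrite /upd /= ltn_eqF //; fr Ag.
- by rewrite /upd /= eqxx.
- by move=> k Hk; rewrite /upd /= ltn_eqF //; fr Ag.
- by rewrite /upd /= eqxx.
- by apply: etrans G1 _; rewrite Hg1 eqxx.
- move=> k Hk; apply: etrans (G2 k Hk _) _; first by rewrite ltn_eqF.
  rewrite -[gv s1 r]G1 Hg1 ltn_eqF //.
Qed.

Lemma DEP_spec s i :
  imem s 2 0 = n.+1 -> imem s 20 0 = i -> 0 < rmem s 11 i -> caraS s i ->
  (forall k, (k < imem s 17 0)%N -> rmem s 13 k = dot (gv s k) (wv s i)) ->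
  wv s i - mix (imem s 17 0) (rmem s 13) (fun k => wv s (imem s 18 k)) = 0 ->
  wp orc DEP s (fun s' t q => agree [:: 3; 5; 18; 19] [:: 9; 12; 16; 17] s s' /\
    [/\ (t <= 200 * (n.+1 * n.+1))%N, q = 0%N & caraS s' i.+1]).
Proof.
move=> Hn Hi Hb HC HZ rho0; apply: wp_agreeS => //.
have rn := cara_size HC; set r := imem s 17 0 in HZ rho0 rn.
have Hr : imem s 17 0 = r by [].
apply: wp_seq; apply: wp_rset; apply: wp_seq; apply: wp_iset; set s1 := setI _ _ _ _.
apply: wp_seq; apply: wp_conseq (@MINLOOP_spec _ _ orc s1 r (rmem s 11 i) _ _ _ _ _) _ => //.
- by rewrite /s1; ev; rewrite Hi.
- exact: ltW.
- exact: (cara_ge0 HC).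
move=> s2 t2 q2 [Ag [Ht2 -> ]]; set S := rmem s2 17 0; set kk := imem s2 19 0.
move=> [S0 Sb Hpos Hkk].
have E17 : imem s2 17 0 = r by fr Ag.
have E20 : imem s2 20 0 = i by fr Ag.
have E2 : imem s2 2 0 = n.+1 by fr Ag.
apply: wp_seq; apply: (@wp_vset _ _ _ (fun k => rmem s 16 k + S * rmem s 13 k) 0 r) => //=.
  by move=> j Hj; ev; split=> //; rewrite add0n ltnn; fr Ag.
move=> t3 Ht3; set s3 := State _ _.
have A3 k : (k < r)%N -> rmem s3 16 k = rmem s 16 k + S * rmem s 13 k.
  by move=> Hk; rewrite /s3; ev; rewrite add0n Hk subn0.
apply: wp_if; rewrite [beval _ _](_ : _ = (kk < r)%N); last by rewrite /s3; ev; rewrite E17 -ltnNge.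
case: Hkk => [[Ek ES]|[Hk zk ak]].
  rewrite Ek ltnn; apply: wp_skip; split; [ev; clear -Ht2 Ht3 rn; nia|by []|].
  rewrite /caraS /s3; ev; rewrite E17.
  rewrite -/s3 (_ : wv s3 = wv s); last by apply: wv_eq; rewrite /s3; ev; fr Ag.
  rewrite (_ : gv s3 = gv s); last by apply: gv_eq; rewrite /s3; ev; fr Ag.
  fr Ag; apply: (cara_move HC (z := rmem s 13) (rho := 0)) => //.
    by move=> k Hk; rewrite add0n Hk subn0 ES.
  by move=> k Hk; rewrite add0n Hk subn0; exact: Hpos.
rewrite Hk; apply: wp_seq; apply: wp_rset; apply: wp_seq; apply: wp_iset; apply: wp_seq; apply: wp_rset.
set s4 := State _ _.
have E4 : imem s4 19 0 = kk by [].
have E42 : imem s4 2 0 = n.+1 by [].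
apply: wp_seq; apply: (@wp_vset _ _ _ (fun j => rmem s 12 (kk * n.+1 + j) / rmem s 13 kk) (kk * n.+1) n.+1) => //=.
  move=> j Hj; ev; rewrite -/kk E2; split=> //; rewrite ltnn andbF; fr Ag; by [].
move=> t4 Ht4; set s5 := State _ _.
have Hg5 k : gv s5 k = if k == kk then (rmem s 13 kk)^-1 *: gv s kk else gv s k.
  rewrite /gv [LHS]vec_fill_row; case: eqP => // _.
    by apply/rowP => j; rewrite !mxE mulrC.
  by apply: vec_at_eq; rewrite /s4; ev; fr Ag.
apply: wp_conseq (@GUPD_spec _ _ orc s5 r kk _ _ _ _) _ => //.
move=> s6 t6 q6 [Ag6 [Ht6 -> G1 G2]]; split; [ev|by []|].
  clear -Ht2 Ht3 Ht4 Ht6 rn; nia.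
have W6 : wv s6 = wv s by apply: wv_eq; fr Ag6; rewrite /s5 /s4 /s3; ev; fr Ag.
have Z6 : rmem s5 13 = rmem s 13 by rewrite /s5 /s4 /s3; ev; fr Ag.
have B6 : rmem s5 11 = rmem s 11 by rewrite /s5 /s4 /s3; ev; fr Ag.
have I18 k : imem s5 18 k = if k == kk then i else imem s 18 k.
  by rewrite /s5 /s4 /s3; ev; rewrite -/kk E20; fr Ag.
have A16 k : (k < r)%N -> rmem s5 16 k = if k == kk then rmem s 11 i - S else rmem s 16 k + S * rmem s 13 k.
  move=> Hkr; rewrite /s5 /s4; ev; rewrite -/kk; case: eqP => _; last exact: A3.
  by rewrite /s3; ev; rewrite E20; fr Ag.
rewrite /caraS W6; fr Ag6; rewrite B6 [imem s5 17 0](_ : _ = r) //.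
apply: (@cara_swap _ _ (wv s) (rmem s 11) i r (imem s 18) (rmem s 16) (gv s) HC Hb
  (rmem s 13) 0 _ _ _ S kk) => //.
- by move=> k Hkr ne; rewrite A16 // (negbTE ne).
- by rewrite A16 // eqxx.
- by move=> k Hkr ne; rewrite I18 (negbTE ne).
- by rewrite I18 eqxx.
- by rewrite G1 Hg5 eqxx.
- by move=> k Hkr ne; rewrite G2 // Z6 G1 Hg5 (negbTE ne).
Qed.

Lemma INSERT_spec s i :
  imem s 2 0 = n.+1 -> imem s 20 0 = i -> 0 <= rmem s 11 i -> caraS s i ->
  wp orc INSERT s (fun s' t q =>
    agree [:: 3; 5; 17; 18; 19] [:: 9; 12; 13; 14; 15; 16; 17] s s' /\
    [/\ (t <= 400 * (n.+1 * n.+1))%N, q = 0%N & caraS s' i.+1]).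
Proof.
move=> Hn Hi Hb HC; apply: wp_agreeS => //.
have rn := cara_size HC.
apply: wp_if => /=; rewrite Hi; case: ifPn => Hb0; last first.
  apply: wp_skip; split=> //.
  by apply: cara_skip => //; rewrite ltNge.
rewrite -ltNge in Hb0.
apply: wp_seq; apply: wp_conseq (@ZLOOP_spec _ _ orc s i _ Hn (erefl _) Hi rn) _.
move=> s1 t1 q1 [Ag1 [Ht1 -> HZ]].
have E2 : imem s1 2 0 = n.+1 by fr Ag1.
have E20 : imem s1 20 0 = i by fr Ag1.
apply: wp_seq; apply: (@wp_vset _ _ _ (fun j => rmem s 10 (i * n.+1 + j)) 0 n.+1) => //=.
  by move=> j Hj; ev; rewrite E2 E20; fr Ag1.
move=> t2 Ht2; set s2 := State _ _.
apply: wp_seq; apply: wp_conseq (@RLOOP_spec _ _ orc s2 (imem s 17 0) _ _ rn) _ => //.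
  by rewrite /s2; ev; fr Ag1.
move=> s3 t3 q3 [Ag3 [Ht3 -> Hrho]].
have E32 : imem s3 2 0 = n.+1 by fr Ag3; rewrite /s2; ev.
apply: wp_seq; apply: (@wp_vsum _ _ _ (fun j => rmem s3 14 j * rmem s3 14 j) n.+1) => //=.
move=> t4 Ht4; set s4 := State _ _.
have C4 : caraS s4 i.
  by apply: caraS_eq HC; rewrite /s4; ev; fr Ag3; rewrite /s2; ev; fr Ag1.
have W4 : wv s4 = wv s by apply: wv_eq; rewrite /s4; ev; fr Ag3; rewrite /s2; ev; fr Ag1.
have G4 : gv s4 = gv s by apply: gv_eq; rewrite /s4; ev; fr Ag3; rewrite /s2; ev; fr Ag1.
have I17 : imem s4 17 = imem s 17 by rewrite /s4; ev; fr Ag3; rewrite /s2; ev; fr Ag1.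
have I18 : imem s4 18 = imem s 18 by rewrite /s4; ev; fr Ag3; rewrite /s2; ev; fr Ag1.
have I20 : imem s4 20 0 = i by rewrite /s4; ev; fr Ag3; rewrite /s2; ev; fr Ag1.
have B4 : rmem s4 11 = rmem s 11 by rewrite /s4; ev; fr Ag3; rewrite /s2; ev; fr Ag1.
have Z4 : rmem s4 13 = rmem s1 13 by rewrite /s4; ev; fr Ag3; rewrite /s2; ev.
have R4 : vec_at s4 n.+1 14 0 = wv s4 i
    - mix (imem s4 17 0) (rmem s4 13) (fun k => wv s4 (imem s4 18 k)).
  rewrite W4 I17 I18 Z4 [LHS](_ : _ = vec_at s3 n.+1 14 0); last exact: vec_at_eq.
  rewrite Hrho; congr (_ - _); first by rewrite vec_fill; apply/rowP => j; rewrite !mxE.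
  have -> : imem s2 18 = imem s 18 by rewrite /s2; ev; fr Ag1.
  by rewrite (_ : wv s2 = wv s) //; apply: wv_eq; rewrite /s2; ev; fr Ag1.
have HZ4 k : (k < imem s4 17 0)%N -> rmem s4 13 k = dot (gv s4 k) (wv s4 i).
  by rewrite I17 Z4 G4 W4; exact: HZ.
have NN4 : rmem s4 15 0 = dot (vec_at s4 n.+1 14 0) (vec_at s4 n.+1 14 0).
  by rewrite dot_vec /s4; ev.
apply: wp_if; rewrite [beval _ _](_ : _ = (rmem s4 15 0 <= 0)) //.
have E42 : imem s4 2 0 = n.+1 by [].
case: ifPn => Hnn.
  apply: wp_conseq (DEP_spec E42 I20 _ C4 HZ4 _) _; rewrite ?B4 //.
    by rewrite -R4; apply/eqP; rewrite -dotvv_eq0 eq_le -NN4 Hnn NN4 dotvv_ge0.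
  by move=> s5 t5 q5 [_ [Ht5 -> C5]]; split=> //; ev; clear -Ht1 Ht2 Ht3 Ht4 Ht5; nia.
apply: wp_conseq (INDEP_spec E42 I20 _ C4 HZ4 R4 _ _) _; rewrite ?B4 -?R4 //.
  by rewrite -dotvv_eq0 -NN4; apply: contra Hnn => /eqP->.
by move=> s5 t5 q5 [_ [Ht5 -> C5]]; split=> //; ev; clear -Ht1 Ht2 Ht3 Ht4 Ht5; nia.
Qed.

Lemma CARA_spec s cnt :
  imem s 2 0 = n.+1 -> imem s 16 0 = cnt -> (forall i, (i < cnt)%N -> 0 <= rmem s 11 i) ->
  wp orc CARA s (fun s' t q =>
    agree [:: 3; 5; 17; 18; 19; 20] [:: 9; 12; 13; 14; 15; 16; 17] s s' /\
    [/\ (t <= 500 * (n.+1 * n.+1) * cnt + 10)%N, q = 0%N & caraS s' cnt]).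
Proof.
move=> Hn Hc Hb; apply: wp_agreeS => //.
apply: wp_seq; apply: wp_iset.
apply: (@wp_for _ _ _ (fun i st => caraS st i) cnt (400 * (n.+1 * n.+1))) => //=.
- by rewrite /caraS; ev; exact: cara0.
- move=> i s2 Hi Ag Hi2 HC.
  have E2 : imem s2 2 0 = n.+1 by fr Ag.
  apply: wp_conseq (INSERT_spec E2 Hi2 _ HC) _; first by fr Ag; exact: Hb.
  by move=> s3 t3 q3 [_ [H1 H2 H3]].
- move=> s2 t2 Ht2 Ag Hk2 I; split=> //; clear -Ht2; nia.
Qed.

End CaraInsert.

(** * R^n inside the lifted space *)

Section Lift.
Variables (R : realType) (n : nat).
Implicit Types (v : 'rV[R]_n).

(** [CARA] works in dimension [n + 1]. With last coordinate 0 the same program reduces combinations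
    in R^n, where no normalization has to be preserved. *)
Definition up v : 'rV[R]_n.+1 :=
  \row_(j < n.+1) (if insub (j : nat) is Some i then v 0 i else 0).

Lemma lo_up v : lo (up v) = v.
Proof.
apply/rowP => j; rewrite !mxE; case: insubP => [i _ /= E|]; last by rewrite /= ltn_ord.
by congr (v 0 _); apply: val_inj.
Qed.

Lemma top_up v : up v 0 ord_max = 0.
Proof. by rewrite mxE insubN // -leqNgt. Qed.

Lemma up_lo (x : 'rV[R]_n.+1) : x 0 ord_max = 0 -> x = up (lo x).
Proof.
move=> H; apply/eqP; rewrite -subr_eq0; apply/eqP; apply: lo_top_eq0.
  by apply/rowP => j; have /rowP/(_ j) := lo_up (lo x); rewrite !mxE => ->; rewrite subrr.
by rewrite mxE H add0r mxE top_up oppr0.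
Qed.

Lemma mix_up r a (v : nat -> 'rV[R]_n) : mix r a (fun k => up (v k)) = up (mix r a v).
Proof.
rewrite [LHS]up_lo; first by rewrite lo_mix; congr up; apply: eq_mix => // k _; exact: lo_up.
by rewrite top_mix big1 // => k _; rewrite top_up mulr0.
Qed.

Lemma enorm_up v : enorm (up v) = enorm v.
Proof.
rewrite /enorm big_ord_recr /= -/(up v) top_up expr0n addr0; congr Num.sqrt.
apply: eq_bigr => i _; congr (_ ^+ 2); have /rowP/(_ i) := lo_up v; rewrite mxE => <-.
by congr (up v 0 _); apply: val_inj.
Qed.

Lemma up_inj : injective up.
Proof. by move=> v w E; rewrite -(lo_up v) E lo_up. Qed.

Lemma up0 : up 0 = 0.
Proof. by rewrite [RHS]up_lo ?mxE //; congr up; apply/rowP => j; rewrite !mxE. Qed.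

Lemma small_coefs_up delta (vecs : 'rV[R]_n -> Prop) cnt (v : nat -> 'rV[R]_n) w :
  lower_bounded delta vecs -> (forall i, (i < cnt)%N -> w i = up (v i) /\ vecs (v i)) ->
  small_coefs delta cnt w.
Proof.
move=> HL Hw r idx a Hidx Hfree k Hk.
have Ew b : mix r b (fun k => w (idx k)) = up (mix r b (fun k => v (idx k))).
  by rewrite -mix_up; apply: eq_mix => // l Hl; have [] := Hw (idx l) (Hidx l Hl).
have [-> _] := Hw (idx k) (Hidx k Hk); rewrite Ew !enorm_up.
apply: (HL r (fun k => v (idx k)) a predT) => // [l Hl _|b _ E l Hl].
  by have [] := Hw (idx l) (Hidx l Hl).
by apply: Hfree => //; rewrite Ew /mix E up0.
Qed.

End Lift.

(* TRIM subtracts multiples of reduced relations; each pass exhausts an item or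
   leaves a small value, so that the weights removed form an exact relation. *)
Definition PHILOOP : cmd :=
  For 5 $17 (If (BAnd (rlt (RCst 0) (RGet 16 $5))
                  (rlt (RGet 11 (IGet 18 $5)) (RGet 17 (ICst 0) *r RGet 16 $5)))
    (RSet 17 (ICst 0) (RGet 11 (IGet 18 $5) /r RGet 16 $5)) Skip).

Definition BLOOP : cmd :=
  For 5 $17 (RSet 11 (IGet 18 $5)
     (RGet 11 (IGet 18 $5) -r RGet 17 (ICst 0) *r RGet 16 $5)).

Definition TRIM : cmd :=
  For 8 ($16 +i ICst 1) (CARA ;; RSet 17 (ICst 0) (RCst 1) ;; PHILOOP ;; BLOOP).

Section Trim.
Variables (R : realType) (n : nat) (orc : nat -> 'rV[R]_n -> answer R n).
Implicit Types (s : state R).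

Notation wv := (@wv R n).
Notation gv := (@gv R n).

Lemma PHILOOP_spec s r : imem s 17 0 = r -> rmem s 17 0 = 1 ->
  (forall k, (k < r)%N -> 0 <= rmem s 11 (imem s 18 k)) ->
  (forall k, (k < r)%N -> 0 <= rmem s 16 k) ->
  wp orc PHILOOP s (fun s' t q => agree [:: 5] [:: 17] s s' /\
    [/\ (t <= 20 * r + 20)%N, q = 0%N &
      let phi := rmem s' 17 0 in
      [/\ 0 <= phi <= 1, forall k, (k < r)%N -> phi * rmem s 16 k <= rmem s 11 (imem s 18 k)
        & phi = 1 \/ exists2 k, (k < r)%N & phi * rmem s 16 k = rmem s 11 (imem s 18 k)]]).
Proof.
move=> Hr H1 HB HA; apply: wp_agreeS => //.
apply: (@wp_for _ _ _ (fun l st => 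
      let phi := rmem st 17 0 in
      [/\ 0 <= phi <= 1, forall k, (k < l)%N -> phi * rmem s 16 k <= rmem s 11 (imem s 18 k)
        & phi = 1 \/ exists2 k, (k < r)%N & phi * rmem s 16 k = rmem s 11 (imem s 18 k)]) r 10) => //=.
- by rewrite H1; split=> //; [rewrite ler01 lexx | left].
- move=> l s2 Hl Ag Hl2 [/andP[I0 I1] I2 I3].
  apply: wp_if => /=; rewrite Hl2; fr Ag; rewrite -!ltNge.
  case: ifPn => [/andP[a0 Hlt]|Hc].
    apply: wp_rset; split=> //; ev; rewrite Hl2; fr Ag.
    set phi := _ / _; have phi0 : 0 <= phi by rewrite divr_ge0 ?HB // ltW.
    have phi1 : phi <= rmem s2 17 0 by rewrite ler_pdivrMr // ltW.
    have E : phi * rmem s 16 l = rmem s 11 (imem s 18 l) by rewrite divfK // gt_eqF.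
    split; [by rewrite phi0 (le_trans phi1) | | by right; exists l].
    move=> k; rewrite ltnS leq_eqVlt => /orP[/eqP->|Hk]; first by rewrite E.
    apply: le_trans (I2 k Hk); rewrite ler_wpM2r // HA //; exact: ltn_trans Hk Hl.
  apply: wp_skip; split=> //; split=> //; first by rewrite I0 I1.
  move=> k; rewrite ltnS leq_eqVlt => /orP[/eqP->|Hk]; last exact: I2.
  move: Hc; rewrite negb_and -!leNgt => /orP[Ha|//].
  have -> : rmem s 16 l = 0 by apply/eqP; rewrite eq_le Ha HA.
  by rewrite mulr0 HB.
- move=> s2 t2 Ht2 Ag Hk2 I; split=> //; lia.
Qed.

Lemma BLOOP_spec s r : imem s 17 0 = r ->
  (forall k l, (k < r)%N -> (l < r)%N -> imem s 18 k = imem s 18 l -> k = l) ->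
  wp orc BLOOP s (fun s' t q => agree [:: 5] [:: 11] s s' /\
    [/\ (t <= 10 * r + 10)%N, q = 0%N,
      forall k, (k < r)%N -> rmem s' 11 (imem s 18 k)
         = rmem s 11 (imem s 18 k) - rmem s 17 0 * rmem s 16 k
    & forall i, (forall k, (k < r)%N -> imem s 18 k != i) -> rmem s' 11 i = rmem s 11 i]).
Proof.
move=> Hr Hinj; apply: wp_agreeS => //.
apply: (@wp_for _ _ _ (fun l st => [/\
      forall k, (k < l)%N -> rmem st 11 (imem s 18 k)
         = rmem s 11 (imem s 18 k) - rmem s 17 0 * rmem s 16 k
    & forall i, (forall k, (k < l)%N -> imem s 18 k != i) -> rmem st 11 i = rmem s 11 i]) r 5) => //=.
- move=> l s2 Hl Ag Hl2 [I1 I2].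
  apply: wp_rset; split=> //; ev; rewrite Hl2; fr Ag.
  have El : rmem s2 11 (imem s 18 l) = rmem s 11 (imem s 18 l).
    by apply: I2 => k Hk; apply/eqP => /Hinj E; have := E (ltn_trans Hk Hl) Hl; lia.
  split.
    move=> k; rewrite ltnS leq_eqVlt => /orP[/eqP->|Hk]; first by rewrite eqxx El.
    case: eqP => [/Hinj E|_]; last exact: I1.
    by have := E (ltn_trans Hk Hl) Hl; lia.
  move=> i Hi; rewrite eq_sym (negbTE (Hi l (ltnSn l))); apply: I2 => k Hk.
  by apply: Hi; exact: ltnW.
- move=> s2 t2 Ht2 Ag Hk2 [I1 I2]; split=> //; lia.
Qed.

(** The weights left at the end form the exact relation. A pass either has [phi = 1], which makes
    the value 0, or empties an item of positive weight, which happens at most [cnt] times; hence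
    [cnt + 1] passes. The losses telescope along the passes, so in total [delta] bounds them by the
    initial norm alone. *)
Lemma TRIM_spec s cnt :
  imem s 2 0 = n.+1 -> imem s 16 0 = cnt -> (forall i, (i < cnt)%N -> 0 <= rmem s 11 i) ->
  wp orc TRIM s (fun s' t q =>
    agree [:: 3; 5; 8; 17; 18; 19; 20] [:: 9; 11; 12; 13; 14; 15; 16; 17] s s' /\
    [/\ (t <= 600 * (n.+1 * n.+1) * (cnt.+1 * cnt.+1))%N, q = 0%N,
      forall i, (i < cnt)%N -> 0 <= rmem s' 11 i <= rmem s 11 i,
      mix cnt (rmem s' 11) (wv s) = 0
    & forall delta, 0 <= delta -> small_coefs delta cnt (wv s) -> forall i, (i < cnt)%N ->
        delta * (enorm (wv s i) * (rmem s 11 i - rmem s' 11 i))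
        <= enorm (mix cnt (rmem s 11) (wv s))]).
Proof.
move=> Hn Hc Hb; apply: wp_agreeS => //.
pose pos (st : state R) := (\sum_(i < cnt) (0 < rmem st 11 i)%R)%N.
pose Inv it st := [/\ forall i, (i < cnt)%N -> 0 <= rmem st 11 i <= rmem s 11 i,
   mix cnt (rmem st 11) (wv s) = 0 \/ (pos st + it <= cnt)%N
  & forall delta, 0 <= delta -> small_coefs delta cnt (wv s) -> forall i, (i < cnt)%N ->
        delta * (enorm (wv s i) * (rmem s 11 i - rmem st 11 i))
        <= enorm (mix cnt (rmem s 11) (wv s)) - enorm (mix cnt (rmem st 11) (wv s))].
apply: (@wp_for _ _ _ Inv cnt.+1 (500 * (n.+1 * n.+1) * cnt + 40 * n.+1 + 60)) => //=.
- by rewrite addn1 Hc.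
- split=> [i Hi||delta d0 _ i Hi] /=.
  + by rewrite Hb // lexx.
  + right; rewrite addn0 /pos /=; apply: (@leq_trans (\sum_(i < cnt) 1)%N).
      by apply: leq_sum => i _; exact: leq_b1.
    by rewrite sum_nat_const card_ord muln1.
  + by rewrite !subrr !mulr0.
- move=> it s2 Hit Ag Hit2 [I1 I2 I3].
  have E2 : imem s2 2 0 = n.+1 by fr Ag.
  have E16 : imem s2 16 0 = cnt by fr Ag.
  have W2 : wv s2 = wv s by apply: wv_eq; fr Ag.
  have HB2 i : (i < cnt)%N -> 0 <= rmem s2 11 i by move=> /I1/andP[].
  apply: wp_seq; apply: wp_conseq (@CARA_spec _ _ orc s2 cnt E2 E16 HB2) _.
  move=> s3 t3 q3 [Ag3 [Ht3 -> HC]].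
  have W3 : wv s3 = wv s2 by apply: wv_eq; fr Ag3.
  move: HC; rewrite /caraS W3 W2 [rmem s3 11](_ : _ = rmem s2 11) => [HC|]; last by fr Ag3.
  have rn := cara_size HC; set r := imem s3 17 0 in HC rn.
  apply: wp_seq; apply: wp_rset; set s4 := State _ _.
  have HB4 k : (k < r)%N -> 0 <= rmem s4 11 (imem s4 18 k).
    by move=> Hk; rewrite /s4; ev; fr Ag3; apply: HB2; exact: (cara_lt HC).
  apply: wp_seq; apply: wp_conseq (@PHILOOP_spec s4 r _ _ HB4 (cara_ge0 HC)) _ => //.
  move=> s5 t5 q5 [Ag5 [Ht5 -> ]]; set phi := rmem s5 17 0.
  move=> [Hphi P1 P2].
  have E17 : imem s5 17 0 = r by fr Ag5.
  have E18 : imem s5 18 = imem s3 18 by fr Ag5.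
  have E516 : rmem s5 16 = rmem s3 16 by fr Ag5; rewrite /s4; ev.
  have E511 : rmem s5 11 = rmem s2 11 by fr Ag5; rewrite /s4; ev; fr Ag3.
  have E411 : rmem s4 11 = rmem s2 11 by rewrite /s4; ev; fr Ag3.
  apply: wp_conseq (@BLOOP_spec s5 r E17 _) _.
    move=> k l Hk Hl; rewrite E18 => E; apply: (cara_inj HC) => //; by rewrite E.
  move=> s6 t6 q6 [Ag6 [Ht6 -> U1 U2]].
  split; [clear -Ht3 Ht5 Ht6 rn; ev; nia|by []|].
  rewrite E511 E18 E516 in U1 U2.
  rewrite E411 in P1 P2; rewrite -/phi in U1.
  have step delta (d0 : 0 <= delta) (Hs : small_coefs delta cnt (wv s)) :=
    @trim_step _ _ delta cnt (wv s) (rmem s2 11) (rmem s6 11) r _ _ _ phi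
      Hs d0 HC Hphi HB2 P1 U1 U2.
  (* For [delta = 0] the bound on coefficients is trivial, so the value and the ranges of the
     weights are obtained unconditionally. *)
  have [S1 S2 _] : [/\ mix cnt (rmem s6 11) (wv s) = (1 - phi) *: mix cnt (rmem s2 11) (wv s),
      forall i, (i < cnt)%N -> 0 <= rmem s6 11 i <= rmem s2 11 i & True].
    have [|X Y _] := step 0 (lexx _) _; last by split.
    by move=> ? ? ? ? ? ? ?; rewrite mul0r enorm_ge0.
  have /andP[phi0 phi1] := Hphi.
  split=> /=.
  + move=> i Hi; have /andP[-> H2] := S2 i Hi; have /andP[_ H3] := I1 i Hi.
    exact: le_trans H3.
  + rewrite S1; case: I2 => [->|I2]; first by left; rewrite scaler0.
    case: P2 => [->|[k Hk Ek]]; first by left; rewrite subrr scale0r.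
    (* A kept item had positive weight before the pass, by [cara_pos]; this is why emptying it
       lowers the count. *)
    right; have Hik := cara_lt HC Hk; pose ik := Ordinal Hik.
    have z6 : rmem s6 11 ik = 0 by rewrite /= U1 // Ek subrr.
    have p2 : 0 < rmem s2 11 ik by exact: (cara_pos HC Hk).
    rewrite addnS -addSn; apply: leq_trans I2; rewrite leq_add2r.
    rewrite /pos /= (bigD1 ik) //= [X in (_ <= X)%N](bigD1 ik) //= z6 ltxx add0n p2 add1n ltnS.
    apply: leq_sum => i _; have /andP[_ H] := S2 i (ltn_ord i).
    case: ltP => // H6; by rewrite (lt_le_trans H6 H).
  + move=> delta d0 Hs i Hi; have [_ _ X] := step delta d0 Hs.
    have Y := X i Hi; have Z := I3 delta d0 Hs i Hi.
    rewrite S1 enormZ ger0_norm ?subr_ge0 //.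
    have -> : rmem s 11 i - rmem s6 11 i =
      (rmem s 11 i - rmem s2 11 i) + (rmem s2 11 i - rmem s6 11 i) by ring.
    rewrite mulrDr mulrDr mulrBl mul1r opprB addrA.
    apply: le_trans (lerD Z Y) _.
    by rewrite addrAC.
- move=> s2 t2 Ht2 Ag Hk2 [I1 I2 I3]; split=> //.
  + clear -Ht2; nia.
  + case: I2 => // I2; exfalso; lia.
  + move=> delta d0 Hs i Hi; apply: le_trans (I3 delta d0 Hs i Hi) _.
    by rewrite lerBlDr lerDl enorm_ge0.
Qed.

End Trim.

Lemma proj_mix (R : realType) n q k r a (v : nat -> 'rV[R]_n) :
  proj q k (mix r a v) = mix r a (fun i => proj q k (v i)).
Proof. by rewrite /mix proj_sum; apply: eq_bigr => i _; rewrite projZ. Qed.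

(** * The ascent: repairing one negative coefficient *)

Definition BUILD : cmd :=
  For 6 $25 (VSet 3 $1 5 $3 (RGet 43 ($6 *i $1 +i $3)) ;; PROJ ;;
    VSet 3 $1 10 ($6 *i $2 +i $3) (RGet 45 $6 *r RGet 6 $3) ;;
    RSet 10 ($6 *i $2 +i $1) (RCst 0)).

(** The coefficient [t] that the starred row of the level must receive so that the current rows
    represent [c - gamma d] one level further down. *)
Definition TCOMP : cmd :=
  VSum 3 $1 46 (RGet 27 $3 *r RGet 7 ($9 *i $1 +i $3)) ;;
  For 5 $23 (VSum 3 $1 9 (RGet 41 ($5 *i $1 +i $3) *r RGet 7 ($9 *i $1 +i $3)) ;;
    RSet 46 (ICst 0) (RGet 46 (ICst 0) -r RGet 42 $5 *r RGet 9 (ICst 0))) ;;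
  RSet 47 (ICst 0) (RGet 46 (ICst 0) /r RGet 8 $9).

Definition PUT src se pe ec b sg : cmd :=
  VSet 3 $1 43 (pe *i $1 +i $3) (RGet src (se *i $1 +i $3)) ;;
  RSet 44 pe ec ;; RSet 11 pe b ;; RSet 45 pe sg.

(** The relation of the level reads: rows of the level, weighted by [lco], minus [mu] times
    [c - gamma d] equals the residual. Replacing [c - gamma d] by the current rows plus [t] times
    the starred row gives the items: level rows with sign 1, solution rows with weight [mu y] and
    sign -1, and a second copy of the starred row with weight [- mu t], nonnegative exactly in the
    case [t < 0] to be repaired. Array 44 holds the coefficients of the representation itself. *)
Definition ECOPY : cmd :=
  For 6 (IGet 21 $9) (PUT 36 ($9 *i $28 +i $6) $6 (RCst 0)
    (RGet 37 ($9 *i $28 +i $6) -r RGet 32 (ICst 0) *r RGet 38 ($9 *i $28 +i $6)) (RCst 1)) ;;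
  For 6 $23 (PUT 41 $6 (IGet 21 $9 +i $6) (RGet 42 $6) (RGet 39 $9 *r RGet 42 $6)
    (RCst 0 -r RCst 1)) ;;
  ISet 25 (ICst 0) (IGet 21 $9 +i $23) ;;
  PUT 36 ($9 *i $28 +i IGet 22 $9) $25 (RGet 47 (ICst 0))
    (RCst 0 -r RGet 39 $9 *r RGet 47 (ICst 0)) (RCst 1) ;;
  incr 25.

Section Items.
Variables (R : realType) (n : nat) (orc : nat -> 'rV[R]_n -> answer R n).
Implicit Types (s : state R).

Notation wv := (@wv R n).
Notation qv := (@qv R n).

Definition er s i := vec_at s n 43 (i * n).
Definition yr s i := vec_at s n 41 (i * n).
Definition lrow s k i := vec_at s n 36 ((k * (n.+1 + n.+1) + i) * n).
Definition lco s k i := rmem s 37 (k * (n.+1 + n.+1) + i)%N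
   - rmem s 32 0 * rmem s 38 (k * (n.+1 + n.+1) + i)%N.

Lemma qv_eq s s' : rmem s' 7 = rmem s 7 -> qv s' = qv s.
Proof. by move=> E; apply/funext => i; apply: vec_at_eq. Qed.

Lemma BUILD_spec s k E :
  imem s 1 0 = n -> imem s 2 0 = n.+1 -> imem s 10 0 = k -> (k <= n)%N ->
  (forall l, (l < k)%N -> rmem s 8 l = dot (qv s l) (qv s l)) ->
  imem s 25 0 = E ->
  wp orc BUILD s (fun s' t q => agree [:: 3; 4; 6] [:: 5; 6; 9; 10] s s' /\
    [/\ (t <= 80 * (n.+1 * n.+1) * E + 10)%N, q = 0%N
      & forall i, (i < E)%N -> wv s' i = up (rmem s 45 i *: proj (qv s) k (er s i))]).
Proof.
move=> Hn Hn1 Hk kn HQ HE; apply: wp_agreeS => //.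
apply: (@wp_for _ _ _ (fun e st => forall i, (i < e)%N ->
   wv st i = up (rmem s 45 i *: proj (qv s) k (er s i))) E (70 * (n.+1 * n.+1))) => //=.
- move=> e s2 He Ag He2 IH.
  have E1 : imem s2 1 0 = n by fr Ag.
  apply: wp_seq; apply: (@wp_vset _ _ _ (fun j => rmem s 43 (e * n + j)) 0 n) => //=.
    by move=> j Hj; ev; rewrite He2 E1; fr Ag.
  move=> t2 Ht2; set s3 := State _ _.
  have Q3 : qv s3 = qv s by apply: qv_eq; rewrite /s3; ev; fr Ag.
  apply: wp_seq; apply: wp_conseq (@PROJ_spec _ _ orc s3 k _ _ kn _) _ => //.
  + by rewrite /s3; ev; fr Ag.
  + by move=> l Hl; rewrite Q3 -HQ // /s3; ev; fr Ag.
  move=> s4 t4 q4 [Ag4 [Ht4 -> HP]].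
  have E41 : imem s4 1 0 = n by fr Ag4.
  have E42 : imem s4 2 0 = n.+1 by fr Ag4; rewrite /s3; ev; fr Ag.
  have E46 : imem s4 6 0 = e by fr Ag4.
  have E445 : rmem s4 45 = rmem s 45 by fr Ag4; rewrite /s3; ev; fr Ag.
  have E410 : rmem s4 10 = rmem s2 10 by fr Ag4; rewrite /s3; ev.
  apply: wp_seq; apply: (@wp_vset _ _ _ (fun j => rmem s 45 e * rmem s4 6 j) (e * n.+1) n) => //=.
    by move=> j Hj; ev; rewrite E42 E46 E445.
  move=> t5 Ht5; apply: wp_rset; split; [|by []|].
    by ev; clear -Ht2 Ht4 Ht5; nia.
  move=> i; rewrite ltnS => Hi; ev; rewrite E42 E46 E41.
  apply/rowP => j; rewrite !mxE /=.
  have [Ei|ne] := eqVneq i e.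
    rewrite Ei eqn_add2l; have [Ej|nj] := eqVneq (j : nat) n.
      by rewrite insubN // -leqNgt Ej.
    have Hj : (j < n)%N by have := ltn_ord j; rewrite ltnS leq_eqVlt (negbTE nj).
    rewrite leq_addr ltn_add2l Hj addKn insubT mxE; congr (_ * _).
    have Er3 : vec_at s3 n 5 0 = er s e by rewrite vec_fill; apply/rowP => jj; rewrite !mxE.
    by move/rowP/(_ (Ordinal Hj)): HP; rewrite Q3 Er3 mxE => <-.
  have Hie : (i < e)%N by rewrite ltn_neqAle ne.
  have /rowP/(_ j) := IH i Hie; rewrite !mxE /= => <-.
  rewrite ifF; last by apply/negbTE/eqP => H; have := ltn_ord j; move/eqP: ne; nia.
  rewrite ifF; first by rewrite E410.
  apply/negbTE/negP => /andP[H1 H2]; have := ltn_ord j; nia.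
- move=> s2 t2 Ht2 Ag Hk2 IH; split=> //; clear -Ht2; nia.
Qed.

Lemma TCOMP_spec s k Y :
  imem s 1 0 = n -> imem s 9 0 = k -> imem s 23 0 = Y -> (Y <= n.+1)%N ->
  wp orc TCOMP s (fun s' t q => agree [:: 3; 5] [:: 9; 46; 47] s s' /\
    [/\ (t <= 60 * (n.+1 * n.+1))%N, q = 0%N
      & rmem s' 47 0 = dot (vec_at s n 27 0 - mix Y (rmem s 42) (yr s)) (qv s k) / rmem s 8 k]).
Proof.
move=> Hn Hk HY Yn; apply: wp_agreeS => //.
apply: wp_seq; apply: (@wp_vsum _ _ _ (fun j => rmem s 27 j * rmem s 7 (k * n + j)) n) => //=.
  by move=> j x Hj; ev; rewrite Hk Hn.
move=> t1 Ht1; set s1 := State _ _; apply: wp_seq.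
apply: (@wp_for _ _ _ (fun e st =>
   rmem st 46 0 = dot (vec_at s n 27 0 - mix e (rmem s 42) (yr s)) (qv s k)) Y (20 * n.+1)) => //=.
- by ev; rewrite /mix big_ord0 subr0 /qv dot_vec.
- move=> e s2 He Ag He2 IH.
  have E1 : imem s2 1 0 = n by fr Ag.
  have E9 : imem s2 9 0 = k by fr Ag.
  apply: wp_seq; apply: (@wp_vsum _ _ _ (fun j => rmem s 41 (e * n + j) * rmem s 7 (k * n + j)) n) => //=.
    by move=> j x Hj; ev; rewrite He2 E1 E9; fr Ag.
  move=> t2 Ht2; apply: wp_rset; split; [by ev; clear -Ht2; nia|by []|].
  ev; rewrite He2 IH mixS opprD addrA dotBl [X in _ = X]dotBl; fr Ag.
  by rewrite -dotBl dotZl /yr /qv -dot_vec.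
- move=> s2 t2 Ht2 Ag Hk2 IH; apply: wp_rset; split; [|by []|].
    by ev; clear -Ht1 Ht2 Yn; nia.
  have E9 : imem s2 9 0 = k by fr Ag.
  by ev; rewrite IH E9; fr Ag.
Qed.

Lemma PUT_spec s src se pe ec b sg p r x1 x2 x3 :
  imem s 1 0 = n ->
  (forall s1, agree [:: 3] [:: 43; 44; 11; 45] s s1 ->
     [/\ ieval s1 se = r, ieval s1 pe = p, reval s1 ec = x1, reval s1 b = x2
       & reval s1 sg = x3]) ->
  [&& 3 \notin ireads se, 3 \notin ireads pe & src != 43] ->
  [&& icost se <= 10, icost pe <= 10, rcost ec <= 10, rcost b <= 10 & rcost sg <= 10]%N ->
  wp orc (PUT src se pe ec b sg) s
   (fun s' t q => agree [:: 3] [:: 43; 44; 11; 45] s s' /\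
    [/\ (t <= 70 * n.+1)%N, q = 0%N,
      forall l, er s' l = if l == p then vec_at s n src (r * n) else er s l
    & [/\ forall l, rmem s' 44 l = if l == p then x1 else rmem s 44 l,
      forall l, rmem s' 11 l = if l == p then x2 else rmem s 11 l
    & forall l, rmem s' 45 l = if l == p then x3 else rmem s 45 l]]).
Proof.
move=> Hn Hv /and3P[_ _ H4] /and5P[c1 c2 c3 c4 c5]; apply: wp_agreeS => //.
have agr im m (H : forall a, a != 3 -> im a = imem s a)
   (H' : forall a, a \notin [:: 43; 44; 11; 45] -> m a = rmem s a) :
   agree [:: 3] [:: 43; 44; 11; 45] s (State im m).
  by split=> a /=; [rewrite inE; exact: H | exact: H'].
apply: wp_seq; apply: (@wp_vset _ _ _ (fun j => rmem s src (r * n + j)) (p * n) n) => //=.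
  move=> j Hj; set s1 := State _ _.
  have [] := Hv s1.
    apply: agr => a; first by move=> Ha; apply/funext => i; rewrite /upd (negbTE Ha).
    by rewrite !inE !negb_or => /and4P[Ha _ _ _]; apply/funext => i; rewrite /fill (negbTE Ha).
  move=> -> -> _ _ _; rewrite {}/s1; ev; rewrite Hn; split=> //.
  by rewrite (negbTE H4).
move=> t1 Ht1; set s1 := State _ _.
have A1 : agree [:: 3] [:: 43; 44; 11; 45] s s1.
  apply: agr => a; first by move=> Ha; apply/funext => i; rewrite /upd (negbTE Ha).
  by rewrite !inE !negb_or => /and4P[Ha _ _ _]; apply/funext => i; rewrite /fill (negbTE Ha).
have updA (st : state R) b' i x : agree [:: 3] [:: 43; 44; 11; 45] s st ->
    b' \in [:: 43; 44; 11; 45] -> agree [:: 3] [:: 43; 44; 11; 45] s (State (imem st) (upd (rmem st) b' i x)).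
  move=> [X Y] Hb; split=> // a Ha; rewrite -Y //; apply/funext => j; rewrite /= /upd.
  by case: eqP => // E; rewrite E Hb in Ha.
have [V1 V2 V3 V4 V5] := Hv s1 A1.
apply: wp_seq; apply: wp_rset; rewrite V2 V3; set s2 := State _ _.
have A2 : agree [:: 3] [:: 43; 44; 11; 45] s s2 by apply: updA.
have [U1 U2 U3 U4 U5] := Hv s2 A2.
apply: wp_seq; apply: wp_rset; rewrite U2 U4; set s3 := State _ _.
have A3 : agree [:: 3] [:: 43; 44; 11; 45] s s3 by apply: updA.
have [W1 W2 W3 W4 W5] := Hv s3 A3.
apply: wp_rset; rewrite W2 W5; split.
- clear -Ht1 c1 c2 c3 c4 c5; nia.
- by [].
- move=> l; apply: etrans (vec_fill_row (imem s) _ _ _ _ _ _) _.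
  by case: eqP => // _; apply/rowP => j; rewrite !mxE.
- by split=> l; rewrite /s3 /s2 /s1 /=; ev; case: eqP.
Qed.

Lemma ECOPY_spec s k L Y :
  imem s 1 0 = n -> imem s 9 0 = k -> imem s 28 0 = (n.+1 + n.+1)%N ->
  imem s 21 k = L -> imem s 23 0 = Y -> (L <= n + n.+1)%N -> (Y <= n.+1)%N ->
  wp orc ECOPY s (fun s' t q => agree [:: 3; 6; 25] [:: 43; 44; 11; 45] s s' /\
    [/\ (t <= 400 * (n.+1 * n.+1))%N, q = 0%N, imem s' 25 0 = (L + Y).+1,
     forall i, (i < L)%N -> [/\ er s' i = lrow s k i, rmem s' 44 i = 0,
        rmem s' 11 i = lco s k i & rmem s' 45 i = 1]
    & (forall i, (i < Y)%N -> [/\ er s' (L + i) = yr s i, rmem s' 44 (L + i)%N = rmem s 42 i,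
        rmem s' 11 (L + i)%N = rmem s 39 k * rmem s 42 i & rmem s' 45 (L + i)%N = -1]) /\
      [/\ er s' (L + Y) = lrow s k (imem s 22 k), rmem s' 44 (L + Y)%N = rmem s 47 0,
         rmem s' 11 (L + Y)%N = - (rmem s 39 k * rmem s 47 0) & rmem s' 45 (L + Y)%N = 1]]).
Proof.
move=> Hn Hk Hcap HL HY Ln Yn; apply: wp_agreeS => //.
apply: wp_seq; apply: (@wp_for _ _ _ (fun e st => forall i, (i < e)%N ->
   [/\ er st i = lrow s k i, rmem st 44 i = 0,
        rmem st 11 i = lco s k i & rmem st 45 i = 1]) L (70 * n.+1)) => //=.
- by rewrite Hk.
- move=> e s2 He Ag He2 IH.
  have E1 : imem s2 1 0 = n by fr Ag.
  apply: wp_conseq (@PUT_spec s2 _ _ _ _ _ _ e (k * (n.+1 + n.+1) + e) 0 (lco s k e) 1 E1 _ _ _) _ => //.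
    move=> s3 Ag3; rewrite /=; fr Ag3; fr Ag; rewrite He2 Hk Hcap.
    by split=> //; rewrite /lco; fr Ag3; fr Ag.
  move=> s3 t3 q3 [Ag3 [Ht3 -> P1 [P2 P3 P4]]]; split=> // i.
  rewrite ltnS leq_eqVlt => /orP[/eqP->|Hi].
    split; [apply: etrans (P1 e) _|apply: etrans (P2 e) _|apply: etrans (P3 e) _|apply: etrans (P4 e) _];
      rewrite eqxx //; apply: vec_at_eq; by fr Ag.
  have [I1 I2 I3 I4] := IH i Hi.
  by split; [apply: etrans (P1 i) _|apply: etrans (P2 i) _|apply: etrans (P3 i) _|apply: etrans (P4 i) _];
    rewrite ltn_eqF.
move=> s1 t1 Ht1 Ag1 _ I1.
apply: wp_seq; apply: (@wp_for _ _ _ (fun e st =>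
   (forall i, (i < L)%N -> [/\ er st i = lrow s k i, rmem st 44 i = 0,
        rmem st 11 i = lco s k i & rmem st 45 i = 1]) /\
   (forall i, (i < e)%N -> [/\ er st (L + i) = yr s i, rmem st 44 (L + i)%N = rmem s 42 i,
        rmem st 11 (L + i)%N = rmem s 39 k * rmem s 42 i & rmem st 45 (L + i)%N = -1])) Y (70 * n.+1)) => //=.
- by fr Ag1.
- move=> e s2 He Ag He2 [IH1 IH2].
  have E1 : imem s2 1 0 = n by fr Ag; fr Ag1.
  apply: wp_conseq (@PUT_spec s2 _ _ _ _ _ _ (L + e) e (rmem s 42 e)
     (rmem s 39 k * rmem s 42 e) (-1) E1 _ _ _) _ => //.
    move=> s3 Ag3; rewrite /=; fr Ag3; fr Ag; fr Ag1; rewrite He2 Hk HL.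
    by split=> //; rewrite sub0r.
  move=> s3 t3 q3 [Ag3 [Ht3 -> P1 [P2 P3 P4]]]; split=> //; split=> i.
    move=> Hi; have [J1 J2 J3 J4] := IH1 i Hi.
    by split; [apply: etrans (P1 i) _|apply: etrans (P2 i) _|apply: etrans (P3 i) _|apply: etrans (P4 i) _];
      rewrite ltn_eqF // (leq_trans Hi) // leq_addr.
  rewrite ltnS leq_eqVlt => /orP[/eqP->|Hi].
    split; [apply: etrans (P1 _) _|apply: etrans (P2 _) _|apply: etrans (P3 _) _|apply: etrans (P4 _) _];
      rewrite eqxx //; apply: vec_at_eq; by fr Ag; fr Ag1.
  have [J1 J2 J3 J4] := IH2 i Hi.
  by split; [apply: etrans (P1 _) _|apply: etrans (P2 _) _|apply: etrans (P3 _) _|apply: etrans (P4 _) _];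
    rewrite eqn_add2l ltn_eqF.
move=> s2 t2 Ht2 Ag2 _ [I21 I22].
apply: wp_seq; apply: wp_iset; set s3 := setI _ _ _ _.
have X25 : imem s3 25 0 = (L + Y)%N by rewrite /s3; ev; fr Ag2; fr Ag1; rewrite Hk HL HY.
have X9 : imem s3 9 0 = k by rewrite /s3; ev; fr Ag2; fr Ag1.
apply: wp_seq; apply: wp_conseq (@PUT_spec s3 _ _ _ _ _ _ (L + Y) (k * (n.+1 + n.+1) + imem s 22 k)
     (rmem s 47 0) (- (rmem s 39 k * rmem s 47 0)) 1 _ _ _ _) _ => //.
- by rewrite /s3; ev; fr Ag2; fr Ag1.
- move=> s4 Ag4; rewrite /=; fr Ag4; rewrite X25 X9 /s3; ev; fr Ag2; fr Ag1.
  by rewrite Hcap sub0r.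
move=> s4 t4 q4 [Ag4 [Ht4 -> P1 [P2 P3 P4]]].
have X425 : imem s4 25 0 = (L + Y)%N by fr Ag4.
apply: wp_iset; split.
- ev; clear -Ht1 Ht2 Ht4 Ln Yn; nia.
- by [].
- by ev; rewrite X425 addn1.
- move=> i Hi; have [J1 J2 J3 J4] := I21 i Hi.
  by split; [apply: etrans (P1 i) _|apply: etrans (P2 i) _|apply: etrans (P3 i) _|apply: etrans (P4 i) _];
      rewrite ltn_eqF // (leq_trans Hi) // leq_addr.
split.
  move=> i Hi; have [J1 J2 J3 J4] := I22 i Hi.
  by split; [apply: etrans (P1 _) _|apply: etrans (P2 _) _|apply: etrans (P3 _) _|apply: etrans (P4 _) _];
    rewrite eqn_add2l ltn_eqF.
split; [apply: etrans (P1 _) _|apply: etrans (P2 _) _|apply: etrans (P3 _) _|apply: etrans (P4 _) _];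
      rewrite eqxx //; apply: vec_at_eq; by rewrite /s3; ev; fr Ag2; fr Ag1.
Qed.

End Items.

Section FixMath.
Variables (R : realType) (n : nat).
Variables (E st last : nat) (V : nat -> 'rV[R]_n) (ec sg B b : nat -> R) (t mu : R).
Hypotheses (stl : (st < last)%N) (El : last.+1 = E) (Vst : V st = V last).
Hypotheses (ec_st : ec st = 0) (ec_last : ec last = t).
Hypotheses (sg_st : sg st = 1) (sg_last : sg last = 1).
Hypothesis B_rel : mix E B (fun i => sg i *: V i) = 0.
Let zs := B st + B last.
Let tau := - t / zs.

(** Adding [tau] times an exact relation leaves the combination unchanged, and [tau] is chosen so
    that the total coefficient [t + tau * zs] of the starred row, listed both as [st] and as [last],
    vanishes. *)
Lemma fix_sum ec' : zs != 0 ->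
  (forall i, (i < E)%N -> ec' i =
     if i == last then 0 else if i == st then 0 else ec i + tau * sg i * B i) ->
  mix E ec' V = mix E ec V.
Proof.
move=> zs0 Hec.
pose x i := ec i + tau * (sg i * B i).
pose y i : R := if i == st then x st else if i == last then x last else 0.
have -> : mix E ec' V = mix E (fun i => x i - y i) V.
  apply: eq_mix => // i Hi; rewrite Hec // /y /x.
  case: (eqVneq i st) => [->|_]; first by rewrite subrr if_same.
  by case: eqP => [->|_]; rewrite ?subrr // subr0 mulrA.
have -> : mix E (fun i => x i - y i) V = mix E x V - mix E y V by exact: mixB.
have -> : mix E x V = mix E ec V.
  rewrite /x mixD mixZ [X in tau *: X](_ : _ = 0) ?scaler0 ?addr0 // -B_rel /mix.
  by apply: eq_bigr => i _; rewrite scalerA mulrC.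
rewrite [mix E y V](_ : _ = 0) ?subr0 //.
have HE : (st < E)%N by lia.
have HE' : (last < E)%N by lia.
have ne : (last == st) = false by lia.
rewrite /mix (bigD1 (Ordinal HE)) //= (bigD1 (Ordinal HE')) /=; last first.
  by apply/negP => /eqP/(congr1 val)/= /eqP; rewrite ne.
rewrite big1 ?addr0 => [|i /andP[H1 H2]]; last first.
  rewrite /y !ifF ?scale0r //; apply/negbTE; first by apply: contra H2 => /eqP Ei; apply/eqP/val_inj.
  by apply: contra H1 => /eqP Ei; apply/eqP/val_inj.
rewrite /y eqxx ne eqxx Vst -scalerDl /x ec_st ec_last sg_st sg_last.
rewrite [X in X *: _](_ : _ = t + tau * zs); last by rewrite /zs; ring.
by rewrite /tau divfK // subrr scale0r.
Qed.

Hypotheses (b_last : b last = - (mu * t)) (t0 : t < 0) (mu0 : 0 <= mu).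
Hypothesis HB : forall i, (i < E)%N -> 0 <= B i <= b i.
Hypothesis Hi : forall i, (i < last)%N ->
  (sg i = 1 /\ ec i = 0) \/ [/\ sg i = -1, b i = mu * ec i & 0 <= ec i].
Variables (delta : R) (u : 'rV[R]_n).
Hypothesis (d0 : 0 <= delta).
Hypothesis Hd : forall i, (i < E)%N -> delta * (enorm (V i) * (b i - B i)) <= enorm u.
Hypothesis good : 2 * enorm u < delta * (b st * enorm (V st)).

(** By [Hd], each of the two copies of the starred row loses at most
    [enorm u / (delta * enorm (V st))], and [good] says that twice this is less than [b st]. So more
    than [b last = - (mu * t)] survives. *)
Lemma fix_zs : - (mu * t) < zs.
Proof.
have HE : (st < E)%N by lia.
have HE' : (last < E)%N by lia.
have H1 := Hd HE; have H2 := Hd HE'; rewrite -Vst b_last in H2.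
have dV : 0 < delta * enorm (V st).
  rewrite lt_def mulr_ge0 // ?enorm_ge0 // andbT; apply/eqP => Z.
  move: good; rewrite mulrCA Z mulr0 => H; have := enorm_ge0 u; lra.
rewrite -(ltr_pM2l dV) /zs.
have -> : delta * enorm (V st) * (B st + B last) =
   delta * (b st * enorm (V st)) + delta * enorm (V st) * (- (mu * t))
   - delta * (enorm (V st) * (b st - B st))
   - delta * (enorm (V st) * (- (mu * t) - B last)) by ring.
move: good H1 H2; move: (delta * (b st * _)) (delta * (enorm (V st) * (b st - _))).
move: (delta * (enorm (V st) * (_ - _))) (delta * enorm (V st) * _) (enorm u).
by move=> x1 x2 x3 x4 x5; lra.
Qed.

(** [zs] exceeding [- (mu * t)] means [tau * mu <= 1]: a solution row, of weight [mu * ec i], loses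
    at most its coefficient [ec i]. *)
Lemma fix_pos : 0 < zs /\ forall i, (i < last)%N -> 0 <= ec i + tau * sg i * B i.
Proof.
have Hz := fix_zs.
have mt : 0 <= - (mu * t) by rewrite oppr_ge0 mulr_ge0_le0 // ltW.
have zs0 : 0 < zs by apply: le_lt_trans Hz.
split=> // i Hil.
have /andP[B0 Bb] := HB (ltn_trans Hil (eq_leq El)).
have tau0 : 0 <= tau by rewrite divr_ge0 ?oppr_ge0 // ltW.
case: (Hi Hil) => [[-> ->]|[-> bi eci]]; first by rewrite mulr1 add0r mulr_ge0.
have taumu : tau * mu <= 1.
  by rewrite /tau mulrAC ler_pdivrMr // mul1r mulNr mulrC ltW.
rewrite mulrN1 mulNr subr_ge0; apply: (@le_trans _ _ (tau * (mu * ec i))).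
  by rewrite ler_wpM2l // -bi.
by rewrite mulrA -[leRHS]mul1r ler_wpM2r.
Qed.

End FixMath.

Definition FIX : cmd :=
  BUILD ;; ISet 16 (ICst 0) $25 ;; If (BLeI (ICst 1) $30) Skip TRIM ;;
  RSet 48 (ICst 0) (RGet 11 (IGet 22 $9) +r RGet 11 ($25 -i ICst 1)) ;;
  If (BLeR (RGet 48 (ICst 0)) (RCst 0)) (ISet 12 (ICst 0) (ICst 3))
   (RSet 48 (ICst 0) ((RCst 0 -r RGet 47 (ICst 0)) /r RGet 48 (ICst 0)) ;;
    VSet 6 $25 44 $6 (RGet 44 $6 +r RGet 48 (ICst 0) *r RGet 45 $6 *r RGet 11 $6) ;;
    RSet 44 (IGet 22 $9) (RCst 0) ;; RSet 44 ($25 -i ICst 1) (RCst 0)).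

(** [fix_pos] relies on an inequality involving the unknown delta; the program can only test the
    resulting signs. *)
Definition CHECK : cmd :=
  For 6 $25 (If (rlt (RGet 44 $6) (RCst 0)) (ISet 12 (ICst 0) (ICst 3)) Skip).

Definition YCOPY : cmd :=
  For 6 $17 (VSet 3 $1 41 ($6 *i $1 +i $3) (RGet 43 (IGet 18 $6 *i $1 +i $3)) ;;
             RSet 42 $6 (RGet 16 $6)) ;;
  ISet 23 (ICst 0) $17.

(** The reduction brings the solution back to at most [n + 1] rows and makes them distinct, as the
    output format demands; the combination is preserved only after projection, which is all the next
    step of the ascent uses. *)
Definition FINISH : cmd :=
  VSet 6 $25 45 $6 (RCst 1) ;; BUILD ;; ISet 16 (ICst 0) $25 ;;
  VSet 6 $25 11 $6 (RGet 44 $6) ;; CARA ;; YCOPY.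

Section StepParts.
Variables (R : realType) (n : nat) (orc : nat -> 'rV[R]_n -> answer R n).
Implicit Types (s : state R).

Notation wv := (@wv R n).
Notation qv := (@qv R n).
Notation er := (@er R n).
Notation yr := (@yr R n).

Lemma er_eq s s' : rmem s' 43 = rmem s 43 -> er s' = er s.
Proof. by move=> E; apply/funext => i; apply: vec_at_eq. Qed.

Lemma CHECK_spec s E : imem s 25 0 = E ->
  wp orc CHECK s (fun s' t q => agree [:: 6; 12] [::] s s' /\
    [/\ (t <= 20 * E + 20)%N, q = 0%N &
      (imem s' 12 0 = imem s 12 0 /\ forall i, (i < E)%N -> 0 <= rmem s 44 i) \/
      (imem s' 12 0 = 3%N /\ exists2 i, (i < E)%N & rmem s 44 i < 0)]).
Proof.
move=> HE; apply: wp_agreeS => //.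
apply: (@wp_for _ _ _ (fun e st =>
   (imem st 12 0 = imem s 12 0 /\ forall i, (i < e)%N -> 0 <= rmem s 44 i) \/
      (imem st 12 0 = 3%N /\ exists2 i, (i < E)%N & rmem s 44 i < 0)) E 10) => //=.
- by left.
- move=> e s2 He Ag He2 IH; apply: wp_if => /=; rewrite He2; fr Ag.
  case: ifPn => Hn; first by apply: wp_iset; split=> //; right; split=> //; exists e; rewrite // ltNge.
  apply: wp_skip; split=> //; case: IH => [[I1 I2]|I]; [left; split=> // i|by right].
  rewrite ltnS leq_eqVlt => /orP[/eqP->|]; [by rewrite negbK in Hn|exact: I2].
- move=> s2 t2 Ht2 Ag _ I; split=> //; lia.
Qed.

(** The term of degree 4 is the cost of trimming at most [3 (n + 1)] items. In exact mode the
    residual [u] is 0, the weights already form an exact relation, and this term disappears. *)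
Lemma FIX_spec s k E mu delta vecs (q := qv s) (V := fun i => proj q k (er s i))
    (st := imem s 22 (imem s 9 0)) (last := E.-1) (ec := rmem s 44) (b := rmem s 11)
    (sg := rmem s 45) (t := rmem s 47 0)
    (u := mix E b (fun i => sg i *: V i)) :
  imem s 1 0 = n -> imem s 2 0 = n.+1 -> imem s 10 0 = k -> (k <= n)%N ->
  (forall l, (l < k)%N -> rmem s 8 l = dot (q l) (q l)) ->
  imem s 25 0 = E -> (E <= 3 * n.+1)%N -> (st < last)%N -> (0 < E)%N ->
  V st = V last -> ec st = 0 -> ec last = t -> sg st = 1 -> sg last = 1 ->
  b last = - (mu * t) -> t < 0 -> 0 <= mu ->
  (forall i, (i < E)%N -> 0 <= b i) ->
  (forall i, (i < last)%N ->
    (sg i = 1 /\ ec i = 0) \/ [/\ sg i = -1, b i = mu * ec i & 0 <= ec i]) ->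
  (forall i, (i < E)%N -> vecs (sg i *: V i)) ->
  0 <= delta -> lower_bounded delta vecs ->
  ((0 < imem s 30 0)%N -> u = 0) ->
  wp orc FIX s (fun s' t q =>
    agree [:: 3; 4; 5; 6; 8; 12; 16; 17; 18; 19; 20]
          [:: 5; 6; 9; 10; 11; 12; 13; 14; 15; 16; 17; 44; 48] s s' /\
    [/\ (t <= 300 * (n.+1 * n.+1 * n.+1)
           + (if (0 < imem s 30 0)%N then 0 else 100 * 100 * (n.+1 * n.+1 * n.+1 * n.+1)))%N,
        q = 0%N, imem s' 12 0 = imem s 12 0 \/ imem s' 12 0 = 3%N,
        imem s' 12 0 = imem s 12 0 -> imem s 12 0 != 3%N ->
          mix E (rmem s' 44) V = mix E ec V
      & 2 * enorm u < delta * (b st * enorm (V st)) ->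
          imem s' 12 0 = imem s 12 0 /\ forall i, (i < E)%N -> 0 <= rmem s' 44 i]).
Proof.
move=> Hn Hn1 Hk kn HQ HE HE3 stl E0 Vst ecst ecl sgst sgl bl t0 mu0 b0 Hcases Hvecs d0 HL Hu.
apply: wp_agreeS => //.
have El : last.+1 = E by rewrite prednK.
apply: wp_seq; apply: wp_conseq (@BUILD_spec _ _ orc s k E Hn Hn1 Hk kn HQ HE) _.
move=> s1 t1 q1 [Ag1 [Ht1 -> HW]].
apply: wp_seq; apply: wp_iset; set s2 := setI _ _ _ _.
have E2 : imem s2 2 0 = n.+1 by rewrite /s2; ev; fr Ag1.
have E16 : imem s2 16 0 = E by rewrite /s2; ev; fr Ag1.
have B2 : rmem s2 11 = b by rewrite /s2; ev; fr Ag1.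
have W2 i : (i < E)%N -> wv s2 i = up (sg i *: V i).
  by move=> Hi; apply: etrans (HW i Hi).
have M2 a : mix E a (wv s2) = up (mix E a (fun i => sg i *: V i)).
  by rewrite -mix_up; apply: eq_mix.
have Hsc : small_coefs delta E (wv s2).
  apply: (small_coefs_up (v := fun i => sg i *: V i) HL) => i Hi; split; [exact: W2|exact: Hvecs].
have eV i : (i < E)%N -> enorm (wv s2 i) = enorm (V i).
  move=> Hi; rewrite W2 // enorm_up enormZ.
  have -> : `|sg i| = 1; last by rewrite mul1r.
  have : (i <= last)%N by rewrite -ltnS El.
  rewrite leq_eqVlt => /orP[/eqP->|/Hcases[[-> _]|[-> _ _]]];
    by rewrite ?sgl ?normrN1 ?normr1.
apply: wp_seq.
apply: (@wp_conseq _ _ _ _ _ (fun s3 t q => agree [:: 3; 5; 8; 17; 18; 19; 20]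
     [:: 9; 11; 12; 13; 14; 15; 16; 17] s2 s3 /\
   [/\ (t <= 1 + (if (0 < imem s 30 0)%N then 0 else 600 * (n.+1 * n.+1) * (E.+1 * E.+1)))%N,
     q = 0%N, forall i, (i < E)%N -> 0 <= rmem s3 11 i <= b i,
     mix E (rmem s3 11) (fun i => sg i *: V i) = 0
   & forall i, (i < E)%N -> delta * (enorm (V i) * (b i - rmem s3 11 i)) <= enorm u])).
  apply: wp_if; rewrite [beval _ _](_ : _ = (0 < imem s 30 0)%N); last first.
    by rewrite /s2; ev; fr Ag1.
  case: ifP => Hex.
    apply: wp_skip; split; first by split.
    split=> //.
    - by move=> i Hi; rewrite B2 lexx b0.
    - by rewrite B2 -/u Hu.
    - by move=> i Hi; rewrite B2 subrr !mulr0 enorm_ge0.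
  apply: wp_conseq (@TRIM_spec _ _ orc s2 E E2 E16 _) _; first by move=> i Hi; rewrite B2 b0.
  move=> s3 t3 q3 [Ag3 [Ht3 -> T1 T2 T3]]; split=> //; split=> //.
  - by rewrite B2 in T1.
  - by apply: up_inj; rewrite -M2 T2 up0.
  - move=> i Hi; rewrite -eV // -B2; apply: le_trans (T3 delta d0 Hsc i Hi) _.
    by rewrite M2 enorm_up B2.
move=> s3 t3 q3 [Ag3 [Ht3 -> H1 H2 H3]].
set BB := rmem s3 11 in H1 H2 H3.
have X25 : imem s3 25 0 = E by fr Ag3; rewrite /s2; ev; fr Ag1.
have X22 : imem s3 22 (imem s3 9 0) = st by fr Ag3; rewrite /s2; ev; fr Ag1.
have X12 : imem s3 12 0 = imem s 12 0 by fr Ag3; rewrite /s2; ev; fr Ag1.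
have Y47 : rmem s3 47 = rmem s 47 by fr Ag3; rewrite /s2; ev; fr Ag1.
have Y44 : rmem s3 44 = rmem s 44 by fr Ag3; rewrite /s2; ev; fr Ag1.
have Y45 : rmem s3 45 = rmem s 45 by fr Ag3; rewrite /s2; ev; fr Ag1.
apply: wp_seq; apply: wp_rset; set s4 := State _ _.
have Z48 : rmem s4 48 0 = BB st + BB last.
  by rewrite /s4; ev; rewrite X22 X25 subn1.
set zs := BB st + BB last in Z48.
have costf : (3 * n.+1 * (80 * (n.+1 * n.+1)) <= 240 * (n.+1 * n.+1 * n.+1))%N by nia.
have cost6 : (600 * (n.+1 * n.+1) * (E.+1 * E.+1) <= 96 * 100 * (n.+1 * n.+1 * n.+1 * n.+1))%N.
  have : (E.+1 * E.+1 <= 16 * (n.+1 * n.+1))%N by clear -HE3; nia.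
  by clear; nia.
have cost1 : (80 * (n.+1 * n.+1) * E <= 240 * (n.+1 * n.+1 * n.+1))%N by clear -HE3; nia.
have x3 : (n.+1 <= n.+1 * n.+1 * n.+1)%N by clear; nia.
have goal_pos : 2 * enorm u < delta * (b st * enorm (V st)) -> 0 < zs /\
   forall i, (i < last)%N -> 0 <= ec i + (- t / zs) * sg i * BB i.
  move=> good; exact: (fix_pos stl El Vst bl t0 mu0 H1 Hcases d0 H3 good).
apply: wp_if; rewrite [beval _ _](_ : _ = (zs <= 0)); last by rewrite -Z48.
case: ifPn => Hzs.
  apply: wp_iset; split.
  - by move: Ht3; case: ifP => _ Ht3; ev; clear -Ht1 Ht3 cost6 cost1 x3; lia.
  - by [].
  - by right.
  - by ev => <-.
  - by move=> /goal_pos[]; rewrite ltNge Hzs.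
rewrite -ltNge in Hzs.
apply: wp_seq; apply: wp_rset; set s5 := State _ _.
have Z5 : rmem s5 48 0 = - t / zs.
  by rewrite /s5 /s4; ev; rewrite Y47 sub0r X22 X25 subn1.
apply: wp_seq; apply: (@wp_vset _ _ _ (fun i => ec i + - t / zs * sg i * BB i) 0 E) => //=.
  move=> j Hj; split=> //; rewrite -Z5 /s5; ev.
  by rewrite add0n ltnn Y44 Y45.
move=> t6 Ht6; set s6 := State _ _.
apply: wp_seq; apply: wp_rset; apply: wp_rset; set s7 := State _ _.
have ec7 i : (i < E)%N -> rmem s7 44 i = if i == last then 0 else if i == st then 0
      else ec i + (- t / zs) * sg i * BB i.
  move=> Hi; rewrite /s7 /s6 /s5 /s4; ev; rewrite X25 X22 subn1 -/last.
  by case: eqP => // _; case: eqP => // _; rewrite add0n Hi subn0.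
have S7 : mix E (rmem s7 44) V = mix E ec V.
  apply: (fix_sum stl El Vst ecst ecl sgst sgl H2 _ ec7).
  by rewrite gt_eqF.
split.
- have HE4 : (E * 20 <= 60 * (n.+1 * n.+1 * n.+1))%N by clear -HE3 x3; nia.
  by move: Ht3; case: ifP => _ Ht3; ev; clear -Ht1 Ht3 Ht6 cost6 cost1 x3 HE4; lia.
- by [].
- by left; rewrite /s7 /s6 /s5 /s4; ev.
- by [].
- move=> /goal_pos[_ Hpos]; split; first by rewrite /s7 /s6 /s5 /s4; ev.
  move=> i Hi; rewrite ec7 //; case: eqP => // /eqP ne; case: eqP => // _; apply: Hpos.
  by rewrite ltn_neqAle ne -ltnS El.
Qed.

Lemma FINISH_spec s k E (q := qv s) (V := fun i => proj q k (er s i)) :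
  imem s 1 0 = n -> imem s 2 0 = n.+1 -> imem s 10 0 = k -> (k <= n)%N ->
  (forall l, (l < k)%N -> rmem s 8 l = dot (q l) (q l)) ->
  imem s 25 0 = E -> (E <= 3 * n.+1)%N ->
  (forall i, (i < E)%N -> 0 <= rmem s 44 i) ->
  wp orc FINISH s (fun s' t q =>
    agree [:: 3; 4; 5; 6; 16; 17; 18; 19; 20; 23]
          [:: 5; 6; 9; 10; 11; 12; 13; 14; 15; 16; 17; 41; 42; 45] s s' /\
    [/\ (t <= 50 * 50 * (n.+1 * n.+1 * n.+1))%N, q = 0%N, (imem s' 23 0 <= n.+1)%N,
       forall i, (i < imem s' 23 0)%N ->
         0 <= rmem s' 42 i /\ exists2 e, (e < E)%N & yr s' i = er s e
     & (forall i j, (i < imem s' 23 0)%N -> (j < imem s' 23 0)%N -> yr s' i = yr s' j -> i = j) /\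
       mix (imem s' 23 0) (rmem s' 42) (fun i => proj (qv s) k (yr s' i)) = mix E (rmem s 44) V]).
Proof.
move=> Hn Hn1 Hk kn HQ HE HE3 Hec; apply: wp_agreeS => //.
apply: wp_seq; apply: (@wp_vset _ _ _ (fun=> 1) 0 E) => //= t0 Ht0; set s0 := State _ _.
have Q0 : qv s0 = q by apply: qv_eq.
have R0 : er s0 = er s by apply: er_eq.
apply: wp_seq; apply: wp_conseq (@BUILD_spec _ _ orc s0 k E _ _ _ _ _ _) _ => //.
move=> s1 t1 q1 [Ag1 [Ht1 -> HW]].
apply: wp_seq; apply: wp_iset; set s2 := setI _ _ _ _.
have X25 : imem s2 25 0 = E by rewrite /s2; ev; fr Ag1.
have X2 : imem s2 2 0 = n.+1 by rewrite /s2; ev; fr Ag1.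
have X16 : imem s2 16 0 = E by rewrite /s2; ev; fr Ag1.
apply: wp_seq; apply: (@wp_vset _ _ _ (rmem s 44) 0 E) => //=.
  by move=> j Hj; ev; fr Ag1.
move=> t3 Ht3; set s3 := State _ _.
have B3 i : (i < E)%N -> rmem s3 11 i = rmem s 44 i.
  by move=> Hi; rewrite /s3; ev; rewrite add0n Hi subn0.
have W3 i : (i < E)%N -> wv s3 i = up (V i).
  move=> Hi; apply: etrans (HW i Hi) _; rewrite Q0 R0; congr up.
  by rewrite /s0; ev; rewrite add0n Hi scale1r.
apply: wp_seq; apply: wp_conseq (@CARA_spec _ _ orc s3 E _ _ _) _ => //.
  by move=> i Hi; rewrite B3 // Hec.
move=> s4 t4 q4 [Ag4 [Ht4 -> HC]].
have W4 : wv s4 = wv s3 by apply: wv_eq; fr Ag4.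
have B4 : rmem s4 11 = rmem s3 11 by fr Ag4.
move: HC; rewrite /caraS W4 B4; set r := imem s4 17 0 => HC.
have rn := cara_size HC.
have X1 : imem s4 1 0 = n by fr Ag4; rewrite /s3; ev; fr Ag1.
have R4 : rmem s4 43 = rmem s 43 by fr Ag4; rewrite /s3; ev; fr Ag1.
apply: wp_seq; apply: (@wp_for _ _ _ (fun e st => forall i, (i < e)%N ->
   yr st i = er s (imem s4 18 i) /\ rmem st 42 i = rmem s4 16 i) r (20 * n.+1)) => //=.
- move=> e s5 He Ag5 He5 IH.
  have X51 : imem s5 1 0 = n by fr Ag5.
  apply: wp_seq; apply: (@wp_vset _ _ _ (fun j => rmem s 43 (imem s4 18 e * n + j)) (e * n) n) => //=.
    by move=> j Hj; ev; rewrite He5 X51; fr Ag5; rewrite R4.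
  move=> t6 Ht6; apply: wp_rset; split; [ev; lia|by []|].
  move=> i; rewrite ltnS => Hi.
  have -> : yr (setI (State (imem (State (upd (imem s5) 3 0 n) (fill (rmem s5) 41 (e * n) n
     (fun j => rmem s 43 (imem s4 18 e * n + j)%N)))) (upd (rmem (State (upd (imem s5) 3 0 n) (fill (rmem s5) 41 (e * n) n
     (fun j => rmem s 43 (imem s4 18 e * n + j)%N)))) 42 (upd (imem s5) 3 0 n 6 0)
      (rmem (State (upd (imem s5) 3 0 n) (fill (rmem s5) 41 (e * n) n
     (fun j => rmem s 43 (imem s4 18 e * n + j)%N))) 16 (upd (imem s5) 3 0 n 6 0)))) 6 0 e.+1) i
     = if i == e then er s (imem s4 18 e) else yr s5 i.
    by apply: etrans (vec_fill_row (imem s5) _ _ _ _ _ _) _; case: eqP.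
  ev; rewrite He5; case: eqP => [->|/eqP ne]; first by split=> //; fr Ag5.
  by apply: IH; rewrite ltn_neqAle ne.
move=> s5 t5 Ht5 Ag5 _ H5; apply: wp_iset; rewrite [ieval s5 $17](_ : _ = r); last by rewrite /=; fr Ag5.
have Vfree (i j : nat) : (i < r)%N -> (j < r)%N -> er s (imem s4 18 i) = er s (imem s4 18 j) -> i = j.
  move=> Hi Hj Eij; apply: (cara_inj HC) => //; rewrite !W3 ?(cara_lt HC) // /V Eij //.
split.
- have c1 : (80 * (n.+1 * n.+1) * E <= 240 * (n.+1 * n.+1 * n.+1))%N by clear -HE3; nia.
  have c2 : (500 * (n.+1 * n.+1) * E <= 1500 * (n.+1 * n.+1 * n.+1))%N by clear -HE3; nia.
  have x3 : (n.+1 <= n.+1 * n.+1 * n.+1)%N by clear; nia.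
  have c3 : (r * (20 * n.+1 + 10) <= 30 * (n.+1 * n.+1 * n.+1))%N by clear -rn; nia.
  have c4 : (E <= 3 * (n.+1 * n.+1 * n.+1))%N by clear -HE3 x3; nia.
  ev; clear -Ht0 Ht1 Ht3 Ht4 Ht5 c1 c2 c3 c4 x3; lia.
- by [].
- by ev.
- move=> i; ev => Hi; have [H6 H7] := H5 i Hi; split.
    by rewrite H7; exact: (cara_ge0 HC).
  by exists (imem s4 18 i) => //; exact: (cara_lt HC).
- ev; split.
    move=> i j Hi Hj; have [H6 _] := H5 i Hi; have [H7 _] := H5 j Hj => E6.
    by apply: Vfree => //; rewrite -H6 -H7.
  apply: up_inj; rewrite -!mix_up.
  transitivity (mix r (rmem s4 16) (fun k => wv s3 (imem s4 18 k))).
    apply: eq_mix => i Hi; have [H6 H7] := H5 i Hi => //.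
    by rewrite W3 ?(cara_lt HC) // -/(yr _ i) [yr _ i]H6.
  rewrite (cara_sum HC); apply: eq_mix => i Hi; [exact: B3|exact: W3].
Qed.

End StepParts.

Definition STEP : cmd :=
  ISet 10 (ICst 0) $9 ;; TCOMP ;; ECOPY ;;
  If (rlt (RGet 47 (ICst 0)) (RCst 0)) FIX Skip ;; CHECK ;;
  If (BLeI $12 (ICst 1)) FINISH Skip.

Definition ASCENT : cmd :=
  VSet 3 $1 27 $3 (RGet 23 $3 -r RGet 32 (ICst 0) *r RGet 24 $3) ;;
  ISet 23 (ICst 0) (ICst 0) ;;
  For 32 $11 (If (ieqb $12 (ICst 1))
    (ISet 9 (ICst 0) ($11 -i $32 -i ICst 1) ;; STEP) Skip).

Section Ascent.
Variables (R : realType) (n : nat) (orc : nat -> 'rV[R]_n -> answer R n).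
Variables (rows : 'rV[R]_n -> Prop) (delta : R) (good : Prop).
Hypotheses (dgt0 : 0 < delta) (HL : lower_bounded delta rows).
Implicit Types (s : state R).

Notation qv := (@qv R n).
Notation er := (@er R n).
Notation yr := (@yr R n).
Notation lrow := (@lrow R n).
Notation lco := (@lco R n).

Lemma mix_cat N L Y a (v : nat -> 'rV[R]_N) :
  mix (L + Y) a v = mix L a v + mix Y (fun i => a (L + i)%N) (fun i => v (L + i)%N).
Proof. by rewrite /mix big_split_ord. Qed.

Lemma setI_agree s a i x : agree [:: a] [::] s (setI s a i x).
Proof.
split=> // b; rewrite inE => Hb; apply/funext => j.
by rewrite /= /upd (negbTE Hb).
Qed.

Definition lstar s k := lrow s k (imem s 22 k).

Definition lu s k := mix (imem s 21 k) (lco s k) (fun i => proj (qv s) k (lrow s k i))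
  - rmem s 39 k *: proj (qv s) k (vec_at s n 27 0).

(** A level as seen by the ascent: a conic combination of rows that projects to [rmem s 39 k] times
    [c - gamma d] up to the residual [lu s k]. [lv_good] is conditional since a level is built
    before it is known whether eps is small enough. *)
Record levok s k : Prop := LevOk {
  lv_cnt : (imem s 21 k <= n + n.+1)%N;
  lv_star : (imem s 22 k < imem s 21 k)%N;
  lv_rows : forall i, (i < imem s 21 k)%N -> rows (lrow s k i);
  lv_q : qv s k = proj (qv s) k (lstar s k);
  lv_q0 : qv s k != 0;
  lv_qn : rmem s 8 k = dot (qv s k) (qv s k);
  lv_co : forall i, (i < imem s 21 k)%N -> 0 <= lco s k i;
  lv_co_st : 0 < lco s k (imem s 22 k);
  lv_mu : 0 <= rmem s 39 k;
  lv_good : good -> 2 * enorm (lu s k) < delta * (lco s k (imem s 22 k) * enorm (qv s k));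
  lv_exact : (0 < imem s 30 0)%N -> lu s k = 0 }.

(** The solution represents [c - gamma d] only modulo the first [k] starred rows; at level 0 this
    becomes an equality. *)
Definition ainv s k :=
  [/\ (imem s 23 0 <= n.+1)%N,
      forall i, (i < imem s 23 0)%N -> rows (yr s i) /\ 0 <= rmem s 42 i,
      forall i j, (i < imem s 23 0)%N -> (j < imem s 23 0)%N -> yr s i = yr s j -> i = j
    & proj (qv s) k (vec_at s n 27 0 - mix (imem s 23 0) (rmem s 42) (yr s)) = 0].

Lemma levok_gs s k : (forall l, (l < k)%N -> levok s l) -> gs (qv s) (lstar s) k.
Proof. by move=> H l Hl; have [_ _ _ H1 H2 _ _ _ _ _ _] := H l Hl. Qed.

Lemma STEP_spec s k :
  imem s 1 0 = n -> imem s 2 0 = n.+1 -> imem s 28 0 = (n.+1 + n.+1)%N ->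
  imem s 9 0 = k -> imem s 12 0 = 1%N ->
  (forall l, (l <= k)%N -> levok s l) -> ainv s k.+1 ->
  wp orc STEP s (fun s' t q =>
    agree [:: 3; 4; 5; 6; 8; 10; 12; 16; 17; 18; 19; 20; 23; 25]
      [:: 5; 6; 9; 10; 11; 12; 13; 14; 15; 16; 17; 41; 42; 43; 44; 45; 46; 47; 48] s s' /\
    [/\ (t <= 40 * 100 * (n.+1 * n.+1 * n.+1)
           + (if (0 < imem s 30 0)%N then 0 else 100 * 100 * (n.+1 * n.+1 * n.+1 * n.+1)))%N,
        q = 0%N, imem s' 12 0 = 1%N \/ imem s' 12 0 = 3%N,
        ((0 < imem s 30 0)%N \/ good) -> imem s' 12 0 = 1%N
      & imem s' 12 0 = 1%N -> ainv s' k]).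
Proof.
move=> Hn Hn1 Hcap Hk Hst HV [Y1 Y2 Y3 Y4]; apply: wp_agreeS => //.
have Hgs1 : gs (qv s) (lstar s) k.+1 by apply: levok_gs => l Hl; exact: HV.
have Hgs := gsW (leqnSn k) Hgs1.
have kn : (k < n)%N := gs_size Hgs1.
have [V1 V2 V3 V4 V5 V6 V7 V8 V9 V10 V11] := HV k (leqnn k).
set L := imem s 21 k in V1 V2 V3 V7.
set Y := imem s 23 0 in Y1 Y2 Y3 Y4.
set mu := rmem s 39 k in V9; set st := imem s 22 k in V2 V8 V10.
set q := qv s in Hgs Hgs1 V4 V5 V6 V10 Y4.
have d0 := ltW dgt0.
have Hrow l : (l < k)%N -> rows (lstar s l).
  by move=> Hl; have [_ Hs Hr _ _ _ _ _ _ _ _] := HV l (ltnW Hl); exact: Hr.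
have HPL := proj_lower_bounded Hgs Hrow d0 HL.
have HQ l : (l < k)%N -> rmem s 8 l = dot (q l) (q l).
  by move=> Hl; have [_ _ _ _ _ Hs _ _ _ _ _] := HV l (ltnW Hl).
apply: wp_seq; apply: wp_iset; set s0 := setI _ _ _ _.
apply: wp_seq; apply: wp_conseq (@TCOMP_spec _ _ orc s0 k Y _ _ _ _) _ => //.
move=> s1 t1 q1 [Ag1 [Ht1 -> HT]].
have {}HT : rmem s1 47 0 = dot (vec_at s n 27 0 - mix Y (rmem s 42) (yr s)) (q k) / rmem s 8 k.
  exact: HT.
set t := rmem s1 47 0 in HT.
have Pq : proj q k (q k) = q k by rewrite [X in proj q k X]V4 (proj_idem _ Hgs) -V4.
(* One more projection step kills the difference, so at level [k] it is a multiple of [q k], and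
   pairing with [q k] shows that the multiple is [t]. *)
have Eproj : proj q k (vec_at s n 27 0) =
    mix Y (rmem s 42) (fun i => proj q k (yr s i)) + t *: q k.
  move: Y4; rewrite /= projB proj_mix => /eqP; rewrite subr_eq0 => /eqP E.
  apply/eqP; rewrite -subr_eq0 opprD addrA subr_eq0; apply/eqP; rewrite E.
  congr (_ *: _); rewrite HT V6 -proj_mix -projB; congr (_ / _).
  by rewrite (proj_adj Hgs) Pq.
apply: wp_seq; apply: wp_conseq (@ECOPY_spec _ _ orc s1 k L Y _ _ _ _ _ V1 Y1) _; try by fr Ag1.
move=> s2 t2 q2 [Ag2 [Ht2 -> X25 HE1 [HE2 HE3]]].
have ELr i : lrow s1 k i = lrow s k i by apply: vec_at_eq; fr Ag1.
have ELc i : lco s1 k i = lco s k i by rewrite /lco; fr Ag1.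
have EYr i : yr s1 i = yr s i by apply: vec_at_eq; fr Ag1.
have M1 : rmem s1 39 = rmem s 39 by fr Ag1.
have M2 : rmem s1 42 = rmem s 42 by fr Ag1.
have M3 : imem s1 22 = imem s 22 by fr Ag1.
rewrite M3 M1 -/mu -/t -/st ELr in HE3.
have {}HE1 i (Hi : (i < L)%N) := HE1 i Hi.
set E := (L + Y).+1 in X25.
have Q2 : qv s2 = q by apply: qv_eq; fr Ag2; fr Ag1.
pose V i := proj q k (er s2 i).
have VL i : (i < L)%N -> V i = proj q k (lrow s k i).
  by move=> Hi; rewrite /V; have [-> _ _ _] := HE1 i Hi; rewrite ELr.
have VY i : (i < Y)%N -> V (L + i)%N = proj q k (yr s i).
  by move=> Hi; rewrite /V; have [-> _ _ _] := HE2 i Hi; rewrite EYr.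
have Vlast : V (L + Y)%N = q k.
  by rewrite /V; have [-> _ _ _] := HE3; rewrite [RHS]V4.
have Vst : V st = V (L + Y)%N by rewrite VL // Vlast [RHS]V4.
have rowsE i : (i < E)%N -> rows (er s2 i).
  move=> Hi; have [H|H] := ltnP i L.
    by have [-> _ _ _] := HE1 i H; rewrite ELr; exact: V3.
  have [H'|H'] := ltnP i (L + Y).
    have -> : i = (L + (i - L))%N by lia.
    have Hy : (i - L < Y)%N by lia.
    by have [-> _ _ _] := HE2 _ Hy; rewrite EYr; case: (Y2 _ Hy).
  have -> : i = (L + Y)%N by lia.
  by have [-> _ _ _] := HE3; exact: V3.
have SumE : mix E (rmem s2 44) V = proj q k (vec_at s n 27 0).
  rewrite mixS mix_cat [mix L _ _](_ : _ = 0) ?add0r; last first.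
    by apply: mix0 => i Hi; have [_ -> _ _] := HE1 i Hi.
  rewrite Eproj; have [_ -> _ _] := HE3; rewrite Vlast; congr (_ + _).
  by apply: eq_mix => i Hi; [have [_ -> _ _] := HE2 i Hi; rewrite M2 | exact: VY].
(* The representation just found is substituted for the projection of [c - gamma d] in the relation
   of the level, so the items have the residual of the level as their value. *)
have Eu : mix E (rmem s2 11) (fun i => rmem s2 45 i *: V i) = lu s k.
  rewrite mixS mix_cat; have [_ _ -> ->] := HE3; rewrite Vlast scale1r.
  rewrite /lu -/q Eproj -/mu scalerDr scalerA opprD addrA scaleNr; congr (_ + _ + _).
    apply: eq_mix => i Hi; have [_ _ E1 E2] := HE1 i Hi; first by rewrite E1.
    by rewrite E2 scale1r VL.
  rewrite -mixZ -scaleN1r -mixZ; apply: eq_bigr => i _.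
  have [_ _ -> ->] := HE2 i (ltn_ord i).
  by rewrite VY // scalerA M1 M2 mulrN1 mulN1r.
have E3 : (E <= 3 * n.+1)%N by rewrite /E; lia.
have stlast : (st < L + Y)%N by apply: leq_trans V2 _; exact: leq_addr.
have X12 : imem s2 12 0 = 1%N by fr Ag2; fr Ag1.
have X30 : imem s2 30 = imem s 30 by fr Ag2; fr Ag1.
have X22 : imem s2 22 (imem s2 9 0) = st.
  have -> : imem s2 9 0 = k by fr Ag2; fr Ag1.
  by fr Ag2; fr Ag1.
have Y47 : rmem s2 47 0 = t by fr Ag2.
have HQ2 l : (l < k)%N -> rmem s2 8 l = dot (qv s2 l) (qv s2 l).
  by move=> Hl; rewrite Q2 -HQ //; fr Ag2; fr Ag1.
have Z1 : imem s2 1 0 = n by fr Ag2; fr Ag1.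
have Z2 : imem s2 2 0 = n.+1 by fr Ag2; fr Ag1.
have Z10 : imem s2 10 0 = k by fr Ag2; fr Ag1; rewrite /s0; ev.
apply: wp_seq.
apply: (@wp_conseq _ _ _ _ _ (fun s3 t' q' =>
    agree [:: 3; 4; 5; 6; 8; 12; 16; 17; 18; 19; 20]
          [:: 5; 6; 9; 10; 11; 12; 13; 14; 15; 16; 17; 44; 48] s2 s3 /\
    [/\ (t' <= 1 + 300 * (n.+1 * n.+1 * n.+1)
           + (if (0 < imem s 30 0)%N then 0 else 100 * 100 * (n.+1 * n.+1 * n.+1 * n.+1)))%N,
        q' = 0%N, imem s3 12 0 = 1%N \/ imem s3 12 0 = 3%N,
        imem s3 12 0 = 1%N -> mix E (rmem s3 44) V = proj q k (vec_at s n 27 0)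
      & ((0 < imem s 30 0)%N \/ good) ->
          imem s3 12 0 = 1%N /\ forall i, (i < E)%N -> 0 <= rmem s3 44 i])).
  apply: wp_if; rewrite [beval _ _](_ : _ = (t < 0)); last by rewrite /= Y47 ltNge.
  (* If [t] is nonnegative there is nothing to repair: the items with their coefficients in array 44
     are already a conic representation. *)
  case: ltP => t0; last first.
    apply: wp_skip; split; first by split.
    split=> //.
    - by left.
    - move=> _; split=> // i Hi.
      have [H|H] := ltnP i L; first by have [_ -> _ _] := HE1 i H.
      have [H'|H'] := ltnP i (L + Y).
        have -> : i = (L + (i - L))%N by lia.
        have Hy : (i - L < Y)%N by lia.
        by have [_ -> _ _] := HE2 _ Hy; rewrite M2; case: (Y2 _ Hy).
      have -> : i = (L + Y)%N by lia.
      by have [_ -> _ _] := HE3.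
  have [_ e44 e11 e45] := HE3.
  have [_ est _ sst] := HE1 st V2.
  apply: wp_conseq (@FIX_spec _ _ orc s2 k E mu delta
    (fun v => exists2 m, rows m & v = proj q k m \/ v = - proj q k m)
    Z1 Z2 Z10 (ltnW kn) HQ2 X25 E3 _ _ _ _ _ _ _ _ _ _ _ _ _ d0 HPL _) _; rewrite ?X22 ?Q2 ?Y47 //=.
  - move=> i Hi; have [H|H] := ltnP i L; first by have [_ _ -> _] := HE1 i H; rewrite ELc; exact: V7.
    have [H'|H'] := ltnP i (L + Y).
      have -> : i = (L + (i - L))%N by lia.
      have Hy : (i - L < Y)%N by lia.
      by have [_ _ -> _] := HE2 _ Hy; rewrite M1 M2 mulr_ge0 //; case: (Y2 _ Hy).
    have -> : i = (L + Y)%N by lia.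
    by rewrite e11 oppr_ge0 mulr_ge0_le0 // ltW.
  - move=> i Hi; have [H|H] := ltnP i L; first by left; have [_ -> _ ->] := HE1 i H.
    have -> : i = (L + (i - L))%N by lia.
    have Hy : (i - L < Y)%N by lia.
    right; have [_ -> -> ->] := HE2 _ Hy; rewrite M1 M2; split=> //; by case: (Y2 _ Hy).
  - move=> i Hi; exists (er s2 i); first exact: rowsE.
    have [H|H] := ltnP i L; first by left; have [_ _ _ ->] := HE1 i H; rewrite scale1r.
    have [H'|H'] := ltnP i (L + Y).
      have Ei : i = (L + (i - L))%N by lia.
      have Hy : (i - L < Y)%N by lia.
      by right; have [_ _ _ H1] := HE2 _ Hy; rewrite {1}Ei H1 scaleN1r.
    have Ei : i = (L + Y)%N by lia.
    by left; rewrite {1}Ei e45 scale1r.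
  - by rewrite X30 => Hx; rewrite -[RHS](V11 Hx) -Eu.
  move=> s3 t3 q3 [Ag3 [Ht3 -> F1 F2 F3]]; split=> //; split=> //.
  - by move: Ht3; rewrite X30; case: ifP => _ /=; lia.
  - by move: F1; rewrite X12.
  - by move=> H3; rewrite F2 ?X12 ?H3 // SumE.
  - move=> H; move: F3; rewrite X12; apply.
    have [_ _ e1 _] := HE1 st V2.
    have -> : proj q k (er s2 st) = q k by have := Vst; rewrite Vlast.
    have -> : mix E (rmem s2 11) (fun i => rmem s2 45 i *: proj q k (er s2 i)) = lu s k.
      exact: Eu.
    rewrite e1 ELc.
    case: H => [Hx|]; last exact: V10.
    by rewrite (V11 Hx) enorm0 mulr0 mulr_gt0 // mulr_gt0 // enorm_gt0.
move=> s3 t3 q3 [Ag3 [Ht3 -> S3 M3' G3]].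
have W1 : imem s3 1 0 = n by fr Ag3.
have W2 : imem s3 2 0 = n.+1 by fr Ag3.
have W10 : imem s3 10 0 = k by fr Ag3.
have W25 : imem s3 25 0 = E by fr Ag3.
apply: wp_seq; apply: wp_conseq (@CHECK_spec _ _ orc s3 E W25) _.
move=> s4 t4 q4 [Ag4 [Ht4 -> C4]].
have x3 : (n.+1 <= n.+1 * n.+1 * n.+1)%N by clear; nia.
have x2 : (n.+1 * n.+1 <= n.+1 * n.+1 * n.+1)%N by clear; nia.
have cost4 : (20 * E + 20 <= 80 * (n.+1 * n.+1 * n.+1))%N by clear -E3 x3; lia.
have S4 : imem s4 12 0 = 1%N \/ imem s4 12 0 = 3%N.
  by case: C4 => [[-> _]|[-> _]] //; right.
have G4 : ((0 < imem s 30 0)%N \/ good) -> imem s4 12 0 = 1%N.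
  move=> /G3[H1 H2]; case: C4 => [[-> _]//|[_ [i Hi]]].
  by rewrite ltNge H2.
have R4 : er s4 = er s2 by apply: er_eq; fr Ag4; fr Ag3.
have Q4 : qv s4 = q by rewrite -Q2; apply: qv_eq; fr Ag4; fr Ag3.
have costx : (t4 <= 80 * (n.+1 * n.+1 * n.+1))%N by exact: leq_trans Ht4 cost4.
apply: wp_if; rewrite [beval _ _](_ : _ = (imem s4 12 0 <= 1)%N) //.
case: (leqP (imem s4 12 0) 1) => H4; last first.
  have H43 : imem s4 12 0 = 3%N by case: S4 => // H1; rewrite H1 in H4.
  apply: wp_skip; split.
  - by rewrite /=; clear -Ht1 Ht2 Ht3 costx x2 x3; move: Ht3; case: ifP => _; lia.
  - by [].
  - by right.
  - by move=> /G4; rewrite H43.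
  - by rewrite H43.
have H41 : imem s4 12 0 = 1%N by case: S4 => // H3; rewrite H3 in H4.
have [H31 HE] : imem s3 12 0 = 1%N /\ forall i, (i < E)%N -> 0 <= rmem s4 44 i.
  case: C4 => [[E1 E2]|[E1 _]]; last by rewrite H41 in E1.
  by split; [rewrite -E1|move=> i Hi; fr Ag4; exact: E2].
have X4 : rmem s4 44 = rmem s3 44 by fr Ag4.
apply: wp_conseq (@FINISH_spec _ _ orc s4 k E _ _ _ (ltnW kn) _ _ E3 HE) _; try by fr Ag4.
  by move=> l Hl; rewrite Q4 -HQ //; fr Ag4; fr Ag3; fr Ag2; fr Ag1.
move=> s5 t5 q5 [Ag5 [Ht5 -> N1 N2 [N3 N4]]].
split.
- by rewrite /=; clear -Ht1 Ht2 Ht3 costx Ht5 x2 x3; move: Ht3; case: ifP => _; lia.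
- by [].
- by left; fr Ag5.
- by move=> _; fr Ag5.
- move=> _; split=> //.
    move=> i Hi; have [Hc [e He ->]] := N2 i Hi; split=> //.
    by rewrite R4; exact: rowsE.
  rewrite projB proj_mix.
  have -> : qv s5 = q by rewrite -Q4; apply: qv_eq; fr Ag5.
  have -> : vec_at s5 n 27 0 = vec_at s n 27 0.
    by apply: vec_at_eq; fr Ag5; fr Ag4; fr Ag3; fr Ag2; fr Ag1.
  rewrite Q4 R4 in N4; rewrite N4 X4 M3' // subrr //.
Qed.

Lemma levok_agree li lr s s' k : agree li lr s s' ->
  all (fun a => a \notin li) [:: 21; 22; 30] ->
  all (fun a => a \notin lr) [:: 7; 8; 27; 32; 36; 37; 38; 39] ->
  levok s k -> levok s' k.
Proof.
move=> [A1 A2] /and4P[i1 i2 i3 _] /and5P[r1 r2 r3 r4 /and5P[r5 r6 r7 r8 _]].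
have Eq : qv s' = qv s by apply: qv_eq; exact: A2.
have Er : lrow s' k = lrow s k by apply/funext => i; apply: vec_at_eq; exact: A2.
have Ec : lco s' k = lco s k by apply/funext => i; rewrite /lco !A2.
have Es : lstar s' k = lstar s k by rewrite /lstar Er A1.
have Eu : lu s' k = lu s k.
  by rewrite /lu Eq Er Ec A1 // A2 //; congr (_ - _ *: proj _ _ _); apply: vec_at_eq; exact: A2.
by case; split; rewrite ?Eq ?Er ?Ec ?Es ?Eu ?A1 // A2.
Qed.

Lemma ASCENT_spec s K c d :
  imem s 1 0 = n -> imem s 2 0 = n.+1 -> imem s 28 0 = (n.+1 + n.+1)%N ->
  imem s 11 0 = K -> imem s 12 0 = 1%N -> (K <= n)%N ->
  vec_at s n 23 0 = c -> vec_at s n 24 0 = d ->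
  (forall s', vec_at s' n 27 0 = c - rmem s 32 0 *: d -> agree [:: 3; 23] [:: 27] s s' ->
     forall l, (l < K)%N -> levok s' l) ->
  proj (qv s) K (c - rmem s 32 0 *: d) = 0 ->
  wp orc ASCENT s (fun s' t q =>
    agree [:: 3; 4; 5; 6; 8; 9; 10; 12; 16; 17; 18; 19; 20; 23; 25; 32]
      [:: 5; 6; 9; 10; 11; 12; 13; 14; 15; 16; 17; 27; 41; 42; 43; 44; 45; 46; 47; 48] s s' /\
    [/\ (t <= 50 * 100 * (n.+1 * n.+1 * n.+1 * n.+1)
           + (if (0 < imem s 30 0)%N then 0 else 100 * 100 * (n.+1 * n.+1 * n.+1 * n.+1 * n.+1)))%N,
        q = 0%N, imem s' 12 0 = 1%N \/ imem s' 12 0 = 3%N,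
        ((0 < imem s 30 0)%N \/ good) -> imem s' 12 0 = 1%N
      & imem s' 12 0 = 1%N ->
        [/\ (imem s' 23 0 <= n.+1)%N,
            forall i, (i < imem s' 23 0)%N -> rows (yr s' i) /\ 0 <= rmem s' 42 i,
            forall i j, (i < imem s' 23 0)%N -> (j < imem s' 23 0)%N -> yr s' i = yr s' j -> i = j
          & mix (imem s' 23 0) (rmem s' 42) (yr s') = c - rmem s 32 0 *: d]]).
Proof.
move=> Hn Hn1 Hcap HK Hst Kn Hc Hd HV Hterm; apply: wp_agreeS => //.
apply: wp_seq; apply: (@wp_vset _ _ _ (fun j => rmem s 23 j - rmem s 32 0 * rmem s 24 j) 0 n) => //= t0 Ht0.
apply: wp_seq; apply: wp_iset; set s1 := setI _ _ _ _.
have CG1 : vec_at s1 n 27 0 = c - rmem s 32 0 *: d.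
  rewrite (_ : vec_at s1 n 27 0 = \row_(j < n) (rmem s 23 j - rmem s 32 0 * rmem s 24 j));
    last exact: vec_fill.
  by rewrite -Hc -Hd; apply/rowP => j; rewrite !mxE.
have Ag1 : agree [:: 3; 23] [:: 27] s s1.
  split=> a /=; rewrite !inE ?negb_or => Ha; apply/funext => j; rewrite /upd /fill.
    by case/andP: Ha => /negbTE-> /negbTE->.
  by rewrite (negbTE Ha).
have V1 := HV s1 CG1 Ag1.
pose li := [:: 32; 9; 3; 4; 5; 6; 8; 10; 12; 16; 17; 18; 19; 20; 23; 25].
pose lr := [:: 5; 6; 9; 10; 11; 12; 13; 14; 15; 16; 17; 41; 42; 43; 44; 45; 46; 47; 48].
apply: (@wp_for _ _ _ (fun e st =>
   [/\ imem st 12 0 = 1%N \/ imem st 12 0 = 3%N,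
     ((0 < imem s 30 0)%N \/ good) -> imem st 12 0 = 1%N
   & imem st 12 0 = 1%N -> ainv st (K - e)]) K
   (45 * 100 * (n.+1 * n.+1 * n.+1)
           + (if (0 < imem s 30 0)%N then 0 else 100 * 100 * (n.+1 * n.+1 * n.+1 * n.+1)))%N) => //=.
- split; [by left|by []|move=> _; split=> //=].
  rewrite subn0 [X in _ - X](_ : _ = 0) ?subr0; last by rewrite /mix /= big_ord0.
  rewrite [vec_at _ _ _ _](_ : _ = vec_at s1 n 27 0) // CG1 -[RHS]Hterm.
  by apply: eq_proj => l _; apply: vec_at_eq.
- move=> e s2 He Ag He2 [I1 I2 I3].
  apply: wp_if; rewrite [beval _ _](_ : _ = (imem s2 12 0 == 1%N)); last by rewrite eqn_leq.
  case: eqP => H1; last first.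
    apply: wp_skip; split; [|by []|split; [exact: I1|exact: I2|by move=> /H1]].
    by ev; have : (0 < n.+1 * n.+1 * n.+1)%N by []; case: ifP => _; lia.
  apply: wp_seq; apply: wp_iset; set s3 := setI _ _ _ _.
  have E9 : imem s3 9 0 = (K - e).-1.
    by rewrite /s3; ev; rewrite He2; fr Ag; rewrite /s1; ev; rewrite HK; lia.
  have Ag3 := agree_trans Ag (setI_agree s2 9 0 (ieval s2 ($11 -i $32 -i ICst 1))).
  apply: wp_conseq (@STEP_spec s3 (K - e).-1 _ _ _ E9 _ _ _) _.
  + by rewrite /s3; ev; fr Ag.
  + by rewrite /s3; ev; fr Ag.
  + by rewrite /s3; ev; fr Ag.
  + by rewrite /s3; ev.
  + by move=> l Hl; apply: (levok_agree Ag3) => //; apply: V1; lia.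
  + by rewrite prednK ?subn_gt0 //; exact: I3 H1.
  move=> s4 t4 q4 [Ag4 [Ht4 -> P1 P2 P3]].
  have X30 : imem s3 30 = imem s 30 by rewrite /s3; ev; fr Ag.
  rewrite X30 in Ht4 P2.
  split; [|by []|].
    by ev; have : (0 < n.+1 * n.+1 * n.+1)%N by []; move: Ht4; case: ifP => _; lia.
  split=> //; rewrite subnS; exact: P3.
- move=> s2 t2 Ht2 Ag _ [I1 I2 I3]; split=> //.
  + have k1 : (K * (45 * 100 * (n.+1 * n.+1 * n.+1)) <= 45 * 100 * (n.+1 * n.+1 * n.+1 * n.+1))%N.
      by clear -Kn; nia.
    have k2 : (K * (100 * 100 * (n.+1 * n.+1 * n.+1 * n.+1))
       <= 100 * 100 * (n.+1 * n.+1 * n.+1 * n.+1 * n.+1))%N.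
      by clear -Kn; move: (n.+1 * n.+1 * n.+1 * n.+1)%N => y; nia.
    have k3 : (n.+1 <= n.+1 * n.+1 * n.+1 * n.+1)%N by rewrite -!mulnA leq_pmulr.
    have k4 : (50 * 100 * (n.+1 * n.+1 * n.+1 * n.+1) =
       45 * 100 * (n.+1 * n.+1 * n.+1 * n.+1) + 500 * (n.+1 * n.+1 * n.+1 * n.+1))%N.
      by rewrite -mulnDl.
    rewrite k4; clear -Ht0 Ht2 Kn k1 k2 k3; move: Ht2 k1 k2 k3.
    set T1 := (45 * 100 * (n.+1 * n.+1 * n.+1))%N.
    set T2 := (100 * 100 * (n.+1 * n.+1 * n.+1 * n.+1))%N.
    set S1 := (45 * 100 * (n.+1 * n.+1 * n.+1 * n.+1))%N.
    set S2 := (100 * 100 * (n.+1 * n.+1 * n.+1 * n.+1 * n.+1))%N.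
    set S3 := (n.+1 * n.+1 * n.+1 * n.+1)%N.
    clearbody T1 T2 S1 S2 S3.
    by case: ifP => _ Ht2 k1 k2 k3; rewrite !mulnDr in Ht2; lia.
  + move=> /I3; rewrite subnn => -[A1 A2 A3 A4]; split=> //.
    move: A4 => /= /eqP; rewrite subr_eq0 => /eqP <-.
    by rewrite -CG1; apply: vec_at_eq; fr Ag.
Qed.

End Ascent.

(** * Running [A] inside another program *)

Definition shift (a : nat) := (100 + a)%N.

Fixpoint shI (e : iexp) : iexp :=
  match e with
  | ICst k => ICst k
  | IGet a i => IGet (shift a) (shI i)
  | IBin o e1 e2 => IBin o (shI e1) (shI e2)
  end.

Fixpoint shR (e : rexp) : rexp :=
  match e with
  | RCst k => RCst k
  | RGet a i => RGet (shift a) (shI i)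
  | RBin o e1 e2 => RBin o (shR e1) (shR e2)
  end.

Fixpoint shB (b : bexp) : bexp :=
  match b with
  | BLeI e1 e2 => BLeI (shI e1) (shI e2)
  | BLeR e1 e2 => BLeR (shR e1) (shR e2)
  | BNot b => BNot (shB b)
  | BAnd b1 b2 => BAnd (shB b1) (shB b2)
  end.

(* [A] may use any array, so it is moved to the arrays from 100 on; its queries
   are served by the code [qb]. *)
Fixpoint relocate (qb : nat -> nat -> nat -> cmd) (c : cmd) : cmd :=
  match c with
  | Skip => Skip
  | ISet a i e => ISet (shift a) (shI i) (shI e)
  | RSet a i e => RSet (shift a) (shI i) (shR e)
  | Seq c1 c2 => Seq (relocate qb c1) (relocate qb c2)
  | If b c1 c2 => If (shB b) (relocate qb c1) (relocate qb c2)
  | While b c => While (shB b) (relocate qb c)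
  | Query _ x f v => qb (shift x) (shift f) (shift v)
  end.

Section Simulation.
Variables (R : realType) (n : nat) (orc : nat -> 'rV[R]_n -> answer R n).
Variables (ans : 'rV[R]_n -> answer R n) (qb : nat -> nat -> nat -> cmd).
Implicit Types (s S : state R).

Definition sim s S := (forall a, imem S (shift a) = imem s a) /\
  (forall a, rmem S (shift a) = rmem s a).

Definition low_eq S S' := forall a, (a < 100)%N -> imem S' a = imem S a /\ rmem S' a = rmem S a.

Lemma sim_ieval s S e : sim s S -> ieval S (shI e) = ieval s e.
Proof.
case=> H1 H2; elim: e => //= [a i ->|o e1 -> e2 ->] //; by rewrite H1.
Qed.

Lemma sim_reval s S e : sim s S -> reval S (shR e) = reval s e.
Proof.
move=> H; elim: e => //= [a i|o e1 -> e2 ->] //; by rewrite (sim_ieval _ H) (proj2 H).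
Qed.

Lemma sim_beval s S b : sim s S -> beval S (shB b) = beval s b.
Proof.
move=> H; elim: b => //= [e1 e2|e1 e2|b ->|b1 -> b2 ->] //.
  by rewrite !(sim_ieval _ H).
by rewrite !(sim_reval _ H).
Qed.

Lemma icost_sh e : icost (shI e) = icost e.
Proof. by elim: e => //= o e1 -> e2 ->. Qed.

Lemma rcost_sh e : rcost (shR e) = rcost e.
Proof. by elim: e => //= [a i|o e1 -> e2 ->] //; rewrite icost_sh. Qed.

Lemma bcost_sh b : bcost (shB b) = bcost b.
Proof. by elim: b => //= [e1 e2|e1 e2|b1 -> b2 ->] //; rewrite ?icost_sh ?rcost_sh. Qed.

Variables (J : seq (answer R n) -> state R -> Prop) (Tq : nat).
Hypothesis HJ : forall l S S', J l S -> low_eq S S' -> J l S'.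
Hypothesis HQ : forall l S x f v, J l S ->
  wp orc (qb (shift x) (shift f) (shift v)) S (fun S' t q =>
    [/\ (t <= Tq)%N, (q <= 1)%N, J (rcons l (ans (vec_at S n (shift x) 0))) S'
      & forall s, sim s S -> sim (put_answer s f v (ans (vec_at S n (shift x) 0))) S']).

(** The induction follows the execution of the original program, which also yields termination of
    the relocated one. [J] speaks of the answers received so far and of the low arrays only, so the
    instructions of [A] cannot break it. *)
Lemma relocate_spec c s s' t l : exec (fun=> ans) c s s' t l ->
  forall l1 S, sim s S -> J l1 S ->
  wp orc (relocate qb c) S (fun S' t' q =>
    [/\ (t' <= t + Tq * size l)%N, (q <= size l)%N, sim s' S' & J (l1 ++ l) S']).
Proof.
elim=> {c s s' t l} /=.
- by move=> s l1 S HS HJ1; apply: wp_skip; rewrite cats0.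
- move=> a i e s l1 S HS HJ1; apply: wp_iset; rewrite cats0 !icost_sh.
  split=> //; first by rewrite leq_addr.
    case: (HS) => H1 H2; rewrite !(sim_ieval _ HS); split=> // b; apply/funext => j.
    by rewrite /= /upd /shift eqn_add2l -/(shift b) H1.
  apply: HJ HJ1 _ => b Hb; split=> //; apply/funext => j; rewrite /= /upd /shift.
  by case: eqP => // E; exfalso; lia.
- move=> a i e s l1 S HS HJ1; apply: wp_rset; rewrite cats0 icost_sh rcost_sh.
  split=> //; first by rewrite leq_addr.
    case: (HS) => H1 H2; rewrite (sim_ieval _ HS) (sim_reval _ HS); split=> // b; apply/funext => j.
    by rewrite /= /upd /shift eqn_add2l -/(shift b) H2.
  apply: HJ HJ1 _ => b Hb; split=> //; apply/funext => j; rewrite /= /upd /shift.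
  by case: eqP => // E; exfalso; lia.
- move=> c1 c2 s s1 s2 t1 t2 l1 l2 _ IH1 _ IH2 l0 S HS HJ1.
  apply: wp_seq; apply: wp_conseq (IH1 l0 S HS HJ1) _ => S1 t3 q3 [Ht3 Hq3 HS1 HJ2].
  apply: wp_conseq (IH2 _ S1 HS1 HJ2) _ => S2 t4 q4 [Ht4 Hq4 HS2 HJ3].
  by rewrite catA size_cat mulnDr; split=> //; lia.
- move=> b c1 c2 s s' t l _ IH l0 S HS HJ1; apply: wp_if; rewrite (sim_beval _ HS).
  rewrite -(fun_if (relocate qb)); apply: wp_conseq (IH l0 S HS HJ1) _.
  by move=> S2 t4 q4 [Ht4 Hq4 HS2 HJ3]; rewrite bcost_sh; split=> //; lia.
- move=> b c s Hb l0 S HS HJ1; exists S, (bcost (shB b)), [::]; split.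
    by apply: ExecWhileF; rewrite (sim_beval _ HS).
  by rewrite bcost_sh cats0 leq_addr.
- move=> b c s s1 s2 t1 t2 l1 l2 Hb _ IH1 _ IH2 l0 S HS HJ1.
  have [S1 [t3 [l3 [He3 [Ht3 Hq3 HS1 HJ2]]]]] := IH1 l0 S HS HJ1.
  have [S2 [t4 [l4 [He4 [Ht4 Hq4 HS2 HJ3]]]]] := IH2 _ S1 HS1 HJ2.
  exists S2, (bcost (shB b) + t3 + t4)%N, (l3 ++ l4); split.
    by apply: ExecWhileT He3 He4; rewrite (sim_beval _ HS).
  by rewrite catA !size_cat mulnDr bcost_sh; split=> //; lia.
- move=> k x f v s l0 S HS HJ1.
  have E : vec_at S n (shift x) 0 = vec_at s n x 0.
    by apply: vec_at_ext => j _; rewrite (proj2 HS).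
  apply: wp_conseq (HQ x f v HJ1) _ => S2 t4 q4; rewrite E => -[Ht4 Hq4 HJ3 HS2].
  by rewrite cats1; split=> //; [lia | exact: HS2].
Qed.

End Simulation.

(* A query x is projected. Unless (c - gamma d) x < 0, it is answered by a cut
   (QCUT); if it is not in K, by a projected row (QROW). A point of K with d x <= 0
   is kept and the rest of the run of A is ignored (QSTOP); one with d x > 0 lowers
   gamma to its ratio, which gives a new cut (QIMP). *)
Definition MEM : cmd :=
  If (BLeI $29 (ICst 0)) (Query 0 6 26 22)
    (ISet 26 (ICst 0) (ICst 0) ;;
     For 6 $24 (VSum 3 $1 9 (RGet 25 ($6 *i $1 +i $3) *r RGet 6 $3) ;;
       If (rlt (RGet 9 (ICst 0)) (RCst 0))
         (ISet 26 (ICst 0) (ICst 1) ;; VSet 3 $1 22 $3 (RGet 25 ($6 *i $1 +i $3))) Skip) ;;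
     If (BLeI (ICst 1) $26) Skip
       (VSum 3 $1 46 (RGet 24 $3 *r RGet 6 $3) ;;
        If (rlt (RCst 0) (RGet 46 (ICst 0))) (Query 0 6 26 22) (Query 1 6 26 22))).

Definition QCUT : cmd :=
  VSet 3 $1 18 $3 (RCst 0 -r RGet 28 $3) ;; ISet 15 $14 (ICst 1) ;;
  RSet 19 $14 (RGet 31 (ICst 0)).

Definition QROW : cmd :=
  VSet 3 $1 5 $3 (RGet 22 $3) ;; PROJ ;; VSet 3 $1 18 $3 (RGet 6 $3) ;;
  ISet 15 $14 (ICst 0).

Definition QSTOP : cmd :=
  ISet 13 (ICst 0) (ICst 2) ;; VSet 3 $1 34 $3 (RGet 6 $3) ;;
  VSet 3 $1 18 $3 (RGet 28 $3).

Definition QIMP : cmd :=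
  RSet 47 (ICst 0) (RGet 47 (ICst 0) /r RGet 46 (ICst 0)) ;;
  If (rlt (RGet 47 (ICst 0)) (RGet 32 (ICst 0)))
    (RSet 32 (ICst 0) (RGet 47 (ICst 0)) ;; VSet 3 $1 33 $3 (RGet 6 $3)) Skip ;;
  VSet 3 $1 18 $3 (RGet 47 (ICst 0) *r RGet 30 $3 -r RGet 29 $3) ;;
  ISet 15 $14 (ICst 1) ;; RSet 19 $14 (RGet 47 (ICst 0)) ;;
  VSum 3 $1 46 (RGet 18 $3 *r RGet 18 $3) ;;
  If (BLeR (RGet 46 (ICst 0)) (RCst 0))
    (VSet 3 $1 18 $3 (RGet 28 $3) ;;
     If (BLeI $13 (ICst 0)) (ISet 13 (ICst 0) (ICst 1)) Skip)
    Skip.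

Definition QCORE (x : nat) : cmd :=
  VSet 3 $1 5 $3 (RGet x $3) ;; ISet 10 (ICst 0) $11 ;; PROJ ;;
  VSum 3 $1 46 (RGet 27 $3 *r RGet 6 $3) ;;
  If (BLeR (RCst 0) (RGet 46 (ICst 0))) QCUT
    (MEM ;;
     If (BLeI (ICst 1) $26) QROW
       (VSum 3 $1 46 (RGet 24 $3 *r RGet 6 $3) ;; VSum 3 $1 47 (RGet 23 $3 *r RGet 6 $3) ;;
        If (BLeR (RGet 46 (ICst 0)) (RCst 0)) QSTOP QIMP)).

Definition QBLOCK (x f v : nat) : cmd :=
  QCORE x ;;
  VSet 3 $1 20 ($14 *i $1 +i $3) (RGet 22 $3) ;;
  VSet 3 $1 21 ($14 *i $1 +i $3) (RGet 18 $3) ;; incr 14 ;;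
  ISet f (ICst 0) (ICst 1) ;; VSet 3 $1 v $3 (RGet 18 $3).

Section AgreeBasics.
Variable (R : realType).
Implicit Types (s : state R).

Lemma vset_agree s v N dst o F :
  agree [:: v] [:: dst] s (State (upd (imem s) v 0 N) (fill (rmem s) dst o N F)).
Proof.
by split=> a; rewrite inE => Ha; apply/funext => j; rewrite /= /upd /fill (negbTE Ha).
Qed.

Lemma vsum_agree s v N dst x :
  agree [:: v] [:: dst] s (State (upd (imem s) v 0 N) (upd (rmem s) dst 0 x)).
Proof.
by split=> a; rewrite inE => Ha; apply/funext => j; rewrite /= /upd (negbTE Ha).
Qed.

Lemma rset_agree s dst i x : agree [::] [:: dst] s (State (imem s) (upd (rmem s) dst i x)).
Proof.
by split=> // a; rewrite inE => Ha; apply/funext => j; rewrite /= /upd (negbTE Ha).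
Qed.

Lemma agree_refl s : agree [::] [::] s s.
Proof. by []. Qed.

Lemma agree_norm l1 r1 l2 r2 s s' : agree l1 r1 s s' ->
  all (mem l2) l1 && all (mem r2) r1 -> agree l2 r2 s s'.
Proof. by move=> H /andP[/allP H1 /allP H2]; exact: agree_sub H H1 H2. Qed.

End AgreeBasics.

Ltac agr := first
  [ exact: vset_agree | exact: vsum_agree | exact: rset_agree | exact: setI_agree
  | assumption
  | let a := fresh "a" in let Ha := fresh "Ha" in let j := fresh "j" in
    split; intros a Ha; apply/funext; intro j; rewrite /= /upd /fill /=;
    repeat (let E := fresh "E" in case: eqP; intro E; [by rewrite E in Ha | clear E; rewrite /=]);
    by [] ].

(** * The oracle offered to [A] *)

Section Queries.
Variables (R : realType) (n : nat) (orc : nat -> 'rV[R]_n -> answer R n).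
Variables (rows : 'rV[R]_n -> Prop) (K : 'rV[R]_n -> Prop) (c d : 'rV[R]_n).
Variables (mem : 'rV[R]_n -> option 'rV[R]_n).
Variable (Mpre : state R -> Prop).
Hypothesis HMpre : forall s s', Mpre s -> imem s' 24 = imem s 24 -> imem s' 29 = imem s 29 ->
  rmem s' 24 = rmem s 24 -> rmem s' 25 = rmem s 25 -> Mpre s'.
Hypothesis HMEM : forall s, imem s 1 0 = n -> Mpre s ->
  wp orc MEM s (fun s' t q => agree [:: 3; 6; 26] [:: 9; 22; 46] s s' /\
    [/\ (t <= 60 * (n.+1 * n.+1))%N, (q <= 1)%N &
      match mem (vec_at s n 6 0) with
      | None => imem s' 26 0 = 0%N
      | Some v => (0 < imem s' 26 0)%N /\ vec_at s' n 22 0 = v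
      end]).
Hypothesis mem_ok : forall g p, dot (c - g *: d) p < 0 ->
  match mem p with None => K p | Some v => rows v /\ dot v p < 0 end.
Implicit Types (s S : state R).

Notation qv := (@qv R n).

Section Run.
Variables (k : nat) (q : nat -> 'rV[R]_n) (g0 : R).
Hypothesis kn : (k <= n)%N.
Hypothesis Hsym : forall x y, dot (proj q k x) y = dot x (proj q k y).
Hypothesis Hidem : forall x, proj q k (proj q k x) = proj q k x.
Let cs := c - g0 *: d.
Hypothesis cs0 : proj q k cs != 0.

(** It depends on [x] and on data frozen at the start of the level, including [g0]; improvements of
    gamma found during the run do not enter. Where the natural cut vanishes any valid vector will
    do, since the outcome of the run is then ignored. *)
Definition ansv (x : 'rV[R]_n) : 'rV[R]_n :=
  let p := proj q k x in
  if 0 <= dot cs p then - proj q k cs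
  else match mem p with
  | Some v => proj q k v
  | None =>
      if dot d p <= 0 then proj q k cs
      else let v := - proj q k (c - (dot c p / dot d p) *: d) in
           if v == 0 then proj q k cs else v
  end.

Lemma ansv_ok x : ansv x != 0 /\ dot (ansv x) x <= 0.
Proof.
rewrite /ansv; set p := proj q k x; case: ifPn => H0.
  by rewrite oppr_eq0 dotNl oppr_le0 Hsym.
rewrite -ltNge in H0; have := mem_ok H0; case: (mem p) => [v [_ Hv]|_].
  have E : dot (proj q k v) x = dot v p by rewrite Hsym.
  rewrite E ltW //; split=> //; apply/eqP => Z; by move: Hv; rewrite -E Z dot0l ltxx.
have csx : dot (proj q k cs) x <= 0 by rewrite Hsym ltW.
case: ifPn => // dp /=.
case: (eqVneq (- proj q k (c - (dot c p / dot d p) *: d)) 0) => // v0; split=> //.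
rewrite dotNl oppr_le0 Hsym dotBl dotZl divfK ?subrr //.
by apply: contra dp => /eqP->.
Qed.

(** A cut only has to satisfy [gam <= g], so that entries of the log stay valid when gamma decreases
    later in the run. *)
Definition entok (gam : R) (kind : nat) (g : R) (lo an : 'rV[R]_n) : Prop :=
  [/\ kind = 0%N, rows lo & an = proj q k lo] \/
  [/\ kind = 1%N, gam <= g & an = - proj q k (c - g *: d)].

Definition xfok s := d = 0 \/
  [/\ K (vec_at s n 33 0), 0 < dot d (vec_at s n 33 0)
    & dot c (vec_at s n 33 0) = rmem s 32 0 * dot d (vec_at s n 33 0)].

(** The third clause serves to identify gamma when a cut vanishes: if [c - g d] projects to 0, all
    points of the complement with [d p > 0] have ratio [g], so a gamma attained at such a point
    equals [g]. *)
Definition dynok s :=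
  [/\ rmem s 32 0 <= g0, xfok s,
      rmem s 32 0 = g0 \/ exists p, [/\ proj q k p = p, 0 < dot d p & dot c p = rmem s 32 0 * dot d p],
      imem s 13 0 = 1%N -> proj q k (c - rmem s 32 0 *: d) = 0
    & (1 < imem s 13 0)%N -> [/\ K (vec_at s n 34 0), dot d (vec_at s n 34 0) <= 0
         & dot cs (vec_at s n 34 0) < 0]].

Definition constok s :=
  [/\ imem s 1 0 = n, imem s 11 0 = k, Mpre s,
    (forall l, qv s l = q l) /\ (forall l, (l < k)%N -> rmem s 8 l = dot (q l) (q l))
    & [/\ vec_at s n 23 0 = c, vec_at s n 24 0 = d, vec_at s n 27 0 = cs
        & [/\ vec_at s n 28 0 = proj q k cs, vec_at s n 29 0 = proj q k c,
          vec_at s n 30 0 = proj q k d & rmem s 31 0 = g0]]].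

Lemma constok_agree li lr s s' : agree li lr s s' ->
  all (fun a => a \notin li) [:: 1; 11; 24; 29] ->
  all (fun a => a \notin lr) [:: 7; 8; 23; 24; 25; 27; 28; 29; 30; 31] ->
  constok s -> constok s'.
Proof.
move=> [A1 A2] /and5P[i1 i2 i3 i4 _] /and5P[r1 r2 r3 r4 /and5P[r5 r6 r7 r8 /and3P[r9 r10 _]]].
have V a : a \notin lr -> vec_at s' n a 0 = vec_at s n a 0.
  by move=> Ha; apply: vec_at_eq; exact: A2.
case=> C1 C2 C3 [C4 C5] [C6 C7 C8 [C9 C10 C11 C12]].
split; rewrite ?A1 ?A2 ?V //.
  by apply: HMpre C3 _ _ _ _; rewrite ?A1 ?A2.
split; last by [].
by move=> l; rewrite -C4; apply: vec_at_eq; exact: A2.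
Qed.

Definition prelog x s s' :=
  [/\ dynok s', vec_at s' n 18 0 = ansv x, rmem s' 32 0 <= rmem s 32 0,
    (imem s' 13 0 = 0%N -> imem s 13 0 = 0%N /\
       entok (rmem s' 32 0) (imem s' 15 (imem s 14 0)) (rmem s' 19 (imem s 14 0))
         (vec_at s' n 22 0) (vec_at s' n 18 0))
    & (forall e, e != imem s 14 0 -> imem s' 15 e = imem s 15 e) /\
      (forall e, e != imem s 14 0 -> rmem s' 19 e = rmem s 19 e)].


Lemma dynok_agree li lr s s' : agree li lr s s' -> 13 \notin li ->
  all (fun a => a \notin lr) [:: 32; 33; 34] -> dynok s -> dynok s'.
Proof.
move=> [A1 A2] i1 /and4P[r1 r2 r3 _].
have V a : a \notin lr -> vec_at s' n a 0 = vec_at s n a 0.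
  by move=> Ha; apply: vec_at_eq; exact: A2.
by rewrite /dynok /xfok A1 // A2 // !V.
Qed.

Lemma constok_proj s x : constok s -> proj (qv s) k x = proj q k x.
Proof. by case=> _ _ _ [H _] _; apply: eq_proj => l _; exact: H. Qed.

Lemma PROJ_const s : constok s -> imem s 10 0 = k ->
  wp orc PROJ s (fun s' t q0 => agree [:: 3; 4] [:: 6; 9] s s' /\
    [/\ (t <= 40 * (n.+1 * n.+1))%N, q0 = 0%N
      & vec_at s' n 6 0 = proj q k (vec_at s n 5 0)]).
Proof.
move=> C Hk; case: (C) => C1 C2 C3 [C4 C5] C6.
apply: wp_conseq (@PROJ_spec _ _ orc s k C1 Hk kn _) _.
  by move=> l Hl; rewrite !C4; exact: C5.
by move=> s' t q0 [Ag [Ht -> H]]; split=> //; split=> //; rewrite H constok_proj.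
Qed.

Lemma vec_vset N s v dst F :
  vec_at (State (upd (imem s) v 0 N) (fill (rmem s) dst 0 N F)) N dst 0 = \row_(j < N) F j.
Proof. exact: vec_fill. Qed.

Lemma prelog_eq x s s1 s' : imem s1 14 = imem s 14 -> imem s1 13 = imem s 13 ->
  imem s1 15 = imem s 15 -> rmem s1 19 = rmem s 19 -> rmem s1 32 = rmem s 32 ->
  prelog x s1 s' -> prelog x s s'.
Proof. by rewrite /prelog => -> -> -> -> ->. Qed.

Lemma constn s : constok s -> imem s 1 0 = n. Proof. by case. Qed.

Lemma QCUT_spec s x (p := proj q k x) : constok s -> dynok s -> 0 <= dot cs p ->
  wp orc QCUT s (fun s' t q0 => agree [:: 3; 15] [:: 18; 19] s s' /\
    [/\ (t <= 20 * n.+1)%N, q0 = 0%N & prelog x s s']).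
Proof.
move=> C D Hcs; apply: wp_agreeS => //.
apply: wp_seq; apply: (@wp_vset _ _ _ (fun j => 0 - rmem s 28 j) 0 n) => //=; first exact: constn.
move=> t1 Ht1; set s1 := State _ _; apply: wp_seq; apply: wp_iset; apply: wp_rset.
set s2 := State _ _.
have X18 : vec_at s2 n 18 0 = - proj q k cs.
  have -> : vec_at s2 n 18 0 = \row_(j < n) (0 - rmem s 28 j) by exact: (vec_vset n s 3 18).
  by case: C => _ _ _ _ [_ _ _ [<- _ _ _]]; apply/rowP => j; rewrite !mxE sub0r.
have XG : rmem s 31 0 = g0 by case: C => _ _ _ _ [_ _ _ [_ _ _ ->]].
split; [by rewrite /=; lia|by []|]; split.
- by apply: (@dynok_agree [:: 3; 15] [:: 18; 19] s s2 _ isT isT D); agr.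
- by rewrite X18 /ansv -/p Hcs.
- by [].
- move=> E0; split=> //; right; split.
  + by rewrite /s2; ev; rewrite eqxx.
  + by rewrite /s2; ev; rewrite eqxx XG; case: D.
  + by rewrite X18; congr (- proj q k _); rewrite /s2; ev; rewrite eqxx XG.
- by split=> e /negbTE ne; rewrite /s2; ev; rewrite ne.
Qed.

Lemma QROW_spec s x v (p := proj q k x) : constok s -> dynok s -> imem s 10 0 = k ->
  dot cs p < 0 -> mem p = Some v -> rows v -> vec_at s n 22 0 = v ->
  wp orc QROW s (fun s' t q0 => agree [:: 3; 4; 15] [:: 5; 6; 9; 18] s s' /\
    [/\ (t <= 60 * (n.+1 * n.+1))%N, q0 = 0%N & prelog x s s']).
Proof.
move=> C D Hk Hcs Em Hr Hv; apply: wp_agreeS => //.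
apply: wp_seq; apply: (@wp_vset _ _ _ (fun j => rmem s 22 j) 0 n) => //=; first exact: constn.
move=> t1 Ht1; set s1 := State _ _.
have Ag1 : agree [:: 3] [:: 5] s s1 := vset_agree _ _ _ _ _ _.
have C1 := constok_agree Ag1 isT isT C.
have V1 : vec_at s1 n 5 0 = v.
  by rewrite -Hv; apply: etrans (vec_vset _ _ _ _ _) _; apply/rowP => j; rewrite !mxE.
apply: wp_seq; apply: wp_conseq (PROJ_const C1 Hk) _ => s2 t2 q2 [Ag12 [Ht2 -> HP]].
have Ag2 := agree_trans Ag1 Ag12.
have C2 := constok_agree Ag2 isT isT C.
apply: wp_seq; apply: (@wp_vset _ _ _ (fun j => rmem s2 6 j) 0 n) => //=; first exact: constn.
move=> t3 Ht3; apply: wp_iset; set s3 := setI _ _ _ _.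
have A23 : agree [:: 3; 15] [:: 18] s2 s3 by agr.
have Ag3 := agree_trans Ag2 A23.
have X14 : imem s2 14 = imem s 14 by exact: (proj1 Ag2 14 isT).
have X15 : imem s2 15 = imem s 15 by exact: (proj1 Ag2 15 isT).
have X19 : rmem s2 19 = rmem s 19 by exact: (proj2 Ag2 19 isT).
have X22 : rmem s2 22 = rmem s 22 by exact: (proj2 Ag2 22 isT).
have X13 : imem s2 13 = imem s 13 by exact: (proj1 Ag2 13 isT).
have X32 : rmem s2 32 = rmem s 32 by exact: (proj2 Ag2 32 isT).
have X18 : vec_at s3 n 18 0 = proj q k v.
  by rewrite -V1 -HP; apply: etrans (vec_vset _ _ _ _ _) _; apply/rowP => j; rewrite !mxE.
have I15 e : imem s3 15 e = if e == imem s 14 0 then 0%N else imem s 15 e.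
  by rewrite /s3 -X14 -X15; ev.
have D3 : dynok s3 by apply: (dynok_agree Ag3).
split; [by rewrite /=; clear -Ht1 Ht2 Ht3; nia|by []|]; split=> //.
- by rewrite X18 /ansv -/p leNgt Hcs Em.
- by rewrite [rmem s3 32]X32.
- rewrite [imem s3 13]X13 => E0; split=> //; left; split; [by rewrite I15 eqxx| |].
    by rewrite (_ : vec_at s3 n 22 0 = v) // -Hv; apply: vec_at_eq.
  by rewrite X18; congr (proj q k _); rewrite -Hv; apply: vec_at_eq.
- by split=> e /negbTE ne; [rewrite I15 ne | rewrite [rmem s3 19]X19].
Qed.

Lemma QSTOP_spec s x (p := proj q k x) : constok s -> dynok s ->
  dot cs p < 0 -> mem p = None -> K p -> dot d p <= 0 -> vec_at s n 6 0 = p ->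
  wp orc QSTOP s (fun s' t q0 => agree [:: 3; 13] [:: 18; 34] s s' /\
    [/\ (t <= 20 * n.+1)%N, q0 = 0%N & prelog x s s']).
Proof.
move=> C D Hcs Em HK Hd Hp; apply: wp_agreeS => //.
apply: wp_seq; apply: wp_iset; set s1 := setI _ _ _ _.
apply: wp_seq; apply: (@wp_vset _ _ _ (fun j => rmem s 6 j) 0 n) => //=; first exact: constn.
move=> t1 Ht1; set s2 := State _ _.
apply: (@wp_vset _ _ _ (fun j => rmem s 28 j) 0 n) => //=; first exact: constn.
move=> t2 Ht2; set s3 := State _ _.
have X18 : vec_at s3 n 18 0 = proj q k cs.
  have -> : vec_at s3 n 18 0 = \row_(j < n) rmem s 28 j by exact: (vec_vset n s2 3 18).
  by case: C => _ _ _ _ [_ _ _ [<- _ _ _]]; apply/rowP => j; rewrite !mxE.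
have X34 : vec_at s3 n 34 0 = p.
  have -> : vec_at s3 n 34 0 = vec_at s2 n 34 0 by exact: vec_at_eq.
  have -> : vec_at s2 n 34 0 = \row_(j < n) rmem s 6 j by exact: (vec_vset n s1 3 34).
  by rewrite -Hp; apply/rowP => j; rewrite !mxE.
have [D1 D2 D3 D4 D5] := D.
split; [by rewrite /=; lia|by []|]; split=> //.
- by split=> //; rewrite X34.
- by rewrite X18 /ansv -/p leNgt Hcs Em Hd.
Qed.

Lemma dot_proj_fix x p : proj q k p = p -> dot (proj q k x) p = dot x p.
Proof. by move=> Pp; rewrite Hsym Pp. Qed.

(** The cut for the new ratio is [g] times the stored projection of [d] minus that of [c], so no
    further projection is computed and the cost is linear in [n]. *)
Lemma QIMP_spec s x (p := proj q k x) : constok s -> dynok s ->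
  dot cs p < 0 -> mem p = None -> K p -> 0 < dot d p -> vec_at s n 6 0 = p ->
  rmem s 46 0 = dot d p -> rmem s 47 0 = dot c p ->
  wp orc QIMP s (fun s' t q0 => agree [:: 3; 13; 15] [:: 18; 19; 32; 33; 46; 47] s s' /\
    [/\ (t <= 60 * n.+1)%N, q0 = 0%N & prelog x s s']).
Proof.
move=> C D Hcs Em HK Hd Hp H46 H47; apply: wp_agreeS => //.
have Pp : proj q k p = p by exact: Hidem.
pose g := dot c p / dot d p.
have Hg : dot c p = g * dot d p by rewrite /g divfK // gt_eqF.
have gg0 : g < g0.
  by rewrite /g ltr_pdivrMr // -subr_lt0; move: Hcs; rewrite dotBl dotZl.
apply: wp_seq; apply: wp_rset; rewrite [reval _ _](_ : _ = g); last by rewrite /= H46 H47.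
set s1 := State _ _.
have [D1 D2 D3 D4 D5] := D.
have Hatt G : proj q k (c - G *: d) = 0 -> forall p', proj q k p' = p' -> dot c p' = G * dot d p'.
  move=> E p' Pp'; apply/eqP; rewrite -subr_eq0 -dotZl -dotBl.
  by rewrite -(dot_proj_fix _ Pp') E dot0l.
have agr1 : agree [::] [:: 47] s s1 := rset_agree _ _ _ _.
apply: wp_seq.
apply: (@wp_conseq _ _ _ _ _ (fun s2 t' q' => agree [:: 3] [:: 32; 33] s1 s2 /\
    [/\ (t' <= 10 * n.+1)%N, q' = 0%N, dynok s2, rmem s2 32 0 <= g
     & rmem s2 32 0 <= rmem s 32 0])).
  apply: wp_agreeS => //.
  apply: wp_if; rewrite [beval _ _](_ : _ = (g < rmem s 32 0)); last by rewrite /= -ltNge.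
  case: ltP => HG; last first.
    apply: wp_skip; split=> //; exact: (dynok_agree agr1).
  apply: wp_seq; apply: wp_rset; set s2 := State _ _.
  apply: (@wp_vset _ _ _ (fun j => rmem s 6 j) 0 n) => //=; first exact: constn.
  move=> t3 Ht3; set s3 := State _ _.
  have G3 : rmem s3 32 0 = g by [].
  have X33 : vec_at s3 n 33 0 = p.
    have -> : vec_at s3 n 33 0 = \row_(j < n) rmem s 6 j by exact: (vec_vset n s2 3 33).
    by rewrite -Hp; apply/rowP => j; rewrite !mxE.
  split; [by rewrite /=; lia|by []| |exact: lexx|exact: ltW].
  split; rewrite ?G3.
  - exact: ltW.
  - by right; rewrite X33 G3.
  - by right; exists p.
  (* Once [c - gamma d] projects to 0, every point of the complement has ratio gamma, and no strict
     improvement can occur. *)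
  - move=> E1; exfalso; have := Hatt _ (D4 E1) p Pp; rewrite Hg => /(mulIf _) E.
    by move: HG; rewrite E ?ltxx // gt_eqF.
  - exact: D5.
move=> s2 t2 q2 [Ag12 [Ht2 -> DD2 G2 G2']].
have Ag2 := agree_trans agr1 Ag12.
have C2 := constok_agree Ag2 isT isT C.
have X47 : rmem s2 47 0 = g by rewrite (proj2 Ag12 47 isT).
apply: wp_seq; apply: (@wp_vset _ _ _ (fun j => g * rmem s 30 j - rmem s 29 j) 0 n) => //=; first exact: constn.
  move=> j Hj; split=> //; rewrite -X47; ev.
  by rewrite (proj2 Ag2 30 isT) (proj2 Ag2 29 isT).
move=> t3 Ht3; set s3 := State _ _.
pose v := - proj q k (c - g *: d).
have X18 : vec_at s3 n 18 0 = v.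
  have -> : vec_at s3 n 18 0 = \row_(j < n) (g * rmem s 30 j - rmem s 29 j) by exact: (vec_vset n s2 3 18).
  case: C => _ _ _ _ [_ _ _ [_ C29 C30 _]].
  by rewrite /v projB projZ opprB -C29 -C30; apply/rowP => j; rewrite !mxE.
have Ag3 := agree_trans Ag2 (vset_agree s2 3 n 18 0 (fun j => g * rmem s 30 j - rmem s 29 j)).
have F14 : imem s3 14 = imem s 14 by exact: (proj1 Ag3 14 isT).
have F15 : imem s3 15 = imem s 15 by exact: (proj1 Ag3 15 isT).
have F13 : imem s3 13 = imem s 13 by exact: (proj1 Ag3 13 isT).
have F19 : rmem s3 19 = rmem s 19 by exact: (proj2 Ag3 19 isT).
have F47 : rmem s3 47 0 = g by [].
have C3 := constok_agree Ag3 isT isT C.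
have D3' : dynok s3 by apply: (dynok_agree (vset_agree s2 3 n 18 0 _) isT isT DD2).
have G3 : rmem s3 32 0 <= g by exact: G2.
have G3' : rmem s3 32 0 <= rmem s 32 0 by exact: G2'.
move: C3 D3' X18 F14 F15 F13 F19 F47 G3 G3'; rewrite /s3.
move: (State _ _) => {}s3 C3 D3' X18 F14 F15 F13 F19 F47 G3 G3'.
apply: wp_seq; apply: wp_iset; apply: wp_seq; apply: wp_rset.
apply: wp_seq; apply: (@wp_vsum _ _ _ (fun j => rmem s3 18 j * rmem s3 18 j) n) => //=; first exact: constn.
move=> t4 Ht4; set s4 := State _ _.
have I15 e : imem s4 15 e = if e == imem s 14 0 then 1%N else imem s 15 e.
  by rewrite -F14 -F15 /s4; ev.
have I19 e : rmem s4 19 e = if e == imem s 14 0 then g else rmem s 19 e.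
  by rewrite -F14 -F19 -F47 /s4; ev.
have A34 : agree [:: 3; 15] [:: 19; 46] s3 s4.
  by agr.
have X46 : rmem s4 46 0 = dot v v by rewrite -X18 dot_vec /s4; ev.
have D4' : dynok s4 by exact: (dynok_agree A34).
have C4 := constok_agree A34 isT isT C3.
have V18 : vec_at s4 n 18 0 = v by rewrite -X18; apply: vec_at_eq.
have R32 : rmem s4 32 0 <= g by exact: G3.
have R32' : rmem s4 32 0 <= rmem s 32 0 by exact: G3'.
have F413 : imem s4 13 = imem s 13 by exact: F13.
clearbody s4.
have Hans : ansv x = if v == 0 then proj q k cs else v.
  by rewrite /ansv -/p leNgt Hcs Em leNgt Hd.
apply: wp_if; rewrite [beval _ _](_ : _ = (v == 0)); last first.
  by rewrite /= X46 -dotvv_eq0 eq_le dotvv_ge0 andbT.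
case: eqP => Hv; last first.
  apply: wp_skip; split; [by rewrite /=; clear -Ht2 Ht3 Ht4; lia|by []|]; split=> //.
  - by rewrite V18 Hans; case: eqP.
  - rewrite F413 => E0; split=> //; right; rewrite I15 I19 eqxx; split=> //.
  - by split=> e /negbTE ne; rewrite ?I15 ?I19 ne.
apply: wp_seq; apply: (@wp_vset _ _ _ (fun j => rmem s4 28 j) 0 n) => //=; first exact: constn.
move=> t5 Ht5; set s5 := State _ _.
have X518 : vec_at s5 n 18 0 = proj q k cs.
  have -> : vec_at s5 n 18 0 = \row_(j < n) rmem s4 28 j by exact: (vec_vset n s4 3 18).
  by case: C4 => _ _ _ _ [_ _ _ [<- _ _ _]]; apply/rowP => j; rewrite !mxE.
have A45 : agree [:: 3] [:: 18] s4 s5 := vset_agree _ _ _ _ _ _.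
have D5' : dynok s5 by exact: (dynok_agree A45).
have [E1 E2 E3 E4 E5] := D5'.
have Pg : proj q k (c - g *: d) = 0 by apply/eqP; rewrite -oppr_eq0; apply/eqP.
(* Were gamma still [g0], it would exceed [g]; otherwise it is the ratio of a point of the
   complement, which is [g]. *)
have GE : rmem s5 32 0 = g.
  case: E3 => [E|[p' [Pp' dp' cp']]].
    by have := R32; rewrite [rmem s4 32 0]E leNgt gg0.
  have := Hatt g Pg p' Pp'; rewrite cp' => /(mulIf _) -> //.
  by rewrite gt_eqF.
apply: wp_if; rewrite [beval _ _](_ : _ = (imem s 13 0 == 0)%N); last by rewrite /= -F413 leqn0.
case: eqP => H13.
  apply: wp_iset; split; [by rewrite /=; clear -Ht2 Ht3 Ht4 Ht5; lia|by []|]; split=> //.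
  - by split=> // _; rewrite [rmem _ 32 0]GE.
  - by rewrite [LHS]X518 Hans Hv eqxx.
  - by split=> e /negbTE ne; [apply: etrans (I15 e) _| apply: etrans (I19 e) _]; rewrite ne.
apply: wp_skip; split; [by rewrite /=; clear -Ht2 Ht3 Ht4 Ht5; lia|by []|]; split=> //.
- by rewrite [LHS]X518 Hans Hv eqxx.
- by rewrite [imem s5 13]F413 => /H13.
- by split=> e /negbTE ne; [apply: etrans (I15 e) _| apply: etrans (I19 e) _]; rewrite ne.
Qed.

Lemma QCORE_spec s x (xv := vec_at s n x 0) : (100 <= x)%N -> constok s -> dynok s ->
  wp orc (QCORE x) s (fun s' t q0 =>
    agree [:: 3; 4; 6; 10; 13; 15; 26] [:: 5; 6; 9; 18; 19; 22; 32; 33; 34; 46; 47] s s' /\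
    [/\ (t <= 400 * (n.+1 * n.+1))%N, (q0 <= 1)%N & prelog xv s s']).
Proof.
move=> Hx C0 D0; apply: wp_agreeS => //.
apply: wp_seq; apply: (@wp_vset _ _ _ (fun j => rmem s x j) 0 n) => //=; first exact: constn.
  by move=> j Hj; ev; case: eqP => // E; exfalso; lia.
move=> t1 Ht1; set s1 := State _ _.
have Ag1 : agree [:: 3] [:: 5] s s1 := vset_agree _ _ _ _ _ _.
apply: wp_seq; apply: wp_iset; set s2 := setI _ _ _ _.
have Ag2 := agree_trans Ag1 (setI_agree s1 10 0 (ieval s1 $11)).
have C2 : constok s2 := constok_agree Ag2 isT isT C0.
have E10 : imem s2 10 0 = k by case: (constok_agree Ag1 isT isT C0).
apply: wp_seq; apply: wp_conseq (PROJ_const C2 E10) _ => s3 t3 q3 [Ag23 [Ht3 -> HP]].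
have Ag3 := agree_trans Ag2 Ag23.
have C3 : constok s3 := constok_agree Ag3 isT isT C0.
set p := proj q k xv.
have {}HP : vec_at s3 n 6 0 = p.
  rewrite HP; congr (proj q k _); apply: etrans (vec_vset _ _ _ _ _) _.
  by apply/rowP => j; rewrite !mxE.
have E310 : imem s3 10 0 = k by rewrite (proj1 Ag23 10 isT).
apply: wp_seq; apply: (@wp_vsum _ _ _ (fun j => rmem s3 27 j * rmem s3 6 j) n) => //=; first exact: constn.
move=> t4 Ht4; set s4 := State _ _.
have Ag34 : agree [:: 3] [:: 46] s3 s4 := vsum_agree _ _ _ _ _.
have Ag4 := agree_trans Ag3 Ag34.
have C4 : constok s4 := constok_agree Ag4 isT isT C0.
have D4 : dynok s4 := dynok_agree Ag4 isT isT D0.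
have HP4 : vec_at s4 n 6 0 = p by rewrite -HP; apply: vec_at_eq.
have E410 : imem s4 10 0 = k by [].
have E46 : rmem s4 46 0 = dot cs p.
  case: C3 => _ _ _ _ [_ _ <- _]; rewrite -HP dot_vec.
  by rewrite /s4; ev.
have PL4 s' : prelog xv s4 s' -> prelog xv s s'.
  apply: prelog_eq; [exact: (proj1 Ag4 14 isT)|exact: (proj1 Ag4 13 isT)|
   exact: (proj1 Ag4 15 isT)|exact: (proj2 Ag4 19 isT)|exact: (proj2 Ag4 32 isT)].
clearbody s4.
apply: wp_if; rewrite [beval _ _](_ : _ = (0 <= dot cs p)); last by rewrite -E46.
have xx : (n.+1 <= n.+1 * n.+1)%N by rewrite leq_pmulr.
case: ifPn => Hcs.
  apply: wp_conseq (@QCUT_spec s4 xv C4 D4 Hcs) _ => s5 t5 q5 [_ [Ht5 -> HL]].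
  by split=> //; [rewrite /=; clear -Ht1 Ht3 Ht4 Ht5 xx; lia | exact: PL4].
rewrite -ltNge in Hcs.
have M4 : Mpre s4 by case: C4.
apply: wp_seq; apply: wp_conseq (HMEM (constn C4) M4) _ => s5 t5 q5 [Ag45 [Ht5 Hq5 Hm]].
have C5 : constok s5 := constok_agree Ag45 isT isT C4.
have D5 : dynok s5 := dynok_agree Ag45 isT isT D4.
have HP5 : vec_at s5 n 6 0 = p by rewrite -HP4; apply: vec_at_eq; fr Ag45.
have E510 : imem s5 10 0 = k by rewrite (proj1 Ag45 10 isT).
have PL5 s' : prelog xv s5 s' -> prelog xv s s'.
  move=> H; apply: PL4; apply: prelog_eq H; [exact: (proj1 Ag45 14 isT)|exact: (proj1 Ag45 13 isT)|
   exact: (proj1 Ag45 15 isT)|exact: (proj2 Ag45 19 isT)|exact: (proj2 Ag45 32 isT)].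
rewrite HP4 in Hm.
have Hmok := mem_ok Hcs.
apply: wp_if; rewrite [beval _ _](_ : _ = (0 < imem s5 26 0)%N) //.
case Em: (mem p) Hm Hmok => [v|].
  move=> [-> Hv] [Hr _].
  apply: wp_conseq (@QROW_spec s5 xv v C5 D5 E510 Hcs Em Hr Hv) _ => s6 t6 q6 [_ [Ht6 -> HL]].
  split=> //; [|by lia|exact: PL5].
  by rewrite /=; clear -Ht1 Ht3 Ht4 Ht5 Ht6 xx; lia.
move=> -> HK /=.
apply: wp_seq; apply: (@wp_vsum _ _ _ (fun j => rmem s5 24 j * rmem s5 6 j) n) => //=; first exact: constn.
move=> t6 Ht6; set s6 := State _ _.
apply: wp_seq; apply: (@wp_vsum _ _ _ (fun j => rmem s5 23 j * rmem s5 6 j) n) => //=; first exact: constn.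
move=> t7 Ht7; set s7 := State _ _.
have Ag57 : agree [:: 3] [:: 46; 47] s5 s7.
  by agr.
have C7 : constok s7 := constok_agree Ag57 isT isT C5.
have D7 : dynok s7 := dynok_agree Ag57 isT isT D5.
have HP7 : vec_at s7 n 6 0 = p by rewrite -HP5; apply: vec_at_eq.
have X46 : rmem s7 46 0 = dot d p.
  by case: C5 => _ _ _ _ [_ <- _ _]; rewrite -HP5 dot_vec /s7 /s6; ev.
have X47 : rmem s7 47 0 = dot c p.
  by case: C5 => _ _ _ _ [<- _ _ _]; rewrite -HP5 dot_vec /s7 /s6; ev.
have PL7 s' : prelog xv s7 s' -> prelog xv s s'.
  by move=> H; apply: PL5; exact: prelog_eq H.
clearbody s7.
apply: wp_if; rewrite [beval _ _](_ : _ = (dot d p <= 0)); last by rewrite /= X46.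
case: leP => Hd.
  apply: wp_conseq (@QSTOP_spec s7 xv C7 D7 Hcs Em HK Hd HP7) _ => s8 t8 q8 [_ [Ht8 -> HL]].
  split=> //; [|by lia|exact: PL7].
  by rewrite /=; clear -Ht1 Ht3 Ht4 Ht5 Ht6 Ht7 Ht8 xx; lia.
apply: wp_conseq (@QIMP_spec s7 xv C7 D7 Hcs Em HK Hd HP7 X46 X47) _ => s8 t8 q8 [_ [Ht8 -> HL]].
split=> //; [|by lia|exact: PL7].
by rewrite /=; clear -Ht1 Ht3 Ht4 Ht5 Ht6 Ht7 Ht8 xx; lia.
Qed.

Lemma entok_le gam gam' kind g lo an : gam' <= gam ->
  entok gam kind g lo an -> entok gam' kind g lo an.
Proof.
move=> H [?|[H1 H2 H3]]; [by left|right; split=> //; exact: le_trans H H2].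
Qed.

Definition QI : seq nat := [:: 3; 4; 6; 10; 13; 14; 15; 26].
Definition QR : seq nat := [:: 5; 6; 9; 18; 19; 20; 21; 22; 32; 33; 34; 46; 47].

Definition low_agree s s' := forall a, (a < 100)%N ->
  (a \notin QI -> imem s' a = imem s a) /\ (a \notin QR -> rmem s' a = rmem s a).

Definition logok s m := forall e, (e < m)%N ->
  entok (rmem s 32 0) (imem s 15 e) (rmem s 19 e)
    (vec_at s n 20 (e * n)) (vec_at s n 21 (e * n)).

(** The answers received are kept equal to the logged vectors: a vector of the certificate is known
    only as one of the answers, and this is how its entry in the log is found. *)
Definition qinv S0 (l : seq (answer R n)) S :=
  [/\ constok S, dynok S, low_agree S0 S, imem S 14 0 = size l
    & [/\ forall e, (e < size l)%N -> nth None l e = Some (false, vec_at S n 21 (e * n)),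
        imem S 13 0 = 0%N -> logok S (size l) & rmem S 32 0 <= rmem S0 32 0]].

Lemma qinv_low S0 l S S' : qinv S0 l S -> low_eq S S' -> qinv S0 l S'.
Proof.
move=> [C D L E [N G M]] H.
have I a : (a < 100)%N -> imem S' a = imem S a by move=> Ha; exact: (proj1 (H a Ha)).
have F a : (a < 100)%N -> rmem S' a = rmem S a by move=> Ha; exact: (proj2 (H a Ha)).
have V a o : (a < 100)%N -> vec_at S' n a o = vec_at S n a o.
  by move=> Ha; apply: vec_at_eq; exact: F.
split.
- case: C => C1 C2 C3 [C4 C5] [C6 C7 C8 [C9 C10 C11 C12]].
  split; rewrite ?I ?F ?V //.
    by apply: HMpre C3 _ _ _ _; rewrite ?I ?F.
  split; last by [].
  by move=> j; rewrite -C4; exact: V.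
- by move: D; rewrite /dynok /xfok I // F // !V.
- by move=> a Ha; rewrite I // F //; exact: L.
- by rewrite I.
- split; last by rewrite F.
    by move=> e He; rewrite V // N.
  rewrite I // => /G; rewrite /logok => K0 e He.
  by rewrite F // I // F // !V //; exact: K0.
Qed.

Lemma QBLOCK_spec S0 l S x f v : qinv S0 l S ->
  wp orc (QBLOCK (shift x) (shift f) (shift v)) S (fun S' t q0 =>
    [/\ (t <= 500 * (n.+1 * n.+1))%N, (q0 <= 1)%N,
        qinv S0 (rcons l (Some (false, ansv (vec_at S n (shift x) 0)))) S'
      & forall s, sim s S ->
          sim (put_answer s f v (Some (false, ansv (vec_at S n (shift x) 0)))) S']).
Proof.
move=> [C D L E [N G M]]; set an := ansv _.
have Hx : (100 <= shift x)%N by rewrite /shift; lia.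
apply: wp_seq; apply: wp_conseq (QCORE_spec Hx C D) _ => s1 t1 q1 [A1 [Ht1 Hq1 HL]].
case: HL => D1 V18 G1 En1 [J15 J19]; rewrite -/an in V18.
have C1 := constok_agree A1 isT isT C.
have m1 := constn C1.
have X14 : imem s1 14 = imem S 14 by exact: (proj1 A1).
apply: wp_seq; apply: (@wp_vset _ _ _ (fun j => rmem s1 22 j) (size l * n) n) => //=.
  by move=> j Hj; ev; rewrite X14 E m1.
move=> t2 Ht2; set s2 := State _ _.
apply: wp_seq; apply: (@wp_vset _ _ _ (fun j => rmem s1 18 j) (size l * n) n) => //=.
  by move=> j Hj; ev; rewrite X14 E m1.
move=> t3 Ht3; set s3 := State _ _.
apply: wp_seq; apply: wp_iset => /=; set s4 := setI _ _ _ _.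
apply: wp_seq; apply: wp_iset => /=; set s5 := setI _ _ _ _.
have Lf b : (b < 100)%N -> (b == shift f) = false by rewrite /shift => Hb; apply/eqP => Eb; lia.
have Lv b : (b < 100)%N -> (b == shift v) = false by rewrite /shift => Hb; apply/eqP => Eb; lia.
apply: (@wp_vset _ _ _ (fun j => rmem s1 18 j) 0 n).
- by rewrite /s5 /s4 /s3; ev; rewrite ?Lf.
- by [].
- by move=> j Hj; rewrite /s5 /s4 /s3; ev; rewrite ?Lv.
move=> t4 Ht4; set s6 := State _ _.
have I6 b : (b < 100)%N -> b != 3%N -> b != 14%N -> imem s6 b = imem s1 b.
  move=> Hb /negbTE H3 /negbTE H14; apply/funext => j.
  by rewrite /s6; ev; rewrite ?Lf // H3 H14.
have I614 : imem s6 14 0 = (size l).+1.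
  by rewrite /s6; ev; rewrite X14 E addn1.
have F6 b : (b < 100)%N -> b != 20%N -> b != 21%N -> rmem s6 b = rmem s1 b.
  move=> Hb /negbTE H3 /negbTE H14; apply/funext => j.
  by rewrite /s6; ev; rewrite ?Lv // H3 H14.
have V6 b : (b < 100)%N -> b != 20%N -> b != 21%N -> vec_at s6 n b 0 = vec_at s1 n b 0.
  by move=> *; apply: vec_at_eq; exact: F6.
have W20 : vec_at s6 n 20 (size l * n) = vec_at s1 n 22 0.
  apply/rowP => j; rewrite !mxE; rewrite /s6; ev; rewrite ?Lv //.
  by rewrite leq_addr ltn_add2l ltn_ord addKn.
have W21 : vec_at s6 n 21 (size l * n) = an.
  rewrite -V18; apply/rowP => j; rewrite !mxE; rewrite /s6; ev; rewrite ?Lv //.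
  by rewrite leq_addr ltn_add2l ltn_ord addKn.
have A01 b : b \in [:: 20; 21]%N -> rmem s1 b = rmem S b.
  by rewrite !inE => /orP[] /eqP ->; exact: (proj2 A1).
have W b e : b \in [:: 20; 21]%N -> (e < size l)%N -> vec_at s6 n b (e * n) = vec_at S n b (e * n).
  move=> Hb He; rewrite /vec_at -(A01 _ Hb); apply/rowP => j; rewrite !mxE.
  have H : (size l * n <= e * n + j)%N = false.
    by apply/negP => H; have := ltn_ord j; move: He H; clear; nia.
  move: Hb; rewrite !inE => /orP[] /eqP ->; rewrite /s6; ev; rewrite ?Lv //.
    by rewrite H.
  by rewrite H.
have xx : (n.+1 <= n.+1 * n.+1)%N by rewrite leq_pmulr.
split.
- by rewrite /= in Ht4; clear -Ht1 Ht2 Ht3 Ht4 xx; lia.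
- by clear -Hq1; lia.
- split.
  + apply: (@constok_agree [:: 3; 14; shift f] [:: 20; 21; shift v] s1) => //.
    * split=> b; rewrite !inE !negb_or => /and3P[/negbTE n1 /negbTE n2 /negbTE n3].
        by apply/funext => j; rewrite /s6; ev; rewrite n1 n2 n3.
      by apply/funext => j; rewrite /s6; ev; rewrite n1 n2 n3.
  + move: D1; rewrite /dynok /xfok; rewrite I6 // F6 // !V6 //.
  + move=> b Hb; have [L1 L2] := L b Hb; rewrite !inE !negb_or; split=> Hn.
      rewrite -L1; last by rewrite !inE !negb_or.
      case/and5P: Hn => ? ? ? ? /and4P[? ? ? ?].
      by rewrite I6 //; apply: (proj1 A1); rewrite !inE !negb_or; do !(apply/andP; split=> //).
    rewrite -L2; last by rewrite !inE !negb_or.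
    case/and5P: Hn => ? ? ? ? /and5P[? ? ? ? /and5P[? ? ? ? ?]].
    by rewrite F6 //; apply: (proj2 A1); rewrite !inE !negb_or; do !(apply/andP; split=> //).
  + by rewrite size_rcons.
  + rewrite size_rcons; split.
    * move=> e; rewrite ltnS leq_eqVlt nth_rcons => /orP[/eqP ->|He].
        by rewrite ltnn eqxx W21.
      by rewrite He W // N.
    * rewrite I6 // => /En1 [f0 En] e; rewrite ltnS leq_eqVlt => /orP[/eqP ->|He].
        rewrite F6 // I6 // F6 // W20 W21 -V18.
        by move: En; rewrite E.
      rewrite F6 // I6 // F6 // !W // J15 ?J19 ?E; [|by rewrite neq_ltn He|by rewrite neq_ltn He].
      exact: entok_le G1 (G f0 _ He).
    * by rewrite F6 //; exact: le_trans G1 M.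
- move=> s [Hs1 Hs2]; split=> b.
    apply/funext => j; rewrite /= /upd -Hs1 /shift eqn_add2l -/(shift b).
    have [n3 n14] : (shift b == 3%N) = false /\ (shift b == 14%N) = false.
      by rewrite /shift; split; apply/eqP; lia.
    by rewrite n3 n14 /= (proj1 A1).
  have [n3 n14] : (shift b == 20%N) = false /\ (shift b == 21%N) = false.
    by rewrite /shift; split; apply/eqP; lia.
  apply/funext => j; rewrite /s6; ev; rewrite ?n3 ?n14.
  have -> : (shift b == shift v) = (b == v) by rewrite /shift eqn_add2l.
  rewrite -Hs2.
  have -> : rmem s1 (shift b) = rmem S (shift b).
    exact: (proj2 A1).
  case: eqP => // _; case: insubP => [i ji <-|].
    by rewrite add0n subn0 ltn_ord -V18 mxE.
  by rewrite add0n => /negbTE ->.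
Qed.

End Run.
End Queries.

(** * Reducing the certificate returned by [A] *)

Definition ABSUM (re : rexp) : cmd :=
  RSet 49 (ICst 0) (RCst 0) ;;
  For 3 $1 (If (BLeR (RCst 0) re) (RSet 49 (ICst 0) (RGet 49 (ICst 0) +r re))
    (RSet 49 (ICst 0) (RGet 49 (ICst 0) -r re))).

(** With the 1-norm as an additional coordinate, the normalization of a certificate becomes linear;
    [CARA] then shrinks the certificate to at most [n + 1] vectors while preserving both its value
    and its mass. *)
Definition LIFT : cmd :=
  For 6 (IGet (shift 0) (ICst 1))
    (VSet 3 $1 10 ($6 *i $2 +i $3) (RGet (shift 2) ($6 *i $1 +i $3)) ;;
     ABSUM (RGet (shift 2) ($6 *i $1 +i $3)) ;;
     RSet 10 ($6 *i $2 +i $1) (RGet 49 (ICst 0)) ;; RSet 11 $6 (RGet (shift 3) $6)) ;;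
  ISet 16 (ICst 0) (IGet (shift 0) (ICst 1)).

(** The coordinates of [etop] in the kept family are the last entries of the dual basis, and the
    residual tests whether [etop] lies in its span. Success yields a combination of value 0 and mass
    1, that is, an exact certificate. *)
Definition EXACT : cmd :=
  VSet 5 $17 13 $5 (RGet 12 ($5 *i $2 +i $1)) ;;
  VSet 3 $2 14 $3 (RCst 0) ;; RSet 14 $1 (RCst 1) ;; RLOOP ;;
  VSum 3 $2 15 (RGet 14 $3 *r RGet 14 $3) ;;
  If (BLeR (RGet 15 (ICst 0)) (RCst 0))
    (For 5 $17 (If (BLeR (RCst 0) (RGet 13 $5)) Skip (ISet 12 (ICst 0) (ICst 3))) ;;
     VSet 5 $17 16 $5 (RGet 13 $5))
    (ISet 12 (ICst 0) (ICst 3)).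

Section Certificate.
Variables (R : realType) (n : nat) (orc : nat -> 'rV[R]_n -> answer R n).
Implicit Types (s : state R).

Notation wv := (@wv R n).
Notation gv := (@gv R n).

Lemma ABSUM_spec s re F : imem s 1 0 = n -> (rcost re <= 5)%N ->
  (forall j x, (j < n)%N ->
     reval (State (upd (imem s) 3 0 j) (upd (rmem s) 49 0 x)) re = F j) ->
  wp orc (ABSUM re) s (fun s' t q => agree [:: 3] [:: 49] s s' /\
    [/\ (t <= 20 * n.+1)%N, q = 0%N & rmem s' 49 0 = \sum_(j < n) `|F j|]).
Proof.
move=> Hn Hre HF; apply: wp_agreeS => //.
have upds : forall T (m : nat -> nat -> T) a (j k : T), upd (upd m a 0 j) a 0 k = upd m a 0 k.
  by move=> T m b j k; apply/funext => a; apply/funext => i; rewrite /upd; case: (_ && _).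
apply: wp_seq; apply: wp_rset => /=.
apply: (@wp_for_gen _ _ _ (fun i s1 =>
   s1 = State (upd (imem s) 3 0 i) (upd (rmem s) 49 0 (\sum_(j < i) `|F j|))) n 13 0).
- by rewrite big_ord0.
- by move=> i s1 _ ->; rewrite /= /upd /= Hn.
- move=> i s1 Hi ->; apply: wp_if => /=; rewrite HF //; case: leP => HF0.
    apply: wp_rset; split; [rewrite /=; lia|by []|by []|].
    rewrite /= HF // /setI /= !upds; congr State; congr upd.
    by rewrite big_ord_recr /= /upd !eqxx /= ger0_norm.
  apply: wp_rset; split; [rewrite /=; lia|by []|by []|].
  rewrite /= HF // /setI /= !upds; congr State; congr upd.
  by rewrite big_ord_recr /= /upd !eqxx /= ltr0_norm.
- move=> s2 t l Ht; rewrite muln0 leqn0 => /eqP -> ->; split; [|by []|by []].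
  by move: Ht; rewrite /=; lia.
Qed.

Lemma LIFT_spec s N : imem s 1 0 = n -> imem s 2 0 = n.+1 -> imem s (shift 0) 1 = N ->
  wp orc LIFT s (fun s' t q => agree [:: 3; 6; 16] [:: 10; 11; 49] s s' /\
    [/\ (t <= 80 * n.+1 * N + 10)%N, q = 0%N, imem s' 16 0 = N
      & forall i, (i < N)%N -> [/\ lo (wv s' i) = vec_at s n (shift 2) (i * n),
          wv s' i 0 ord_max = norm1 (vec_at s n (shift 2) (i * n))
        & rmem s' 11 i = rmem s (shift 3) i]]).
Proof.
move=> Hn Hn1 HN; apply: wp_agreeS => //.
have L102 b : (b < 100)%N -> (shift 2 == b) = false by rewrite /shift => Hb; apply/eqP => Eb; lia.
apply: wp_seq; apply: (@wp_for _ _ _ (fun l st => forall i, (i < l)%N ->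
   [/\ lo (wv st i) = vec_at s n (shift 2) (i * n),
          wv st i 0 ord_max = norm1 (vec_at s n (shift 2) (i * n))
        & rmem st 11 i = rmem s (shift 3) i]) N (60 * n.+1)) => //=.
- move=> i s1 Hi Ag Hv IH.
  have m1 : imem s1 1 0 = n by fr Ag.
  have m2 : imem s1 2 0 = n.+1 by fr Ag.
  have E2 : rmem s1 (shift 2) = rmem s (shift 2) by exact: (proj2 Ag).
  have E3 : rmem s1 (shift 3) = rmem s (shift 3) by exact: (proj2 Ag).
  apply: wp_seq; apply: (@wp_vset _ _ _ (fun j => rmem s (shift 2) (i * n + j)) (i * n.+1) n) => //=.
    by move=> j Hj; ev; rewrite Hv m1 m2 E2.
  move=> t1 Ht1; set s2 := State _ _; apply: wp_seq.
  apply: wp_conseq (@ABSUM_spec s2 _ (fun j => rmem s (shift 2) (i * n + j)) _ _ _) _ => //.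
    by move=> j x Hj; rewrite /s2; ev; rewrite Hv m1 E2.
  move=> s3 t3 q3 [A3 [Ht3 -> H49]].
  apply: wp_seq; apply: wp_rset; apply: wp_rset; set s4 := State _ _.
  have X1 : imem s3 1 0 = n by fr A3.
  have X2 : imem s3 2 0 = n.+1 by fr A3.
  have X6 : imem s3 6 0 = i by fr A3.
  have X10 : rmem s3 10 = rmem s2 10 by fr A3.
  have X11 : rmem s3 11 = rmem s1 11 by fr A3.
  have X103 : rmem s3 (shift 3) = rmem s (shift 3) by rewrite -E3; exact: (proj2 A3).
  have N1 : norm1 (vec_at s n (shift 2) (i * n)) = rmem s3 49 0.
    by rewrite H49; apply: eq_bigr => j _; rewrite mxE.
  have W k j : (j < n.+1)%N -> rmem s4 10 (k * n.+1 + j) =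
      if k == i then (if (j < n)%N then rmem s (shift 2) (i * n + j) else rmem s3 49 0)
      else rmem s1 10 (k * n.+1 + j)%N.
    move=> Hj; rewrite /s4 /= /upd /= X6 X2 X1 X10 /s2 /= /fill /=.
    have [->|ne] := eqVneq k i.
      rewrite eqn_add2l leq_addr ltn_add2l addKn /=.
      case: eqP => [->|ne]; first by rewrite ltnn.
      by have -> : (j < n)%N by lia.
    case: eqP => [E|_]; first by exfalso; move/eqP: ne; apply; nia.
    case: ifP => // /andP[H1 H2]; exfalso; move/eqP: ne; apply; nia.
  split; first by rewrite /=; clear -Ht1 Ht3; nia.
    by [].
  move=> k; rewrite ltnS leq_eqVlt => Hk.
  have Lo : k = i -> lo (wv s4 k) = vec_at s n (shift 2) (i * n).
    move=> Ek; apply/rowP => j; rewrite !mxE W /=; last by have := ltn_ord j; lia.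
    by rewrite Ek eqxx ltn_ord.
  have wvE : k != i -> wv s4 k = wv s1 k.
    by move=> /negbTE ne; apply/rowP => j; rewrite !mxE W // ne.
  case/orP: Hk => [/eqP Ek|Hk].
    split; first by rewrite Lo // Ek.
      by rewrite Ek N1 mxE W //= eqxx ltnn.
    by rewrite /s4; ev; rewrite Ek X6 eqxx X103.
  have ne : k != i by rewrite neq_ltn Hk.
  have [I1 I2 I3] := IH k Hk; rewrite [wv _ k](wvE ne); split=> //.
  by rewrite /s4; ev; rewrite X6 (negbTE ne) X11.
- move=> s2 t Ht Ag Hv IH; apply: wp_iset.
  have E : imem s2 (shift 0) = imem s (shift 0) by exact: (proj1 Ag).
  split; [rewrite /=; clear -Ht; nia|by []|by ev; rewrite E|exact: IH].
Qed.

Lemma EXACT_spec s cnt : imem s 1 0 = n -> imem s 2 0 = n.+1 -> imem s 12 0 = 0%N ->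
  @caraS R n s cnt ->
  wp orc EXACT s (fun s' t q => agree [:: 3; 5; 12] [:: 13; 14; 15; 16] s s' /\
    [/\ (t <= 200 * (n.+1 * n.+1))%N, q = 0%N, imem s' 12 0 = 0%N \/ imem s' 12 0 = 3%N,
      (let z k := dot (gv s k) (etop R n) in
       etop R n = mix (imem s 17 0) z (fun k => wv s (imem s 18 k)) /\
       (forall k, (k < imem s 17 0)%N -> 0 <= z k)) -> imem s' 12 0 = 0%N
     & imem s' 12 0 = 0%N ->
         etop R n = mix (imem s 17 0) (rmem s' 16) (fun k => wv s (imem s 18 k)) /\
         forall k, (k < imem s 17 0)%N -> 0 <= rmem s' 16 k]).
Proof.
move=> Hn Hn1 Hst HC; apply: wp_agreeS => //.
have rn := cara_size HC; set r := imem s 17 0 in rn *.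
have Hr : imem s 17 0 = r by [].
have Ez k : dot (gv s k) (etop R n) = rmem s 12 (k * n.+1 + n).
  rewrite /dot (bigD1 ord_max) //= big1 ?addr0 => [|j /negbTE Hj]; rewrite !mxE ?eqxx ?mulr1 //.
  by rewrite Hj mulr0.
set z := fun k => dot (gv s k) (etop R n).
apply: wp_seq; apply: (@wp_vset _ _ _ z 0 r) => //=.
  by move=> j Hj; ev; rewrite Hn Hn1 /z Ez.
move=> t1 Ht1; set s1 := State _ _.
apply: wp_seq; apply: (@wp_vset _ _ _ (fun=> 0) 0 n.+1) => //=.
move=> t2 Ht2; set s2 := State _ _.
apply: wp_seq; apply: wp_rset; set s3 := State _ _.
have V14 : vec_at s3 n.+1 14 0 = etop R n.
  apply/rowP => j; rewrite !mxE /s3 /=; ev; rewrite Hn add0n.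
  have -> : (j == n :> nat) = (j == ord_max) by [].
  by case: eqP => //; rewrite ltn_ord.
have Z3 k : (k < r)%N -> rmem s3 13 k = z k by move=> Hk; rewrite /s3; ev; rewrite Hk subn0.
apply: wp_seq; apply: wp_conseq (@RLOOP_spec _ _ orc s3 r _ _ rn) _ => //.
move=> s4 t4 q4 [A4 [Ht4 -> H4]].
have A13 : agree [:: 3; 5] [:: 13; 14] s s3.
  by split=> a; rewrite !inE !negb_or => /andP[/negbTE n1 /negbTE n2]; apply/funext => j;
    rewrite /s3; ev; rewrite ?n1 ?n2.
have A14 := agree_trans A13 A4.
apply: wp_seq; apply: (@wp_vsum _ _ _ (fun j => rmem s4 14 j * rmem s4 14 j) n.+1) => //=.
  by fr A14.
move=> t5 Ht5; set s5 := State _ _.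
pose rho := etop R n - mix r z (fun k => wv s (imem s 18 k)).
have {}H4 : vec_at s4 n.+1 14 0 = rho.
  rewrite H4 V14; congr (_ - _); apply: eq_mix => k Hk; first exact: Z3.
  by apply: vec_at_eq.
have X15 : rmem s5 15 0 = dot rho rho by rewrite -H4 dot_vec.
have Z5 k : (k < r)%N -> rmem s5 13 k = z k by move=> Hk; rewrite -Z3 // -(proj2 A4 13 isT).
have St5 : imem s5 12 0 = 0%N by rewrite /s5; ev; fr A14.
have R5 : imem s5 17 0 = r by rewrite /s5; ev; fr A14.
clearbody s5.
have xx : (n.+1 <= n.+1 * n.+1)%N by rewrite leq_pmulr.
apply: wp_if; rewrite [beval _ _](_ : _ = (rho == 0)); last first.
  by rewrite /= X15 -dotvv_eq0 eq_le dotvv_ge0 andbT.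
case: eqP => Hrho; last first.
  apply: wp_iset; split; [|by []|by right| |by []].
    by rewrite /=; clear -Ht1 Ht2 Ht4 Ht5 xx rn; nia.
  by move=> [E _]; exfalso; apply: Hrho; rewrite /rho {1}E subrr.
apply: wp_seq; apply: (@wp_for _ _ _ (fun l st => (imem st 12 0 = 0%N \/ imem st 12 0 = 3%N) /\
   (imem st 12 0 = 0%N <-> forall k, (k < l)%N -> 0 <= z k)) r 5) => //=.
- by split; [left|split].
- move=> l s6 Hl Ag Hv [IH1 IH2]; apply: wp_if.
  rewrite [beval _ _](_ : _ = (0 <= z l)); last by rewrite /= Hv; fr Ag; rewrite Z5.
  case: ifPn => Hz.
    apply: wp_skip; split=> //; split=> //; rewrite IH2; split=> H k Hk; last by apply: H; exact: ltnW.
    by move: Hk; rewrite ltnS leq_eqVlt => /orP[/eqP->//|]; exact: H.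
  apply: wp_iset; split=> //; split; first by right.
  by split=> // H; exfalso; move: Hz; rewrite H.
- move=> s6 t6 Ht6 Ag Hv [IH1 IH2].
  have R6 : imem s6 17 0 = r by fr Ag.
  apply: (@wp_vset _ _ _ z 0 r) => //=.
    by move=> j Hj; ev; fr Ag; rewrite Z5.
  move=> t7 Ht7; split=> //.
  + by clear -Ht1 Ht2 Ht4 Ht5 Ht6 Ht7 xx rn; nia.
  + by move=> [_ H]; ev; apply/IH2.
  + move=> H; have {}H : imem s6 12 0 = 0%N by [].
    have E k : (k < r)%N -> (fill (rmem s6) 16 0 r z) 16 k = z k.
      by move=> Hk; rewrite /fill /= Hk subn0.
    split; last by move=> k Hk; rewrite /= E //; apply: (proj1 IH2 H).
    move/eqP: Hrho; rewrite subr_eq0 => /eqP {1}->; apply: eq_mix => // k Hk.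
    by rewrite E.
Qed.

End Certificate.

(** * From a certificate to a level *)

Definition SEARCH : cmd :=
  For 7 $14
    (VSum 3 $1 9 ((RGet 21 ($7 *i $1 +i $3) -r RGet 10 (IGet 18 $6 *i $2 +i $3))
               *r (RGet 21 ($7 *i $1 +i $3) -r RGet 10 (IGet 18 $6 *i $2 +i $3))) ;;
     If (BLeR (RGet 9 (ICst 0)) (RCst 0)) (ISet 27 (ICst 0) $7) Skip).

Definition APP (src : nat) (se : iexp) (a b : rexp) : cmd :=
  VSet 3 $1 36 (($11 *i $28 +i IGet 21 $11) *i $1 +i $3) (RGet src (se *i $1 +i $3)) ;;
  RSet 37 ($11 *i $28 +i IGet 21 $11) a ;; RSet 38 ($11 *i $28 +i IGet 21 $11) b ;;
  ISet 21 $11 (IGet 21 $11 +i ICst 1).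

Definition ADDCUT : cmd :=
  RSet 39 $11 (RGet 39 $11 +r RGet 16 $6) ;;
  RSet 40 (ICst 0) (RGet 40 (ICst 0) +r RGet 16 $6 *r RGet 19 $27).

(** Cuts with coefficients [a_i] and ratios [g_i] add up to [- mu c + g d], where [mu] is the sum of
    the [a_i] and [g] that of the [a_i g_i]. Writing [d] with its rows, each of them enters with the
    pair [(g yd, mu yd)], read as [(g - gamma mu) yd]: nonnegative since no [g_i] is below gamma,
    and leaving a relation for [c - gamma d] whatever gamma becomes. *)
Definition LBUILD : cmd :=
  ISet 21 $11 (ICst 0) ;; RSet 39 $11 (RCst 0) ;; RSet 40 (ICst 0) (RCst 0) ;;
  For 6 $17 (SEARCH ;;
    If (BLeI (IGet 15 $27) (ICst 0)) (APP 20 $27 (RGet 16 $6) (RCst 0)) ADDCUT) ;;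
  For 6 $24 (APP 25 $6 (RGet 40 (ICst 0) *r RGet 26 $6) (RGet 39 $11 *r RGet 26 $6)).

Section LevelBuild.
Variables (R : realType) (n : nat) (orc : nat -> 'rV[R]_n -> answer R n).
Variables (rows : 'rV[R]_n -> Prop).
Implicit Types (s : state R).

Notation wv := (@wv R n).
Notation qv := (@qv R n).
Notation lrow := (@lrow R n).
Notation lco := (@lco R n).
Notation cap := (n.+1 + n.+1)%N.

Definition la s k i := rmem s 37 (k * cap + i)%N.
Definition lb s k i := rmem s 38 (k * cap + i)%N.
Definition di s i := vec_at s n 25 (i * n).

Lemma lcoE s k i : lco s k i = la s k i - rmem s 32 0 * lb s k i.
Proof. by []. Qed.

Lemma pair_eq c k l i j : (i < c)%N -> (j < c)%N ->
  (l * c + i == k * c + j)%N = (l == k) && (i == j).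
Proof.
move=> Hi Hj; apply/eqP/andP => [E|[/eqP-> /eqP->]//].
have c0 : (0 < c)%N by lia.
have El : l = k by have := congr1 (divn^~ c) E; rewrite !divnMDl // !divn_small // !addn0.
by split; [rewrite El | apply/eqP; move: E; rewrite El; lia].
Qed.

(** A certificate names its vectors by value only; the log tells which row or which cut stands
    behind each. Searching after the reduction to at most [n + 1] vectors keeps the cost of a level
    at order [n^2] per logged query. *)
Lemma SEARCH_spec s m k (v := lo (wv s (imem s 18 k))) :
  imem s 1 0 = n -> imem s 2 0 = n.+1 -> imem s 14 0 = m -> imem s 6 0 = k ->
  (exists2 e, (e < m)%N & vec_at s n 21 (e * n) = v) ->
  wp orc SEARCH s (fun s' t q => agree [:: 3; 7; 27] [:: 9] s s' /\
    [/\ (t <= 40 * n.+1 * m + 10)%N, q = 0%N, (imem s' 27 0 < m)%N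
      & vec_at s' n 21 (imem s' 27 0 * n) = v]).
Proof.
move=> Hn Hn1 Hm Hk Hex; apply: wp_agreeS => //.
apply: (@wp_for _ _ _ (fun l st => (exists2 e, (e < l)%N & vec_at s n 21 (e * n) = v) ->
   (imem st 27 0 < l)%N /\ vec_at s n 21 (imem st 27 0 * n) = v) m (30 * n.+1)) => //=.
- by case=> e; rewrite ltn0.
- move=> i s1 Hi Ag Hv IH.
  have m1 : imem s1 1 0 = n by fr Ag.
  have m2 : imem s1 2 0 = n.+1 by fr Ag.
  have m6 : imem s1 6 0 = k by fr Ag.
  pose x := vec_at s n 21 (i * n) - v.
  have H3 a : a != 3%N -> imem s1 a = upd (imem s1) 3 0 0 a.
    by move=> /negbTE ne; apply/funext => j; rewrite /upd ne.
  apply: wp_seq; apply: (@wp_vsum _ _ _ (fun j =>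
     (rmem s1 21 (i * n + j) - rmem s1 10 (imem s1 18 k * n.+1 + j)) *
     (rmem s1 21 (i * n + j) - rmem s1 10 (imem s1 18 k * n.+1 + j))) n) => //=.
    by move=> j z Hj; ev; rewrite Hv m1 m2 m6.
  move=> t1 Ht1; set s2 := State _ _.
  have E : rmem s2 9 0 = dot x x.
    rewrite /s2; ev; apply: eq_bigr => j _; rewrite !mxE /=.
    by fr Ag.
  apply: wp_if; rewrite [beval _ _](_ : _ = (x == 0)); last first.
    by rewrite [LHS](_ : _ = (rmem s2 9 0 <= 0)) // E -dotvv_eq0 eq_le dotvv_ge0 andbT.
  rewrite subr_eq0; case: eqP => Hx.
    apply: wp_iset; split; [by rewrite /=; lia|by []|move=> _].
    by rewrite /s2; ev; rewrite Hv; split.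
  apply: wp_skip; split; [by rewrite /=; lia|by []|].
  move=> [e]; rewrite ltnS leq_eqVlt => /orP[/eqP->//|He Ev].
  have [IH1 IH2] := IH (ex_intro2 _ _ e He Ev).
  by split; [exact: leqW|].
- move=> s2 t Ht Ag Hv IH; have [IH1 IH2] := IH Hex; split=> //.
    by clear -Ht; nia.
  by rewrite -IH2; apply: vec_at_eq; fr Ag.
Qed.

Lemma APP_spec s src se a b K L e va vb :
  imem s 1 0 = n -> imem s 28 0 = cap -> imem s 11 0 = K -> imem s 21 K = L ->
  (L < cap)%N -> src != 36%N -> 3%N \notin ireads se -> ieval s se = e ->
  (icost se + rcost a + rcost b <= 5)%N ->
  (forall j F, reval (State (upd (imem s) 3 0 j) (fill (rmem s) 36 ((K * cap + L) * n) n F)) a = va) ->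
  (forall j F, reval (State (upd (imem s) 3 0 j)
     (upd (fill (rmem s) 36 ((K * cap + L) * n) n F) 37 (K * cap + L)%N va)) b = vb) ->
  wp orc (APP src se a b) s (fun s' t q => agree [:: 3; 21] [:: 36; 37; 38] s s' /\
    [/\ (t <= 40 * n.+1)%N, q = 0%N,
      imem s' 21 K = L.+1 /\ (forall l, l != K -> imem s' 21 l = imem s 21 l),
      [/\ lrow s' K L = vec_at s n src (e * n), la s' K L = va & lb s' K L = vb]
    & forall l i, (i < cap)%N -> (l != K) || (i != L) ->
       [/\ lrow s' l i = lrow s l i, la s' l i = la s l i & lb s' l i = lb s l i]]).
Proof.
move=> Hn Hcap HK HL Lc Hsrc Hse He Hcost Ha Hb; apply: wp_agreeS => //.
pose F j := rmem s src (e * n + j)%N.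
apply: wp_seq; apply: (@wp_vset _ _ _ F ((K * cap + L) * n) n) => //=.
  move=> j Hj; have -> : ieval (State (upd (imem s) 3 0 j) (fill (rmem s) 36 ((K * cap + L) * n) j F)) se = e.
    rewrite -He; apply: ieval_agree => x Hx; apply/funext => i; rewrite /= /upd.
    by case: eqP => // E; move: Hse; rewrite -E Hx.
  by ev; rewrite HK Hcap HL Hn (negbTE Hsrc).
move=> t1 Ht1; set s1 := State _ _.
apply: wp_seq; apply: wp_rset; rewrite [reval _ _]Ha [ieval _ _](_ : _ = (K * cap + L)%N); last first.
  by rewrite /s1; ev; rewrite HK Hcap HL.
set s2 := State _ _.
apply: wp_seq; apply: wp_rset; rewrite [reval _ _]Hb [ieval _ _](_ : _ = (K * cap + L)%N); last first.
  by rewrite /s2 /s1; ev; rewrite HK Hcap HL.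
apply: wp_iset; set s4 := setI _ _ _ _.
have E36 : rmem s4 36 = fill (rmem s) 36 ((K * cap + L) * n) n F 36 by [].
have I21 l : imem s4 21 l = if l == K then L.+1 else imem s 21 l.
  by rewrite /s4 /s1; ev; rewrite HK HL addn1.
have E37 i : rmem s4 37 i = if i == (K * cap + L)%N then va else rmem s 37 i.
  by rewrite /s4 /s1; ev.
have E38 i : rmem s4 38 i = if i == (K * cap + L)%N then vb else rmem s 38 i.
  by rewrite /s4 /s1; ev.
have ER x : vec_at s4 n 36 (x * n) = if x == (K * cap + L)%N then \row_(j < n) F j else vec_at s n 36 (x * n).
  by apply/rowP => j; rewrite mxE E36 fill_row //; case: eqP => _; rewrite !mxE.
clearbody s4.
split.
- by rewrite /=; clear -Ht1 Hcost; nia.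
- by [].
- by split=> [|l /negbTE ne]; rewrite I21 ?eqxx ?ne.
- rewrite /la /lb E37 E38 eqxx; split=> //.
  by rewrite /Submission.lrow ER eqxx; apply/rowP => j; rewrite !mxE.
- move=> l i Hi ne; have {}ne : (l * cap + i == K * cap + L)%N = false.
    by rewrite pair_eq //; apply/negbTE; rewrite negb_and.
  by rewrite /la /lb E37 E38 /Submission.lrow ER ne.
Qed.

Definition lsame s s' l :=
  [/\ imem s' 21 l = imem s 21 l, rmem s' 39 l = rmem s 39 l
    & forall i, (i < cap)%N ->
       [/\ lrow s' l i = lrow s l i, la s' l i = la s l i & lb s' l i = lb s l i]].

Lemma lsame_trans s1 s2 s3 l : lsame s1 s2 l -> lsame s2 s3 l -> lsame s1 s3 l.
Proof.
move=> [A1 A2 A3] [B1 B2 B3]; split; rewrite ?B1 ?B2 // => i Hi.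
by have [-> -> ->] := B3 i Hi; exact: A3.
Qed.

Lemma lsame_eq s s' l : imem s' 21 l = imem s 21 l -> rmem s' 39 l = rmem s 39 l ->
  rmem s' 36 = rmem s 36 -> rmem s' 37 = rmem s 37 -> rmem s' 38 = rmem s 38 -> lsame s s' l.
Proof.
by move=> E1 E2 E3 E4 E5; split=> // i _; rewrite /la /lb E4 E5; split=> //; exact: vec_at_eq.
Qed.

Section Build.
Variables (c d : 'rV[R]_n) (K : nat) (q : nat -> 'rV[R]_n).
Notation P := (proj q K).

(** Subtracting gamma times the second equation from the first gives the relation of the level for
    [c - gamma d], with the same residual [u] for every gamma. By the last inequality the rows carry
    half of the mass, up to the residual. *)
Definition built u s := let L := imem s 21 K in
  [/\ (L <= n + n.+1)%N, forall i, (i < L)%N -> rows (lrow s K i),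
      forall i, (i < L)%N -> 0 <= lb s K i /\ 0 <= lco s K i, 0 <= rmem s 39 K
    & [/\ mix L (la s K) (fun i => P (lrow s K i)) - rmem s 39 K *: P c = u,
        mix L (lb s K) (fun i => P (lrow s K i)) = rmem s 39 K *: P d
      & 1 <= 2 * (\sum_(i < L) lco s K i * norm1 (P (lrow s K i))) + norm1 u]].

Section Build1.
Variables (s : state R) (m r : nat).
Let G := rmem s 32 0.
Let a := rmem s 16.
Let v k := lo (wv s (imem s 18 k)).
Let cs := c - G *: d.

(** The mass of a cut of ratio [ge] is split into that of [c - G d] and that of [(ge - G) d]; the
    accumulated excess [g - G * mu] is what the rows of [d] have to make up for afterwards. *)
Definition binv1 i st := let L := imem st 21 K in let mu := rmem st 39 K in
  let g := rmem st 40 0 in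
  [/\ (L <= i)%N, forall j, (j < L)%N -> [/\ rows (lrow st K j), lb st K j = 0 & 0 <= la st K j],
      0 <= mu, G * mu <= g
    & [/\ mix L (la st K) (fun j => P (lrow st K j)) - mu *: P c + g *: P d = mix i a v,
        \sum_(j < i) a j * norm1 (v j) <=
          \sum_(j < L) la st K j * norm1 (P (lrow st K j)) + mu * norm1 (P cs)
            + (g - G * mu) * norm1 (P d)
      & forall l, l != K -> lsame s st l]].

Lemma binv1_row i st st' e : binv1 i st ->
  imem st' 21 K = (imem st 21 K).+1 -> (forall l, l != K -> imem st' 21 l = imem st 21 l) ->
  (imem st 21 K < cap)%N ->
  [/\ lrow st' K (imem st 21 K) = e, la st' K (imem st 21 K) = a i & lb st' K (imem st 21 K) = 0] ->
  (forall l i, (i < cap)%N -> (l != K) || (i != imem st 21 K) ->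
       [/\ lrow st' l i = lrow st l i, la st' l i = la st l i & lb st' l i = lb st l i]) ->
  rmem st' 39 = rmem st 39 -> rmem st' 40 = rmem st 40 ->
  rows e -> v i = P e -> 0 <= a i -> binv1 i.+1 st'.
Proof.
rewrite /binv1; set L := imem st 21 K.
move=> [I1 I2 I3 I4 [I5 I6 I7]] EL EL' Lc [E1 E2 E3] Hold E39 E40 He Hv a0.
have Hj j : (j < L)%N -> [/\ lrow st' K j = lrow st K j, la st' K j = la st K j & lb st' K j = lb st K j].
  by move=> H; apply: Hold; [exact: ltn_trans Lc | rewrite (ltn_eqF H) orbT].
rewrite EL E39 E40; split=> //.
- by move=> j; rewrite ltnS leq_eqVlt => /orP[/eqP->|H]; [rewrite E1 E2 E3 | have [-> -> ->] := Hj j H; exact: I2].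
- split.
  + rewrite !mixS -I5 Hv E1 E2.
    rewrite (@eq_mix _ _ L (la st' K) (la st K) _ (fun j => P (lrow st K j))).
    * by rewrite -!addrA; congr (_ + _); rewrite addrC -!addrA.
    * by move=> j H; have [] := Hj j H.
    * by move=> j H; have [-> _ _] := Hj j H.
  + rewrite !big_ord_recr /= E1 E2 -Hv.
    have -> : \sum_(j < L) la st' K j * norm1 (P (lrow st' K j)) =
        \sum_(j < L) la st K j * norm1 (P (lrow st K j)).
      by apply: eq_bigr => j _; have [-> -> _] := Hj j (ltn_ord j).
    by move: I6; set A := \sum_(j < i) _; set B := \sum_(j < L) _; clear; lra.
  + move=> l Hl; apply: lsame_trans (I7 l Hl) _; split; rewrite ?E39 ?EL' // => j Hj'.
    by apply: Hold => //; rewrite Hl.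
Qed.

Lemma binv1_cut i st st' ge : binv1 i st ->
  imem st' 21 = imem st 21 -> rmem st' 36 = rmem st 36 -> rmem st' 37 = rmem st 37 ->
  rmem st' 38 = rmem st 38 -> rmem st' 39 K = rmem st 39 K + a i ->
  (forall l, l != K -> rmem st' 39 l = rmem st 39 l) ->
  rmem st' 40 0 = rmem st 40 0 + a i * ge ->
  G <= ge -> v i = - P (c - ge *: d) -> 0 <= a i -> binv1 i.+1 st'.
Proof.
rewrite /binv1; set L := imem st 21 K.
move=> [I1 I2 I3 I4 [I5 I6 I7]] E21 E36 E37 E38 E39 E39' E40 Hge Hv a0.
have Er : lrow st' K = lrow st K by apply/funext => j; apply: vec_at_eq.
have Ea : la st' K = la st K by rewrite /la E37.
have Eb : lb st' K = lb st K by rewrite /lb E38.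
rewrite Er Ea Eb E39 E40 E21 -/L; split.
- exact: leqW.
- exact: I2.
- exact: addr_ge0.
- by rewrite mulrDr lerD // mulrC ler_wpM2l.
split.
- rewrite mixS -I5 Hv projB projZ; set X := mix _ _ _.
  by rewrite !scalerDl scalerN scalerBr scalerA opprB opprD; apply/rowP => j; rewrite !mxE; ring.
- rewrite big_ord_recr /=; apply: le_trans (lerD I6 (lexx _)) _.
  have : norm1 (v i) <= norm1 (P cs) + (ge - G) * norm1 (P d).
    rewrite Hv norm1N; have -> : P (c - ge *: d) = P cs + - ((ge - G) *: P d).
      by rewrite /cs !projB !projZ scalerBl opprB addrA; apply/rowP => j; rewrite !mxE; ring.
    apply: le_trans (norm1D _ _) _; rewrite norm1N norm1Z ger0_norm ?subr_ge0 //.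
  move=> /(ler_wpM2l a0); set S := \sum_(j < L) _.
  by set N1 := norm1 (P cs); set N2 := norm1 (P d); set Nv := norm1 (v i) => H; nra.
- move=> l Hl; apply: lsame_trans (I7 l Hl) _; apply: lsame_eq; rewrite ?E21 //; exact: E39'.
Qed.

End Build1.

Section Build2.
Variables (s : state R) (st1 : state R) (u : 'rV[R]_n) (T0 : R).
Let G := rmem s 32 0.
Let mu := rmem st1 39 K.
Let g := rmem st1 40 0.
Let yd := rmem s 26.

Definition binv2 L0 i st := let L := imem st 21 K in
  [/\ L = (L0 + i)%N, forall j, (j < L)%N -> [/\ rows (lrow st K j), 0 <= lb st K j
         & 0 <= la st K j - G * lb st K j],
      rmem st 39 = rmem st1 39
    & [/\ mix L (la st K) (fun j => P (lrow st K j)) - mu *: P c + g *: P d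
            = u + g *: mix i yd (fun j => P (di s j)),
        mix L (lb st K) (fun j => P (lrow st K j)) = mu *: mix i yd (fun j => P (di s j)),
        T0 + (g - G * mu) * (\sum_(j < i) yd j * norm1 (P (di s j))) <=
          \sum_(j < L) (la st K j - G * lb st K j) * norm1 (P (lrow st K j))
      & forall l, l != K -> lsame st1 st l]].

Lemma binv2_row L0 i st st' : binv2 L0 i st ->
  imem st' 21 K = (imem st 21 K).+1 -> (forall l, l != K -> imem st' 21 l = imem st 21 l) ->
  (imem st 21 K < cap)%N ->
  [/\ lrow st' K (imem st 21 K) = di s i, la st' K (imem st 21 K) = g * yd i
     & lb st' K (imem st 21 K) = mu * yd i] ->
  (forall l i, (i < cap)%N -> (l != K) || (i != imem st 21 K) ->
       [/\ lrow st' l i = lrow st l i, la st' l i = la st l i & lb st' l i = lb st l i]) ->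
  rmem st' 39 = rmem st 39 -> 
  rows (di s i) -> 0 <= yd i -> 0 <= mu -> G * mu <= g -> binv2 L0 i.+1 st'.
Proof.
rewrite /binv2; set L := imem st 21 K.
move=> [I1 I2 I3 [I5 I6 I6' I7]] EL EL' Lc [E1 E2 E3] Hold E39 He y0 mu0 Gg.
have Hj j : (j < L)%N -> [/\ lrow st' K j = lrow st K j, la st' K j = la st K j & lb st' K j = lb st K j].
  by move=> H; apply: Hold; [exact: ltn_trans Lc | rewrite (ltn_eqF H) orbT].
have HG : g * yd i - G * (mu * yd i) = (g - G * mu) * yd i by ring.
have HP : {in gtn L, forall j, P (lrow st' K j) = P (lrow st K j)}.
  by move=> j H; have [-> _ _] := Hj j H.
rewrite EL E39; split=> //.
- by rewrite I1 addnS.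
- move=> j; rewrite ltnS leq_eqVlt => /orP[/eqP->|H].
    by rewrite E1 E2 E3 HG; split=> //; rewrite ?mulr_ge0 // subr_ge0.
  by have [-> -> ->] := Hj j H; exact: I2.
split.
- rewrite !mixS E1 E2 scalerDr addrA -I5 scalerA.
  rewrite (@eq_mix _ _ L (la st' K) (la st K) _ (fun j => P (lrow st K j))) //.
    by rewrite -!addrA; congr (_ + _); rewrite addrC -!addrA.
  by move=> j H; have [] := Hj j H.
- rewrite !mixS E1 E3 scalerDr -I6 scalerA; congr (_ + _); apply: eq_mix => //.
  by move=> j H; have [] := Hj j H.
- rewrite !big_ord_recr /= E1 E2 E3 HG mulrDr addrA mulrA lerD2r.
  apply: le_trans I6' _; rewrite le_eqVlt; apply/orP; left; apply/eqP.
  by apply: eq_bigr => j _; have [-> -> ->] := Hj j (ltn_ord j).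
- move=> l Hl; apply: lsame_trans (I7 l Hl) _; split; rewrite ?E39 ?EL' // => j Hj'.
  by apply: Hold => //; rewrite Hl.
Qed.

End Build2.

Lemma LBUILD_spec s m r nI (v := fun k => lo (wv s (imem s 18 k))) :
  imem s 1 0 = n -> imem s 2 0 = n.+1 -> imem s 28 0 = cap -> imem s 11 0 = K ->
  imem s 14 0 = m -> imem s 17 0 = r -> (r <= n.+1)%N ->
  (forall k, (k < r)%N -> 0 <= rmem s 16 k) ->
  (forall k, (k < r)%N -> exists2 e, (e < m)%N & vec_at s n 21 (e * n) = v k) ->
  logok rows c d K q s m -> imem s 24 0 = nI -> (nI <= n)%N ->
  (forall i, (i < nI)%N -> rows (di s i) /\ 0 <= rmem s 26 i) ->
  d = mix nI (rmem s 26) (di s) ->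
  1 <= \sum_(k < r) rmem s 16 k * norm1 (v k) ->
  wp orc LBUILD s (fun s' t q0 =>
    agree [:: 3; 6; 7; 21; 27] [:: 9; 36; 37; 38; 39; 40] s s' /\
    [/\ (t <= 100 * (n.+1 * n.+1) * m + 500 * (n.+1 * n.+1))%N, q0 = 0%N,
        forall l, l != K -> lsame s s' l & built (mix r (rmem s 16) v) s']).
Proof.
move=> Hn Hn1 Hcap HK Hm Hr rn Ha Hsearch Hlog HnI nIn HDI Hd Hone; apply: wp_agreeS => //.
set a := rmem s 16; set G := rmem s 32 0.
apply: wp_seq; apply: wp_iset; apply: wp_seq; apply: wp_rset; apply: wp_seq; apply: wp_rset.
set s1 := State _ _.
have A1 : agree [:: 21] [:: 39; 40] s s1 by agr.
have I21 l : imem s1 21 l = if l == K then 0%N else imem s 21 l by rewrite /s1; ev; rewrite HK.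
have I39 l : rmem s1 39 l = if l == K then 0 else rmem s 39 l by rewrite /s1; ev; rewrite HK.
have I40 : rmem s1 40 0 = 0 by [].
clearbody s1.
apply: wp_seq; apply: (@wp_for _ _ _ (binv1 s) r (40 * n.+1 * m + 100 * n.+1)) => //=.
- by fr A1.
- rewrite /binv1 [imem _ 21 K]I21 [rmem _ 39 K]I39 eqxx [rmem _ 40 0]I40; split=> //.
    by rewrite mulr0.
  split.
  + by rewrite /mix !big_ord0 !scale0r subrr addr0.
  + by rewrite !big_ord0 mul0r add0r mulr0 subrr mul0r addr0.
  + move=> l /negbTE Hl; apply: lsame_eq; try exact: (proj2 A1).
      by apply: etrans (I21 l) _; rewrite Hl.
    by apply: etrans (I39 l) _; rewrite Hl.
- move=> i s2 Hi Ag Hv IH.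
  have {}Ag : agree [:: 3; 6; 7; 21; 27] [:: 9; 36; 37; 38; 39; 40] s s2.
    by apply: agree_norm (agree_trans A1 Ag) _.
  have F1 : imem s2 1 0 = n by fr Ag.
  have F2 : imem s2 2 0 = n.+1 by fr Ag.
  have F14 : imem s2 14 0 = m by fr Ag.
  have E21 : rmem s2 21 = rmem s 21 by fr Ag.
  have Hv2 : lo (wv s2 (imem s2 18 i)) = v i.
    by rewrite /v; congr lo; fr Ag; apply: vec_at_eq; fr Ag.
  apply: wp_seq; apply: wp_conseq (@SEARCH_spec s2 m i F1 F2 F14 Hv _) _.
    by rewrite Hv2; have [e He Ee] := Hsearch i Hi; exists e => //; rewrite -Ee; exact: vec_at_eq.
  move=> s3 t3 q3 [A3 [Ht3 -> He]]; rewrite Hv2; set e := imem s3 27 0 in He *.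
  move=> Ev.
  have Ag3 : agree [:: 3; 6; 7; 21; 27] [:: 9; 36; 37; 38; 39; 40] s s3.
    by apply: agree_norm (agree_trans Ag A3) _.
  have IH3 : binv1 s i s3.
    have S3 l : lsame s2 s3 l.
      by apply: lsame_eq; [rewrite (proj1 A3 21 isT)|rewrite (proj2 A3 39 isT)|exact: (proj2 A3 36 isT)|exact: (proj2 A3 37 isT)|exact: (proj2 A3 38 isT)].
    case: IH; rewrite /binv1 (proj1 A3 21 isT) (proj2 A3 39 isT) (proj2 A3 40 isT).
    have -> : lrow s3 K = lrow s2 K by apply/funext => j; apply: vec_at_eq; fr A3.
    have -> : la s3 K = la s2 K by rewrite /la; fr A3.
    have -> : lb s3 K = lb s2 K by rewrite /lb; fr A3.
    move=> I1 I2 I3 I4 [I5 I6 I7]; split=> //; split=> // l Hl.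
    exact: lsame_trans (I7 l Hl) (S3 l).
  have Hent : entok rows c d K q G (imem s3 15 e) (rmem s3 19 e)
      (vec_at s3 n 20 (e * n)) (v i).
    rewrite -Ev (proj1 Ag3 15 isT) (proj2 Ag3 19 isT).
    have V x o : x \in [:: 20; 21]%N -> vec_at s3 n x o = vec_at s n x o.
      by rewrite !inE => /orP[]/eqP->; apply: vec_at_eq; fr Ag3.
    by rewrite !V //; exact: Hlog.
  have X6 : imem s3 6 0 = i by rewrite (proj1 A3 6 isT).
  have X16 : rmem s3 16 = a by rewrite (proj2 Ag3 16 isT).
  have X11 : imem s3 11 0 = K by rewrite (proj1 Ag3 11 isT).
  apply: wp_if; rewrite [beval _ _](_ : _ = (imem s3 15 e == 0)%N); last by rewrite /= -/e leqn0.
  case: Hent => -[Hk Hrow Hvi].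
    rewrite Hk eqxx.
    have Lc : (imem s3 21 K < cap)%N by case: IH3 => I1 _ _ _ _; clear -I1 Hi rn; lia.
    apply: wp_conseq (@APP_spec s3 20 $27 (RGet 16 $6) (RCst 0) K (imem s3 21 K) e (a i) 0 _ _ _ _ Lc _ _ _ _ _ _) _ => //.
    + by rewrite (proj1 Ag3 1 isT).
    + by rewrite (proj1 Ag3 28 isT).
    + by move=> j F; ev; rewrite X6 X16.
    + by move=> s4 t4 q4 [A4 [Ht4 -> [J1 J2] J3 J4]]; split; [rewrite /=; clear -Ht3 Ht4; lia|by []|];
      apply: (binv1_row IH3 J1 J2 Lc J3 J4) => //; [exact: (proj2 A4 39 isT)|exact: (proj2 A4 40 isT)|exact: Ha].
  rewrite Hk /=; apply: wp_seq; apply: wp_rset; apply: wp_rset; set s4 := State _ _.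
  have R39 l : rmem s4 39 l = if l == K then rmem s3 39 K + a i else rmem s3 39 l.
    by rewrite /s4; ev; rewrite X11 X6 X16.
  have R40 : rmem s4 40 0 = rmem s3 40 0 + a i * rmem s3 19 e.
    by rewrite /s4; ev; rewrite X6 X16.
  split; [by rewrite /=; clear -Ht3; lia|by []|].
  apply: (binv1_cut (ge := rmem s3 19 e) IH3) => //.
  + by rewrite R39 eqxx.
  + by move=> l /negbTE Hl; rewrite R39 Hl.
  + exact: Ha.
move=> s2 t2 Ht2 Ag2 Hv2 IH.
have {}Ag2 : agree [:: 3; 6; 7; 21; 27] [:: 9; 36; 37; 38; 39; 40] s s2.
  by apply: agree_norm (agree_trans A1 Ag2) _.
set u := mix r a v; set mu := rmem s2 39 K; set g := rmem s2 40 0; set L0 := imem s2 21 K.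
set cs := c - G *: d.
(* The mass that the rows collected so far must carry once the cuts are accounted for. The part due
   to [d] is paid back by adding its rows, by the triangle inequality. *)
pose T0 := 1 - mu * norm1 (P cs) - (g - G * mu) * norm1 (P d).
have [I1 I2 mu0 Gg [I5 I6 I7]] := IH.
apply: (@wp_for _ _ _ (binv2 s s2 u T0 L0) nI (60 * n.+1)) => //=.
- by fr Ag2.
- rewrite /binv2 addn0 [imem _ 21 K](_ : _ = L0) //.
  have M0 f h : mix 0 f h = 0 :> 'rV[R]_n by rewrite /mix big_ord0.
  have -> : lrow (setI s2 6 0 0) K = lrow s2 K by [].
  have -> : la (setI s2 6 0 0) K = la s2 K by [].
  have -> : lb (setI s2 6 0 0) K = lb s2 K by [].
  split=> //.
    by move=> j Hj; have [H1 H2 H3] := I2 j Hj; rewrite H2 mulr0 subr0.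
  split=> //.
  + by rewrite M0 scaler0 addr0; exact: I5.
  + by rewrite M0 scaler0; apply: mix0 => j Hj; have [_ -> _] := I2 j Hj.
  + rewrite big_ord0 mulr0 addr0 /T0.
    have -> : \sum_(j < L0) (la s2 K j - G * lb s2 K j) * norm1 (P (lrow s2 K j))
       = \sum_(j < L0) la s2 K j * norm1 (P (lrow s2 K j)).
      by apply: eq_bigr => j _; have [_ -> _] := I2 j (ltn_ord j); rewrite mulr0 subr0.
    have := le_trans Hone I6; rewrite -/mu -/g -/L0 -/G -/cs; set S := \sum_(j < L0) _.
    by clear; lra.
- move=> i s3 Hi Ag Hv IH3.
  have Ag3 : agree [:: 3; 6; 7; 21; 27] [:: 9; 36; 37; 38; 39; 40] s s3.
    by apply: agree_norm (agree_trans Ag2 Ag) _.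
  have [J1 J2 J39 _] := IH3.
  have Lc : (imem s3 21 K < cap)%N by rewrite J1; clear -I1 Hi rn nIn; rewrite -/L0 in I1; lia.
  have X40 : rmem s3 40 0 = g by rewrite (proj2 Ag 40 isT).
  have X26 : rmem s3 26 = rmem s 26 by exact: (proj2 Ag3 26 isT).
  have X11 : imem s3 11 0 = K by rewrite (proj1 Ag3 11 isT).
  have X25 : rmem s3 25 = rmem s 25 by exact: (proj2 Ag3 25 isT).
  apply: wp_conseq (@APP_spec s3 25 $6 (RGet 40 (ICst 0) *r RGet 26 $6) (RGet 39 $11 *r RGet 26 $6)
    K (imem s3 21 K) i (g * rmem s 26 i) (mu * rmem s 26 i) _ _ _ _ Lc _ _ _ _ _ _) _ => //.
  + by rewrite (proj1 Ag3 1 isT).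
  + by rewrite (proj1 Ag3 28 isT).
  + by move=> j F; ev; rewrite Hv X40 X26.
  + by move=> j F; ev; rewrite Hv X11 J39 X26.
  move=> s4 t4 q4 [A4 [Ht4 -> [K1 K2] [K3 K3' K3''] K4]]; split; [by clear -Ht4; lia|by []|].
  have [D1 D2] := HDI i Hi.
  apply: (binv2_row IH3 K1 K2 Lc _ K4) => //; last exact: (proj2 A4 39 isT).
  by split=> //; rewrite [LHS]K3; exact: vec_at_eq.
- move=> s3 t3 Ht3 Ag Hv [J1 J2 J39 [J5 J6 J7 J8]].
  have Ag3 : agree [:: 3; 6; 7; 21; 27] [:: 9; 36; 37; 38; 39; 40] s s3.
    by apply: agree_norm (agree_trans Ag2 Ag) _.
  have EPd : mix nI (rmem s 26) (fun j => P (di s j)) = P d by rewrite {1}Hd proj_mix.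
  have EG : rmem s3 32 0 = G by rewrite (proj2 Ag3 32 isT).
  have Elco j : lco s3 K j = la s3 K j - G * lb s3 K j by rewrite lcoE EG.
  split.
  + by clear -Ht2 Ht3 rn nIn; nia.
  + by [].
  + by move=> l Hl; exact: lsame_trans (I7 l Hl) (J8 l Hl).
  have A : mix (imem s3 21 K) (la s3 K) (fun i => P (lrow s3 K i)) - mu *: P c = u.
    by apply: (addIr (g *: P d)); rewrite J5 EPd.
  have B : mix (imem s3 21 K) (lb s3 K) (fun i => P (lrow s3 K i)) = mu *: P d.
    by rewrite J6 EPd.
  split.
  + by rewrite J1; clear -I1 rn nIn; rewrite -/L0 in I1; lia.
  + by move=> j Hj; have [] := J2 j Hj.
  + by move=> j Hj; have [_ H1 H2] := J2 j Hj; rewrite Elco.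
  + by rewrite J39.
  split; rewrite ?J39 //.
  have -> : \sum_(i < imem s3 21 K) lco s3 K i * norm1 (P (lrow s3 K i)) =
      \sum_(i < imem s3 21 K) (la s3 K i - G * lb s3 K i) * norm1 (P (lrow s3 K i)).
    by apply: eq_bigr => j _; rewrite Elco.
  move: J7; set S := \sum_(j < imem s3 21 K) _ => J7.
  have H1 : norm1 (P d) <= \sum_(j < nI) rmem s 26 j * norm1 (P (di s j)).
    rewrite -EPd; apply: le_trans (norm1_sum _ _ _) _; apply: ler_sum => j _.
    by rewrite norm1Z ger0_norm //; have [] := HDI j (ltn_ord j).
  (* The relation itself bounds the mass of the cuts by that of the rows plus the residual, whence
     the factor 2 in [built]. *)
  have H2 : mu * norm1 (P cs) <= S + norm1 u.
    have -> : mu * norm1 (P cs) = norm1 (mu *: P cs) by rewrite norm1Z ger0_norm.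
    have -> : mu *: P cs = mix (imem s3 21 K) (fun j => la s3 K j - G * lb s3 K j)
        (fun i => P (lrow s3 K i)) - u.
      rewrite mixB mixZ B -A /cs projB projZ scalerBr !scalerA [G * mu]mulrC.
      by set X := mix _ _ _; apply/rowP => j; rewrite !mxE; ring.
    apply: le_trans (norm1D _ _) _; rewrite norm1N lerD2r.
    apply: le_trans (norm1_sum _ _ _) _; apply: ler_sum => j _.
    by rewrite norm1Z ger0_norm //; have [] := J2 j (ltn_ord j).
  have H3 : (g - G * mu) * norm1 (P d) <= (g - G * mu) * (\sum_(j < nI) rmem s 26 j * norm1 (P (di s j))).
    by rewrite ler_wpM2l // subr_ge0.
  move: J7 H2 H3; rewrite /T0; set X1 := mu * _; set X2 := (g - _) * norm1 _; set X3 := _ * \sum_(j < nI) _.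
  by clear; lra.
Qed.

End Build.

End LevelBuild.

(** * One level of the descent *)

Definition LVEC : cmd :=
  VSet 3 $1 27 $3 (RGet 23 $3 -r RGet 32 (ICst 0) *r RGet 24 $3) ;;
  RSet 31 (ICst 0) (RGet 32 (ICst 0)) ;; ISet 10 (ICst 0) $11 ;;
  VSet 3 $1 5 $3 (RGet 23 $3) ;; PROJ ;; VSet 3 $1 29 $3 (RGet 6 $3) ;;
  VSet 3 $1 5 $3 (RGet 24 $3) ;; PROJ ;; VSet 3 $1 30 $3 (RGet 6 $3) ;;
  VSet 3 $1 28 $3 (RGet 29 $3 -r RGet 31 (ICst 0) *r RGet 30 $3) ;;
  VSum 3 $1 46 (RGet 28 $3 *r RGet 28 $3).

Definition STAR : cmd :=
  ISet 10 (ICst 0) $11 ;; RSet 47 (ICst 0) (RCst 0) ;; ISet 22 $11 (ICst 0) ;;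
  For 7 (IGet 21 $11)
    (VSet 3 $1 5 $3 (RGet 36 (($11 *i $28 +i $7) *i $1 +i $3)) ;; PROJ ;;
     ABSUM (RGet 6 $3) ;;
     RSet 46 (ICst 0) ((RGet 37 ($11 *i $28 +i $7)
        -r RGet 32 (ICst 0) *r RGet 38 ($11 *i $28 +i $7)) *r RGet 49 (ICst 0)) ;;
     If (rlt (RGet 47 (ICst 0)) (RGet 46 (ICst 0)))
       (RSet 47 (ICst 0) (RGet 46 (ICst 0)) ;; ISet 22 $11 $7 ;;
        VSet 3 $1 7 ($11 *i $1 +i $3) (RGet 6 $3)) Skip) ;;
  VSum 3 $1 46 (RGet 7 ($11 *i $1 +i $3) *r RGet 7 ($11 *i $1 +i $3)) ;;
  RSet 8 $11 (RGet 46 (ICst 0)) ;; ISet 11 (ICst 0) ($11 +i ICst 1).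

Section Level.
Variables (R : realType) (n : nat) (orc : nat -> 'rV[R]_n -> answer R n).
Variables (rows : 'rV[R]_n -> Prop) (c d : 'rV[R]_n).
Variables (Mpre : state R -> Prop).
Hypothesis HMpre : forall s s', Mpre s -> imem s' 24 = imem s 24 -> imem s' 29 = imem s 29 ->
  rmem s' 24 = rmem s 24 -> rmem s' 25 = rmem s 25 -> Mpre s'.
Implicit Types (s : state R).

Notation wv := (@wv R n).
Notation qv := (@qv R n).
Notation lrow := (@lrow R n).
Notation lco := (@lco R n).
Notation la := (@la R n).
Notation lb := (@lb R n).
Notation cap := (n.+1 + n.+1)%N.

Lemma LVEC_spec s K (G := rmem s 32 0) :
  imem s 1 0 = n -> imem s 11 0 = K -> (K <= n)%N -> Mpre s ->
  vec_at s n 23 0 = c -> vec_at s n 24 0 = d ->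
  (forall l, (l < K)%N -> rmem s 8 l = dot (qv s l) (qv s l)) ->
  wp orc LVEC s (fun s' t q0 => agree [:: 3; 4; 10] [:: 5; 6; 9; 27; 28; 29; 30; 31; 46] s s' /\
    [/\ (t <= 200 * (n.+1 * n.+1))%N, q0 = 0%N, constok c d Mpre K (qv s) G s'
      & rmem s' 46 0 = dot (proj (qv s) K (c - G *: d)) (proj (qv s) K (c - G *: d))]).
Proof.
move=> Hn HK Kn HM Hc Hd H8; apply: wp_agreeS => //.
set P := proj (qv s) K.
apply: wp_seq; apply: (@wp_vset _ _ _ (fun j => rmem s 23 j - G * rmem s 24 j) 0 n) => //=.
move=> t1 Ht1; set s1 := State _ _.
apply: wp_seq; apply: wp_rset; set s2 := State _ _; apply: wp_seq; apply: wp_iset; set s3 := setI _ _ _ _.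
apply: wp_seq; apply: (@wp_vset _ _ _ (fun j => rmem s 23 j) 0 n) => //= t2 Ht2; set s4 := State _ _.
have A4 : agree [:: 3; 10] [:: 5; 27; 31] s s4.
  have A : agree [:: 3] [:: 27] s s1 by agr.
  have B : agree [:: 3; 10] [:: 5; 31] s1 s4 by agr.
  by apply: agree_norm (agree_trans A B) _.
have V27 : vec_at s4 n 27 0 = c - G *: d.
  have -> : vec_at s4 n 27 0 = \row_(j < n) (rmem s 23 j - G * rmem s 24 j) by exact: (vec_vset n s 3 27).
  by rewrite -Hc -Hd; apply/rowP => j; rewrite !mxE.
have R31 : rmem s4 31 0 = G by [].
have V5 : vec_at s4 n 5 0 = c by rewrite -Hc; apply: (etrans (vec_vset n s3 3 5 _)); apply/rowP => j; rewrite !mxE.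
have Q10 : imem s4 10 0 = K by rewrite -HK.
clearbody s4.
have N4 : imem s4 1 0 = n by fr A4.
have Eq4 : qv s4 = qv s by apply/funext => l; apply: vec_at_eq; fr A4.
apply: wp_seq; apply: wp_conseq (@PROJ_spec _ _ orc s4 K N4 Q10 Kn _) _.
  by move=> l Hl; rewrite Eq4 (proj2 A4 8 isT); exact: H8.
move=> s5 t5 q5 [A45 [Ht5 -> V6]]; rewrite V5 Eq4 -/P in V6.
have A5 : agree [:: 3; 4; 10] [:: 5; 6; 9; 27; 31] s s5 by apply: agree_norm (agree_trans A4 A45) _.
have N5 : imem s5 1 0 = n by fr A5.
apply: wp_seq; apply: (@wp_vset _ _ _ (fun j => rmem s5 6 j) 0 n) => //= t6 Ht6; set s6 := State _ _.
apply: wp_seq; apply: (@wp_vset _ _ _ (fun j => rmem s5 24 j) 0 n) => //= t7 Ht7; set s7 := State _ _.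
have A57 : agree [:: 3] [:: 5; 29] s5 s7 by agr.
have A7 : agree [:: 3; 4; 10] [:: 5; 6; 9; 27; 29; 31] s s7 by apply: agree_norm (agree_trans A5 A57) _.
have V29 : vec_at s7 n 29 0 = P c.
  rewrite -V6; apply: (etrans (y := vec_at s6 n 29 0)); first exact: vec_at_eq.
  by apply: (etrans (vec_vset n s5 3 29 _)); apply/rowP => j; rewrite !mxE.
have V57 : vec_at s7 n 5 0 = d.
  apply: (etrans (vec_vset n s6 3 5 _)); rewrite -Hd -(vec_at_eq _ _ (proj2 A5 24 isT)).
  by apply/rowP => j; rewrite !mxE.
have Q107 : imem s7 10 0 = K by rewrite -Q10 -(proj1 A45 10 isT).
have V277 : vec_at s7 n 27 0 = c - G *: d.
  by rewrite -V27 -(vec_at_eq _ _ (proj2 A45 27 isT)); apply: vec_at_eq.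
have R317 : rmem s7 31 0 = G by rewrite -R31 -(proj2 A45 31 isT).
clearbody s7.
have N7 : imem s7 1 0 = n by fr A7.
have Eq7 : qv s7 = qv s by apply/funext => l; apply: vec_at_eq; fr A7.
apply: wp_seq; apply: wp_conseq (@PROJ_spec _ _ orc s7 K N7 Q107 Kn _) _.
  by move=> l Hl; rewrite Eq7 (proj2 A7 8 isT); exact: H8.
move=> s8 t8 q8 [A78 [Ht8 -> W6]]; rewrite V57 Eq7 -/P in W6.
have N8 : imem s8 1 0 = n by rewrite (proj1 A78 1 isT).
have R318 : rmem s8 31 0 = G by rewrite (proj2 A78 31 isT).
have V298 : vec_at s8 n 29 0 = P c by rewrite -V29; apply: vec_at_eq; fr A78.
apply: wp_seq; apply: (@wp_vset _ _ _ (fun j => rmem s8 6 j) 0 n) => //= t9 Ht9; set s9 := State _ _.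
apply: wp_seq; apply: (@wp_vset _ _ _ (fun j => rmem s8 29 j - G * rmem s8 6 j) 0 n) => //=.
  by move=> j Hj; ev; rewrite R318 add0n subn0 Hj.
move=> t10 Ht10; set s10 := State _ _.
apply: (@wp_vsum _ _ _ (fun j => rmem s10 28 j * rmem s10 28 j) n);
  [by []|by []|by move=> j x Hj; ev|move=> t11 /= Ht11; set s11 := State _ _].
have V28 : vec_at s10 n 28 0 = P (c - G *: d).
  apply: (etrans (vec_vset n s9 3 28 _)).
  by rewrite /P projB projZ -/P -V298 -W6; apply/rowP => j; rewrite !mxE.
have A8b : agree [:: 3] [:: 28; 30; 46] s8 s11 by agr.
have V30 : vec_at s11 n 30 0 = P d.
  rewrite -W6; apply: (etrans (y := vec_at s9 n 30 0)); first exact: vec_at_eq.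
  by apply: (etrans (vec_vset n s8 3 30 _)); apply/rowP => j; rewrite !mxE.
have V28' : vec_at s11 n 28 0 = P (c - G *: d) by rewrite -V28; apply: vec_at_eq.
have X46 : rmem s11 46 0 = dot (P (c - G *: d)) (P (c - G *: d)).
  by rewrite -V28 dot_vec /s11; ev.
have A811 : agree [:: 3; 4] [:: 6; 9; 28; 30; 46] s7 s11 by apply: agree_norm (agree_trans A78 A8b) _.
have A11 : agree [:: 3; 4; 10] [:: 5; 6; 9; 27; 28; 29; 30; 31; 46] s s11.
  by apply: agree_norm (agree_trans A7 A811) _.
split; [by clear -Ht1 Ht2 Ht5 Ht6 Ht7 Ht8 Ht9 Ht10 Ht11; nia|by []| |exact: X46].
clearbody s11; split.
- by fr A11.
- by rewrite (proj1 A11 11 isT).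
- by apply: HMpre HM _ _ _ _; fr A11.
- split=> l; first by apply: vec_at_eq; fr A11.
  by move=> Hl; rewrite (proj2 A11 8 isT); exact: H8.
- split.
  + by rewrite -Hc; apply: vec_at_eq; fr A11.
  + by rewrite -Hd; apply: vec_at_eq; fr A11.
  + by rewrite -V277; apply: vec_at_eq; fr A811.
  split=> //; [by rewrite -/P -V298; apply: vec_at_eq; fr A8b|by rewrite (proj2 A811 31 isT)].
Qed.

(** The running maximum starts at 0, so positivity of the sum guarantees that some row is chosen.
    The direction is overwritten at each improvement in slot [K], which a projection on level [K]
    does not read. *)
Lemma STAR_spec s K L (P := proj (qv s) K) (val := fun i => lco s K i * norm1 (P (lrow s K i))) :
  imem s 1 0 = n -> imem s 28 0 = cap -> imem s 11 0 = K -> (K <= n)%N ->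
  imem s 21 K = L -> (L <= n + n.+1)%N ->
  (forall l, (l < K)%N -> rmem s 8 l = dot (qv s l) (qv s l)) ->
  0 < \sum_(i < L) val i ->
  wp orc STAR s (fun s' t q0 =>
    agree [:: 3; 4; 7; 10; 11; 22] [:: 5; 6; 7; 8; 9; 46; 47; 49] s s' /\
    [/\ (t <= 700 * (n.+1 * n.+1 * n.+1))%N, q0 = 0%N, imem s' 11 0 = K.+1,
      (forall l, l != K -> [/\ imem s' 22 l = imem s 22 l, rmem s' 8 l = rmem s 8 l
           & qv s' l = qv s l])
    & [/\ (imem s' 22 K < L)%N, qv s' K = P (lrow s K (imem s' 22 K)),
          rmem s' 8 K = dot (qv s' K) (qv s' K)
        & \sum_(i < L) val i <= L%:R * val (imem s' 22 K)]]).
Proof.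
move=> Hn Hcap HK Kn HL Ln H8 Hpos; apply: wp_agreeS => //.
apply: wp_seq; apply: wp_iset; apply: wp_seq; apply: wp_rset; apply: wp_seq; apply: wp_iset.
set s1 := setI _ _ _ _.
have A1 : agree [:: 10; 22] [:: 47] s s1 by agr.
have I22 l : imem s1 22 l = if l == K then 0%N else imem s 22 l by rewrite /s1; ev; rewrite HK.
have R47 : rmem s1 47 0 = 0 by [].
have I10 : imem s1 10 0 = K by rewrite -HK.
clearbody s1.
have N1 : imem s1 1 0 = n by fr A1.
pose Inv i st := [/\ 0 <= rmem st 47 0, forall j, (j < i)%N -> val j <= rmem st 47 0,
   0 < rmem st 47 0 -> [/\ (imem st 22 K < i)%N, rmem st 47 0 = val (imem st 22 K)
       & qv st K = P (lrow s K (imem st 22 K))],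
   forall l, l != K -> imem st 22 l = imem s 22 l & forall l, l != K -> qv st l = qv s l].
apply: wp_seq; apply: (@wp_for _ _ _ Inv L (300 * (n.+1 * n.+1))) => //=.
- by fr A1; rewrite HK HL.
- split=> //=; rewrite ?R47 ?ltxx //.
    by move=> l /negbTE Hl; apply: etrans (I22 l) _; rewrite Hl.
  by move=> l _; apply: vec_at_eq; exact: (proj2 A1 7 isT).
- move=> i s2 Hi Ag Hv [J1 J2 J3 J4 J5].
  have Ag2 : agree [:: 3; 4; 7; 10; 22] [:: 5; 6; 7; 9; 46; 47; 49] s s2.
    by apply: agree_norm (agree_trans A1 Ag) _.
  have m1 : imem s2 1 0 = n by fr Ag2.
  have m11 : imem s2 11 0 = K by fr Ag2.
  have m28 : imem s2 28 0 = cap by fr Ag2.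
  have E36 : rmem s2 36 = rmem s 36 by exact: (proj2 Ag2 36 isT).
  pose F j := rmem s 36 ((K * cap + i) * n + j)%N.
  apply: wp_seq; apply: (@wp_vset _ _ _ F 0 n) => //=.
    by move=> j Hj; ev; rewrite Hv m1 m11 m28 E36.
  move=> t3 Ht3; set s3 := State _ _.
  have A23 : agree [:: 3] [:: 5] s2 s3 by agr.
  have Ag3 : agree [:: 3; 4; 7; 10; 22] [:: 5; 6; 7; 9; 46; 47; 49] s s3.
    by apply: agree_norm (agree_trans Ag2 A23) _.
  have V5 : vec_at s3 n 5 0 = lrow s K i by apply: (etrans (vec_vset n s2 3 5 F)); apply/rowP => j; rewrite !mxE.
  have Q10 : imem s3 10 0 = K by rewrite (proj1 A23 10 isT) (proj1 Ag 10 isT).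
  have Eq3 l : l != K -> qv s3 l = qv s l.
    by move=> Hl; rewrite -(J5 l Hl); apply: vec_at_eq.
  have R8 : rmem s3 8 = rmem s 8 by exact: (proj2 Ag3 8 isT).
  have X3 : imem s3 22 = imem s2 22 by [].
  have Y3 : qv s3 = qv s2 by apply/funext => l; apply: vec_at_eq.
  have Z3 : rmem s3 47 = rmem s2 47 by [].
  have m37 : imem s3 7 0 = i by rewrite -Hv.
  clearbody s3.
  apply: wp_seq; apply: wp_conseq (@PROJ_spec _ _ orc s3 K _ Q10 Kn _) _.
  + by fr Ag3.
  + by move=> l Hl; rewrite Eq3 ?(ltn_eqF Hl) // R8; exact: H8.
  move=> s4 t4 q4 [A34 [Ht4 -> V6]].
  have {}V6 : vec_at s4 n 6 0 = P (lrow s K i).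
    by rewrite V6 V5; apply: eq_proj => l Hl; rewrite Eq3 ?(ltn_eqF Hl).
  have m41 : imem s4 1 0 = n by rewrite (proj1 A34 1 isT); fr Ag3.
  apply: wp_seq; apply: wp_conseq (@ABSUM_spec _ _ orc s4 (RGet 6 $3) (fun j => rmem s4 6 j) m41 isT _) _.
    by move=> j x Hj; ev.
  move=> s5 t5 q5 [A45 [Ht5 -> H49]].
  have A35 := agree_trans A34 A45.
  have Ag5 : agree [:: 3; 4; 7; 10; 22] [:: 5; 6; 7; 9; 46; 47; 49] s s5.
    by apply: agree_norm (agree_trans Ag3 A35) _.
  have {}H49 : rmem s5 49 0 = norm1 (P (lrow s K i)).
    by rewrite H49 -V6; apply: eq_bigr => j _; rewrite mxE.
  have V65 : vec_at s5 n 6 0 = P (lrow s K i) by rewrite -V6; apply: vec_at_eq; fr A45.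
  have n5 : imem s5 1 0 = n by fr Ag5.
  have m5 : imem s5 11 0 = K by fr Ag5.
  have m57 : imem s5 7 0 = i by rewrite (proj1 A35 7 isT).
  have n28 : imem s5 28 0 = cap by fr Ag5.
  have X5 : imem s5 22 = imem s2 22 by rewrite (proj1 A35 22 isT).
  have Y5 : qv s5 = qv s2 by rewrite -Y3; apply/funext => l; apply: vec_at_eq; fr A35.
  have Z5 : rmem s5 47 = rmem s2 47 by rewrite (proj2 A35 47 isT).
  apply: wp_seq; apply: wp_rset.
  rewrite [reval _ _](_ : _ = val i); last first.
    by rewrite /= m5 n28 m57 H49 /val /Submission.lco; fr Ag5.
  set s6 := State _ _.
  have xx : (n.+1 <= n.+1 * n.+1)%N by rewrite leq_pmulr.
  apply: wp_if; rewrite [beval _ _](_ : _ = (rmem s2 47 0 < val i)); last first.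
    by rewrite /= /upd /= Z5 -ltNge.
  case: ltP => Hval; last first.
    apply: wp_skip; split; [by rewrite /=; clear -Ht3 Ht4 Ht5 xx; lia|by []|].
    rewrite /Inv [rmem _ 47](_ : _ = rmem s2 47) // [imem _ 22](_ : _ = imem s2 22) //.
    have -> : qv (setI s6 7 0 i.+1) = qv s2 by rewrite -Y5.
    split=> //.
      by move=> j; rewrite ltnS leq_eqVlt => /orP[/eqP->//|]; exact: J2.
    by move=> /J3[K1 K2 K3]; split=> //; exact: leqW.
  apply: wp_seq; apply: wp_rset; apply: wp_seq; apply: wp_iset; set s7 := setI _ _ _ _.
  apply: (@wp_vset _ _ _ (fun j => rmem s5 6 j) (K * n) n) => //=.
    by move=> j Hj; ev; rewrite m5 n5.
  move=> t8 Ht8; set s8 := State _ _.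
  have E22 l : imem s8 22 l = if l == K then i else imem s2 22 l.
    by rewrite /s8; ev; rewrite m5 m57 X5.
  have E47 : rmem s8 47 0 = val i by rewrite /s8; ev.
  have EQ l : qv s8 l = if l == K then P (lrow s K i) else qv s2 l.
    rewrite /Submission.qv vec_fill_row; case: eqP => _; last exact: (congr1 (@^~ l) Y5).
    by rewrite -V65; apply/rowP => j; rewrite !mxE.
  clearbody s8; split; [by rewrite /=; clear -Ht3 Ht4 Ht5 Ht8 xx; lia|by []|].
  rewrite /Inv [rmem _ 47 0]E47 [imem _ 22 K]E22 eqxx; split.
  + by rewrite ltW // (le_lt_trans J1).
  + move=> j; rewrite ltnS leq_eqVlt => /orP[/eqP->//|/J2 Hj].
    exact: le_trans Hj (ltW Hval).
  + by split=> //; apply: etrans (EQ K) _; rewrite eqxx.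
  + by move=> l Hl; apply: etrans (E22 l) _; rewrite (negbTE Hl) J4.
  + by move=> l Hl; apply: etrans (EQ l) _; rewrite (negbTE Hl) J5.
move=> s2 t2 Ht2 Ag Hv [J1 J2 J3 J4 J5].
have Ag2 : agree [:: 3; 4; 7; 10; 22] [:: 5; 6; 7; 9; 46; 47; 49] s s2.
  by apply: agree_norm (agree_trans A1 Ag) _.
have m1 : imem s2 1 0 = n by fr Ag2.
have m11 : imem s2 11 0 = K by fr Ag2.
have Hsum : \sum_(i < L) val i <= L%:R * rmem s2 47 0.
  rewrite mulr_natl -[X in _ *+ X]card_ord -sumr_const; apply: ler_sum => i _; exact: J2.
have Hb : 0 < rmem s2 47 0.
  rewrite lt_neqAle J1 andbT; apply/eqP => E; move: (lt_le_trans Hpos Hsum).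
  by rewrite -E mulr0 ltxx.
have [K1 K2 K3] := J3 Hb.
apply: wp_seq; apply: (@wp_vsum _ _ _ (fun j => rmem s2 7 (K * n + j) * rmem s2 7 (K * n + j)) n) => //=.
  by move=> j x Hj; ev; rewrite m11 m1.
move=> t3 Ht3; apply: wp_seq; apply: wp_rset; apply: wp_iset; set s4 := setI _ _ _ _.
have E8 l : rmem s4 8 l = if l == K then dot (qv s2 K) (qv s2 K) else rmem s2 8 l.
  by rewrite /s4; ev; rewrite m11 dot_vec.
have E22 : imem s4 22 = imem s2 22 by [].
have EQ : qv s4 = qv s2 by apply/funext => l; apply: vec_at_eq.
have E11 : imem s4 11 0 = K.+1 by rewrite /s4; ev; rewrite m11 addn1.
clearbody s4; split=> //.
- have xx : (n.+1 <= n.+1 * n.+1)%N by rewrite leq_pmulr.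
  have LL : (L * (300 * (n.+1 * n.+1) + 2) <= 2 * n.+1 * (300 * (n.+1 * n.+1) + 2))%N.
    by rewrite leq_mul2r; apply/orP; right; lia.
  have xxx : (n.+1 * n.+1 <= n.+1 * n.+1 * n.+1)%N by rewrite leq_pmulr.
  rewrite /=; move: Ht2 Ht3 LL xx xxx; rewrite /= !addn0.
  rewrite [(2 * n.+1 * _)%N](_ : _ = 600 * (n.+1 * n.+1 * n.+1) + 4 * n.+1)%N; last by clear; lia.
  set x3 := (n.+1 * n.+1 * n.+1)%N; set x2 := (n.+1 * n.+1)%N.
  by set y := (L * _)%N; clear; lia.
- move=> l Hl; rewrite E22 E8 EQ (negbTE Hl) J4 // J5 //; split=> //.
  by fr Ag2.
- by rewrite E22 EQ E8 eqxx -K2.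
Qed.

End Level.

Definition LCALL (A : cmd) : cmd :=
  ISet 14 (ICst 0) (ICst 0) ;; ISet 13 (ICst 0) (ICst 0) ;;
  ISet (shift 0) (ICst 0) $1 ;; RSet (shift 0) (ICst 0) (RGet 35 (ICst 0)) ;;
  relocate QBLOCK A.

Definition LCERT : cmd :=
  LIFT ;; CARA ;; If (BLeI (ICst 1) $30) EXACT Skip ;;
  If (BLeI $12 (ICst 0)) (LBUILD ;; STAR) Skip.

Definition LEVEL (A : cmd) : cmd :=
  LVEC ;; If (BLeR (RGet 46 (ICst 0)) (RCst 0)) (ISet 12 (ICst 0) (ICst 1))
    (LCALL A ;; If (BLeI $13 (ICst 0)) LCERT
       (If (BLeI $13 (ICst 1)) (ISet 12 (ICst 0) (ICst 1)) (ISet 12 (ICst 0) (ICst 2)))).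

Section LowAgree.
Variable (R : realType).
Implicit Types (s : state R).

(** Arrays from 100 on belong to [A]; after a run of [A] two states can be compared on the low
    arrays only. *)
Definition lagree (li lr : seq nat) s s' := forall a, (a < 100)%N ->
  (a \notin li -> imem s' a = imem s a) /\ (a \notin lr -> rmem s' a = rmem s a).

Lemma agree_lagree li lr s s' : agree li lr s s' -> lagree li lr s s'.
Proof. by move=> [H1 H2] a _; split=> Ha; [exact: H1 | exact: H2]. Qed.

Lemma lagree_comp li lr l1 r1 l2 r2 s1 s2 s3 : lagree l1 r1 s1 s2 -> lagree l2 r2 s2 s3 ->
  all (mem li) (l1 ++ l2) && all (mem lr) (r1 ++ r2) -> lagree li lr s1 s3.
Proof.
rewrite !all_cat => H1 H2 /andP[/andP[/allP i1 /allP i2] /andP[/allP r1' /allP r2']] a Ha.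
have [A1 A2] := H1 a Ha; have [B1 B2] := H2 a Ha; split=> Hn.
  rewrite B1 ?A1 //; apply: contra Hn; [exact: i1 | exact: i2].
by rewrite B2 ?A2 //; apply: contra Hn; [exact: r1' | exact: r2'].
Qed.

Lemma lagree_sub li lr l1 r1 s1 s2 : lagree l1 r1 s1 s2 ->
  all (mem li) l1 && all (mem lr) r1 -> lagree li lr s1 s2.
Proof.
move=> H Hl; apply: (lagree_comp H (agree_lagree (agree_refl s2))).
by rewrite !cats0.
Qed.

End LowAgree.

Ltac lfr H := repeat match type of H with lagree _ _ ?s1 ?s2 =>
  match goal with
  | |- context [rmem s2 ?a] => rewrite (proj2 (H a isT) isT)
  | |- context [imem s2 ?a] => rewrite (proj1 (H a isT) isT)
  end end.

Section Level.
Variables (R : realType) (n : nat) (orc : nat -> 'rV[R]_n -> answer R n).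
Variables (rows Kset : 'rV[R]_n -> Prop) (c d : 'rV[R]_n).
Variables (mem : 'rV[R]_n -> option 'rV[R]_n).
Variables (Mpre : state R -> Prop).
Hypothesis HMpre : forall s s', Mpre s -> imem s' 24 = imem s 24 -> imem s' 29 = imem s 29 ->
  rmem s' 24 = rmem s 24 -> rmem s' 25 = rmem s 25 -> Mpre s'.
Hypothesis HMEM : forall s, imem s 1 0 = n -> Mpre s ->
  wp orc MEM s (fun s' t q => agree [:: 3; 6; 26] [:: 9; 22; 46] s s' /\
    [/\ (t <= 60 * (n.+1 * n.+1))%N, (q <= 1)%N &
      match mem (vec_at s n 6 0) with
      | None => imem s' 26 0 = 0%N
      | Some v => (0 < imem s' 26 0)%N /\ vec_at s' n 22 0 = v
      end]).
Hypothesis mem_ok : forall g p, dot (c - g *: d) p < 0 ->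
  match mem p with None => Kset p | Some v => rows v /\ dot v p < 0 end.
Variables (To Ta : nat -> R -> R) (tau : nat -> nat) (A : cmd) (delta eps : R).
Hypothesis HA : solves_approx_conic_dual A To Ta tau.
Hypotheses (n0 : (0 < n)%N) (eps0 : 0 < eps) (neps : n%:R * eps <= 4%:R^-1).
Hypotheses (dgt0 : 0 < delta) (HL : lower_bounded delta rows).
Implicit Types (s : state R).

Notation wv := (@wv R n).
Notation qv := (@qv R n).
Notation lrow := (@lrow R n).
Notation lco := (@lco R n).
Notation la := (@la R n).
Notation lb := (@lb R n).
Notation di := (@di R n).
Notation lsame := (@lsame R n).
Notation lstar := (@lstar R n).
Notation cap := (n.+1 + n.+1)%N.
Notation x2 := (n.+1 * n.+1)%N.
Notation x3 := (n.+1 * n.+1 * n.+1)%N.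

(** The starred row has weight at least [1 / (8 n^2)], and twice the residual, itself below eps,
    must stay under delta times this weight: [16 = 2 * 8]. *)
Definition good : Prop := 16%:R * n%:R ^+ 2 * eps < delta.

Definition certok s m := let N := imem s (shift 0) 1 in
  [/\ (N <= tau n)%N,
      forall j, (j < N)%N -> (exists2 e, (e < m)%N &
         vec_at s n 21 (e * n) = vec_at s n (shift 2) (j * n)) /\ 0 < rmem s (shift 3) j,
      enorm (mix N (rmem s (shift 3)) (fun j => vec_at s n (shift 2) (j * n))) < eps
    & 1 <= \sum_(j < N) rmem s (shift 3) j * norm1 (vec_at s n (shift 2) (j * n))].

Lemma LCALL_spec s K q (G := rmem s 32 0) :
  constok c d Mpre K q G s -> (K <= n)%N ->
  (forall x y, dot (proj q K x) y = dot x (proj q K y)) ->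
  (forall x, proj q K (proj q K x) = proj q K x) ->
  proj q K (c - G *: d) != 0 -> xfok Kset c d s -> rmem s 35 0 = eps ->
  wp orc (LCALL A) s (fun s' t q0 => exists m : nat,
    [/\ q0%:R <= To n eps, t%:R <= Ta n eps + (500 * x2)%N%:R * To n eps, m%:R <= To n eps,
      [/\ constok c d Mpre K q G s', dynok Kset c d K q G s', lagree QI QR s s' & imem s' 14 0 = m]
    & [/\ imem s' 13 0 = 0%N -> logok rows c d K q s' m, rmem s' 32 0 <= G & certok s' m]]).
Proof.
move=> C Kn Hsym Hidem cs0 X E35.
apply: wp_seq; apply: wp_iset; apply: wp_seq; apply: wp_iset; apply: wp_seq; apply: wp_iset.
apply: wp_seq; apply: wp_rset; set s1 := State _ _.
have L1 : lagree [:: 13; 14] [::] s s1.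
  move=> a Ha; have Na b : (a == shift b) = false by rewrite /shift; apply/eqP; lia.
  split=> H; apply/funext => j; rewrite /s1; ev; rewrite ?Na //.
  by move: H; rewrite !inE => /norP[/negbTE-> /negbTE->].
have E13 : imem s1 13 0 = 0%N by [].
have E14 : imem s1 14 0 = 0%N by [].
have S0 : imem s1 (shift 0) 0 = n by rewrite /s1; ev; case: C.
have S1 : rmem s1 (shift 0) 0 = eps by rewrite -E35.
clearbody s1.
have V a : (a < 100)%N -> rmem s1 a = rmem s a by move=> Ha; exact: (proj2 (L1 a Ha) isT).
have C1 : constok c d Mpre K q G s1.
  case: C => C1 C2 C3 [C4 C5] [C6 C7 C8 [C9 C10 C11 C12]].
  have I a : (a < 100)%N -> a \notin [:: 13; 14]%N -> imem s1 a = imem s a.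
    by move=> Ha; exact: (proj1 (L1 a Ha)).
  split; rewrite ?I ?V //.
    by apply: HMpre C3 _ _ _ _; rewrite ?I ?V.
  - split; last by [].
    by move=> l; rewrite -C4; apply: vec_at_eq; exact: V.
  - have W a : (a < 100)%N -> vec_at s1 n a 0 = vec_at s n a 0 by move=> Ha; apply: vec_at_eq; exact: V.
    by rewrite !W.
have EG : rmem s1 32 0 = G by rewrite V.
have X1 : xfok Kset c d s1.
  have W a : (a < 100)%N -> vec_at s1 n a 0 = vec_at s n a 0 by move=> Ha; apply: vec_at_eq; exact: V.
  by move: X; rewrite /xfok !W // V.
have D1 : dynok Kset c d K q G s1.
  by split; [rewrite EG|exact: X1|left|rewrite E13|rewrite E13].
(* The cone is empty and no query is ever accepted: [A] cannot return a point and has to produce a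
   certificate. *)
pose o x := Some (ansv c d mem K q G x).
have Ho : conic_oracle (set0 : set 'rV[R]_n) o.
  move=> x /=; have [H1 H2] := ansv_ok mem_ok Hsym cs0 x.
  by split=> //; split.
have H0 : is_cone (set0 : set 'rV[R]_n).
  by split=> [x y t|x t []]; rewrite inE => -[].
pose s0 : state R := State (fun a => imem s1 (shift a)) (fun a => rmem s1 (shift a)).
have [s0' [t [l [He Hq Ht Hpost]]]] := @HA n set0 o eps s0 n0 H0 Ho eps0 S0 S1.
have Q1 : qinv rows Kset c d Mpre K q G s1 [::] s1.
  by split=> //; split.
have HQ l0 S x f v : qinv rows Kset c d Mpre K q G s1 l0 S ->
  wp orc (QBLOCK (shift x) (shift f) (shift v)) S (fun S' t q0 =>
    [/\ (t <= 500 * x2)%N, (q0 <= 1)%N,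
        qinv rows Kset c d Mpre K q G s1 (rcons l0 (answers_of_conic o (vec_at S n (shift x) 0))) S'
      & forall s, sim s S ->
          sim (put_answer s f v (answers_of_conic o (vec_at S n (shift x) 0))) S']).
  by move=> HJ; exact: (QBLOCK_spec HMpre HMEM mem_ok Kn Hsym Hidem cs0 _ _ _ HJ).
have Hsim : sim s0 s1 by [].
apply: wp_conseq (relocate_spec (fun l0 S S' => @qinv_low _ _ _ _ _ _ _ HMpre _ _ _ _ l0 S S') HQ He Hsim Q1) _.
move=> s' t' q' [Ht' Hq' [Hi Hr] [J1 J2 J3 J4 [J5 J6 J7]]].
exists (size l).
have To0 : 0 <= To n eps by apply: le_trans Hq.
split.
- by apply: le_trans Hq; rewrite ler_nat; lia.
- have -> : (icost (ICst 0) + icost (ICst 0) + (icost (ICst 0) + icost (ICst 0) + (icost (ICst 0) + icost $1 + (icost (ICst 0) + rcost (RGet 35 (ICst 0)) + t'))))%N = t' by [].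
  move: Ht'; set T := (500 * x2)%N; clearbody T => Ht'.
  apply: (@le_trans _ _ (t + T * size l)%N%:R); first by rewrite ler_nat.
  by rewrite natrD natrM lerD // ler_wpM2l.
- exact: Hq.
- split=> //; apply: lagree_comp L1 J3 _; by [].
split; first by move=> /J6.
  by rewrite -EG.
case: Hpost => [[_ []]|[_ [Hn1 Hn2 Hn3 Hn4]]].
have N0 : imem s' (shift 0) 1 = list_len s0' by rewrite Hi.
have Hv j : vec_at s' n (shift 2) (j * n) = list_vec s0' n j.
  by apply: vec_at_ext => i _; rewrite Hr.
have Hc j : rmem s' (shift 3) j = list_coef s0' j by rewrite Hr.
split; rewrite N0 //.
- move=> j Hj; have [H1 H2] := Hn2 j Hj; split; last by rewrite Hc.
  have /nthP - /(_ None) [e He1 He2] := H1; exists e => //.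
  by rewrite Hv; have := J5 e He1; rewrite He2 => -[].
- rewrite (_ : mix _ _ _ = \sum_(j < list_len s0') list_coef s0' j *: list_vec s0' n j) //.
  by apply: eq_bigr => j _; rewrite Hv Hc.
- by rewrite (eq_bigr (fun j : 'I_(list_len s0') => list_coef s0' j * norm1 (list_vec s0' n j))) // => j _; rewrite Hv Hc.
Qed.

Definition lkeep k s s' :=
  [/\ lsame s s' k, imem s' 22 k = imem s 22 k, rmem s' 8 k = rmem s 8 k,
      imem s' 30 0 = imem s 30 0 & forall l, (l <= k)%N -> qv s' l = qv s l].

(** Gamma may still drop while deeper levels are built, whereas [levok] refers to the current gamma;
    so the level is asserted for all later states that keep its data and do not raise gamma. *)
Definition levst s k := forall s', lkeep k s s' -> rmem s' 32 0 <= rmem s 32 0 ->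
  vec_at s' n 27 0 = c - rmem s' 32 0 *: d -> levok rows delta good s' k.

Lemma lkeep_trans k s1 s2 s3 : lkeep k s1 s2 -> lkeep k s2 s3 -> lkeep k s1 s3.
Proof.
move=> [A1 A2 A3 A4 A5] [B1 B2 B3 B4 B5]; split; rewrite ?B2 ?B3 ?B4 //.
  exact: lsame_trans A1 B1.
by move=> l Hl; rewrite B5 // A5.
Qed.

Lemma levst_keep k s s' : levst s k -> lkeep k s s' -> rmem s' 32 0 <= rmem s 32 0 -> levst s' k.
Proof.
by move=> H H1 H2 s'' H3 H4; apply: H; [exact: lkeep_trans H1 H3 | exact: le_trans H4 H2].
Qed.

(** When gamma drops, the coefficients [la - gamma * lb] can only grow because [lb >= 0], and the
    residual does not move because the rows weighted by [lb] add up to [mu] times the projection of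
    [d]. *)
Lemma built_levst u s K : (built rows c d K (qv s) u s) -> (imem s 22 K < imem s 21 K)%N ->
  qv s K = proj (qv s) K (lstar s K) -> qv s K != 0 -> rmem s 8 K = dot (qv s K) (qv s K) ->
  0 < lco s K (imem s 22 K) ->
  (good -> 2 * enorm u < delta * (lco s K (imem s 22 K) * enorm (qv s K))) ->
  ((0 < imem s 30 0)%N -> u = 0) -> levst s K.
Proof.
move=> [B1 B2 B3 B4 [B5 B6 B7]] HS Hq Hq0 H8 Hco Hgood Hex s' [[S1 S2 S3] K2 K3 K4 K5] HG H27.
have Lc : (imem s 21 K <= cap)%N by clear -B1; lia.
have R3 i : (i < imem s 21 K)%N -> [/\ lrow s' K i = lrow s K i, la s' K i = la s K i & lb s' K i = lb s K i].
  by move=> Hi; apply: S3; exact: leq_trans Hi Lc.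
have Hst : lstar s' K = lstar s K by rewrite /Submission.lstar K2; have [-> _ _] := R3 _ HS.
have Hp x : proj (qv s') K x = proj (qv s) K x by apply: eq_proj => l Hl; rewrite K5 // ltnW.
have Hcle i : (i < imem s 21 K)%N -> lco s K i <= lco s' K i.
  move=> Hi; rewrite !lcoE; have [_ -> ->] := R3 i Hi; have [b0 _] := B3 i Hi.
  by rewrite lerD2l lerN2 ler_wpM2r.
have Elu : lu n s' K = u.
  rewrite /lu S1 S2 H27 Hp -B5 projB projZ scalerBr scalerA.
  have -> : mix (imem s 21 K) (lco s' K) (fun i => proj (qv s') K (lrow s' K i)) =
     mix (imem s 21 K) (fun i => la s K i - rmem s' 32 0 * lb s K i) (fun i => proj (qv s) K (lrow s K i)).
    apply: eq_mix => i Hi; have [E1 E2 E3] := R3 i Hi; first by rewrite lcoE E2 E3.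
    by rewrite Hp E1.
  rewrite mixB mixZ B6 scalerA [_ * rmem s 39 K]mulrC.
  by set X := mix _ _ _; apply/rowP => j; rewrite !mxE; ring.
split; rewrite ?S1 ?K2 ?K3 ?S2 ?K4 //.
- by move=> i Hi; have [-> _ _] := R3 i Hi; exact: B2.
- by rewrite K5 // Hst Hp.
- by rewrite K5.
- by rewrite K5.
- by move=> i Hi; apply: le_trans (Hcle i Hi); have [] := B3 i Hi.
- exact: lt_le_trans (Hcle _ HS).
- move=> /Hgood H; rewrite Elu K5 //; apply: lt_le_trans H _.
  by rewrite ler_wpM2l ?(ltW dgt0) // ler_wpM2r ?enorm_ge0 // Hcle.
- by rewrite Elu.
Qed.

(* Half of the mass of the certificate is carried by the rows of the level,
   hence the chosen row has weight at least 1 / (8 n^2). *)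
Lemma star_weight u s K q' L : built rows c d K q' u s -> enorm u < eps ->
  imem s 21 K = L -> 
  let S := \sum_(i < L) lco s K i * norm1 (proj q' K (lrow s K i)) in
  0 < S /\ forall co (x : 'rV[R]_n), 0 <= co -> S <= L%:R * (co * norm1 x) ->
    [/\ 0 < co, x != 0 & good -> 2 * enorm u < delta * (co * enorm x)].
Proof.
move=> [B1 B2 B3 B4 [B5 B6 B7]] Hu EL S; rewrite EL in B1 B7.
have nu : norm1 u <= 4%:R^-1.
  apply: le_trans (norm1_enorm u) _; apply: le_trans neps; rewrite ler_wpM2l //; exact: ltW.
have S38 : 3%:R / 8%:R <= S by move: B7 nu; rewrite -/S; lra.
have S0 : 0 < S by apply: lt_le_trans S38; lra.
split=> // co x co0 HS.
have n1 : 1 <= n%:R :> R by rewrite (ler_nat _ 1).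
have co1 : 0 < co.
  rewrite lt_neqAle co0 andbT; apply/eqP => E; move: HS; rewrite -E mul0r mulr0.
  by rewrite leNgt S0.
have x0 : x != 0.
  by apply/eqP => E; move: HS; rewrite E norm10 !mulr0 leNgt S0.
split=> // Hg.
have w0 : 0 <= co * enorm x by rewrite mulr_ge0 // enorm_ge0.
set w := co * enorm x in w0 *.
have H1 : 3%:R / 8%:R <= 3%:R * n%:R * (n%:R * w).
  apply: le_trans S38 _; apply: le_trans HS _.
  apply: (@le_trans _ _ (L%:R * (n%:R * w))).
    rewrite ler_wpM2l // /w mulrCA ler_wpM2l // norm1_enorm //.
  apply: ler_wpM2r; first exact: mulr_ge0.
  by rewrite -[3%:R * _]natrM ler_nat; clear -B1 n0; lia.
have H2 : 1 <= 8%:R * n%:R ^+ 2 * w.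
  by move: H1; rewrite expr2; set y := n%:R * (n%:R * w) => H1;
    rewrite (_ : 8%:R * _ * w = 8%:R * y); [move: H1; rewrite -mulrA -/y; lra | rewrite /y; ring].
have : 2 * eps <= 16%:R * n%:R ^+ 2 * eps * w.
  rewrite (_ : 16%:R * _ * _ * w = 2 * eps * (8%:R * n%:R ^+ 2 * w)); last by ring.
  by rewrite -[leLHS]mulr1 ler_wpM2l // mulr_ge0 // ltW.
have wp : 0 < w by rewrite mulr_gt0 // enorm_gt0.
move=> H3; apply: (@lt_trans _ _ (2 * eps)); first by rewrite ltr_pM2l.
by apply: le_lt_trans H3 _; rewrite ltr_pM2r.
Qed.

(** The last clause is the basis of the exact mode: with [d = 0] and [- c] a row, every logged
    vector is a projected row, and the lower bound by delta applies to the whole certificate. *)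
Definition dirok s :=
  [/\ (imem s 24 0 <= n)%N, forall i, (i < imem s 24 0)%N -> rows (di s i) /\ 0 <= rmem s 26 i,
      d = mix (imem s 24 0) (rmem s 26) (di s)
    & (0 < imem s 30 0)%N -> d = 0 /\ rows (- c)].

Definition starok s l := [/\ qv s l = proj (qv s) l (lstar s l), qv s l != 0,
  rmem s 8 l = dot (qv s l) (qv s l), rows (lstar s l) & (imem s 22 l < cap)%N].

Definition CI := [:: 3; 4; 5; 6; 7; 10; 11; 12; 16; 17; 18; 19; 20; 21; 22; 27]%N.
Definition CR := [:: 5; 6; 7; 8; 9; 10; 11; 12; 13; 14; 15; 16; 17; 36; 37; 38; 39; 40; 46; 47; 49]%N.

Lemma LCERT_spec s K m N :
  imem s 1 0 = n -> imem s 2 0 = n.+1 -> imem s 28 0 = cap -> imem s 11 0 = K ->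
  imem s 12 0 = 0%N -> imem s 14 0 = m -> imem s (shift 0) 1 = N -> (K <= n)%N ->
  (forall l, (l < K)%N -> starok s l) ->
  dirok s -> certok s m -> logok rows c d K (qv s) s m ->
  wp orc LCERT s (fun s' t q0 => agree CI CR s s' /\
    [/\ (t <= 700 * x2 * N + 100 * x2 * m + 2000 * x3)%N, q0 = 0%N
      & [/\ imem s' 12 0 = 0%N, imem s' 11 0 = K.+1,
            forall l, (l < K)%N -> lkeep l s s', starok s' K & levst s' K] \/
        [/\ imem s' 12 0 = 3%N, (0 < imem s 30 0)%N & ~ good]]).
Proof.
move=> Hn Hn1 Hcap HK Hst Hm HN Kn Hstar [nIn HDI Hd Hex] [_ HC1 HC2 HC3] Hlog.
rewrite HN in HC1 HC2 HC3.
apply: wp_agreeS => //.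
have Hgs : gs (qv s) (lstar s) K by move=> l Hl; have [] := Hstar l Hl.
set cv := fun j => vec_at s n (shift 2) (j * n) in HC1 HC2 HC3.
set b := rmem s (shift 3) in HC1 HC2 HC3.
apply: wp_seq; apply: wp_conseq (@LIFT_spec R n orc s N Hn Hn1 HN) _.
move=> s1 t1 q1 [A1 [Ht1 -> E16 HW]].
have b0 i : (i < N)%N -> 0 <= rmem s1 11 i.
  by move=> Hi; have [_ _ ->] := HW i Hi; apply: ltW; have [] := HC1 i Hi.
apply: wp_seq; apply: wp_conseq (@CARA_spec R n orc s1 N _ E16 b0) _; first by fr A1.
move=> s2 t2 q2 [A2 [Ht2 -> HC]].
have A02 : agree [:: 3; 5; 6; 16; 17; 18; 19; 20] [:: 9; 10; 11; 12; 13; 14; 15; 16; 17; 49] s s2.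
  by apply: agree_norm (agree_trans A1 A2) _.
have W2 : wv s2 = wv s1 by apply: wv_eq; fr A2.
have B2 : rmem s2 11 = rmem s1 11 by exact: (proj2 A2 11 isT).
have rn : (imem s2 17 0 <= n.+1)%N := cara_size HC.
set r := imem s2 17 0 in rn *.
have Hidx k : (k < r)%N -> (imem s2 18 k < N)%N by exact: (cara_lt HC).
have Hlo k : (k < N)%N -> lo (wv s2 k) = cv k by move=> Hk; rewrite W2; have [] := HW k Hk.
have Hmix : mix N (rmem s2 11) (wv s2) = mix N b (wv s1).
  by apply: eq_mix => i Hi; rewrite ?W2 // B2; have [] := HW i Hi.
have Hlomix : lo (mix N (rmem s2 11) (wv s2)) = mix N b cv.
  by rewrite Hmix lo_mix; apply: eq_mix => // i Hi; rewrite -W2 Hlo.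
have Htop : 1 <= (mix N (rmem s2 11) (wv s2)) 0 ord_max.
  rewrite Hmix top_mix; apply: le_trans HC3 _.
  by rewrite le_eqVlt; apply/orP; left; apply/eqP; apply: eq_bigr => i _; have [_ -> _] := HW i (ltn_ord i).
set v := fun k => lo (wv s2 (imem s2 18 k)).
have Hvtop k : (k < r)%N -> wv s2 (imem s2 18 k) 0 ord_max = norm1 (v k).
  move=> Hk; rewrite /v Hlo ?Hidx //; rewrite W2; by have [_ -> _] := HW _ (Hidx k Hk).
have topE a : (mix r a (fun k => wv s2 (imem s2 18 k))) 0 ord_max = \sum_(k < r) a k * norm1 (v k).
  by rewrite top_mix; apply: eq_bigr => k _; rewrite Hvtop.
pose Post a := [/\ forall k, (k < r)%N -> 0 <= a k, 1 <= \sum_(k < r) a k * norm1 (v k),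
  enorm (mix r a v) < eps & (0 < imem s 30 0)%N -> mix r a v = 0].
have E30 : imem s2 30 0 = imem s 30 0 by fr A02.
have E12 : imem s2 12 0 = 0%N by fr A02.
apply: wp_seq; apply: (@wp_conseq _ _ _ _ _ (fun s3 t3 q3 =>
    agree [:: 3; 5; 12] [:: 13; 14; 15; 16] s2 s3 /\
    [/\ (t3 <= 200 * x2 + 10)%N, q3 = 0%N &
     (imem s3 12 0 = 0%N /\ Post (rmem s3 16)) \/
     [/\ imem s3 12 0 = 3%N, (0 < imem s 30 0)%N & ~ good]])).
  apply: wp_agreeS => //; apply: wp_if.
  rewrite [beval _ _](_ : _ = (0 < imem s 30 0)%N); last by rewrite -E30.
  case: ifPn => Hx; last first.
    apply: wp_skip; split=> //; left; split=> //; split.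
    + exact: (cara_ge0 HC).
    + by rewrite -topE (cara_sum HC).
    + by rewrite /v -lo_mix (cara_sum HC) Hlomix.
    + by rewrite (negbTE Hx).
  apply: wp_conseq (@EXACT_spec R n orc s2 N _ _ E12 HC) _; [by fr A02|by fr A02|].
  move=> s3 t3 q3 [_ [Ht3 -> H12 Hgood H0]]; split; [by rewrite /=; clear -Ht3; lia|by []|].
  have [d0 Rc] := Hex Hx.
  case: H12 => H12; [left|right]; split=> //.
    have [He Hpos] := H0 H12.
    have Z : mix r (rmem s3 16) v = 0 by rewrite /v -lo_mix -He lo_etop.
    split=> //; last by rewrite Z enorm0.
    by rewrite -topE -He top_etop.
  move=> Hg; suff : imem s3 12 0 = 0%N by rewrite H12.
  apply: Hgood.
  apply: (@exact_relation R n delta (wv s2) (rmem s2 11) N r (imem s2 18) (rmem s2 16)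
    (gv n s2) (fun x => exists2 m0, rows m0 & x = proj (qv s) K m0 \/ x = - proj (qv s) K m0)) => //.
  + apply: (proj_lower_bounded Hgs) => //; last exact: ltW.
    by move=> l Hl; have [] := Hstar l Hl.
  + move=> i Hi; rewrite Hlo // W2; have [_ -> _] := HW i Hi; split=> //.
    have [[e He Ee] _] := HC1 i Hi.
    rewrite /cv -Ee; case: (Hlog e He) => -[_ H1 H2].
      by exists (vec_at s n 20 (e * n)) => //; left.
    by exists (- c) => //; left; rewrite H2 d0 scaler0 subr0 projN.
  (* [(n + 1) n <= 16 n^2], so [good] also covers the smallness required by [exact_relation]. *)
  + rewrite Hlomix; apply: le_lt_trans Hg.
    apply: (@le_trans _ _ (n.+1%:R * n%:R * eps)).
      by rewrite ler_wpM2l ?mulr_ge0 // ltW.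
    rewrite ler_wpM2r ?(ltW eps0) // expr2 mulrA ler_wpM2r // -[16%:R * _]natrM ler_nat.
    by clear -n0; lia.
move=> s3 t3 q3 [A23 [Ht3 -> Hres]].
have A03 : agree [:: 3; 5; 6; 12; 16; 17; 18; 19; 20] [:: 9; 10; 11; 12; 13; 14; 15; 16; 17; 49] s s3.
  by apply: agree_norm (agree_trans A02 A23) _.
have xx : (n.+1 <= x2)%N by rewrite leq_pmulr.
have xxx : (x2 <= x3)%N by rewrite leq_pmulr.
have Hcost z : (z <= 100 * x2 * m + 1300 * x3)%N -> (t1 + (t2 + (t3 + (z + 5))) <= 700 * x2 * N + 100 * x2 * m + 2000 * x3)%N.
  have : (80 * n.+1 * N <= 80 * x2 * N)%N by rewrite leq_mul2r leq_mul2l xx !orbT.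
  move: Ht1 Ht2 Ht3 xx xxx; clear.
  rewrite -!mulnA; set y1 := (n.+1 * N)%N; set y2 := (n.+1 * (n.+1 * N))%N; set y3 := (n.+1 * (n.+1 * m))%N.
  set y4 := (n.+1 * (n.+1 * n.+1))%N; set y5 := (n.+1 * n.+1)%N; lia.
apply: wp_if; case: Hres => [[S3 [P1 P2 P3 P4]]|[S3 Hx Hg]]; last first.
  rewrite [beval _ _](_ : _ = false); last by rewrite /= S3.
  apply: wp_skip; split; [|by []|by right].
  by move: (Hcost 0%N (leq0n _)); rewrite /=; clear; lia.
rewrite [beval _ _](_ : _ = true); last by rewrite /= S3.
have F a : a \notin [:: 3; 5; 6; 12; 16; 17; 18; 19; 20]%N -> imem s3 a = imem s a by exact: (proj1 A03).
have Fr a : a \notin [:: 9; 10; 11; 12; 13; 14; 15; 16; 17; 49]%N -> rmem s3 a = rmem s a by exact: (proj2 A03).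
have Q3 : qv s3 = qv s by apply/funext => l; apply: vec_at_eq; fr A03.
have D3 : di s3 = di s by apply/funext => l; apply: vec_at_eq; fr A03.
have W3 : wv s3 = wv s2 by apply: wv_eq; fr A23.
have I18 : imem s3 18 = imem s2 18 by fr A23.
have I17 : imem s3 17 0 = r by fr A23.
have Ev k : lo (wv s3 (imem s3 18 k)) = v k by rewrite W3 I18.
have Evm a : mix r a (fun k => lo (wv s3 (imem s3 18 k))) = mix r a v by apply: eq_mix.
have V3 a o : a \notin [:: 9; 10; 11; 12; 13; 14; 15; 16; 17; 49]%N -> vec_at s3 n a o = vec_at s n a o.
  by move=> Ha; apply: vec_at_eq; exact: Fr.
have Hbuild : wp orc LBUILD s3 (fun s' t q0 =>
    agree [:: 3; 6; 7; 21; 27] [:: 9; 36; 37; 38; 39; 40] s3 s' /\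
    [/\ (t <= 100 * x2 * m + 500 * x2)%N, q0 = 0%N,
        forall l, l != K -> lsame s3 s' l & built rows c d K (qv s) (mix r (rmem s3 16) v) s']).
  rewrite -(Evm (rmem s3 16)); apply: (@LBUILD_spec R n orc rows c d K (qv s) s3 m r (imem s3 24 0)) => //.
  + by rewrite F.
  + by rewrite F.
  + by rewrite F.
  + by rewrite F.
  + by rewrite F.
  + move=> k Hk; rewrite Ev /v Hlo ?Hidx //; have [[e He Ee] _] := HC1 _ (Hidx k Hk).
    by exists e => //; rewrite V3.
  + by move=> e He; rewrite !Fr // !F // !V3 //; exact: Hlog.
  + by rewrite F.
  + by rewrite F // D3 Fr.
  + by rewrite F // D3 Fr.
  + by rewrite (eq_bigr (fun k : 'I_r => rmem s3 16 k * norm1 (v k))) // => k _; rewrite Ev.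
apply: wp_seq; apply: wp_conseq Hbuild _ => s4 t4 q4 [A34 [Ht4 -> SL HB]].
set u := mix r (rmem s3 16) v in P3 P4 HB.
have A04 : agree [:: 3; 5; 6; 7; 12; 16; 17; 18; 19; 20; 21; 27]
    [:: 9; 10; 11; 12; 13; 14; 15; 16; 17; 36; 37; 38; 39; 40; 49] s s4.
  by apply: agree_norm (agree_trans A03 A34) _.
have Q4 : qv s4 = qv s by rewrite -Q3; apply/funext => l; apply: vec_at_eq; fr A34.
have [S0 Hw] := star_weight HB P3 (erefl _).
have [L1 B2' B3 B4 B5] := HB.
have E4 l : (l < K)%N -> rmem s4 8 l = dot (qv s4 l) (qv s4 l).
  by move=> Hl; rewrite Q4 (proj2 A04 8 isT); have [] := Hstar l Hl.
apply: wp_conseq (@STAR_spec R n orc s4 K (imem s4 21 K) _ _ _ Kn erefl L1 E4 _) _.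
- by fr A04.
- by fr A04.
- by fr A04.
- by rewrite Q4.
move=> s5 t5 q5 [A45 [Ht5 -> E11 Hoth [K1 K2 K3 K4]]]; rewrite Q4 in K2 K4.
have Q5 l : l != K -> qv s5 l = qv s l by move=> Hl; have [_ _ ->] := Hoth l Hl; rewrite Q4.
have HB5 : built rows c d K (qv s5) u s5.
  have Ep x : proj (qv s5) K x = proj (qv s) K x by apply: eq_proj => l Hl; rewrite Q5 // (ltn_eqF Hl).
  rewrite /built (proj1 A45 21 isT) (proj2 A45 39 isT).
  have Er : lrow s5 K = lrow s4 K by apply/funext => j; apply: vec_at_eq; fr A45.
  have Ea : la s5 K = la s4 K by rewrite /Submission.la; fr A45.
  have Eb : lb s5 K = lb s4 K by rewrite /Submission.lb; fr A45.
  have Ec : lco s5 K = lco s4 K by apply/funext => j; rewrite !lcoE Ea Eb; fr A45.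
  rewrite Er Ea Eb Ec !Ep.
  have EP : (fun i => proj (qv s5) K (lrow s4 K i)) = (fun i => proj (qv s) K (lrow s4 K i)).
    by apply/funext => i; rewrite Ep.
  rewrite EP; move: HB; rewrite /built => -[X1 X2 X3 X4 [X5 X6 X7]]; split=> //; split=> //.
  by rewrite (eq_bigr (fun i : 'I_(imem s4 21 K) => lco s4 K i * norm1 (proj (qv s) K (lrow s4 K i)))) // => i _; rewrite Ep.
have Elst : lstar s5 K = lrow s4 K (imem s5 22 K) by rewrite /Submission.lstar; apply: vec_at_eq; fr A45.
have Elco : lco s5 K = lco s4 K by apply/funext => j; rewrite /Submission.lco; fr A45.
have co0 : 0 <= lco s4 K (imem s5 22 K) by have [] := B3 _ K1.
have [C1 C2 C3] := Hw _ _ co0 K4.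
have Sk : starok s5 K.
  split=> //; first by rewrite K2 Elst; apply: eq_proj => l Hl; rewrite Q5 // (ltn_eqF Hl).
    by rewrite K2.
    by rewrite Elst; exact: B2'.
  by clear -K1 L1; lia.
split.
- rewrite [(bcost _ + _)%N]/=; have := @Hcost (t4 + t5)%N; move: Ht4 Ht5 xxx; clear; lia.
- by [].
left; split=> //.
- by rewrite (proj1 A45 12 isT) (proj1 A34 12 isT).
- move=> l Hl; have ne : l != K by rewrite (ltn_eqF Hl).
  split.
  + have S03 : lsame s s3 l by apply: lsame_eq; fr A03.
    have S45 : lsame s4 s5 l by apply: lsame_eq; fr A45.
    exact: (lsame_trans (lsame_trans S03 (SL l ne)) S45).
  + by have [-> _ _] := Hoth l ne; fr A04.
  + by have [_ -> _] := Hoth l ne; fr A04.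
  + by rewrite (proj1 A45 30 isT) (proj1 A04 30 isT).
  + by move=> l' Hl'; rewrite Q5 // (ltn_eqF (leq_ltn_trans Hl' Hl)).
- case: Sk => Sk1 Sk2 Sk3 Sk4 Sk5.
  apply: (built_levst HB5) => //; rewrite ?Elco //.
  + by rewrite (proj1 A45 21 isT).
  + by rewrite K2.
  + by rewrite (proj1 A45 30 isT) (proj1 A04 30 isT).
Qed.

Lemma lagree_lkeep li lr s s' l : lagree li lr s s' ->
  all (fun a => a \notin li) [:: 21; 22; 30] ->
  all (fun a => a \notin lr) [:: 7; 8; 36; 37; 38; 39] -> lkeep l s s'.
Proof.
move=> H /and4P[i1 i2 i3 _] /and5P[r1 r2 r3 r4 /and3P[r5 r6 _]].
have I a : (a < 100)%N -> a \notin li -> imem s' a = imem s a by move=> Ha; exact: (proj1 (H a Ha)).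
have F a : (a < 100)%N -> a \notin lr -> rmem s' a = rmem s a by move=> Ha; exact: (proj2 (H a Ha)).
split; rewrite ?I ?F //.
  by apply: lsame_eq; rewrite ?I ?F.
by move=> l' _; apply: vec_at_eq; exact: F.
Qed.

Lemma starok_keep s s' l : lkeep l s s' -> starok s l -> starok s' l.
Proof.
move=> [[S1 S2 S3] K2 K3 K4 K5] [H1 H2 H3 H4 H5].
have Est : lstar s' l = lstar s l by rewrite /Submission.lstar K2; have [-> _ _] := S3 _ H5.
split; rewrite ?Est ?K2 ?K3 ?(K5 l) //.
by rewrite {1}H1; apply: eq_proj => l' Hl'; rewrite K5 // ltnW.
Qed.

Definition dbase s := [/\ imem s 1 0 = n, imem s 2 0 = n.+1, imem s 28 0 = cap, Mpre s
  & [/\ vec_at s n 23 0 = c, vec_at s n 24 0 = d, dirok s & xfok Kset c d s]].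

Definition dinv s K := [/\ dbase s, rmem s 35 0 = eps, imem s 11 0 = K,
  forall l, (l < K)%N -> starok s l & forall l, (l < K)%N -> levst s l].

Lemma dinv_size s K : dinv s K -> (K <= n)%N.
Proof.
move=> [_ _ _ H _]; apply: (@gs_size R n (qv s) (lstar s)) => l Hl; by have [] := H l Hl.
Qed.

Lemma dbase_lagree li lr s s' : dbase s -> lagree li lr s s' ->
  all (fun a => a \notin li) [:: 1; 2; 24; 28; 29; 30] ->
  all (fun a => a \notin lr) [:: 23; 24; 25; 26] -> xfok Kset c d s' -> dbase s'.
Proof.
move=> [D1 D2 D3 D4 [D5 D6 [D7 D7' D8 D9] _]] H /and5P[i1 i2 i3 i4 /and3P[i5 i6 _]] /and5P[r1 r2 r3 r4 _] X.
have I a : (a < 100)%N -> a \notin li -> imem s' a = imem s a by move=> Ha; exact: (proj1 (H a Ha)).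
have F a : (a < 100)%N -> a \notin lr -> rmem s' a = rmem s a by move=> Ha; exact: (proj2 (H a Ha)).
have V a : (a < 100)%N -> a \notin lr -> vec_at s' n a 0 = vec_at s n a 0.
  by move=> *; apply: vec_at_eq; exact: F.
have ED : di s' = di s by apply/funext => j; apply: vec_at_eq; exact: F.
split; rewrite ?I //; first by apply: HMpre D4 _ _ _ _; rewrite ?I ?F.
by split; rewrite ?V // /dirok ?I // ED F.
Qed.

Lemma xfok_lagree li lr s s' : lagree li lr s s' ->
  all (fun a => a \notin lr) [:: 32; 33] -> xfok Kset c d s -> xfok Kset c d s'.
Proof.
move=> H /and3P[r1 r2 _].
have F a : (a < 100)%N -> a \notin lr -> rmem s' a = rmem s a by move=> Ha; exact: (proj2 (H a Ha)).
have V a : (a < 100)%N -> a \notin lr -> vec_at s' n a 0 = vec_at s n a 0.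
  by move=> *; apply: vec_at_eq; exact: F.
by rewrite /xfok F // V.
Qed.

Lemma dinv_lagree li lr s s' K : dinv s K -> lagree li lr s s' ->
  rmem s' 32 0 <= rmem s 32 0 ->
  all (fun a => a \notin li) [:: 1; 2; 11; 21; 22; 24; 28; 29; 30] ->
  all (fun a => a \notin lr) [:: 7; 8; 23; 24; 25; 26; 35; 36; 37; 38; 39] ->
  xfok Kset c d s' -> dinv s' K.
Proof.
move=> [B E35 HK Hstar Hlev] L' G' /and5P[i1 i2 i3 i4 /and5P[i5 i6 i7 i8 /andP[i9 _]]].
move=> /and5P[r1 r2 r3 r4 /and5P[r5 r6 r7 r8 /and4P[r9 r10 r11 _]]] X'.
have Kp l : lkeep l s s'.
  by apply: (lagree_lkeep l L'); rewrite /= ?i4 ?i5 ?i9 ?r1 ?r2 ?r8 ?r9 ?r10 ?r11.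
split.
- by apply: (dbase_lagree B L') X'; rewrite /= ?i1 ?i2 ?i6 ?i7 ?i8 ?i9 ?r3 ?r4 ?r5 ?r6.
- by rewrite (proj2 (L' 35%N isT) r7).
- by rewrite (proj1 (L' 11%N isT) i3).
- by move=> l Hl; apply: starok_keep (Kp l) (Hstar l Hl).
- by move=> l Hl; apply: levst_keep (Hlev l Hl) (Kp l) G'.
Qed.

(** The two bounds dominate the counts of an actual run, here on the whole space with an oracle
    accepting every point, and counts are nonnegative. *)
Lemma To_ge0 : 0 <= To n eps /\ 0 <= Ta n eps.
Proof.
pose o (x : 'rV[R]_n) : option 'rV[R]_n := None.
have Ho : conic_oracle (setT : set 'rV[R]_n) o by [].
have H0 : is_cone (setT : set 'rV[R]_n).
  by split=> // x y t _ _; rewrite inE.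
pose s0 : state R := State (fun _ _ => n) (fun _ _ => eps).
have [s0' [t [l [_ Hq Ht _]]]] := @HA n setT o eps s0 n0 H0 Ho eps0 erefl erefl.
by split; [apply: le_trans Hq | apply: le_trans Ht].
Qed.

Definition LI := [:: 3; 4; 5; 6; 7; 10; 11; 12; 13; 14; 15; 16; 17; 18; 19; 20; 21; 22; 26; 27]%N.
Definition LR := [:: 5; 6; 7; 8; 9; 10; 11; 12; 13; 14; 15; 16; 17; 18; 19; 20; 21; 22;
  27; 28; 29; 30; 31; 32; 33; 34; 36; 37; 38; 39; 40; 46; 47; 49]%N.

Definition stopok s := [/\ Kset (vec_at s n 34 0), dot d (vec_at s n 34 0) <= 0
  & exists g, dot (c - g *: d) (vec_at s n 34 0) < 0].

(** Of the [600 x2] operations per oracle call, 500 pay for answering the query and 100 for the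
    later searches in the log. *)
Lemma LEVEL_spec s K : dinv s K -> imem s 12 0 = 0%N ->
  wp orc (LEVEL A) s (fun s' t q0 => [/\ lagree LI LR s s', rmem s' 32 0 <= rmem s 32 0, dbase s'
    & [/\ q0%:R <= To n eps,
     t%:R <= Ta n eps + (600 * x2)%N%:R * To n eps + (700 * x2 * tau n)%N%:R + (3000 * x3)%N%:R
    & [\/ imem s' 12 0 = 0%N /\ dinv s' K.+1,
          [/\ imem s' 12 0 = 1%N, dinv s' K & proj (qv s') K (c - rmem s' 32 0 *: d) = 0],
          imem s' 12 0 = 2%N /\ stopok s'
        | [/\ imem s' 12 0 = 3%N, (0 < imem s 30 0)%N & ~ good]]]]).
Proof.
move=> D Hst; have Kn := dinv_size D.
have [B E35 HK Hstar Hlev] := D.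
have [Hn Hn1 Hcap HM [Hc Hd Hdir HX]] := B.
have Hgs : gs (qv s) (lstar s) K by move=> l Hl; have [] := Hstar l Hl.
have Hsym := proj_adj Hgs; have Hidem x := proj_idem x Hgs.
have [To0 Ta0] := To_ge0.
set G := rmem s 32 0.
have H8 l : (l < K)%N -> rmem s 8 l = dot (qv s l) (qv s l) by move=> Hl; have [] := Hstar l Hl.
apply: wp_seq; apply: wp_conseq (LVEC_spec orc HMpre Hn HK Kn HM Hc Hd H8) _.
move=> s1 t1 q1 [A1 [Ht1 -> C1 E46]]; rewrite -/G in C1 E46.
set cs := proj (qv s) K (c - G *: d) in E46.
have L1 := agree_lagree A1.
have X1 : xfok Kset c d s1 by apply: xfok_lagree L1 _ HX.
have G1 : rmem s1 32 0 = G by rewrite (proj2 A1 32 isT).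
apply: wp_if; rewrite [beval _ _](_ : _ = (cs == 0)); last first.
  by rewrite /= E46 -dotvv_eq0 eq_le dotvv_ge0 andbT.
have dinvK li lr s' : lagree li lr s s' -> rmem s' 32 0 <= G ->
    all (fun a => a \notin li) [:: 1; 2; 11; 21; 22; 24; 28; 29; 30] ->
    all (fun a => a \notin lr) [:: 7; 8; 23; 24; 25; 26; 35; 36; 37; 38; 39] ->
    xfok Kset c d s' -> dbase s' /\ dinv s' K.
  by move=> L' G' i r X'; have H := dinv_lagree D L' G' i r X'; split=> //; case: H.
case: eqP => Hcs.
  apply: wp_iset; set s2 := setI _ _ _ _.
  have A2 : agree [:: 3; 4; 10; 12] [:: 5; 6; 9; 27; 28; 29; 30; 31; 46] s s2.
    by apply: agree_norm (agree_trans A1 (setI_agree s1 12 0 1)) _.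
  have L2 := agree_lagree A2.
  have G2 : rmem s2 32 0 <= G by rewrite [rmem s2 32 0]G1.
  have [B2 D2] := dinvK _ _ s2 L2 G2 isT isT (xfok_lagree L2 isT HX).
  split=> //.
  - exact: lagree_sub L2 _.
  split=> //.
    apply: (@le_trans _ _ (3000 * x3)%N%:R).
      rewrite ler_nat; have xxx : (x2 <= x3)%N by rewrite leq_pmulr.
      by move: Ht1 xxx; rewrite /=; clear; lia.
    move: (600 * x2)%N (700 * x2 * tau n)%N (3000 * x3)%N => a1 a2 a3.
    by rewrite lerDr !addr_ge0 // mulr_ge0.
  apply: Or42; split=> //.
  rewrite [rmem s2 32 0]G1 -/cs -Hcs; apply: eq_proj => l _.
  by apply: vec_at_eq; exact: (proj2 A2 7 isT).
have cs0 : cs != 0 by apply/eqP.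
have E351 : rmem s1 35 0 = eps by rewrite (proj2 A1 35 isT).
have C1' := C1; rewrite -G1 in C1'; rewrite /cs -G1 in cs0.
apply: wp_seq; apply: wp_conseq (LCALL_spec C1' Kn Hsym Hidem cs0 X1 E351) _; rewrite G1.
move=> s2 t2 q2 [m [Hq2 Ht2 Hm [C2 D2 L12 E14] [Hlog G2 Hcert]]].
have L2 : lagree (3 :: 4 :: 6 :: 10 :: [:: 13; 14; 15; 26])%N
   ([:: 27; 28; 29; 30; 31] ++ QR)%N s s2 by apply: lagree_comp L1 L12 _.
have [D1' X2 D3' D4' D5'] := D2.
have [B2 DK2] := dinvK _ _ s2 L2 G2 isT isT X2.
have S12 : imem s2 12 0 = 0%N by rewrite (proj1 (L2 12 isT) isT).
have Q2 : qv s2 = qv s by apply/funext => l; apply: vec_at_eq; exact: (proj2 (L2 7 isT) isT).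
have Hn2 : imem s2 1 0 = n by case: B2.
have tauE : (imem s2 (shift 0) 1 <= tau n)%N by case: Hcert.
have Hcost z (T := (600 * x2)%N) : (z <= 700 * x2 * imem s2 (shift 0) 1 + 100 * x2 * m + 2500 * x3)%N ->
   (t1 + (bcost (BLeR (RGet 46 (ICst 0)) (RCst 0)) + (t2 + (bcost (BLeI $13 (ICst 0)) + z))))%N%:R <=
   Ta n eps + T%:R * To n eps + (700 * x2 * tau n)%N%:R + (3000 * x3)%N%:R.
  move=> Hz; have xxx : (x2 <= x3)%N by rewrite leq_pmulr.
  have xx0 : (0 < x3)%N by [].
  have Hz' : (t1 + (bcost (BLeR (RGet 46 (ICst 0)) (RCst 0)) + (t2 + (bcost (BLeI $13 (ICst 0)) + z))) <=
      t2 + 100 * x2 * m + 700 * x2 * tau n + 3000 * x3)%N.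
    have : (700 * x2 * imem s2 (shift 0) 1 <= 700 * x2 * tau n)%N by rewrite leq_mul2l tauE orbT.
    by move: Ht1 Hz xxx xx0; rewrite /=; clear; lia.
  apply: (@le_trans _ _ (t2 + 100 * x2 * m + 700 * x2 * tau n + 3000 * x3)%N%:R); first by rewrite ler_nat.
  have -> : T = (500 * x2 + 100 * x2)%N by rewrite /T -mulnDl.
  move: Ht2; move: (500 * x2)%N (100 * x2)%N (700 * x2 * tau n)%N (3000 * x3)%N => a1 a2 a3 a4 Ht2.
  rewrite !natrD natrM mulrDl [_ + (_ + _)]addrA !lerD2r lerD //.
  by rewrite ler_wpM2l.
apply: wp_if; rewrite [beval _ _](_ : _ = (imem s2 13 0 == 0)%N); last by rewrite /= leqn0.
case: eqP => H13; last first.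
  apply: wp_if; rewrite [beval _ _](_ : _ = (imem s2 13 0 <= 1)%N) //.
  case: (leqP (imem s2 13 0) 1) => H13'; apply: wp_iset; set s3 := setI _ _ _ _.
    have A3 : agree [:: 12] [::] s2 s3 by exact: setI_agree.
    have L3 : lagree (3 :: 4 :: 6 :: 10 :: [:: 12; 13; 14; 15; 26])%N
       ([:: 27; 28; 29; 30; 31] ++ QR)%N s s3 by apply: lagree_comp L2 (agree_lagree A3) _.
    have [B3 D3] := dinvK _ _ s3 L3 G2 isT isT X2.
    split=> //; first by apply: lagree_comp L2 (agree_lagree A3) _.
    split; [by rewrite /= !addn0| |].
      by apply: Hcost; rewrite /=; have xx0 : (0 < x3)%N by []; move: xx0; clear; lia.
    apply: Or42; split=> //.
    have H1 : imem s2 13 0 = 1%N by move/eqP: H13; rewrite -lt0n; clear -H13'; lia.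
    by rewrite -(D4' H1); apply: eq_proj => l _; rewrite -Q2.
  have A3 : agree [:: 12] [::] s2 s3 by exact: setI_agree.
  split=> //; first by apply: lagree_comp L2 (agree_lagree A3) _.
    by apply: (dbase_lagree B2 (agree_lagree A3)).
  split; [by rewrite /= !addn0| |].
    by apply: Hcost; rewrite /=; have xx0 : (0 < x3)%N by []; move: xx0; clear; lia.
  apply: Or43; split=> //; have [F1 F2 F3] := D5' H13'.
  by split=> //; exists G.
have [DB2 DE DK DS DL] := DK2.
have [_ _ _ _ [_ _ Hdir2 _]] := B2.
have Hcap2 : imem s2 28 0 = cap by case: B2.
have Hn12 : imem s2 2 0 = n.+1 by case: B2.
have Hlog2 := Hlog H13; rewrite -Q2 in Hlog2.
apply: wp_conseq (LCERT_spec Hn2 Hn12 Hcap2 DK S12 E14 erefl Kn DS Hdir2 Hcert Hlog2) _.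
move=> s3 t3 q3 [A3 [Ht3 -> Hres]].
have L3 := agree_lagree A3.
have G3 : rmem s3 32 0 = rmem s2 32 0 by rewrite (proj2 A3 32 isT).
have X3 : xfok Kset c d s3 by apply: xfok_lagree L3 _ X2.
have B3 : dbase s3 by apply: (dbase_lagree B2 L3).
split=> //.
- by apply: lagree_comp L2 L3 _.
- by rewrite G3.
split; [by rewrite /= !addn0| |].
  apply: Hcost; move: Ht3; clear; lia.
case: Hres => [[R1 R2 R3 R4 R5]|[R1 R2 R3]]; [apply: Or41|apply: Or44]; split=> //.
- split=> //.
  + by rewrite (proj2 A3 35 isT).
  + move=> l; rewrite ltnS leq_eqVlt => /orP[/eqP->//|Hl].
    exact: starok_keep (R3 l Hl) (DS l Hl).
  + move=> l; rewrite ltnS leq_eqVlt => /orP[/eqP->//|Hl].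
    by apply: levst_keep (DL l Hl) (R3 l Hl) _; rewrite G3.
- by rewrite -(proj1 (L2 30 isT) isT).
Qed.

End Level.

(** * Phases *)

Definition DESCENT (A : cmd) : cmd :=
  ISet 11 (ICst 0) (ICst 0) ;; ISet 12 (ICst 0) (ICst 0) ;;
  For 41 $2 (If (BLeI $12 (ICst 0)) (LEVEL A) Skip).

Definition PHASE (A : cmd) : cmd :=
  DESCENT A ;; If (ieqb $12 (ICst 1)) ASCENT Skip.

(** [n] is an index and only literals become reals, so it is rebuilt as a sum of ones. The first
    eps, [1 / (4 n)], makes the 1-norm of every residual at most 1/4, as needed for the weight of
    the starred row; squaring keeps it so. *)
Definition CORE (A : cmd) : cmd :=
  VSum 3 $1 35 (RCst 1) ;;
  RSet 35 (ICst 0) (RCst 1 /r (RCst 4 *r RGet 35 (ICst 0))) ;;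
  ISet 31 (ICst 0) (ICst 0) ;;
  While (BLeI $31 (ICst 0))
    (PHASE A ;; If (BLeI $12 (ICst 2)) (ISet 31 (ICst 0) (ICst 1)) Skip ;;
     RSet 35 (ICst 0) (RGet 35 (ICst 0) *r RGet 35 (ICst 0))).

Section RealBounds.
Variables (R : realType) (n : nat) (orc : nat -> 'rV[R]_n -> answer R n).
Implicit Types (s : state R).

(** The costs of [A] are real functions while [wp_for_gen] counts in naturals; truncation loses
    nothing since the counts are naturals. *)
Lemma wp_forR (Inv : nat -> state R -> Prop) N (T q : R) v e body s
    (Q : state R -> nat -> nat -> Prop) : 0 <= T -> 0 <= q ->
  Inv 0%N (setI s v 0 0) ->
  (forall i s1, (i <= N)%N -> Inv i s1 -> ieval s1 e = N /\ imem s1 v 0 = i) ->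
  (forall i s1, (i < N)%N -> Inv i s1 ->
    wp orc body s1 (fun s2 t l => [/\ t%:R <= T, l%:R <= q, imem s2 v 0 = i
       & Inv i.+1 (setI s2 v 0 i.+1)])) ->
  (forall s2 t l, t%:R <= N%:R * (T + (icost e + 2)%:R) + (icost e + 1)%:R ->
     l%:R <= N%:R * q -> Inv N s2 -> Q s2 t l) ->
  wp orc (For v e body) s Q.
Proof.
move=> T0 q0 H0 H1 H2 H3.
apply: (@wp_for_gen _ _ _ Inv N (Num.truncn T) (Num.truncn q) v e body s Q H0 H1) => [i s1 Hi HI|s2 t l Ht Hl HI].
  by apply: wp_conseq (H2 i s1 Hi HI) _ => s2 t l [? ? ? ?]; rewrite !truncn_ge_nat.
apply: H3 => //.
  move: Ht; rewrite -(ler_nat R) => /le_trans; apply.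
  rewrite -addnA -[X in (_ * (X))%N]addnA natrD natrM lerD2r ler_wpM2l // natrD lerD2r.
  by rewrite truncn_le.
move: Hl; rewrite -(ler_nat R) natrM => /le_trans; apply.
by rewrite ler_wpM2l // truncn_le.
Qed.

(** The bounds depend on the iteration because each phase has its own eps. The loop must exit by
    iteration [p]; an earlier exit is covered by the full sums since their terms are nonnegative. *)
Lemma wp_while (Inv : nat -> state R -> Prop) (Post : state R -> Prop) (T q : nat -> R) p b body s :
  (forall i, 0 <= T i) -> (forall i, 0 <= q i) ->
  Inv 0%N s ->
  (forall i s1, (i <= p)%N -> Inv i s1 -> beval s1 b /\
    wp orc body s1 (fun s2 t l => [/\ t%:R <= T i, l%:R <= q i
       & (if beval s2 b then Inv i.+1 s2 /\ (i < p)%N else Post s2)])) ->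
  wp orc (While b body) s (fun s2 t l =>
    [/\ t%:R <= \sum_(i < p.+1) (T i + (bcost b)%:R) + (bcost b)%:R,
        l%:R <= \sum_(i < p.+1) q i & Post s2]).
Proof.
move=> T0 q0 H0 H.
suff main m : forall i s1, (i <= p)%N -> (p - i < m)%N -> Inv i s1 ->
    wp orc (While b body) s1 (fun s2 t l =>
    [/\ t%:R <= \sum_(i <= j < p.+1) (T j + (bcost b)%:R) + (bcost b)%:R,
        l%:R <= \sum_(i <= j < p.+1) q j & Post s2]).
  by have := main p.+1 0%N s (leq0n p) (leq_subr _ _) H0; rewrite !big_mkord.
elim: m => [//|m IH] i s1 ip im HI.
have [Hb [s2 [t [l [He [Ht Hl Hres]]]]]] := H i s1 ip HI.
have -> : \sum_(i <= j < p.+1) (T j + (bcost b)%:R) =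
      T i + (bcost b)%:R + \sum_(i.+1 <= j < p.+1) (T j + (bcost b)%:R) by rewrite big_ltn.
have -> : \sum_(i <= j < p.+1) q j = q i + \sum_(i.+1 <= j < p.+1) q j by rewrite big_ltn.
have S0 : 0 <= \sum_(i.+1 <= j < p.+1) (T j + (bcost b)%:R) by apply: sumr_ge0 => j _; apply: addr_ge0.
have S1 : 0 <= \sum_(i.+1 <= j < p.+1) q j by apply: sumr_ge0.
have [Hb2|/negbTE Hb2] := boolP (beval s2 b); rewrite Hb2 in Hres.
  have [HI2 ip2] := Hres.
  have [|s3 [t3 [l3 [He3 [Ht3 Hl3 HP]]]]] := IH i.+1 s2 ip2 _ HI2; first by clear -im ip2; lia.
  exists s3, (bcost b + t + t3)%N, (l ++ l3); split; first exact: ExecWhileT He He3.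
  rewrite size_cat !natrD; split=> //; last exact: lerD.
  by move: Ht Ht3; set A := \sum_(_ <= j < _) _; lra.
exists s2, (bcost b + t + bcost b)%N, (l ++ [::]); split.
  exact: ExecWhileT He (ExecWhileF _ _ Hb2).
rewrite cats0 !natrD; split=> //.
  by move: Ht S0; set A := \sum_(_ <= j < _) _; lra.
by move: Hl S1; set A := \sum_(_ <= j < _) _; lra.
Qed.

End RealBounds.

Section Phases.
Variables (R : realType) (n : nat) (orc : nat -> 'rV[R]_n -> answer R n).
Variables (rows Kset : 'rV[R]_n -> Prop) (c d : 'rV[R]_n).
Variables (mem : 'rV[R]_n -> option 'rV[R]_n).
Variables (Mpre : state R -> Prop).
Hypothesis HMpre : forall s s', Mpre s -> imem s' 24 = imem s 24 -> imem s' 29 = imem s 29 ->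
  rmem s' 24 = rmem s 24 -> rmem s' 25 = rmem s 25 -> Mpre s'.
Hypothesis HMEM : forall s, imem s 1 0 = n -> Mpre s ->
  wp orc MEM s (fun s' t q => agree [:: 3; 6; 26] [:: 9; 22; 46] s s' /\
    [/\ (t <= 60 * (n.+1 * n.+1))%N, (q <= 1)%N &
      match mem (vec_at s n 6 0) with
      | None => imem s' 26 0 = 0%N
      | Some v => (0 < imem s' 26 0)%N /\ vec_at s' n 22 0 = v
      end]).
Hypothesis mem_ok : forall g p, dot (c - g *: d) p < 0 ->
  match mem p with None => Kset p | Some v => rows v /\ dot v p < 0 end.
Variables (To Ta : nat -> R -> R) (tau : nat -> nat) (A : cmd) (delta : R).
Hypothesis HA : solves_approx_conic_dual A To Ta tau.
Hypotheses (n0 : (0 < n)%N) (dgt0 : 0 < delta) (HL : lower_bounded delta rows).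
Implicit Types (s : state R).

Notation qv := (@qv R n).
Notation yr := (@yr R n).
Notation x2 := (n.+1 * n.+1)%N.
Notation x3 := (n.+1 * n.+1 * n.+1)%N.
Notation x4 := (n.+1 * n.+1 * n.+1 * n.+1)%N.
Notation x5 := (n.+1 * n.+1 * n.+1 * n.+1 * n.+1)%N.
Notation dbase := (dbase rows Kset c d Mpre).

Definition ysolved s :=
  [/\ (imem s 23 0 <= n.+1)%N,
      forall i, (i < imem s 23 0)%N -> rows (yr s i) /\ 0 <= rmem s 42 i,
      forall i j, (i < imem s 23 0)%N -> (j < imem s 23 0)%N -> yr s i = yr s j -> i = j
    & mix (imem s 23 0) (rmem s 42) (yr s) = c - rmem s 32 0 *: d].

Definition PI0 := (LI ++ [:: 41; 8; 9; 23; 25; 32])%N.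
Definition PI := (31 :: PI0)%N.
Definition PR := (LR ++ [:: 35; 41; 42; 43; 44; 45; 48])%N.

Section Phase.
Variable eps : R.
Hypotheses (eps0 : 0 < eps) (neps : n%:R * eps <= 4%:R^-1).

Notation good := (good n delta eps).
Notation dinv := (dinv rows Kset c d Mpre delta eps).
Notation levst := (levst rows c d delta eps).

Let LT : R := Ta n eps + (600 * x2)%N%:R * To n eps + (700 * x2 * tau n)%N%:R + (3000 * x3)%N%:R.

Lemma ToTa_ge0 : 0 <= To n eps /\ 0 <= Ta n eps.
Proof. exact: (To_ge0 HA). Qed.

Lemma LT_ge0 : 0 <= LT.
Proof.
have [H1 H2] := ToTa_ge0; apply: addr_ge0; last exact: ler0n.
apply: addr_ge0; last exact: ler0n.
by apply: addr_ge0; [exact: H2 | apply: mulr_ge0; [exact: ler0n | exact: H1]].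
Qed.

Definition phres s ex := 
   [\/ imem s 12 0 = 1%N /\ exists K, dinv s K /\ proj (qv s) K (c - rmem s 32 0 *: d) = 0,
       imem s 12 0 = 2%N /\ stopok Kset c d s
     | [/\ imem s 12 0 = 3%N, (0 < ex)%N & ~ good]].

Lemma DESCENT_spec s : dbase s -> rmem s 35 0 = eps ->
  wp orc (DESCENT A) s (fun s' t q0 => [/\ lagree (LI ++ [:: 41])%N LR s s', rmem s' 32 0 <= rmem s 32 0, dbase s'
    & [/\ q0%:R <= n.+1%:R * To n eps, t%:R <= n.+1%:R * (LT + 3%:R) + 1
       & phres s' (imem s 30 0)]]).
Proof.
move=> B E35.
apply: wp_seq; apply: wp_iset; apply: wp_seq; apply: wp_iset; set s1 := setI _ _ _ _.
have A1 : agree [:: 11; 12] [::] s s1 by agr.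
have L1 := agree_lagree A1.
have [_ _ _ _ [_ _ _ HX]] := B.
have Hn1 : imem s 2 0 = n.+1 by case: B.
have B1 : dbase s1 by apply: (dbase_lagree HMpre B L1).
have E11 : imem s1 11 0 = 0%N by [].
have E12 : imem s1 12 0 = 0%N by [].
have E351 : rmem s1 35 0 = eps by [].
have G1 : rmem s1 32 0 = rmem s 32 0 by [].
have E30 : imem s1 30 0 = imem s 30 0 by [].
clearbody s1.
pose Inv i st := [/\ lagree (LI ++ [:: 41])%N LR s st, rmem st 32 0 <= rmem s 32 0, dbase st, imem st 41 0 = i &
  (imem st 12 0 = 0%N /\ dinv st i) \/ phres st (imem s 30 0)].
have [To0 Ta0] := ToTa_ge0.
have set41 st j : dbase st -> dbase (setI st 41 0 j).
  move=> Bs; have [_ _ _ _ [_ _ _ HXs]] := Bs.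
  by apply: (dbase_lagree HMpre Bs (agree_lagree (setI_agree st 41 0 j))).
have dinv41 st j K : dinv st K -> dinv (setI st 41 0 j) K.
  move=> Ds; have [Bs _ _ _ _] := Ds; have [_ _ _ _ [_ _ _ HXs]] := Bs.
  by apply: (dinv_lagree HMpre Ds (agree_lagree (setI_agree st 41 0 j))).
have lag41 st j : lagree (LI ++ [:: 41])%N LR s st -> lagree (LI ++ [:: 41])%N LR s (setI st 41 0 j).
  by move=> H; apply: lagree_comp H (agree_lagree (setI_agree st 41 0 j)) _.
have phr41 st j e : phres st e -> phres (setI st 41 0 j) e.
  case=> [[H1 [K [H2 H3]]]|[H1 H2]|[H1 H2 H3]]; [apply: Or31|apply: Or32|apply: Or33] => //.
  by split=> //; exists K; split; [exact: dinv41|].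
apply: (@wp_forR _ _ _ Inv n.+1 (LT + 1) (To n eps)) => //.
- by rewrite addr_ge0 // LT_ge0.
- split=> //; first by apply: lag41; apply: lagree_sub L1 _.
    by rewrite [rmem _ 32 0]G1.
    exact: set41.
  left; split=> //; apply: dinv41; split=> //.
- move=> i s2 _ [H1 _ _ H2 _]; split=> //.
  by rewrite /= (proj1 (H1 2 isT) isT).
- move=> i s2 Hi [H1 H2 H3 H4 H5].
  apply: wp_if; case: H5 => [[S0 D2]|Hres].
    rewrite [beval _ _](_ : _ = true); last by rewrite /= S0.
    apply: wp_conseq (LEVEL_spec HMpre HMEM mem_ok HA n0 eps0 neps dgt0 HL D2 S0) _.
    move=> s3 t3 q3 [K1 K2 K3 [K4 K5 K6]]; split=> //.
    + by rewrite natrD addrC lerD.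
    + by rewrite (proj1 (K1 41 isT) isT).
    + split=> //.
      * by apply: lag41; apply: lagree_comp H1 K1 _.
      * exact: le_trans K2 H2.
      * exact: set41.
      have E30' : imem s2 30 0 = imem s 30 0 by rewrite (proj1 (H1 30 isT) isT).
      case: K6 => [[F1 F2]|[F1 F2 F3]|[F1 F2]|[F1 F2 F3]]; [left|right..].
      * by split=> //; exact: dinv41.
      * by apply: phr41; apply: Or31; split=> //; exists i.
      * by apply: phr41; apply: Or32.
      * by apply: phr41; apply: Or33; split=> //; rewrite -E30'.
  rewrite [beval _ _](_ : _ = false); last first.
    by apply/negbTE; rewrite /=; case: Hres => [[-> _]|[-> _]|[-> _ _]].
  apply: wp_skip; split=> //.
    by rewrite addn0 /= -[leLHS]add0r lerD // LT_ge0.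
  by split; [exact: lag41|by []|exact: set41|by []|right; exact: phr41].
move=> s2 t2 q2 Ht2 Hq2 [H1 H2 H3 _ H5]; split=> //; split.
- by rewrite !add0n.
- rewrite /= !add0n; apply: le_trans Ht2 _; rewrite /= !add0n.
  by rewrite -addrA -(natrD _ 1 2).
(* Still running after [n + 1] levels would mean [n + 1] nonzero orthogonal directions in dimension
   [n]. *)
- case: H5 => [[_ D2]|//]; have := dinv_size D2; by rewrite ltnn.
Qed.

Definition PT (ex : nat) : R := n.+1%:R * (LT + 3%:R) + (60 * 100 * x4)%N%:R +
  (if (0 < ex)%N then 0 else 100 * 100 * x5)%N%:R.

Lemma PHASE_spec s : dbase s -> rmem s 35 0 = eps ->
  wp orc (PHASE A) s (fun s' t q0 => [/\ lagree PI0 (LR ++ [:: 41; 42; 43; 44; 45; 48])%N s s',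
      rmem s' 32 0 <= rmem s 32 0, dbase s'
    & [/\ q0%:R <= n.+1%:R * To n eps, t%:R <= PT (imem s 30 0)
       & [\/ imem s' 12 0 = 1%N /\ ysolved s', imem s' 12 0 = 2%N /\ stopok Kset c d s'
          | imem s' 12 0 = 3%N /\ ~ good]]]).
Proof.
move=> B E35.
apply: wp_seq; apply: wp_conseq (DESCENT_spec B E35) _.
move=> s1 t1 q1 [L1 G1 B1 [Hq1 Ht1 Hres]].
have L1' : lagree PI0 (LR ++ [:: 41; 42; 43; 44; 45; 48])%N s s1 by apply: lagree_sub L1 _.
have x40 : (0 < x4)%N by [].
have cost0 z : (z <= 50 * 100 * x4 + 5 + (if (0 < imem s 30 0)%N then 0 else 100 * 100 * x5))%N ->
    (t1 + z)%N%:R <= PT (imem s 30 0).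
  move=> Hz; rewrite natrD /PT.
  have : (1 + z <= 60 * 100 * x4 + (if (0 < imem s 30 0)%N then 0 else 100 * 100 * x5))%N.
    by move: Hz x40; clear; case: ifP => _; set y := (100 * 100 * x5)%N; lia.
  move: (60 * 100 * x4)%N (if (0 < imem s 30 0)%N then 0 else 100 * 100 * x5)%N => a b.
  rewrite -(ler_nat R) !natrD; move: Ht1; set X := _ * (LT + _); clearbody X; lra.
have E30 : imem s1 30 0 = imem s 30 0 by rewrite (proj1 (L1 30 isT) isT).
apply: wp_if; case: Hres => [[S1 [K [D1 HP]]]|[S1 HS]|[S1 Hx Hg]].
- rewrite [beval _ _](_ : _ = true); last by rewrite /= S1.
  have Kn := dinv_size D1.
  have [_ _ EK Hstar Hlev] := D1.
  have [Hn Hn1 Hcap HM [Hc Hd _ HX]] := B1.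
  have HV s' : vec_at s' n 27 0 = c - rmem s1 32 0 *: d -> agree [:: 3; 23] [:: 27] s1 s' ->
     forall l, (l < K)%N -> levok rows delta good s' l.
    move=> V27 A1 l Hl; apply: (Hlev l Hl).
    + exact: lagree_lkeep (agree_lagree A1) isT isT.
    + by rewrite (proj2 A1 32 isT).
    + by rewrite (proj2 A1 32 isT).
  apply: wp_conseq (ASCENT_spec orc dgt0 HL Hn Hn1 Hcap EK S1 Kn Hc Hd HV HP) _.
  move=> s2 t2 q2 [A2 [Ht2 -> Hst Hok Hy]].
  have L2 := agree_lagree A2.
  have G2 : rmem s2 32 0 = rmem s1 32 0 by rewrite (proj2 A2 32 isT).
  split.
  + by apply: lagree_comp L1 L2 _.
  + by rewrite G2.
  + by apply: (dbase_lagree HMpre B1 L2) => //; apply: xfok_lagree L2 _ HX.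
  split; first by rewrite addn0.
    by apply: cost0; move: Ht2; rewrite E30 /=; clear; case: ifP => _; set y := (100 * 100 * x5)%N; lia.
  case: Hst => Hst.
    by apply: Or31; split=> //; have [Y1 Y2 Y3 Y4] := Hy Hst; split=> //; rewrite G2.
  by apply: Or33; split=> // Hg; have := Hok (or_intror Hg); rewrite Hst.
- rewrite [beval _ _](_ : _ = false); last by rewrite /= S1.
  apply: wp_skip; split=> //; split; first by rewrite addn0.
    by apply: cost0; rewrite /=; lia.
  by apply: Or32.
- rewrite [beval _ _](_ : _ = false); last by rewrite /= S1.
  apply: wp_skip; split=> //; split; first by rewrite addn0.
    by apply: cost0; rewrite /=; lia.
  by apply: Or33.
Qed.

End Phase.

Definition epsk (i : nat) : R := ((4%:R * n%:R)^-1) ^+ (2 ^ i).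

Lemma epsk_gt0 i : 0 < epsk i.
Proof. by rewrite exprn_gt0 // invr_gt0 mulr_gt0 // ltr0n. Qed.

Lemma epskS i : epsk i.+1 = epsk i * epsk i.
Proof. by rewrite /epsk expnS mulnC exprM expr2. Qed.

Lemma epsk_le i : n%:R * epsk i <= 4%:R^-1.
Proof.
have n1 : 1 <= n%:R :> R by rewrite (ler_nat _ 1).
have E0 : n%:R * epsk 0 = 4%:R^-1 by rewrite /epsk expr1 invfM mulrCA divff ?mulr1 // pnatr_eq0 -lt0n.
elim: i => [|i IH]; first by rewrite E0.
rewrite epskS mulrA; apply: le_trans IH; rewrite -[leRHS]mulr1.
have e0 := epsk_gt0 i.
have n4 : 0 < 4%:R * n%:R :> R by rewrite mulr_gt0 // ltr0n.
have e1 : epsk i <= 1.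
  apply: exprn_ile1; first by rewrite invr_ge0 ltW.
  by rewrite invf_le1 // -[4%:R * _]natrM (ler_nat R 1) muln_gt0.
by rewrite ler_wpM2l // mulr_ge0 // ltW.
Qed.

Lemma CORE_spec s p : dbase s -> good n delta (epsk p) ->
  wp orc (CORE A) s (fun s' t q0 => [/\ lagree PI PR s s', rmem s' 32 0 <= rmem s 32 0, dbase s'
    & [/\ q0%:R <= \sum_(i < p.+1) n.+1%:R * To n (epsk i),
          t%:R <= \sum_(i < p.+1) (PT (epsk i) (imem s 30 0) + 10%:R) + (20 * n.+1)%N%:R
       & (imem s' 12 0 = 1%N /\ ysolved s') \/ (imem s' 12 0 = 2%N /\ stopok Kset c d s')]]).
Proof.
move=> B Hp.
have [Hn Hn1 Hcap HM [Hc Hd Hdir HX]] := B.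
apply: wp_seq; apply: (@wp_vsum _ _ _ (fun=> 1) n) => // t0 Ht0.
apply: wp_seq; apply: wp_rset; apply: wp_seq; apply: wp_iset.
rewrite [reval _ _](_ : _ = epsk 0); last first.
  by rewrite /= /upd /= sumr_const card_ord /epsk expr1 div1r.
set s1 := setI _ _ _ _.
have A1 : agree [:: 3; 31] [:: 35] s s1 by agr.
have L1 := agree_lagree A1.
have B1 : dbase s1 by apply: (dbase_lagree HMpre B L1).
have E351 : rmem s1 35 0 = epsk 0 by [].
have E31 : imem s1 31 0 = 0%N by [].
have G1 : rmem s1 32 0 = rmem s 32 0 by [].
clearbody s1.
pose Inv i st := [/\ lagree PI PR s st, rmem st 32 0 <= rmem s 32 0, dbase st, rmem st 35 0 = epsk i & imem st 31 0 = 0%N].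
pose Post st := [/\ lagree PI PR s st, rmem st 32 0 <= rmem s 32 0, dbase st
  & (imem st 12 0 = 1%N /\ ysolved st) \/ (imem st 12 0 = 2%N /\ stopok Kset c d st)].
have Tge i : 0 <= To n (epsk i) /\ 0 <= Ta n (epsk i) by exact: ToTa_ge0 (epsk_gt0 i).
have PTge i : 0 <= PT (epsk i) (imem s 30 0).
  rewrite /PT; have [H1 H2] := Tge i.
  by apply: addr_ge0; [apply: addr_ge0; [apply: mulr_ge0; [|apply: addr_ge0; [apply: LT_ge0; exact: epsk_gt0|]]|] |]; rewrite ler0n.
apply: wp_conseq (@wp_while _ _ _ Inv Post (fun i => PT (epsk i) (imem s 30 0) + 5%:R)
   (fun i => n.+1%:R * To n (epsk i)) p (BLeI $31 (ICst 0)) _ s1 _ _ _ _) _.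
- by move=> i; rewrite addr_ge0.
- by move=> i; rewrite mulr_ge0 //; case: (Tge i).
- split=> //; first exact: lagree_sub L1 _.
  by rewrite G1.
- move=> i s2 Hi [I1 I2 I3 I4 I5]; split; first by rewrite /= I5.
  apply: wp_seq; apply: wp_conseq (PHASE_spec (epsk_gt0 i) (epsk_le i) I3 I4) _.
  move=> s3 t3 q3 [K1 K2 K3 [K4 K5 K6]].
  have E30 : imem s2 30 0 = imem s 30 0 by rewrite (proj1 (I1 30 isT) isT).
  rewrite E30 in K5.
  have X35 : rmem s3 35 0 = epsk i by rewrite (proj2 (K1 35 isT) isT).
  have X31 : imem s3 31 0 = 0%N.
    by rewrite (proj1 (K1 31 isT) isT).
  have L3 : lagree PI PR s s3 by apply: lagree_comp I1 K1 _.
  have G3 : rmem s3 32 0 <= rmem s 32 0 by exact: le_trans K2 I2.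
  have [_ _ _ _ [_ _ _ HX3]] := K3.
  pose fin b := State (if b then upd (imem s3) 31 0 1%N else imem s3) (upd (rmem s3) 35 0 (epsk i.+1)).
  have Afin b : agree [:: 31] [:: 35] s3 (fin b) by case: b; rewrite /fin; agr.
  have Lfin b : lagree PI PR s (fin b) by apply: lagree_comp L3 (agree_lagree (Afin b)) _.
  have Bfin b : dbase (fin b).
    apply: (dbase_lagree HMpre K3 (agree_lagree (Afin b))) => //.
  apply: wp_seq; apply: wp_if.
  have Hcase : (imem s3 12 0 <= 2)%N /\ Post (fin true) \/ (2 < imem s3 12 0)%N /\ ~ good n delta (epsk i).
    case: K6 => [[F1 F2]|[F1 F2]|[F1 F2]]; [left|left|right]; rewrite F1; split=> //.
      by split=> //; left.
    by split=> //; right.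
  case: Hcase => [[S3 HP]|[S3 Hg]].
    rewrite [beval _ _](_ : _ = true) //.
    apply: wp_iset; apply: wp_rset.
    rewrite [State _ _](_ : _ = fin true); last by rewrite /fin /= X35 epskS.
    split=> //.
    + by rewrite natrD lerD // ler_nat.
    + by rewrite !addn0.
  rewrite [beval _ _](_ : _ = false); last by apply/negbTE; rewrite /= -ltnNge.
  apply: wp_skip; apply: wp_rset.
  rewrite [State _ _](_ : _ = fin false); last by rewrite /fin /= X35 epskS.
  split=> //.
  + by rewrite natrD lerD // ler_nat.
  + by rewrite !addn0.
  rewrite [beval _ _](_ : _ = true); last by rewrite /= X31.
  split; first by split=> //; rewrite /= /upd /=.
  (* A phase fails only if its eps is not good, so the failed phase cannot be [p]. *)
  by rewrite ltn_neqAle Hi andbT; apply/eqP => E; apply: Hg; rewrite E.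
move=> s2 t2 q2 [Ht2 Hq2 [P1 P2 P3 P4]]; split=> //; split=> //.
apply: (@le_trans _ _ (t2%:R + (15 * n.+1)%N%:R)).
  by rewrite -natrD ler_nat; move: Ht0; rewrite /=; clear; lia.
have : (\sum_(i < p.+1) (PT (epsk i) (imem s 30 0) + 5%:R + (bcost (BLeI $31 (ICst 0)))%:R)) <=
   \sum_(i < p.+1) (PT (epsk i) (imem s 30 0) + 10%:R).
  by apply: ler_sum => i _; rewrite -addrA lerD2l -natrD ler_nat.
move: Ht2; set S1 := \sum_(i < _) _; set S2 := \sum_(i < _) _ => Ht2 HS.
apply: le_trans (lerD Ht2 (lexx _)) _; rewrite -addrA; apply: lerD => //.
by rewrite -natrD ler_nat /=; clear; lia.
Qed.

End Phases.

(** * Inputs and outputs of the solvers *)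

Definition SETUP (cexp : rexp) : cmd :=
  ISet 1 (ICst 0) $0 ;; ISet 2 (ICst 0) ($1 +i ICst 1) ;; ISet 28 (ICst 0) ($2 +i $2) ;;
  VSet 3 $1 23 $3 cexp ;; VSet 3 $1 24 $3 (RCst 0) ;;
  ISet 24 (ICst 0) (ICst 0) ;; ISet 29 (ICst 0) (ICst 0) ;; RSet 32 (ICst 0) (RCst 0).

Definition YOUT : cmd :=
  For 6 $23 (VSet 3 $1 2 ($6 *i $1 +i $3) (RGet 41 ($6 *i $1 +i $3)) ;;
             RSet 3 $6 (RGet 42 $6 /r RGet 9 (ICst 0))) ;;
  ISet 0 (ICst 1) $23.

Definition XCOPY (dst src : nat) : cmd := VSet 3 $1 dst $3 (RGet src $3).

(** From [M^T y = - m_1] to a certificate with [y_1 = 1]: the coefficient of [m_1], appended with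
    coefficient 0 if absent, is raised by 1, which makes the combination vanish; array 9 receives
    the new value, by which [YOUT] divides. *)
Definition ADDROW : cmd :=
  ISet 7 (ICst 0) $23 ;;
  For 6 $23 (VSum 3 $1 9 ((RGet 41 ($6 *i $1 +i $3) -r RGet 0 $3)
                       *r (RGet 41 ($6 *i $1 +i $3) -r RGet 0 $3)) ;;
     If (BLeR (RGet 9 (ICst 0)) (RCst 0)) (ISet 7 (ICst 0) $6) Skip) ;;
  If (BLeI $23 $7) (VSet 3 $1 41 ($23 *i $1 +i $3) (RGet 0 $3) ;;
     RSet 42 $23 (RCst 0) ;; incr 23) Skip ;;
  RSet 9 (ICst 0) (RCst 1 +r RGet 42 $7) ;; RSet 42 $7 (RGet 9 (ICst 0)).

Section Output.
Variables (R : realType) (n : nat) (orc : nat -> 'rV[R]_n -> answer R n).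
Implicit Types (s : state R).
Notation yr := (@yr R n).
Notation x2 := (n.+1 * n.+1)%N.

(** The programs handle rows as vectors, while [represents] speaks of indices, and rows may repeat.
    An index is chosen for each distinct vector; [Z] constrains the choice, so that [m_1] can be
    given the index [ord0]. *)
Lemma list_represents m (M : 'M[R]_(m, n)) s (Z : nat -> 'I_m -> Prop) :
  let N := list_len s in
  (forall j, (j < N)%N -> exists i, row i M = list_vec s n j /\ Z j i) ->
  (forall i j, (i < N)%N -> (j < N)%N -> list_vec s n i = list_vec s n j -> i = j) ->
  (forall j, (j < N)%N -> 0 <= list_coef s j) ->
  exists y, [/\ represents M s y, nonneg_vec y,
    y *m M = mix N (list_coef s) (list_vec s n)
    & forall j, (j < N)%N -> exists2 i, Z j i & y 0 i = list_coef s j].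
Proof.
move=> N H Hd H0.
have /choice [f Hf] : forall j : 'I_N, exists i, row i M = list_vec s n j /\ Z j i by move=> j; apply: H.
have fi : injective f.
  move=> i j E; apply: val_inj; apply: Hd; rewrite ?ltn_ord //.
  by have [<- _] := Hf i; have [<- _] := Hf j; rewrite E.
pose y : 'rV[R]_m := \row_i \sum_(j < N | f j == i) list_coef s j.
have yf j : y 0 (f j) = list_coef s j.
  rewrite mxE (bigD1 j) //= big1 ?addr0 // => k /andP[/eqP/fi-> ].
  by rewrite eqxx.
exists y; split.
- exists f; split=> //; first by move=> j; have [] := Hf j.
  move=> i Hi; rewrite mxE big_pred0 // => j; apply/negbTE; apply: contra Hi => /eqP <-.
  exact: codom_f.
- by move=> i; rewrite mxE; apply: sumr_ge0 => j _; exact: H0.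
- rewrite /mix; under [RHS]eq_bigr => j _ do rewrite -(proj1 (Hf j)).
  apply/rowP => k; rewrite mxE summxE.
  under eq_bigr => i _ do rewrite mxE mulr_suml.
  under [RHS]eq_bigr => j _ do rewrite !mxE.
  rewrite (exchange_big_dep predT) //=; apply: eq_bigr => j _.
  by rewrite (bigD1 (f j)) //= big1 ?addr0 // => i /andP[/eqP->]; rewrite eqxx.
- by move=> j Hj; have [_ HZ] := Hf (Ordinal Hj); exists (f (Ordinal Hj)) => //; rewrite yf.
Qed.

Lemma YOUT_spec s N (a := rmem s 9 0) : imem s 1 0 = n -> imem s 23 0 = N -> (N <= n.+1 + 1)%N ->
  wp orc YOUT s (fun s' t q0 => agree [:: 0; 3; 6] [:: 2; 3] s s' /\
    [/\ (t <= 100 * x2)%N, q0 = 0%N, list_len s' = N, imem s' 0 0 = imem s 0 0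
      & forall j, (j < N)%N -> list_vec s' n j = yr s j /\ list_coef s' j = rmem s 42 j / a]).
Proof.
move=> Hn HN Nn; apply: wp_agreeS => //.
apply: wp_seq; apply: (@wp_for _ _ _ (fun i st => forall j, (j < i)%N ->
   list_vec st n j = yr s j /\ list_coef st j = rmem s 42 j / a) N (20 * n.+1)) => //=.
- move=> i s1 Hi Ag Hv IH.
  have m1 : imem s1 1 0 = n by fr Ag.
  apply: wp_seq; apply: (@wp_vset _ _ _ (fun j => rmem s 41 (i * n + j)) (i * n) n) => //=.
    by move=> j Hj; ev; rewrite Hv m1; fr Ag.
  move=> t1 Ht1; set s2 := State _ _; apply: wp_rset; set s3 := State _ _.
  split; [by rewrite /=; lia|by []|].
  have E2 l : vec_at s3 n 2 (l * n) = if l == i then yr s i else vec_at s1 n 2 (l * n).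
    by apply: (etrans (vec_fill_row _ _ _ _ _ _ _)); case: eqP => // ->.
  have E3 l : rmem s3 3 l = if l == i then rmem s 42 i / a else rmem s1 3 l.
    by rewrite /s3; ev; rewrite Hv; fr Ag.
  move=> j; rewrite ltnS leq_eqVlt /list_vec /list_coef [vec_at _ _ _ _]E2 [rmem _ 3 j]E3.
  by case: eqP => [->|_] //= Hj; exact: IH.
- move=> s2 t2 Ht2 Ag Hv IH; apply: wp_iset; set s3 := setI _ _ _ _.
  have N2 : imem s2 23 0 = N by fr Ag.
  split=> //.
  + move: Ht2 Nn; rewrite /=; clear => Ht2 Nn; apply: (@leq_trans ((n.+1 + 1) * (20 * n.+1 + 2) + 10)%N).
      by have : (N * (20 * n.+1 + 0 + 2) <= (n.+1 + 1) * (20 * n.+1 + 2))%N; [rewrite addn0 leq_mul2r Nn orbT | lia].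
    by nia.
  + by rewrite /s3; ev; fr Ag.
Qed.

Lemma XCOPY_spec s dst src : imem s 1 0 = n -> src != dst ->
  wp orc (XCOPY dst src) s (fun s' t q0 => agree [:: 3] [:: dst] s s' /\
    [/\ (t <= 10 * n.+1)%N, q0 = 0%N & vec_at s' n dst 0 = vec_at s n src 0]).
Proof.
move=> Hn Hne; apply: wp_agreeS; first by rewrite /= !inE eqxx.
apply: (@wp_vset _ _ _ (fun j => rmem s src j) 0 n) => //=.
  by move=> j Hj; rewrite /upd /fill /= (negbTE Hne).
move=> t1 Ht1; split; [lia|by []|].
by apply: (etrans (vec_fill _ _ _ _ _ _)); apply/rowP => j; rewrite !mxE.
Qed.

Lemma SETUP_spec s cexp F : imem s 0 0 = n -> (rcost cexp <= 3)%N ->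
  (forall s1 j, (j < n)%N -> imem s1 3 0 = j -> rmem s1 0 = rmem s 0 -> rmem s1 1 = rmem s 1 ->
     reval s1 cexp = F j) ->
  wp orc (SETUP cexp) s (fun s' t q0 => agree [:: 1; 2; 3; 24; 28; 29] [:: 23; 24; 32] s s' /\
    [/\ (t <= 40 * n.+1)%N, q0 = 0%N,
      [/\ imem s' 1 0 = n, imem s' 2 0 = n.+1 & imem s' 28 0 = (n.+1 + n.+1)%N],
      [/\ imem s' 24 0 = 0%N, imem s' 29 0 = 0%N & rmem s' 32 0 = 0]
      & vec_at s' n 23 0 = \row_(j < n) F j /\ vec_at s' n 24 0 = 0]).
Proof.
move=> H0 Hc HF; apply: wp_agreeS => //.
apply: wp_seq; apply: wp_iset; apply: wp_seq; apply: wp_iset; apply: wp_seq; apply: wp_iset.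
set s1 := setI _ _ _ _.
have [M1 M2 M3] : [/\ imem s1 1 0 = n, imem s1 2 0 = n.+1 & imem s1 28 0 = (n.+1 + n.+1)%N].
  by rewrite /s1; ev; rewrite H0 addn1.
have F0 : rmem s1 0 = rmem s 0 by [].
have F1 : rmem s1 1 = rmem s 1 by [].
clearbody s1.
apply: wp_seq; apply: (@wp_vset _ _ _ F 0 n) => //=.
  by move=> j Hj; split=> //; apply: HF.
move=> t1 Ht1; set s2 := State _ _.
apply: wp_seq; apply: (@wp_vset _ _ _ (fun=> 0) 0 n) => //= t2 Ht2; set s3 := State _ _.
apply: wp_seq; apply: wp_iset; apply: wp_seq; apply: wp_iset; apply: wp_rset; set s4 := State _ _.
split.
- by rewrite /=; clear -Ht1 Ht2 Hc; nia.
- by [].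
- by rewrite /s4; ev.
- by rewrite /s4; ev.
split.
  apply: (etrans (y := vec_at s2 n 23 0)); first exact: vec_at_eq.
  exact: (vec_vset n s1 3 23).
apply: (etrans (y := vec_at s3 n 24 0)); first exact: vec_at_eq.
by apply: (etrans (vec_vset n s2 3 24 _)); apply/rowP => j; rewrite !mxE.
Qed.

Lemma ADDROW_spec s N (v := vec_at s n 0 0) :
  imem s 1 0 = n -> imem s 23 0 = N -> (N <= n.+1)%N ->
  (forall i j, (i < N)%N -> (j < N)%N -> yr s i = yr s j -> i = j) ->
  (forall i, (i < N)%N -> 0 <= rmem s 42 i) ->
  wp orc ADDROW s (fun s' t q0 => agree [:: 3; 6; 7; 23] [:: 9; 41; 42] s s' /\
    [/\ (t <= 100 * x2)%N, q0 = 0%N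
      & exists N' k, [/\ imem s' 23 0 = N', (N' <= N + 1)%N /\ (k < N')%N, yr s' k = v /\ rmem s' 42 k = rmem s' 9 0,
        [/\ forall i, (i < N')%N -> (exists2 j, (j < N)%N & yr s' i = yr s j) \/ yr s' i = v,
          (forall i j, (i < N')%N -> (j < N')%N -> yr s' i = yr s' j -> i = j) &
          (forall i, (i < N')%N -> 0 <= rmem s' 42 i)]
        & 0 < rmem s' 9 0 /\ mix N' (rmem s' 42) (yr s') = mix N (rmem s 42) (yr s) + v]]).
Proof.
move=> Hn HN Nn Hd H0; apply: wp_agreeS => //.
apply: wp_seq; apply: wp_iset; set s1 := setI _ _ _ _.
have A1 : agree [:: 7] [::] s s1 by agr.
have E7 : imem s1 7 0 = N by rewrite -HN.
clearbody s1.
apply: wp_seq; apply: (@wp_for _ _ _ (fun i st => (imem st 7 0 = N /\ forall j, (j < i)%N -> yr s j != v) \/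
   ((imem st 7 0 < i)%N /\ yr s (imem st 7 0) = v)) N (20 * n.+1)) => //=.
- by fr A1.
- by left; split; [exact: E7|].
- move=> i s2 Hi Ag Hv IH.
  have {}Ag : agree [:: 3; 6; 7] [:: 9] s s2 by apply: agree_norm (agree_trans A1 Ag) _.
  have m1 : imem s2 1 0 = n by fr Ag.
  pose x := yr s i - v.
  apply: wp_seq; apply: (@wp_vsum _ _ _ (fun j =>
     (rmem s2 41 (i * n + j) - rmem s2 0 j) * (rmem s2 41 (i * n + j) - rmem s2 0 j)) n) => //=.
    by move=> j z Hj; ev; rewrite Hv m1.
  move=> t1 Ht1; set s3 := State _ _.
  have E : rmem s3 9 0 = dot x x by rewrite /s3; ev; apply: eq_bigr => j _; rewrite !mxE /= add0n; fr Ag.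
  apply: wp_if; rewrite [beval _ _](_ : _ = (x == 0)); last first.
    by rewrite [LHS](_ : _ = (rmem s3 9 0 <= 0)) // E -dotvv_eq0 eq_le dotvv_ge0 andbT.
  rewrite subr_eq0; case: eqP => Hx.
    apply: wp_iset; split; [by rewrite /=; lia|by []|right].
    by rewrite /s3; ev; rewrite Hv.
  apply: wp_skip; split; [by rewrite /=; lia|by []|].
  case: IH => [[I1 I2]|[I1 I2]]; [left|right]; split=> //.
    by move=> j; rewrite ltnS leq_eqVlt => /orP[/eqP->|]; [apply/eqP | exact: I2].
  exact: leqW.
- move=> s2 t2 Ht2 Ag Hv IH.
  have {}Ag : agree [:: 3; 6; 7] [:: 9] s s2 by apply: agree_norm (agree_trans A1 Ag) _.
  set k := imem s2 7 0 in IH *.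
  have m1 : imem s2 1 0 = n by fr Ag.
  have m23 : imem s2 23 0 = N by fr Ag.
  have Hcost z : (z <= 30 * n.+1)%N -> (t2 + z <= 100 * x2)%N.
    by move: Ht2 Nn; clear; nia.
  have Y2 j : yr s2 j = yr s j by apply: vec_at_eq; fr Ag.
  have fin s3 t3 N' (F := rmem s3 42 k) : agree [:: 3; 23] [:: 41; 42] s2 s3 -> (t3 <= 20 * n.+1)%N -> imem s3 23 0 = N' ->
      (N' <= N + 1)%N -> (k < N')%N -> yr s3 k = v ->
      (forall i, (i < N')%N -> (exists2 j, (j < N)%N & yr s3 i = yr s j) \/ yr s3 i = v) ->
      (forall i j, (i < N')%N -> (j < N')%N -> yr s3 i = yr s3 j -> i = j) ->
      (forall i, (i < N')%N -> 0 <= rmem s3 42 i) ->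
      mix N' (rmem s3 42) (yr s3) = mix N (rmem s 42) (yr s) ->
      wp orc (RSet 9 (ICst 0) (RCst 1 +r RGet 42 $7) ;; RSet 42 $7 (RGet 9 (ICst 0))) s3
        (fun s' t4 q0 => [/\ (t2 + (t3 + t4) <= 100 * x2)%N, q0 = 0%N
      & exists N' k, [/\ imem s' 23 0 = N', (N' <= N + 1)%N /\ (k < N')%N, yr s' k = v /\ rmem s' 42 k = rmem s' 9 0,
        [/\ forall i, (i < N')%N -> (exists2 j, (j < N)%N & yr s' i = yr s j) \/ yr s' i = v,
          (forall i j, (i < N')%N -> (j < N')%N -> yr s' i = yr s' j -> i = j) &
          (forall i, (i < N')%N -> 0 <= rmem s' 42 i)]
        & 0 < rmem s' 9 0 /\ mix N' (rmem s' 42) (yr s') = mix N (rmem s 42) (yr s) + v]]).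
    move=> A3 Ht3 E23 N'N kN' Yk Hin Hinj Hpos Hmix.
    apply: wp_seq; apply: wp_rset; apply: wp_rset; set s4 := State _ _.
    have k3 : imem s3 7 0 = k by fr A3.
    have Y4 : yr s4 = yr s3 by apply/funext => j; apply: vec_at_eq.
    have E9 : rmem s4 9 0 = 1 + F by rewrite /s4; ev; rewrite k3.
    have E42 j : rmem s4 42 j = if j == k then 1 + F else rmem s3 42 j by rewrite /s4; ev; rewrite k3.
    have E23' : imem s4 23 0 = N' by [].
    clearbody s4.
    have F0 : 0 <= F by exact: Hpos.
    split; [by apply: Hcost; rewrite /=; lia|by []|].
    exists N', k; rewrite E9 Y4; split=> //.
    - by rewrite E42 eqxx.
    - by split=> // i Hi; rewrite E42; case: eqP => _; [rewrite addr_ge0|exact: Hpos].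
    split; first by rewrite ltr_pwDl.
    rewrite -Hmix !(mix_split _ _ kN') E42 eqxx scalerDl scale1r Yk.
    rewrite -addrA [in RHS]addrC; congr (_ + _); rewrite addrC [in LHS]addrC; congr (_ + _).
    by apply: eq_bigr => i /negbTE Hi; rewrite E42 Hi.
  apply: wp_seq; apply: wp_if.
  case: IH => [[I1 I2]|[I1 I2]].
    rewrite [beval _ _](_ : _ = true); last by rewrite /= m23 -/k I1 leqnn.
    apply: wp_seq; apply: (@wp_vset _ _ _ (fun j => rmem s2 0 j) (N * n) n) => //=.
      by move=> j Hj; ev; rewrite m23 m1.
    move=> t3 Ht3; set s3 := State _ _.
    apply: wp_seq; apply: wp_rset; apply: wp_iset; set s4 := setI _ _ _ _.
    have A4 : agree [:: 3; 23] [:: 41; 42] s2 s4 by agr.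
    have EY j : yr s4 j = if j == N then v else yr s j.
      apply: (etrans (vec_fill_row _ _ _ _ _ _ _)); case: eqP => _; last exact: Y2.
      by apply/rowP => i; rewrite !mxE; fr Ag.
    have E42 j : rmem s4 42 j = if j == N then 0 else rmem s 42 j.
      by rewrite /s4; ev; rewrite m23; fr Ag.
    have E23 : imem s4 23 0 = N.+1 by rewrite /s4; ev; rewrite m23 addn1.
    clearbody s4.
    apply: wp_conseq (@fin s4 (bcost (BLeI $23 $7) + (t3 + (1 + 1)))%N N.+1 A4 _ E23 _ _ _ _ _ _ _) _ => //.
    + by rewrite /=; clear -Ht3; lia.
    + by rewrite addn1.
    + by rewrite I1.
    + by rewrite I1 EY eqxx.
    + move=> i; rewrite ltnS leq_eqVlt EY => /orP[->|Hi]; first by right.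
      by rewrite (ltn_eqF Hi); left; exists i.
    + move=> i j; rewrite 2!ltnS (leq_eqVlt i) (leq_eqVlt j) !EY => /orP[/eqP->|Hi] /orP[/eqP->|Hj] //.
      * by rewrite eqxx (ltn_eqF Hj) => /esym E; move: (I2 j Hj); rewrite E eqxx.
      * by rewrite eqxx (ltn_eqF Hi) => E; move: (I2 i Hi); rewrite E eqxx.
      * by rewrite (ltn_eqF Hi) (ltn_eqF Hj); exact: Hd.
    + by move=> i; rewrite ltnS leq_eqVlt E42 => /orP[->//|Hi]; rewrite (ltn_eqF Hi) H0.
    + rewrite mixS E42 eqxx scale0r addr0; apply: eq_mix => i Hi.
        by rewrite E42 (ltn_eqF Hi).
      by rewrite EY (ltn_eqF Hi).
    + move=> s5 t5 q5; rewrite /=; move=> [Ht5 -> Hex]; split=> //.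
      by move: Ht5; clear; lia.
  rewrite [beval _ _](_ : _ = false); last by rewrite /= m23 -/k leqNgt I1.
  apply: wp_skip.
  apply: wp_conseq (@fin s2 (bcost (BLeI $23 $7)) N _ _ m23 _ I1 _ _ _ _ _) _ => //.
  + by rewrite /=; clear; lia.
  + by rewrite Y2.
  + by move=> i Hi; left; exists i => //; rewrite Y2.
  + by move=> i j Hi Hj; rewrite !Y2; exact: Hd.
  + by move=> i Hi; fr Ag; exact: H0.
  + by apply: eq_mix => i Hi; [fr Ag | exact: Y2].
Qed.

End Output.

(** * The three solvers *)

Definition FEAS (A : cmd) : cmd :=
  SETUP (RCst 0 -r RGet 0 $3) ;; ISet 30 (ICst 0) (ICst 1) ;; CORE A ;;
  If (BLeI $12 (ICst 1)) (ADDROW ;; YOUT ;; ISet 0 (ICst 0) (ICst 1))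
    (XCOPY 0 34 ;; ISet 0 (ICst 0) (ICst 0)).

Definition VALID (A : cmd) : cmd :=
  SETUP (RGet 0 $3) ;; ISet 30 (ICst 0) (ICst 0) ;; CORE A ;;
  If (BLeI $12 (ICst 1)) (RSet 9 (ICst 0) (RCst 1) ;; YOUT ;; ISet 0 (ICst 0) (ICst 1))
    (XCOPY 0 34 ;; ISet 0 (ICst 0) (ICst 0)).

(** The point found by the first run provides the initial gamma together with its witness. A copy
    goes to array 50 because the second run may overwrite array 34, and the unbounded case returns
    both points. *)
Definition RPREP : cmd :=
  XCOPY 33 34 ;; XCOPY 50 34 ;;
  VSum 3 $1 46 (RGet 0 $3 *r RGet 34 $3) ;; VSum 3 $1 47 (RGet 1 $3 *r RGet 34 $3) ;;
  RSet 32 (ICst 0) (RGet 46 (ICst 0) /r RGet 47 (ICst 0)) ;;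
  XCOPY 23 0 ;; XCOPY 24 1 ;;
  ISet 24 (ICst 0) (IGet 0 (ICst 1)) ;;
  VSet 3 ($24 *i $1) 25 $3 (RGet 2 $3) ;; VSet 3 $24 26 $3 (RGet 3 $3) ;;
  ISet 29 (ICst 0) (ICst 1).

(** The first run is the validity problem for [- d]: either [- d] is a conic combination of the
    rows, which is the infeasible case, or a point with [d x > 0] turns up, from which gamma can
    start. *)
Definition RATIO (A : cmd) : cmd :=
  SETUP (RCst 0 -r RGet 1 $3) ;; ISet 30 (ICst 0) (ICst 0) ;; CORE A ;;
  If (BLeI $12 (ICst 1)) (RSet 9 (ICst 0) (RCst 1) ;; YOUT ;; ISet 0 (ICst 0) (ICst 1))
    (RPREP ;; CORE A ;;
     If (BLeI $12 (ICst 1))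
       (RSet 4 (ICst 0) (RGet 32 (ICst 0)) ;; XCOPY 0 33 ;; RSet 9 (ICst 0) (RCst 1) ;;
        YOUT ;; ISet 0 (ICst 0) (ICst 0))
       (XCOPY 0 50 ;; XCOPY 1 34 ;; ISet 0 (ICst 0) (ICst 2))).

Section Simple.
Variables (R : realType) (n : nat) (orc : nat -> 'rV[R]_n -> answer R n).
Variables (To Ta : nat -> R -> R) (tau : nat -> nat) (A : cmd).
Hypothesis HA : solves_approx_conic_dual A To Ta tau.
Hypothesis n0 : (0 < n)%N.
Implicit Types (s : state R).
Notation yr := (@yr R n).
Notation x2 := (n.+1 * n.+1)%N.

Definition qb p : R := \sum_(i < p.+1) n.+1%:R * To n (epsk R n i).
Definition tb ex p : R :=
  \sum_(i < p.+1) (PT n To Ta tau (epsk R n i) ex + 10%:R) + (20 * n.+1)%N%:R.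

Lemma wp_runs_within c s (calls ops : R) (post : state R -> Prop) :
  wp orc c s (fun s' t q => [/\ q%:R <= calls, t%:R <= ops & post s']) ->
  runs_within orc c s calls ops (fun s' _ => post s').
Proof. by move=> [s' [t [l [He [Hq Ht HP]]]]]; exists s', t, l; split. Qed.

Definition mem0 p q (MT : 'M[R]_(p, n)) (MS : 'M[R]_(q, n)) (o : 'rV[R]_n -> option ('I_p + 'I_q)) x :=
  omap (fun r => match r with inl i => row i MT | inr j => row j MS end) (o x).

Definition mpre0 s := imem s 29 0 = 0%N.

Lemma query_spec k s p q (MT : 'M[R]_(p, n)) (MS : 'M[R]_(q, n)) o :
  orc k = answers_of_poly MT MS o ->
  wp orc (Query k 6 26 22) s (fun s' t q0 => agree [:: 26] [:: 22] s s' /\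
    [/\ t = 0%N, q0 = 1%N &
      match mem0 MT MS o (vec_at s n 6 0) with
      | None => imem s' 26 0 = 0%N
      | Some v => (0 < imem s' 26 0)%N /\ vec_at s' n 22 0 = v
      end]).
Proof.
move=> Ho; apply: wp_agreeS => //; apply: wp_query; rewrite Ho; split=> //.
have V (w : 'rV[R]_n) b : vec_at (put_answer s 26 22 (Some (b, w))) n 22 0 = w.
  apply/rowP => j; rewrite mxE /=; case: insubP => [i _ E|]; last by rewrite add0n ltn_ord.
  by congr (w 0 _); apply: val_inj; rewrite /= E add0n.
rewrite /mem0 /answers_of_poly; case: (o _) => [[i|j]|] //=; by rewrite V.
Qed.

Lemma MEM0_spec s m (M : 'M[R]_(m, n)) (MS : 'rV[R]_n) o :
  orc 0%N = answers_of_poly M MS o -> imem s 1 0 = n -> mpre0 s ->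
  wp orc MEM s (fun s' t q => agree [:: 3; 6; 26] [:: 9; 22; 46] s s' /\
    [/\ (t <= 60 * (n.+1 * n.+1))%N, (q <= 1)%N &
      match mem0 M MS o (vec_at s n 6 0) with
      | None => imem s' 26 0 = 0%N
      | Some v => (0 < imem s' 26 0)%N /\ vec_at s' n 22 0 = v
      end]).
Proof.
move=> Ho _ Hp; apply: wp_agreeS => //; apply: wp_if.
rewrite [beval _ _](_ : _ = true); last by rewrite /= Hp.
by apply: wp_conseq (query_spec s Ho) _ => s' t q [_ [-> -> H]].
Qed.

(** Membership is tested only at points with [c x < 0], where the strict row [- c] cannot be
    returned. *)
Lemma mem0_ok m (M : 'M[R]_(m, n)) c o g p : poly_oracle M (- c) o ->
  dot (c - g *: 0) p < 0 ->
  match mem0 M (- c) o p with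
  | None => polyhedral_cone M p | Some v => rowset M v /\ dot v p < 0 end.
Proof.
rewrite scaler0 subr0 => Ho Hp; have := Ho p; rewrite /mem0; case: (o p) => [[i|j]|] /=.
- by move=> H; split=> //; exists i.
- by rewrite row_id dotNl oppr_le0 leNgt Hp.
- by case.
Qed.

Lemma CORE0_spec s m (M : 'M[R]_(m, n)) c o p (delta := cond_number M) :
  poly_oracle M (- c) o -> orc 0%N = answers_of_poly M (- c) o ->
  [/\ imem s 1 0 = n, imem s 2 0 = n.+1 & imem s 28 0 = (n.+1 + n.+1)%N] ->
  [/\ imem s 24 0 = 0%N, imem s 29 0 = 0%N & rmem s 32 0 = 0] ->
  vec_at s n 23 0 = c -> vec_at s n 24 0 = 0 ->
  ((0 < imem s 30 0)%N -> rowset M (- c)) -> good n delta (epsk R n p) ->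
  wp orc (CORE A) s (fun s' t q0 => lagree PI PR s s' /\
    [/\ q0%:R <= qb p, t%:R <= tb (imem s 30 0) p
     & (imem s' 12 0 = 1%N /\
        [/\ (imem s' 23 0 <= n.+1)%N,
          forall i, (i < imem s' 23 0)%N -> rowset M (yr s' i) /\ 0 <= rmem s' 42 i,
          forall i j, (i < imem s' 23 0)%N -> (j < imem s' 23 0)%N -> yr s' i = yr s' j -> i = j
        & mix (imem s' 23 0) (rmem s' 42) (yr s') = c]) \/
       [/\ imem s' 12 0 = 2%N, polyhedral_cone M (vec_at s' n 34 0) & dot c (vec_at s' n 34 0) < 0]]).
Proof.
move=> Ho Horc [H1 H2 H3] [H4 H5 H6] Hc Hd Hex Hg.
have B : dbase (rowset M) (polyhedral_cone M) c 0 mpre0 s.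
  split=> //; split=> //; last by left.
  split; rewrite ?H4 //; first by rewrite /mix big_ord0.
  by move=> /Hex.
have HMpre (s1 s2 : state R) : mpre0 s1 -> imem s2 24 = imem s1 24 -> imem s2 29 = imem s1 29 ->
  rmem s2 24 = rmem s1 24 -> rmem s2 25 = rmem s1 25 -> mpre0 s2.
  by rewrite /mpre0 => E _ -> _ _.
apply: wp_conseq (CORE_spec HMpre (fun s1 => MEM0_spec Horc) (fun g x => @mem0_ok m M c o g x Ho)
  HA n0 (cond_number_gt0 M) (@cond_number_lower_bounded _ _ _ M) B Hg) _.
move=> s' t q [K1 K2 K3 [K4 K5 K6]]; split=> //; split=> //.
case: K6 => [[S [Y1 Y2 Y3 Y4]]|[S [F1 F2 [g F3]]]]; [left|right]; split=> //.
  by split=> //; rewrite Y4 scaler0 subr0.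
by move: F3; rewrite scaler0 subr0.
Qed.

Lemma rowset_represents m (M : 'M[R]_(m, n)) s N (a : nat -> R) (w : nat -> 'rV[R]_n) (Z : nat -> 'I_m -> Prop) :
  list_len s = N ->
  (forall j, (j < N)%N -> list_vec s n j = w j /\ list_coef s j = a j) ->
  (forall j, (j < N)%N -> exists i, row i M = w j /\ Z j i) ->
  (forall i j, (i < N)%N -> (j < N)%N -> w i = w j -> i = j) ->
  (forall j, (j < N)%N -> 0 <= a j) ->
  exists y, [/\ represents M s y, nonneg_vec y, y *m M = mix N a w
    & forall j, (j < N)%N -> exists2 i, Z j i & y 0 i = a j].
Proof.
move=> HN HV HM Hinj Ha.
have [||| y [Y1 Y2 Y3 Y4]] := @list_represents R n m M s Z; rewrite ?HN.
- by move=> j Hj; have [-> _] := HV j Hj; exact: HM.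
- by move=> i j Hi Hj; have [-> _] := HV i Hi; have [-> _] := HV j Hj; exact: Hinj.
- by move=> j Hj; have [_ ->] := HV j Hj; exact: Ha.
rewrite HN in Y3 Y4; exists y; split=> //.
  by rewrite Y3; apply: eq_mix => j Hj; have [] := HV j Hj.
by move=> j Hj; have [i Zi Ei] := Y4 j Hj; exists i => //; rewrite Ei; have [] := HV j Hj.
Qed.

Lemma YOUT1_spec s m (M : 'M[R]_(m, n)) v kind :
  imem s 1 0 = n -> (imem s 23 0 <= n.+1)%N ->
  (forall i, (i < imem s 23 0)%N -> rowset M (yr s i) /\ 0 <= rmem s 42 i) ->
  (forall i j, (i < imem s 23 0)%N -> (j < imem s 23 0)%N -> yr s i = yr s j -> i = j) ->
  mix (imem s 23 0) (rmem s 42) (yr s) = v ->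
  wp orc (RSet 9 (ICst 0) (RCst 1) ;; YOUT ;; ISet 0 (ICst 0) (ICst kind)) s
    (fun s' t q0 => agree [:: 0; 3; 6] [:: 2; 3; 9] s s' /\
    [/\ (t <= 100 * x2)%N, q0 = 0%N, imem s' 0 0 = kind, (list_len s' <= n.+2)%N
      & exists y, [/\ represents M s' y, nonneg_vec y & y *m M = v]]).
Proof.
move=> Hn HN HR Hinj Hmix; apply: wp_agreeS => //.
apply: wp_seq; apply: wp_rset; set s1 := State _ _.
apply: wp_seq; apply: wp_conseq (@YOUT_spec R n orc s1 (imem s 23 0) Hn erefl _) _; first by lia.
move=> s2 t2 q2 [_ [Ht2 -> HL _ HV]]; apply: wp_iset; set s3 := setI _ _ _ _.
have HL3 : list_len s3 = imem s 23 0 by rewrite -HL /list_len /s3; ev.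
split; [by move: Ht2; rewrite /=; clear; lia|by []|by rewrite /s3; ev|by rewrite HL3; lia|].
have HV3 j : (j < imem s 23 0)%N -> list_vec s3 n j = yr s j /\ list_coef s3 j = rmem s 42 j.
  by move=> Hj; have [E1 E2] := HV j Hj; split; [exact: E1 | rewrite [LHS]E2 /= divr1].
have [|||y [Y1 Y2 Y3 _]] := @rowset_represents m M s3 _ (rmem s 42) (yr s) (fun _ _ => True) HL3 HV3.
- by move=> j Hj; have [[i Ei] _] := HR j Hj; exists i.
- exact: Hinj.
- by move=> j Hj; have [] := HR j Hj.
by exists y; split=> //; rewrite Y3.
Qed.

End Simple.

Section Solvers.
Variables (R : realType) (n : nat).
Variables (To Ta : nat -> R -> R) (tau : nat -> nat) (A : cmd).
Hypothesis HA : solves_approx_conic_dual A To Ta tau.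
Hypothesis n0 : (0 < n)%N.
Implicit Types (s : state R).
Notation yr := (@yr R n).
Notation x2 := (n.+1 * n.+1)%N.
Notation qb := (@qb R n To).
Notation tb := (@tb R n To Ta tau).

Lemma cost_add (t t3 e : nat) (B : R) : t3%:R <= B -> (t <= t3 + e)%N -> t%:R <= B + e%:R.
Proof.
move=> H1 H2; apply: (@le_trans _ _ (t3 + e)%N%:R); first by rewrite ler_nat.
by rewrite natrD lerD2r.
Qed.

Lemma FEAS_spec m (M : 'M[R]_(m.+1, n)) o s p (m1 := row ord0 M) :
  poly_oracle M m1 o -> imem s 0 0 = n -> vec_at s n 0 0 = m1 ->
  good n (cond_number M) (epsk R n p) ->
  runs_within (fun _ => answers_of_poly M m1 o) (FEAS A) s (qb p) (tb 1 p + (400 * x2)%N%:R)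
    (fun s' _ => let x := vec_at s' n 0 0 in
       (imem s' 0 0 = 0%N /\ polyhedral_cone M x /\ 0 < dot m1 x) \/
       (imem s' 0 0 = 1%N /\ (list_len s' <= n.+2)%N /\
        exists y, [/\ represents M s' y, nonneg_vec y, y 0 ord0 = 1 & y *m M = 0])).
Proof.
move=> Ho Hn Hm1 Hg; set orc := fun _ => _.
apply: (wp_runs_within (post := fun s' => let x := vec_at s' n 0 0 in
       (imem s' 0 0 = 0%N /\ polyhedral_cone M x /\ 0 < dot m1 x) \/
       (imem s' 0 0 = 1%N /\ (list_len s' <= n.+2)%N /\
        exists y, [/\ represents M s' y, nonneg_vec y, y 0 ord0 = 1 & y *m M = 0]))).
have Ho' : poly_oracle M (- - m1) o by rewrite opprK.
have Horc : orc 0%N = answers_of_poly M (- - m1) o by rewrite opprK.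
apply: wp_seq; apply: wp_conseq (@SETUP_spec R n orc s (RCst 0 -r RGet 0 $3) (fun j => 0 - rmem s 0 j) Hn isT _) _.
  by move=> s1 j Hj H3 H0 _; rewrite /= H3 H0.
move=> s1 t1 q1 [A1 [Ht1 -> [S1 S1' S1''] [S2 S3 S4] [V23 V24]]].
apply: wp_seq; apply: wp_iset; set s2 := setI _ _ _ _.
have V23' : vec_at s2 n 23 0 = - m1.
  by apply: (etrans V23); rewrite -Hm1; apply/rowP => j; rewrite !mxE sub0r.
have V24' : vec_at s2 n 24 0 = 0 by exact: V24.
(* Here [c] is [- m1], so [- c] is the row of index [ord0], which is what the exact mode
   requires. *)
have Hex : (0 < imem s2 30 0)%N -> rowset M (- - m1) by move=> _; exists ord0; rewrite opprK.
have V0 : vec_at s2 n 0 0 = m1 by rewrite -Hm1; apply: vec_at_eq; exact: (proj2 A1 0%N isT).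
have T2 : [/\ imem s2 1 0 = n, imem s2 2 0 = n.+1 & imem s2 28 0 = (n.+1 + n.+1)%N] by [].
have T3 : [/\ imem s2 24 0 = 0%N, imem s2 29 0 = 0%N & rmem s2 32 0 = 0] by [].
have E30 : imem s2 30 0 = 1%N by [].
clearbody s2.
apply: wp_seq; apply: wp_conseq (CORE0_spec HA n0 Ho' Horc T2 T3 V23' V24' Hex Hg) _.
move=> s3 t3 q3 [L3 [Hq3 Ht3 Hres]]; rewrite E30 in Ht3.
have N3 : imem s3 1 0 = n by case: T2 => <- _ _; rewrite (proj1 (L3 1%N isT) isT).
have V03 : vec_at s3 n 0 0 = m1 by rewrite -V0; apply: vec_at_eq; exact: (proj2 (L3 0%N isT) isT).
have xx : (n.+1 <= x2)%N by rewrite leq_pmulr.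
apply: wp_if; case: Hres => [[S12 [Y1 Y2 Y3 Y4]]|[S12 HK Hc]]; last first.
  rewrite [beval _ _](_ : _ = false); last by rewrite /= S12.
  apply: wp_seq; apply: wp_conseq (@XCOPY_spec R n orc s3 0%N 34%N N3 isT) _.
  move=> s4 t4 q4 [A4 [Ht4 -> V4]]; apply: wp_iset; split.
  - by rewrite !addn0 !add0n.
  - by apply: cost_add Ht3 _; rewrite /=; clear -Ht1 Ht4 xx; lia.
  left; split=> //.
  have -> : vec_at (setI s4 0 (ieval s4 (ICst 0)) (ieval s4 (ICst 0))) n 0 0 = vec_at s3 n 34 0 by [].
  by split=> //; move: Hc; rewrite dotNl oppr_lt0.
rewrite [beval _ _](_ : _ = true); last by rewrite /= S12.
apply: wp_seq; apply: wp_conseq (@ADDROW_spec R n orc s3 _ N3 erefl Y1 Y3 _) _.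
  by move=> i Hi; have [] := Y2 i Hi.
move=> s4 t4 q4 [A4 [Ht4 -> [N' [k [E23 [N'N kN'] [Yk Ck] [Hin Hinj Hpos] [a0 Hmix]]]]]].
rewrite V03 in Yk Hin Hmix; rewrite Y4 addNr in Hmix.
have N4 : imem s4 1 0 = n by rewrite (proj1 A4 1%N isT).
apply: wp_seq; apply: wp_conseq (@YOUT_spec R n orc s4 N' N4 E23 _) _; first by clear -N'N Y1; lia.
move=> s5 t5 q5 [A5 [Ht5 -> HL _ HV]]; apply: wp_iset; set s6 := setI _ _ _ _.
have HL6 : list_len s6 = N' by rewrite -HL /list_len /s6; ev.
split.
- by rewrite !addn0 !add0n.
- by apply: cost_add Ht3 _; rewrite /=; clear -Ht1 Ht4 Ht5 xx; lia.
right; split; first by rewrite /s6; ev.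
split; first by rewrite HL6; clear -N'N Y1; lia.
have HV6 j : (j < N')%N -> list_vec s6 n j = yr s4 j /\ list_coef s6 j = rmem s4 42 j / rmem s4 9 0.
  by move=> Hj; exact: HV.
(* Another row may coincide with [m1]; the choice of indices is constrained so that the coefficient
   1 lands on [ord0]. *)
have [|||y [W1 W2 W3 W4]] := @rowset_represents R n _ M s6 N' (fun j => rmem s4 42 j / rmem s4 9 0) (yr s4)
   (fun j i => yr s4 j = m1 -> i = ord0) HL6 HV6.
- move=> j Hj; have [E|ne] := eqVneq (yr s4 j) m1; first by exists ord0.
  case: (Hin j Hj) => [[j' Hj' E]|/eqP]; last by rewrite (negbTE ne).
  by have [[i Ei] _] := Y2 j' Hj'; exists i; split; [rewrite E -Ei | move=> /eqP; rewrite (negbTE ne)].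
- exact: Hinj.
- by move=> j Hj; rewrite divr_ge0 ?Hpos // ltW.
exists y; split=> //.
  by have [i Zi Ei] := W4 k kN'; rewrite -(Zi Yk) Ei Ck divff // gt_eqF.
rewrite W3 (_ : mix _ _ _ = (rmem s4 9 0)^-1 *: mix N' (rmem s4 42) (yr s4)); first by rewrite Hmix scaler0.
by rewrite -mixZ; apply: eq_mix => // j _; rewrite mulrC.
Qed.

Lemma VALID_spec m (M : 'M[R]_(m, n)) c o s p :
  poly_oracle M (- c) o -> imem s 0 0 = n -> vec_at s n 0 0 = c ->
  good n (cond_number M) (epsk R n p) ->
  runs_within (fun _ => answers_of_poly M (- c) o) (VALID A) s (qb p) (tb 0 p + (400 * x2)%N%:R)
    (fun s' _ => let x := vec_at s' n 0 0 in
       (imem s' 0 0 = 0%N /\ polyhedral_cone M x /\ dot c x < 0) \/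
       (imem s' 0 0 = 1%N /\ (list_len s' <= n.+2)%N /\
        exists y, [/\ represents M s' y, nonneg_vec y & y *m M = c])).
Proof.
move=> Ho Hn Hc0 Hg; set orc := fun _ => _.
apply: (wp_runs_within (post := fun s' => let x := vec_at s' n 0 0 in
       (imem s' 0 0 = 0%N /\ polyhedral_cone M x /\ dot c x < 0) \/
       (imem s' 0 0 = 1%N /\ (list_len s' <= n.+2)%N /\
        exists y, [/\ represents M s' y, nonneg_vec y & y *m M = c]))).
apply: wp_seq; apply: wp_conseq (@SETUP_spec R n orc s (RGet 0 $3) (fun j => rmem s 0 j) Hn isT _) _.
  by move=> s1 j Hj H3 H0 _; rewrite /= H3 H0.
move=> s1 t1 q1 [A1 [Ht1 -> [S1 S1' S1''] [S2 S3 S4] [V23 V24]]].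
apply: wp_seq; apply: wp_iset; set s2 := setI _ _ _ _.
have V23' : vec_at s2 n 23 0 = c.
  by apply: (etrans V23); rewrite -Hc0; apply/rowP => j; rewrite !mxE.
have V24' : vec_at s2 n 24 0 = 0 by exact: V24.
have Hex : (0 < imem s2 30 0)%N -> rowset M (- c) by [].
have T2 : [/\ imem s2 1 0 = n, imem s2 2 0 = n.+1 & imem s2 28 0 = (n.+1 + n.+1)%N] by [].
have T3 : [/\ imem s2 24 0 = 0%N, imem s2 29 0 = 0%N & rmem s2 32 0 = 0] by [].
have E30 : imem s2 30 0 = 0%N by [].
clearbody s2.
apply: wp_seq; apply: wp_conseq (CORE0_spec HA n0 Ho erefl T2 T3 V23' V24' Hex Hg) _.
move=> s3 t3 q3 [L3 [Hq3 Ht3 Hres]]; rewrite E30 in Ht3.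
have N3 : imem s3 1 0 = n by case: T2 => <- _ _; rewrite (proj1 (L3 1%N isT) isT).
have xx : (n.+1 <= x2)%N by rewrite leq_pmulr.
apply: wp_if; case: Hres => [[S12 [Y1 Y2 Y3 Y4]]|[S12 HK Hc]]; last first.
  rewrite [beval _ _](_ : _ = false); last by rewrite /= S12.
  apply: wp_seq; apply: wp_conseq (@XCOPY_spec R n orc s3 0%N 34%N N3 isT) _.
  move=> s4 t4 q4 [A4 [Ht4 -> V4]]; apply: wp_iset; split.
  - by rewrite !addn0 !add0n.
  - by apply: cost_add Ht3 _; rewrite /=; clear -Ht1 Ht4 xx; lia.
  left; split=> //.
  by have -> : vec_at (setI s4 0 (ieval s4 (ICst 0)) (ieval s4 (ICst 0))) n 0 0 = vec_at s3 n 34 0 by [].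
rewrite [beval _ _](_ : _ = true); last by rewrite /= S12.
apply: wp_conseq (@YOUT1_spec R n orc n0 s3 m M c 1%N N3 Y1 Y2 Y3 Y4) _.
move=> s4 t4 q4 [A4 [Ht4 -> K0 HL Hy]]; split.
- by rewrite !addn0 !add0n.
- by apply: cost_add Ht3 _; rewrite /=; clear -Ht1 Ht4 xx; lia.
by right.
Qed.

Lemma represents_mix m (M : 'M[R]_(m, n)) s y : represents M s y ->
  y *m M = mix (list_len s) (list_coef s) (list_vec s n).
Proof.
move=> [f [fi Hr Hc H0]]; apply/rowP => k; rewrite mxE summxE.
rewrite (bigID (mem (codom f))) /= [X in _ + X]big1 ?addr0; last first.
  by move=> i Hi; rewrite H0 // mul0r.
rewrite -big_uniq /=; last exact/injectiveP.
by rewrite big_image; apply: eq_bigr => j _; rewrite -Hr Hc !mxE.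
Qed.

Fixpoint memdi (dirs : nat -> 'rV[R]_n) k x : option 'rV[R]_n :=
  if k is k'.+1 then (if dot (dirs k') x < 0 then Some (dirs k') else memdi dirs k' x) else None.

(** Neither oracle is one for [K] itself. If all rows of [d] are nonnegative at [x], then either
    [d x > 0], where the strict constraint of the first cone cannot be violated, or [d x = 0] and
    all these rows vanish at [x], so that the equations of the second cone cannot be. *)
Definition mem1 (dirs : nat -> 'rV[R]_n) nI d (mo me : 'rV[R]_n -> option 'rV[R]_n) x :=
  match memdi dirs nI x with
  | Some v => Some v
  | None => if 0 < dot d x then mo x else me x
  end.

Definition mpre1 (dirs : nat -> 'rV[R]_n) nI d s := [/\ imem s 29 0 = 1%N, imem s 24 0 = nI,
  vec_at s n 24 0 = d & forall i, (i < nI)%N -> vec_at s n 25 (i * n) = dirs i].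

Lemma memdi_none dirs k x : memdi dirs k x = None -> forall i, (i < k)%N -> 0 <= dot (dirs i) x.
Proof.
elim: k => //= k IH; case: ltP => // H0 /IH H i; rewrite ltnS leq_eqVlt => /orP[/eqP->//|]; exact: H.
Qed.

Lemma memdi_some dirs k x v : memdi dirs k x = Some v ->
  dot v x < 0 /\ exists2 i, (i < k)%N & v = dirs i.
Proof.
elim: k => //= k IH; case: ltP => [H0 [<-]|_ /IH [H1 [i Hi Ei]]]; first by split=> //; exists k.
by split=> //; exists i => //; exact: leqW.
Qed.

Lemma MEM1_spec orc s dirs nI d p0 q0 (MT0 : 'M[R]_(p0, n)) (MS0 : 'M[R]_(q0, n)) o0
    p1 q1 (MT1 : 'M[R]_(p1, n)) (MS1 : 'M[R]_(q1, n)) o1 :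
  orc 0%N = answers_of_poly MT0 MS0 o0 -> orc 1%N = answers_of_poly MT1 MS1 o1 ->
  (nI <= n)%N -> imem s 1 0 = n -> mpre1 dirs nI d s ->
  wp orc MEM s (fun s' t q => agree [:: 3; 6; 26] [:: 9; 22; 46] s s' /\
    [/\ (t <= 60 * (n.+1 * n.+1))%N, (q <= 1)%N &
      match mem1 dirs nI d (mem0 MT0 MS0 o0) (mem0 MT1 MS1 o1) (vec_at s n 6 0) with
      | None => imem s' 26 0 = 0%N
      | Some v => (0 < imem s' 26 0)%N /\ vec_at s' n 22 0 = v
      end]).
Proof.
move=> H0 H1 nIn Hn [M1 M2 M3 M4]; apply: wp_agreeS => //; set x := vec_at s n 6 0.
apply: wp_if; rewrite [beval _ _](_ : _ = false); last by rewrite /= M1.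
apply: wp_seq; apply: wp_iset; set s1 := setI _ _ _ _.
have A1 : agree [:: 26] [::] s s1 by agr.
have E26 : imem s1 26 0 = 0%N by [].
clearbody s1.
apply: wp_seq; apply: (@wp_for _ _ _ (fun i st =>
    match memdi dirs i x with
    | None => imem st 26 0 = 0%N
    | Some v => (0 < imem st 26 0)%N /\ vec_at st n 22 0 = v
    end) nI (20 * n.+1)) => //=.
- by fr A1.
- move=> i s2 Hi Ag Hv IH.
  have {}Ag : agree [:: 3; 6; 26] [:: 9; 22] s s2 by apply: agree_norm (agree_trans A1 Ag) _.
  have m1 : imem s2 1 0 = n by fr Ag.
  apply: wp_seq; apply: (@wp_vsum _ _ _ (fun j => rmem s2 25 (i * n + j) * rmem s2 6 j) n) => //=.
    by move=> j z Hj; ev; rewrite Hv m1.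
  move=> t1 Ht1; set s3 := State _ _.
  have E : rmem s3 9 0 = dot (dirs i) x.
    by rewrite -M4 // /x dot_vec /s3; ev; fr Ag.
  have m3 : imem s3 1 0 = n by [].
  have m36 : imem s3 6 0 = i by [].
  have F25 : rmem s3 25 = rmem s 25 by rewrite -(proj2 Ag 25%N isT).
  have E263 : imem s3 26 0 = imem s2 26 0 by [].
  have V223 : vec_at s3 n 22 0 = vec_at s2 n 22 0 by exact: vec_at_eq.
  clearbody s3.
  apply: wp_if; rewrite [beval _ _](_ : _ = (dot (dirs i) x < 0)); last by rewrite /= E -ltNge.
  case: ltP => Hd; last first.
    apply: wp_skip; split; [by rewrite /=; clear -Ht1; lia|by []|].
    move: IH; case: (memdi _ _ _) => [v [I1 I2]|I1]; last exact: (etrans E263).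
    by split; [change ((0 < imem s3 26 0)%N); rewrite E263 | exact: (etrans V223)].
  apply: wp_seq; apply: wp_iset; apply: (@wp_vset _ _ _ (fun j => rmem s 25 (i * n + j)) 0 n) => //=.
    by move=> j Hj; ev; rewrite m36 m3 F25.
  move=> t4 Ht4; split; [by rewrite /=; clear -Ht1 Ht4; lia|by []|].
  split=> //; apply: (etrans (vec_fill _ _ _ _ _ _)); rewrite -M4 //.
- move=> s2 t2 Ht2 Ag Hv IH.
  have {}Ag : agree [:: 3; 6; 26] [:: 9; 22] s s2 by apply: agree_norm (agree_trans A1 Ag) _.
  have m1 : imem s2 1 0 = n by fr Ag.
  have Hx : vec_at s2 n 6 0 = x by apply: vec_at_eq; fr Ag.
  have Vd : vec_at s2 n 24 0 = d by rewrite -M3; apply: vec_at_eq; fr Ag.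
  have LL : (nI * (20 * n.+1 + 0 + 2) <= n.+1 * (20 * n.+1 + 2))%N by rewrite addn0 leq_mul2r; apply/orP; right; lia.
  have xx : (n.+1 <= n.+1 * n.+1)%N by rewrite leq_pmulr.
  have Ht2' : (t2 <= 22 * (n.+1 * n.+1) + 1)%N.
    by move: Ht2 LL xx; clear; set z := (nI * _)%N; set y := (n.+1 * n.+1)%N; rewrite mulnDr mulnCA -/y; lia.
  rewrite /mem1; apply: wp_if; case Em: (memdi dirs nI x) IH => [v|].
    move=> [I1 I2]; rewrite [beval _ _](_ : _ = true) //.
    by apply: wp_skip; split=> //; rewrite /=; clear -Ht2'; lia.
  move=> I26; rewrite [beval _ _](_ : _ = false); last by rewrite /= I26.
  apply: wp_seq; apply: (@wp_vsum _ _ _ (fun j => rmem s2 24 j * rmem s2 6 j) n) => //=.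
  move=> t3 Ht3; set s3 := State _ _.
  have E46 : rmem s3 46 0 = dot d x by rewrite -Vd -Hx dot_vec /s3; ev.
  have Hx3 : vec_at s3 n 6 0 = x by rewrite -Hx; apply: vec_at_eq.
  clearbody s3.
  apply: wp_if; rewrite [beval _ _](_ : _ = (0 < dot d x)); last by rewrite /= E46 -ltNge.
  case: ltP => _.
    apply: wp_conseq (query_spec s3 H0) _ => s4 t4 q4 [_ [-> -> H]]; rewrite Hx3 in H.
    by split=> //; rewrite /=; clear -Ht2' Ht3 xx; lia.
  apply: wp_conseq (query_spec s3 H1) _ => s4 t4 q4 [_ [-> -> H]]; rewrite Hx3 in H.
  by split=> //; rewrite /=; clear -Ht2' Ht3 xx; lia.
Qed.

Lemma dot_mulmx m (M : 'M[R]_(m, n)) (y : 'rV[R]_m) x :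
  dot (y *m M) x = \sum_i y 0 i * dot (row i M) x.
Proof.
rewrite /dot; under eq_bigr => j _ do rewrite mxE mulr_suml.
rewrite exchange_big; apply: eq_bigr => i _; rewrite mulr_sumr.
by apply: eq_bigr => j _; rewrite mxE mulrA.
Qed.

Section MinRatio.
Variables (m : nat) (M : 'M[R]_(m, n)) (c d : 'rV[R]_n) (yd : 'rV[R]_m).
Variables (o_d : 'rV[R]_n -> option ('I_m + 'I_1)).
Variables (o_eq : 'rV[R]_n -> option ('I_(m + (#|supp yd| + #|supp yd|)) + 'I_0)).
Let noS : 'M[R]_(0, n) := 0.
Hypotheses (yd0 : nonneg_vec yd) (Hd : d = yd *m M).
Hypotheses (Hod : poly_oracle M d o_d) (Hoe : poly_oracle (eq_rows M (supp yd)) noS o_eq).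
Notation K := (polyhedral_cone M).

Lemma d_ge0 x : K x -> 0 <= dot d x.
Proof. by move=> Hx; rewrite Hd dot_mulmx; apply: sumr_ge0 => i _; rewrite mulr_ge0. Qed.

Lemma mem1_ok s g x : represents M s yd -> dot (c - g *: d) x < 0 ->
  match mem1 (list_vec s n) (list_len s) d (mem0 M d o_d)
     (mem0 (eq_rows M (supp yd)) noS o_eq) x with
  | None => K x | Some v => rowset M v /\ dot v x < 0 end.
Proof.
move=> [f [fi Hr _ Hf]] _; rewrite /mem1; case Em: (memdi _ _ _) => [v|].
  have [Hv [i Hi Ei]] := memdi_some Em; split=> //.
  by exists (f (Ordinal Hi)); rewrite Hr.
have Hpos := memdi_none Em.
case: ltP => Hdx.
  have := Hod x; rewrite /mem0; case: (o_d x) => [[i|j]|] /=.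
  - by move=> H; split=> //; exists i.
  - by rewrite row_id leNgt Hdx.
  - by case.
(* All terms of [d x], expanded along [yd], are nonnegative and their sum is at most 0, so each of
   them vanishes. *)
have Hsupp i : i \in supp yd -> dot (row i M) x = 0.
  have Hge j : 0 <= yd 0 j * dot (row j M) x.
    have [/codomP[k ->]|/Hf->] := boolP (j \in codom f); last by rewrite mul0r.
    by rewrite mulr_ge0 // Hr Hpos.
  have /eqP : \sum_j yd 0 j * dot (row j M) x = 0.
    by apply/eqP; rewrite eq_le sumr_ge0 // andbT -dot_mulmx -Hd.
  rewrite psumr_eq0 // => /allP /(_ i (mem_index_enum i)) /=.
  by rewrite mulf_eq0 inE => /orP[->//|/eqP->].
have := Hoe x; rewrite /mem0; case: (o_eq x) => [[i|[]//]|] /=.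
  rewrite /eq_rows; case: (split_ordP i) => [j ->|j ->].
    by rewrite rowKu => H; split=> //; exists j.
  rewrite rowKd; have E k : row k (rowsub (fun k : 'I_#|supp yd| => enum_val k) M) = row (enum_val k) M.
    by apply/rowP => l; rewrite !mxE.
  case: (split_ordP j) => [k ->|k ->].
    by rewrite rowKu E Hsupp ?ltxx // enum_valP.
  by rewrite rowKd raddfN /= E dotNl Hsupp ?oppr0 ?ltxx // enum_valP.
move=> [H _] i; have := H (lshift _ i); by rewrite /eq_rows rowKu.
Qed.

Definition orc_mr (i : nat) : 'rV[R]_n -> answer R n :=
  if i is 0%N then answers_of_poly M d o_d
  else answers_of_poly (eq_rows M (supp yd)) noS o_eq.

Lemma RPREP_spec s (x := vec_at s n 34 0) : imem s 1 0 = n -> vec_at s n 0 0 = c ->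
  vec_at s n 1 0 = d -> (list_len s <= n)%N ->
  wp orc_mr RPREP s (fun s' t q0 => agree [:: 3; 24; 29] [:: 23; 24; 25; 26; 32; 33; 46; 47; 50] s s' /\
    [/\ (t <= 300 * x2)%N, q0 = 0%N, 
      [/\ vec_at s' n 33 0 = x, vec_at s' n 50 0 = x & rmem s' 32 0 = dot c x / dot d x],
      vec_at s' n 23 0 = c /\ vec_at s' n 24 0 = d
    & [/\ imem s' 24 0 = list_len s, imem s' 29 0 = 1%N,
        forall i, (i < list_len s)%N -> vec_at s' n 25 (i * n) = list_vec s n i
      & forall i, (i < list_len s)%N -> rmem s' 26 i = list_coef s i]]).
Proof.
move=> Hn Hc Hdd Hl; apply: wp_agreeS => //.
apply: wp_seq; apply: wp_conseq (@XCOPY_spec R n orc_mr s 33%N 34%N Hn isT) _.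
move=> s1 t1 q1 [A1 [Ht1 -> V33]].
have N1 : imem s1 1 0 = n by rewrite (proj1 A1 1%N isT).
apply: wp_seq; apply: wp_conseq (@XCOPY_spec R n orc_mr s1 50%N 34%N N1 isT) _.
move=> s2 t2 q2 [A2 [Ht2 -> V50]].
have A12 : agree [:: 3] [:: 33; 50] s s2 by apply: agree_norm (agree_trans A1 A2) _.
have W33 : vec_at s2 n 33 0 = x by rewrite /x -V33; apply: vec_at_eq; exact: (proj2 A2 33%N isT).
have W50 : vec_at s2 n 50 0 = x by rewrite V50; apply: vec_at_eq; exact: (proj2 A1 34%N isT).
have N2 : imem s2 1 0 = n by rewrite (proj1 A12 1%N isT).
apply: wp_seq; apply: (@wp_vsum _ _ _ (fun j => rmem s 0 j * rmem s 34 j) n) => //=.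
  by move=> j z Hj; ev; fr A12.
move=> t3 Ht3; apply: wp_seq; set s3 := State _ _.
apply: (@wp_vsum _ _ _ (fun j => rmem s 1 j * rmem s 34 j) n) => //=.
  by move=> j z Hj; ev; fr A12.
move=> t4 Ht4; set s4 := State _ _; apply: wp_seq; apply: wp_rset.
have D46 : rmem s4 46 0 = dot c x by rewrite -Hc /x dot_vec /s4 /s3; ev.
have D47 : rmem s4 47 0 = dot d x by rewrite -Hdd /x dot_vec /s4 /s3; ev.
rewrite [reval _ _](_ : _ = dot c x / dot d x); last by rewrite /= -D46 -D47.
set s5 := State _ _.
have A5 : agree [:: 3] [:: 32; 33; 46; 47; 50] s s5.
  have A25 : agree [:: 3] [:: 32; 46; 47] s2 s5 by agr.
  by apply: agree_norm (agree_trans A12 A25) _.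
have X33 : vec_at s5 n 33 0 = x by exact: W33.
have X50 : vec_at s5 n 50 0 = x by exact: W50.
have X32 : rmem s5 32 0 = dot c x / dot d x by [].
clearbody s5.
have N5 : imem s5 1 0 = n by rewrite (proj1 A5 1%N isT).
apply: wp_seq; apply: wp_conseq (@XCOPY_spec R n orc_mr s5 23%N 0%N N5 isT) _.
move=> s6 t6 q6 [A6 [Ht6 -> V23]].
have N6 : imem s6 1 0 = n by rewrite (proj1 A6 1%N isT).
apply: wp_seq; apply: wp_conseq (@XCOPY_spec R n orc_mr s6 24%N 1%N N6 isT) _.
move=> s7 t7 q7 [A7 [Ht7 -> V24]].
have A57 : agree [:: 3] [:: 23; 24] s5 s7 by apply: agree_norm (agree_trans A6 A7) _.
have A07 : agree [:: 3] [:: 23; 24; 32; 33; 46; 47; 50] s s7 by apply: agree_norm (agree_trans A5 A57) _.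
have Y23 : vec_at s7 n 23 0 = c.
  rewrite -Hc -(vec_at_eq _ _ (proj2 A5 0%N isT)) -V23; apply: vec_at_eq; exact: (proj2 A7 23%N isT).
have Y24 : vec_at s7 n 24 0 = d.
  have B6 : agree [:: 3] [:: 23; 32; 33; 46; 47; 50] s s6 by apply: agree_norm (agree_trans A5 A6) _.
  by rewrite V24 -Hdd; apply: vec_at_eq; exact: (proj2 B6 1%N isT).
apply: wp_seq; apply: wp_iset; set s8 := setI _ _ _ _.
have E24 : imem s8 24 0 = list_len s by rewrite /s8; ev; fr A07.
have N8 : imem s8 1 0 = n by have -> : imem s8 1 0 = imem s7 1 0 by []; rewrite (proj1 A07 1%N isT).
have R2 : rmem s8 2 = rmem s 2 by exact: (proj2 A07 2%N isT).
have R3 : rmem s8 3 = rmem s 3 by exact: (proj2 A07 3%N isT).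
apply: wp_seq; apply: (@wp_vset _ _ _ (fun j => rmem s 2 j) 0 (list_len s * n)) => //.
- by rewrite /= -E24 -N8.
- by move=> j Hj; ev; rewrite (proj2 A07 2%N isT).
move=> t9 Ht9; set s9 := State _ _.
apply: wp_seq; apply: (@wp_vset _ _ _ (fun j => rmem s 3 j) 0 (list_len s)) => //.
- by move=> j Hj; ev; rewrite (proj2 A07 3%N isT).
move=> t10 Ht10; set s10 := State _ _.
apply: wp_iset; set s11 := setI _ _ _ _.
have F a : a \notin [:: 25; 26]%N -> rmem s11 a = rmem s7 a.
  rewrite !inE => /norP[/negbTE h1 /negbTE h2]; apply/funext => j; by rewrite /s11; ev; rewrite h1 h2.
have V a : a \notin [:: 25; 26]%N -> vec_at s11 n a 0 = vec_at s7 n a 0 by move=> Ha; apply: vec_at_eq; exact: F.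
split.
- rewrite /= in Ht9 Ht10 *; move: Ht1 Ht2 Ht3 Ht4 Ht6 Ht7 Ht9 Ht10 Hl; rewrite !addn0 !add0n.
  set l := list_len s; clearbody l; clear=> *.
  have : (l * n <= n * n)%N by rewrite leq_mul2r; apply/orP; right.
  nia.
- by [].
- rewrite !V // F // (proj2 A57 32%N isT); split=> //.
    by rewrite -X33; apply: vec_at_eq; exact: (proj2 A57 33%N isT).
  by rewrite -X50; apply: vec_at_eq; exact: (proj2 A57 50%N isT).
- by rewrite !V.
split.
- by rewrite -E24.
- by [].
- move=> i Hi; apply/rowP => j; rewrite !mxE /s11; ev; rewrite add0n subn0 /list_len.
  have -> // : (i * n + j < imem s 0 1 * n)%N.
  by have := ltn_ord j; move: Hi; rewrite /list_len; clear; nia.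
- by move=> i Hi; rewrite /s11; ev; rewrite add0n subn0 Hi.
Qed.

Lemma RATIO_spec s p : (#|supp yd| <= n)%N -> imem s 0 0 = n -> vec_at s n 0 0 = c ->
  vec_at s n 1 0 = d -> list_len s = #|supp yd| -> represents M s yd ->
  good n (cond_number M) (epsk R n p) ->
  runs_within orc_mr (RATIO A) s (qb p + qb p) (tb 0 p + tb 0 p + (1000 * x2)%N%:R)
    (fun s' _ => min_ratio_output M c d n.+2 s').
Proof.
move=> Hsn Hn Hc Hdd HL Hrep Hg.
apply: (wp_runs_within (post := min_ratio_output M c d n.+2)).
have qb0 : 0 <= qb p.
  apply: sumr_ge0 => i _; rewrite mulr_ge0 //.
  by case: (ToTa_ge0 HA n0 (@epsk_gt0 R n n0 i)).
have Hod' : poly_oracle M (- - d) o_d by rewrite opprK.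
have Horc : orc_mr 0%N = answers_of_poly M (- - d) o_d by rewrite opprK.
apply: wp_seq; apply: wp_conseq (@SETUP_spec R n orc_mr s (RCst 0 -r RGet 1 $3) (fun j => 0 - rmem s 1 j) Hn isT _) _.
  by move=> s1 j Hj H3 _ H1; rewrite /= H3 H1.
move=> s1 t1 q1 [A1 [Ht1 -> [S1 S1' S1''] [S2 S3 S4] [V23 V24]]].
apply: wp_seq; apply: wp_iset; set s2 := setI _ _ _ _.
have A2 : agree [:: 1; 2; 3; 24; 28; 29; 30] [:: 23; 24; 32] s s2.
  by apply: agree_norm (agree_trans A1 (setI_agree s1 30 0 0)) _.
have V23' : vec_at s2 n 23 0 = - d.
  by apply: (etrans V23); rewrite -Hdd; apply/rowP => j; rewrite !mxE sub0r.
have V24' : vec_at s2 n 24 0 = 0 by exact: V24.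
have Hex : (0 < imem s2 30 0)%N -> rowset M (- - d) by [].
have T2 : [/\ imem s2 1 0 = n, imem s2 2 0 = n.+1 & imem s2 28 0 = (n.+1 + n.+1)%N] by [].
have T3 : [/\ imem s2 24 0 = 0%N, imem s2 29 0 = 0%N & rmem s2 32 0 = 0] by [].
have E30 : imem s2 30 0 = 0%N by [].
clearbody s2.
apply: wp_seq; apply: wp_conseq (CORE0_spec HA n0 Hod' Horc T2 T3 V23' V24' Hex Hg) _.
move=> s3 t3 q3 [L3 [Hq3 Ht3 Hres]]; rewrite E30 in Ht3.
have N3 : imem s3 1 0 = n by case: T2 => <- _ _; rewrite (proj1 (L3 1%N isT) isT).
have xx : (n.+1 <= x2)%N by rewrite leq_pmulr.
have tb0 : 0 <= tb 0 p by apply: le_trans Ht3.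
have R3 a : (a < 23)%N -> a \notin PR -> rmem s3 a = rmem s a.
  move=> Ha HPR; rewrite (proj2 (L3 a (leq_trans Ha (isT : (23 <= 100)%N))) HPR); apply: (proj2 A2).
  by rewrite !inE; do !(apply/norP; split); apply/eqP => E; move: Ha; rewrite E.
have L03 : list_len s3 = #|supp yd|.
  by rewrite -HL /list_len (proj1 (L3 0%N isT) isT) (proj1 A2 0%N isT).
have LV3 : list_vec s3 n = list_vec s n by apply/funext => j; apply: vec_at_eq; exact: R3.
have LC3 : list_coef s3 = list_coef s by apply/funext => j; rewrite /list_coef R3.
apply: wp_if; case: Hres => [[S12 [Y1 Y2 Y3 Y4]]|[S12 HK Hdx]].
  rewrite [beval _ _](_ : _ = true); last by rewrite /= S12.
  apply: wp_conseq (@YOUT1_spec R n orc_mr n0 s3 m M (- d) 1%N N3 Y1 Y2 Y3 Y4) _.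
  move=> s4 t4 q4 [A4 [Ht4 -> K0 HL4 [y [W1 W2 W3]]]]; split.
  - by rewrite !addn0 !add0n; apply: le_trans Hq3 _; rewrite lerDl.
  - apply: cost_add; first by apply: le_trans Ht3 _; rewrite lerDl; exact: tb0.
    by rewrite /=; clear -Ht1 Ht4 xx; lia.
  have Kd x : K x -> dot d x = 0.
    move=> Hx; apply/eqP; rewrite eq_le d_ge0 // andbT -oppr_ge0 -dotNl -W3 dot_mulmx.
    by apply: sumr_ge0 => i _; rewrite mulr_ge0.
  split.
  - move=> gamma [G1 G2]; exfalso.
    (* If [d] vanishes on [K], then [gamma + 1] is as valid as [gamma], and there is no maximum. *)
    have /G2 : [set g : R | forall x, K x -> 0 <= dot (c - g *: d) x]%classic (gamma + 1).
      move=> x Hx; have := G1 x Hx; by rewrite !dotBl !dotZl (Kd x Hx) !mulr0.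
    by rewrite gerDl ler10.
  - by move=> _; split=> //; exists y.
  - by move=> [[x [Hx Hx']] _]; exfalso; move: Hx'; rewrite Kd // ltxx.
have {}Hdx : 0 < dot d (vec_at s3 n 34 0) by rewrite dotNl oppr_lt0 in Hdx.
set xb := vec_at s3 n 34 0 in HK Hdx.
have d0 : d != 0 by apply/eqP => E; move: Hdx; rewrite E dot0l ltxx.
rewrite [beval _ _](_ : _ = false); last by rewrite /= S12.
have C3 : vec_at s3 n 0 0 = c by rewrite -Hc; apply: vec_at_eq; exact: R3.
have D3 : vec_at s3 n 1 0 = d by rewrite -Hdd; apply: vec_at_eq; exact: R3.
apply: wp_seq; apply: wp_conseq (RPREP_spec N3 C3 D3 _) _; first by rewrite L03.
move=> s4 t4 q4 [A4 [Ht4 -> [X33 X50 G4] [X23 X24] [M24 M29 M25 M26]]]; rewrite -/xb in X33 X50 G4.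
have Hrep3 : represents M s3 yd.
  move: Hrep => [f [fi Hr Hcf Hf]]; rewrite -HL in L03.
  rewrite /represents L03 LV3 LC3; by exists f.
pose dirs := list_vec s3 n; pose nI := list_len s3.
have nIn : (nI <= n)%N by rewrite /nI L03.
have HMpre (sa sb : state R) : mpre1 dirs nI d sa -> imem sb 24 = imem sa 24 -> imem sb 29 = imem sa 29 ->
  rmem sb 24 = rmem sa 24 -> rmem sb 25 = rmem sa 25 -> mpre1 dirs nI d sb.
  move=> [P1 P2 P3 P4] e1 e2 e3 e4; split; rewrite ?e1 ?e2 //.
    by rewrite -P3; apply: vec_at_eq.
  by move=> i Hi; rewrite -P4 //; apply: vec_at_eq.
have Hdmix : d = mix nI (list_coef s3) dirs by rewrite Hd (represents_mix Hrep3).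
have N4 : imem s4 1 0 = n by rewrite (proj1 A4 1%N isT).
have B4 : dbase (rowset M) K c d (mpre1 dirs nI d) s4.
  have [f [fi Hr Hcf Hf]] := Hrep3.
  split=> //.
  - by rewrite (proj1 A4 2%N isT) (proj1 (L3 2%N isT) isT); case: T2.
  - by rewrite (proj1 A4 28%N isT) (proj1 (L3 28%N isT) isT); case: T2.
  split=> //.
    split; rewrite ?M24 //.
    + move=> i Hi; split; last by rewrite M26 // -(Hcf (Ordinal Hi)).
      by rewrite /Submission.di M25 //; exists (f (Ordinal Hi)); rewrite Hr.
    + by rewrite [LHS]Hdmix; apply: eq_mix => i Hi; rewrite ?M26 // /Submission.di M25.
    + by rewrite (proj1 A4 30%N isT) (proj1 (L3 30%N isT) isT) E30.
  by right; rewrite X33; split=> //; rewrite G4 divfK // gt_eqF.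
apply: wp_seq.
apply: wp_conseq (CORE_spec HMpre (fun sa => @MEM1_spec orc_mr sa dirs nI d _ _ _ _ _ _ _ _ _ _ erefl erefl nIn)
  (fun g x => @mem1_ok s3 g x Hrep3) HA n0 (cond_number_gt0 M) (@cond_number_lower_bounded _ _ _ M) B4 Hg) _.
move=> s5 t5 q5 [L5 G5 B5 [Hq5 Ht5 Hres]].
have E304 : imem s4 30 0 = 0%N by rewrite (proj1 A4 30%N isT) (proj1 (L3 30%N isT) isT) E30.
rewrite E304 in Ht5.
have N5 : imem s5 1 0 = n by rewrite (proj1 (L5 1%N isT) isT).
have {}Hq5 : (q3 + q5)%N%:R <= qb p + qb p by rewrite natrD lerD.
have {}Ht5 : (t3 + t5)%N%:R <= tb 0 p + tb 0 p by rewrite natrD lerD.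
have [_ _ _ _ [_ _ _ X5]] := B5.
apply: wp_if; case: Hres => [[S5 [Y1 Y2 Y3 Y4]]|[S5 [F1 F2 [g F3]]]].
  rewrite [beval _ _](_ : _ = true); last by rewrite /= S5.
  apply: wp_seq; apply: wp_rset; set s6 := State _ _.
  have N6 : imem s6 1 0 = n by [].
  apply: wp_seq; apply: wp_conseq (@XCOPY_spec R n orc_mr s6 0%N 33%N N6 isT) _.
  move=> s7 t7 q7 [A7 [Ht7 -> V0]].
  have A57 : agree [:: 3] [:: 0; 4] s5 s7.
    have A56 : agree [::] [:: 4] s5 s6 by agr.
    by apply: agree_norm (agree_trans A56 A7) _.
  have N7 : imem s7 1 0 = n by rewrite (proj1 A57 1%N isT).
  have I23 : imem s7 23 = imem s5 23 by exact: (proj1 A57 23%N isT).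
  have I42 : rmem s7 42 = rmem s5 42 by exact: (proj2 A57 42%N isT).
  have Iy : yr s7 = yr s5 by apply/funext => j; apply: vec_at_eq; exact: (proj2 A57 41%N isT).
  rewrite -I23 -I42 -Iy in Y1 Y2 Y3 Y4.
  apply: wp_conseq (@YOUT1_spec R n orc_mr n0 s7 m M _ 0%N N7 Y1 Y2 Y3 Y4) _.
  move=> s8 t8 q8 [A8 [Ht8 -> K0 HL8 [y [W1 W2 W3]]]]; split.
  - by rewrite !addn0 !add0n.
  - apply: cost_add Ht5 _.
    by rewrite /=; clear -Ht1 Ht4 Ht7 Ht8 xx; lia.
  set Gm := rmem s5 32 0 in W3.
  have X8 : vec_at s8 n 0 0 = vec_at s5 n 33 0.
    by rewrite (vec_at_eq _ _ (proj2 A8 0%N isT)) V0.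
  have R4 : rmem s8 4 0 = Gm.
    by rewrite (proj2 A8 4%N isT) (proj2 A7 4%N isT).
  case: X5 => [E|[Q1 Q2 Q3]]; first by move: d0; rewrite E eqxx.
  rewrite -/Gm in Q3.
  (* The conic combination shows that [Gm] is a valid value, which excludes unboundedness; the
     witness in array 33 shows that no larger value is valid. *)
  have GG x : K x -> 0 <= dot (c - Gm *: d) x.
    by move=> Hx; rewrite -W3 dot_mulmx; apply: sumr_ge0 => i _; rewrite mulr_ge0.
  have Q4 : dot (c - Gm *: d) (vec_at s5 n 33 0) = 0 by rewrite dotBl dotZl Q3 subrr.
  split.
  - move=> gamma [G1 G2]; have E : gamma = Gm.
      apply/eqP; rewrite eq_le; apply/andP; split; last exact: G2.
      have := G1 _ Q1; rewrite dotBl dotZl Q3 -mulrBl pmulr_lge0 // subr_ge0 //.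
    by rewrite E X8; split=> //; exists y.
  - by move=> H; exfalso; move: Q2; rewrite H // ltxx.
  - move=> [_ /(_ Gm) [x [Hx Hx1 Hx2]]]; exfalso; have := GG x Hx.
    by rewrite dotBl dotZl leNgt subr_lt0 -ltr_pdivrMr // Hx2.
rewrite [beval _ _](_ : _ = false); last by rewrite /= S5.
apply: wp_seq; apply: wp_conseq (@XCOPY_spec R n orc_mr s5 0%N 50%N N5 isT) _.
move=> s6 t6 q6 [A6 [Ht6 -> V0]].
have N6 : imem s6 1 0 = n by rewrite (proj1 A6 1%N isT).
apply: wp_seq; apply: wp_conseq (@XCOPY_spec R n orc_mr s6 1%N 34%N N6 isT) _.
move=> s7 t7 q7 [A7 [Ht7 -> V1]]; apply: wp_iset; set s8 := setI _ _ _ _; split.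
- by rewrite !addn0 !add0n.
- apply: cost_add Ht5 _.
  by rewrite /=; clear -Ht1 Ht4 Ht6 Ht7 xx; lia.
have X0 : vec_at s8 n 0 0 = xb.
  apply: (etrans (y := vec_at s6 n 0 0)); first by apply: vec_at_eq; exact: (proj2 A7 0%N isT).
  by rewrite V0 -X50; apply: vec_at_eq; exact: (proj2 (L5 50%N isT) isT).
have X1 : vec_at s8 n 1 0 = vec_at s5 n 34 0.
  apply: (etrans (y := vec_at s7 n 1 0)); first by apply: vec_at_eq.
  by rewrite V1; apply: vec_at_eq; exact: (proj2 A6 34%N isT).
have S8 : imem s8 0 0 = 2%N by rewrite /s8; ev.
clearbody s8.
have Z : dot d (vec_at s5 n 34 0) = 0 by apply/eqP; rewrite eq_le F2 d_ge0.
have cneg : dot c (vec_at s5 n 34 0) < 0 by move: F3; rewrite dotBl dotZl Z mulr0 subr0.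
split.
- by move=> gamma [G1 _]; exfalso; have := G1 _ F1; rewrite dotBl dotZl Z mulr0 subr0 leNgt cneg.
- by move=> H; exfalso; move: Hdx; rewrite H // ltxx.
- by move=> _; rewrite S8 X0 X1.
Qed.

End MinRatio.

End Solvers.

(** * Running time *)

Section Asymptotics.
Variable (R : realType).

Lemma ln2_ge : 2^-1 <= ln (2 : R).
Proof.
have H := @le_ln1Dx R (- 2^-1) ltac:(by rewrite ltrN2 invf_lt1 // ltr1n).
have E : 1 + - 2^-1 = 2^-1 :> R by lra.
by move: H; rewrite E lnV ?posrE // lerN2.
Qed.

(** As [nu >= 1], consecutive terms grow at least by a factor 2, so the sum is at most twice its
    last term. *)
Lemma geometric_sum (t nu : R) p : 0 <= t -> 1 <= nu ->
  \sum_(i < p.+1) (2 ^+ i * t) `^ nu <= 2 * (2 ^+ p * t) `^ nu.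
Proof.
move=> t0 nu1; elim: p => [|p IH].
  by rewrite big_ord_recl big_ord0 addr0 expr0 mul1r mulr2n mulrDl !mul1r lerDl powR_ge0.
rewrite big_ord_recr /= mulrDl mul1r lerD2r; apply: le_trans IH _.
rewrite (_ : 2 ^+ p.+1 * t = 2 * (2 ^+ p * t)); last by rewrite exprS mulrA.
rewrite (@powRM _ 2) // ?mulr_ge0 ?exprn_ge0 // ler_wpM2r ?powR_ge0 //.
by apply: le1r_powR => //; rewrite ler1n.
Qed.

Section Size.
Variable n : nat.
Hypothesis n0 : (0 < n)%N.
Let L : R := ln (4%:R * n%:R).

Let np : 0 < n%:R :> R. Proof. by rewrite ltr0n. Qed.
Let np4 : 0 < 4%:R * n%:R :> R. Proof. by rewrite mulr_gt0. Qed.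

Lemma L_ge1 : 1 <= L.
Proof.
apply: (@le_trans _ _ (ln (2 ^+ 2))); last first.
  rewrite ler_ln ?posrE ?exprn_gt0 // expr2 -natrM.
  by rewrite -[X in X <= _]mulr1 ler_wpM2l // ler1n.
by rewrite lnXn // -[leRHS]mulr_natl; have := ln2_ge; lra.
Qed.

Lemma ln_epsk i : ln (n%:R / epsk R n i) = ln n%:R + 2 ^+ i * L.
Proof.
rewrite /epsk exprVn invrK lnM ?posrE ?exprn_gt0 // lnXn // -/L.
by rewrite -[L *+ _]mulr_natl natrX.
Qed.

Lemma lg_epsk_le i : lg (n%:R / epsk R n i) <= 2 ^+ i * (2 * L).
Proof.
have L1 := L_ge1; have e1 : 1 <= 2 ^+ i :> R by rewrite exprn_ege1 // ler1n.
have lnL : ln n%:R <= L by rewrite ler_ln ?posrE // ler_peMl // ler1n.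
have eL : L <= 2 ^+ i * L by rewrite ler_peMl // (le_trans _ L1).
rewrite /lg ge_max ln_epsk mulrCA; apply/andP; split; lra.
Qed.

Definition budget (C : nat) (delta : R) := lg (n%:R / (delta / (C%:R * n%:R))).

(** The factor 2 is that of the geometric sum. The factor [4 ^ nu] collects the 2 in [lg_epsk_le]
    and the 2 by which the last phase may exceed the budget. *)
Lemma cost_sum (g : nat -> R) (nu : R) p C delta : 1 <= nu -> 0 <= g n ->
  2 ^+ p * L <= 2 * budget C delta ->
  \sum_(i < p.+1) cost_fun g nu n (epsk R n i)
    <= 2 * 4%:R `^ nu * cost_fun g nu n (delta / (C%:R * n%:R)).
Proof.
move=> nu1 g0 Hp; rewrite /cost_fun -mulr_sumr mulrCA ler_wpM2l // -/(budget C delta).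
have L1 := L_ge1; have L0 : 0 <= L by apply: le_trans L1.
have B0 : 0 <= budget C delta by rewrite /budget /lg le_max ler01.
have nu0 : 0 <= nu by apply: le_trans nu1.
apply: (@le_trans _ _ (\sum_(i < p.+1) (2 ^+ i * (2 * L)) `^ nu)).
  apply: ler_sum => i _; apply: ge0_ler_powR; rewrite ?nnegrE ?lg_epsk_le //.
    by rewrite /lg le_max ler01.
  by rewrite !mulr_ge0 // exprn_ge0.
apply: le_trans (geometric_sum _ _ nu1) _; first by rewrite mulr_ge0.
rewrite -mulrA ler_wpM2l // -powRM // ge0_ler_powR ?nnegrE // ?mulr_ge0 ?exprn_ge0 //.
by rewrite mulrCA (_ : 4%:R = 2 * 2 :> R) -?mulrA ?ler_wpM2l //; lra.
Qed.

(** [p] is the least good phase. At the preceding one [1 / eps] was at most [16 n^2 / delta], and a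
    further squaring doubles its logarithm; [16 <= C] puts [16 n^2 / delta] within the argument of
    the logarithm in the budget. *)
Lemma phase_exists (delta : R) : 0 < delta -> delta <= 1 ->
  exists p, [/\ good n delta (epsk R n p),
    forall C, (16 <= C)%N -> 2 ^+ p * L <= 2 * budget C delta
    & p.+1%:R <= 5%:R * loglog_inv delta].
Proof.
move=> d0 d1; have L1 := L_ge1.
have Lp : 0 < L by apply: lt_le_trans L1.
pose P p := 16%:R * n%:R ^+ 2 * epsk R n p < delta.
have exP : exists p, P p.
  pose i := (Num.truncn (16%:R * n%:R ^+ 2 / delta)).+1; exists i.
  suff H : 16%:R * n%:R ^+ 2 / delta < (4%:R * n%:R) ^+ (2 ^ i).
    rewrite /P /epsk exprVn ltr_pdivrMr; last by rewrite exprn_gt0.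
    by rewrite [ltRHS]mulrC -ltr_pdivrMr.
  have H0 : 0 <= 16%:R * n%:R ^+ 2 / delta by rewrite divr_ge0 ?mulr_ge0 ?exprn_ge0 // ltW.
  have /andP[_ /lt_le_trans] := truncn_itv H0; apply.
  rewrite (_ : (4%:R * n%:R) ^+ (2 ^ i) = ((4 * n) ^ (2 ^ i))%N%:R :> R); last by rewrite natrX natrM.
  rewrite ler_nat -/i.
  apply: leq_trans (ltnW (ltn_expl i (isT : 1 < 2)%N)) _.
  apply: leq_trans (ltnW (ltn_expl (2 ^ i) (isT : 1 < 2)%N)) _.
  by rewrite leq_exp2r ?expn_gt0 //; lia.
have [p Pp Hmin] := ex_minnP exP.
exists p; have Y1 C : 1 <= budget C delta by rewrite /budget /lg le_max lexx.
(* The last failed phase bounds 1 / delta from below. *)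
have Hfail k : p = k.+1 -> 2 ^+ k * L <= ln (16%:R * n%:R ^+ 2 / delta).
  move=> E; have : ~~ P k by apply/negP => /Hmin; rewrite E ltnn.
  rewrite /P -leNgt /epsk exprVn ler_pdivlMr ?exprn_gt0 // => H.
  rewrite (_ : 2 ^+ k * L = ln ((4%:R * n%:R) ^+ (2 ^ k))); last first.
    by rewrite lnXn // -/L -[L *+ _]mulr_natl natrX.
  by rewrite ler_ln ?posrE ?exprn_gt0 // ?divr_gt0 ?mulr_gt0 ?exprn_gt0 // ler_pdivlMr // mulrC.
have Hbud C : (16 <= C)%N -> ln (16%:R * n%:R ^+ 2 / delta) <= budget C delta.
  move=> HC; have C0 : 0 < C%:R :> R by rewrite ltr0n; lia.
  rewrite /budget /lg le_max; apply/orP; right.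
  rewrite ler_ln ?posrE; [|by rewrite divr_gt0 ?mulr_gt0 ?exprn_gt0|by rewrite !divr_gt0 // mulr_gt0].
  rewrite (_ : n%:R / _ = C%:R * n%:R ^+ 2 / delta); last first.
    by rewrite invf_div expr2; ring.
  rewrite ler_wpM2r ?invr_ge0 ?(ltW d0) //.
  by rewrite ler_wpM2r ?exprn_ge0 // ler_nat.
split=> //.
- move=> C HC; case E: p => [|k].
    rewrite expr0 mul1r; apply: (@le_trans _ _ (budget C delta)); last by have := Y1 C; lra.
    apply: le_trans _ (Hbud C HC); rewrite ler_ln ?posrE // ?divr_gt0 ?mulr_gt0 ?exprn_gt0 //.
    rewrite ler_pdivlMr //; apply: (@le_trans _ _ (4%:R * n%:R)); first by rewrite ler_piMr // ltW.
    by rewrite expr2 mulrA ler_wpM2r // -natrM ler_nat; lia.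
  by rewrite exprS -mulrA ler_wpM2l //; apply: le_trans (Hfail k E) (Hbud C HC).
rewrite /loglog_inv; set l := ln delta^-1.
have l0 : 0 <= l by rewrite ln_ge0 // invf_ge1.
have lg1 : 1 <= lg l by rewrite /lg le_max lexx.
case E: p => [|k]; first by rewrite mulr1n; lra.
have H2k : 2 ^+ k <= 2 + l.
  have := Hfail k E; rewrite lnM ?posrE ?invr_gt0 ?mulr_gt0 ?exprn_gt0 // -/l.
  (* [16 n^2] is the square of [4 n], the inverse of the first eps. This is why the number of phases
     depends on delta but not on [n]. *)
  have -> : ln (16%:R * n%:R ^+ 2) = 2 * L.
    rewrite (_ : 16%:R * n%:R ^+ 2 = (4%:R * n%:R) ^+ 2 :> R); last by ring.
    by rewrite lnXn // -/L mulr_natl.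
  move=> H; have lL : l <= l * L by rewrite ler_peMr.
  rewrite -(ler_pM2r Lp) mulrDl; lra.
(* For small [l] the bound [2 ^ k <= 2 + l] leaves at most four phases, and the logarithmic factor
   is at least 1. *)
have [l2|l2] := leP l 2.
  have k2 : (k <= 2)%N.
    rewrite leqNgt; apply/negP => k3.
    have : (2 ^ 3)%:R <= 2 ^+ k :> R by rewrite -natrX ler_nat leq_exp2l.
    move=> H; have : (2 ^ 3)%:R <= 4%:R :> R by lra.
    by rewrite ler_nat.
  apply: (@le_trans _ _ 5%:R); first by rewrite ler_nat; lia.
  by rewrite -[leLHS]mulr1 ler_wpM2l.
have lp : 0 < l by apply: lt_trans l2.
have Hk : k%:R * ln (2 : R) <= ln 2 + ln l.
  rewrite mulr_natl -lnXn // -lnM ?posrE // ler_ln ?posrE ?exprn_gt0 ?mulr_gt0 //; lra.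
have H1 : ln l <= lg l by rewrite /lg le_max lexx orbT.
have h2 := ln2_ge.
have Hk2 : k%:R <= 1 + 2 * lg l.
  have [k1|k1] := leP (k%:R : R) 1; first by lra.
  have : 0 <= (k%:R - 1) * (ln (2 : R) - 2^-1) by rewrite mulr_ge0 // subr_ge0 // ltW.
  move: Hk; rewrite mulrBl mul1r mulrBr; lra.
by rewrite -!natr1; lra.
Qed.

End Size.

End Asymptotics.

(** * A lower bound on the size of certificates *)

Section CertificateSize.
Variables (R : realType) (n : nat).
Hypothesis n0 : (0 < n)%N.

Lemma exec_answers (orc : nat -> 'rV[R]_n -> answer R n) c s s' t l r :
  exec orc c s s' t l -> r \in l -> exists k x, r = orc k x.
Proof.
move=> He; elim: He r => //=.
- move=> c1 c2 {}s s1 s2 t1 t2 l1 l2 _ IH1 _ IH2 r.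
  by rewrite mem_cat => /orP[/IH1|/IH2].
- move=> b {}c {}s s1 s2 t1 t2 l1 l2 _ _ IH1 _ IH2 r.
  by rewrite mem_cat => /orP[/IH1|/IH2].
- by move=> k x f v {}s r; rewrite inE => /eqP ->; exists k, (vec_at s n x 0).
Qed.

Lemma coord_le_enorm (u : 'rV[R]_n) i : `|u 0 i| <= enorm u.
Proof.
rewrite -sqrtr_sqr ler_wsqrtr // (bigD1 i) //= lerDl.
by apply: sumr_ge0 => j _; exact: sqr_ge0.
Qed.

(* The only linear relation among these n + 1 vectors has all coefficients equal,
   so a certificate made of them must use them all. *)
Definition simplex_vec (h : option 'I_n) : 'rV[R]_n :=
  if h is Some i then delta_mx 0 i else const_mx (-1).

Definition simplex_oracle (x : 'rV[R]_n) : option 'rV[R]_n :=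
  Some (simplex_vec [pick i | x 0 i <= 0]).

Arguments simplex_vec : simpl never.

Lemma simplex_vecE h j :
  simplex_vec h 0 j = if h is Some i then (j == i)%:R else -1.
Proof. by case: h => [i|]; rewrite /simplex_vec mxE ?eqxx. Qed.

Lemma simplex_vec_norm1 h : norm1 (simplex_vec h) = if h is Some i then 1 else n%:R.
Proof.
rewrite /norm1; case: h => [i|].
  rewrite (bigD1 i) //= big1 => [|j /negPf ji]; rewrite simplex_vecE ?eqxx ?ji ?normr1 ?addr0 //.
  by rewrite normr0.
under eq_bigr => i _ do rewrite simplex_vecE normrN1.
by rewrite sumr_const card_ord.
Qed.

Lemma simplex_oracleP : conic_oracle set0 simplex_oracle.
Proof.
move=> x; split=> //; split=> //.
- apply/eqP => /rowP H; case: pickP H => [i _ /(_ i)|_ /(_ (Ordinal n0))];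
    rewrite simplex_vecE mxE ?eqxx; move/eqP; rewrite ?oppr_eq0 oner_eq0 //.
- rewrite /dot; case: pickP => [i Hi|H].
    rewrite (bigD1 i) //= big1 => [|j /negPf ji]; rewrite simplex_vecE ?eqxx ?ji ?mul1r ?addr0 //.
    by rewrite mul0r.
  apply: sumr_le0 => i _; rewrite simplex_vecE mulN1r oppr_le0.
  by have := H i; move/negbT; rewrite -ltNge => /ltW.
Qed.

(** This lets [n^3 tau n] absorb the operations of order [n^4] that a phase spends independently of
    [tau]. The empty cone forces [A] to return a certificate, and the oracle offers only the vectors
    of a simplex. *)
Lemma certificate_size (A : cmd) (To Ta : nat -> R -> R) (tau : nat -> nat) :
  solves_approx_conic_dual A To Ta tau -> (n < tau n)%N.
Proof.
move=> HA; have np : 0 < n%:R :> R by rewrite ltr0n.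
pose eps : R := (4%:R * n%:R)^-1.
have eps0 : 0 < eps by rewrite invr_gt0 mulr_gt0.
have C0 : is_cone (set0 : set 'rV[R]_n) by split=> // x y t; rewrite inE.
pose s0 : state R := State (fun _ _ => n) (fun _ _ => eps).
have [s [t [l [He _ _]]]] := HA n set0 _ eps s0 n0 C0 simplex_oracleP eps0 erefl erefl.
case=> [[_ []]|[_ [HN Hl Hsum Hone]]].
apply: leq_trans HN; set N := list_len s in Hl Hsum Hone *.
have Hh (j : 'I_N) : exists h, list_vec s n j = simplex_vec h.
  have [/(exec_answers He) [k [x]]] := Hl j (ltn_ord j).
  by rewrite /answers_of_conic /= => -[->] _; exists [pick i | x 0 i <= 0].
have [h hE] := choice Hh.
have pos (j : 'I_N) : 0 <= list_coef s j by have [_ /ltW] := Hl j (ltn_ord j).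
pose a o := \sum_(j < N | h j == o) list_coef s j.
have a0 o : 0 <= a o by apply: sumr_ge0.
set u := \sum_(j < N) _ in Hsum.
have regroup (F : option 'I_n -> R) :
    \sum_(j < N) list_coef s j * F (h j) = a None * F None + \sum_i a (Some i) * F (Some i).
  rewrite (partition_big h xpredT) //= (bigD1 None) //=; congr (_ + _).
    by rewrite mulr_suml; apply: eq_bigr => j /eqP ->.
  rewrite (reindex_onto Some (fun o => odflt (Ordinal n0) o)) /=; last by case.
  rewrite (eq_bigl xpredT) => [|i]; last by rewrite eqxx.
  by apply: eq_bigr => i _; rewrite mulr_suml; apply: eq_bigr => j /eqP ->.
have uE i : u 0 i = a (Some i) - a None.
  rewrite summxE (eq_bigr (fun j : 'I_N => list_coef s j * simplex_vec (h j) 0 i)); last first.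
    by move=> j _; rewrite mxE hE.
  rewrite (regroup (fun o => simplex_vec o 0 i)) simplex_vecE mulrN1 addrC; congr (_ - _).
  rewrite (bigD1 i) //= big1 => [|k /negPf ki]; rewrite simplex_vecE ?eqxx ?mulr1 ?addr0 //.
  by rewrite eq_sym ki mulr0.
have ue i : `|a (Some i) - a None| < eps by rewrite -uE (le_lt_trans (coord_le_enorm u i)).
(* If one of the vectors were missing, the weight of the all-negative one would be at most eps and
   the others at most [2 eps], so the mass would be at most [3 n eps = 3/4]; this is where
   [eps = 1 / (4 n)] comes from. *)
have surj o : o \in codom h.
  apply/negPn/negP => Ho.
  have ao : a o = 0.
    by apply: big_pred0 => j; apply/negP => /eqP E; move: Ho; rewrite -E codom_f.
  have aN : a None <= eps.
    case: o ao {Ho} => [i ai|->]; last exact: ltW.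
    by have := ue i; rewrite ai sub0r normrN ger0_norm // => /ltW.
  move: Hone; rewrite (eq_bigr (fun j : 'I_N => list_coef s j * norm1 (simplex_vec (h j)))); last first.
    by move=> j _; rewrite hE.
  rewrite (regroup (fun o => norm1 (simplex_vec o))) simplex_vec_norm1 leNgt => /negP; apply.
  have Hi : \sum_i a (Some i) * norm1 (simplex_vec (Some i)) <= n%:R * (2 * eps).
    rewrite -[n in n%:R]card_ord mulr_natl -sumr_const; apply: ler_sum => i _.
    rewrite simplex_vec_norm1 mulr1; have := ue i; rewrite ltr_norml => /andP[_]; lra.
  apply: (@le_lt_trans _ _ (n%:R * (3%:R * eps))).
    have : a None * n%:R <= n%:R * eps by rewrite mulrC ler_wpM2l // ltW.
    rewrite -[3%:R]/(1 + 2) mulrDl mul1r mulrDr; lra.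
  rewrite (_ : n%:R * (3%:R * eps) = 3%:R / 4%:R); last by rewrite /eps; field; rewrite gt_eqF.
  by rewrite ltr_pdivrMr // mul1r ltr_nat.
have : (#|{: option 'I_n}| <= #|codom h|)%N by apply: subset_leq_card; apply/fintype.subsetP => o _; exact: surj.
by move/leq_trans => /(_ _ (leq_image_card _ _)); rewrite card_option !card_ord.
Qed.

End CertificateSize.

Section NatBounds.
Variable n : nat.
Hypothesis n0 : (0 < n)%N.

Lemma nat_cube : (n.+1 * n.+1 * n.+1 <= 8 * n ^ 3)%N.
Proof.
rewrite (_ : 8 * n ^ 3 = (2 * n) * (2 * n) * (2 * n))%N; last by ring.
by rewrite !leq_mul //; lia.
Qed.

Lemma nat_fifth : (n.+1 * n.+1 * n.+1 * n.+1 * n.+1 <= 32 * n ^ 5)%N.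
Proof.
rewrite (_ : 32 * n ^ 5 = (2 * n) * (2 * n) * (2 * n) * (2 * n) * (2 * n))%N; last by ring.
by rewrite !leq_mul //; lia.
Qed.

Lemma nat_linear k : (n.+1 * k + n.+1 * k <= 100 * (100 * (100 * (10 * k))) * n)%N.
Proof.
have : (n.+1 * k <= 2 * (k * n))%N by rewrite mulSn; have := leq_pmulr k n0; lia.
rewrite (_ : 100 * _ * n = 100 * (100 * (100 * (10 * (k * n)))))%N; last by ring.
by move: (n.+1 * k)%N (k * n)%N; clear; lia.
Qed.

Lemma nat_cubic k :
  (n.+1 * (600 * (n.+1 * n.+1)) * k + n.+1 * (600 * (n.+1 * n.+1)) * k
   <= 100 * (100 * (100 * (10 * k))) * n ^ 3)%N.
Proof.
have : (n.+1 * n.+1 * n.+1 * k <= 8 * (n ^ 3 * k))%N by rewrite mulnA leq_mul2r nat_cube orbT.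
rewrite (_ : 100 * _ * _ = 100 * (100 * (100 * (10 * (n ^ 3 * k)))))%N; last by ring.
rewrite (_ : n.+1 * (600 * (n.+1 * n.+1)) * k = 600 * (n.+1 * n.+1 * n.+1 * k))%N; last by ring.
by move: (n ^ 3 * k)%N (_ * k)%N; clear; lia.
Qed.

Lemma const_ge16 k : (0 < k)%N -> (16 <= 100 * (100 * (100 * (10 * k))))%N.
Proof. by clear; lia. Qed.

End NatBounds.

(** * Adding up the phases *)

Section Totals.
Variables (R : realType) (nu_o nu_a : R).
Hypotheses (nu_o_ge1 : 1 <= nu_o) (nu_a_ge1 : 1 <= nu_a).
Variables (g_o g_a : nat -> R) (tau : nat -> nat) (A : cmd).
Notation To := (cost_fun g_o nu_o).
Notation Ta := (cost_fun g_a nu_a).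
Hypothesis HA : solves_approx_conic_dual A To Ta tau.
Variables (kappa n p : nat) (delta : R).
Hypotheses (kappa_o : 2 * 4%:R `^ nu_o <= kappa%:R) (kappa_a : 2 * 4%:R `^ nu_a <= kappa%:R).
Hypotheses (kappa0 : (0 < kappa)%N) (n0 : (0 < n)%N).
Hypothesis budget_p : forall C, (16 <= C)%N ->
  2 ^+ p * ln (4%:R * n%:R : R) <= 2 * budget n C delta.
Hypothesis phases_p : p.+1%:R <= 5%:R * loglog_inv delta.
Let C := (100 * (100 * (100 * (10 * kappa))))%N.
Let D : R := delta / (C%:R * n%:R).
Notation x2 := (n.+1 * n.+1)%N.
Notation x3 := (n.+1 * n.+1 * n.+1)%N.
Notation x4 := (n.+1 * n.+1 * n.+1 * n.+1)%N.
Notation x5 := (n.+1 * n.+1 * n.+1 * n.+1 * n.+1)%N.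

Let C16 : (16 <= C)%N := const_ge16 kappa0.

(** Read off from a run with [eps = 1], the logarithmic factors being positive. *)
Lemma cost_factor_ge0 : 0 <= g_o n /\ 0 <= g_a n.
Proof.
have [H1 H2] := ToTa_ge0 HA n0 (@ltr01 R).
have P (nu : R) : 0 < lg (n%:R / (1 : R)) `^ nu.
  by rewrite powR_gt0 // (lt_le_trans ltr01) // /lg le_max lexx.
by move: H1 H2; rewrite /cost_fun !pmulr_lge0 ?P.
Qed.

Lemma To_sum : \sum_(i < p.+1) To n (epsk R n i) <= kappa%:R * To n D.
Proof.
have [g0 _] := cost_factor_ge0.
apply: le_trans (cost_sum n0 nu_o_ge1 g0 (budget_p C16)) _.
by rewrite ler_wpM2r // /cost_fun mulr_ge0 ?powR_ge0.
Qed.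

Lemma Ta_sum : \sum_(i < p.+1) Ta n (epsk R n i) <= kappa%:R * Ta n D.
Proof.
have [_ g0] := cost_factor_ge0.
apply: le_trans (cost_sum n0 nu_a_ge1 g0 (budget_p C16)) _.
by rewrite ler_wpM2r // /cost_fun mulr_ge0 ?powR_ge0.
Qed.

Let ToD0 : 0 <= To n D.
Proof. by have [g0 _] := cost_factor_ge0; rewrite /cost_fun mulr_ge0 ?powR_ge0. Qed.
Let TaD0 : 0 <= Ta n D.
Proof. by have [_ g0] := cost_factor_ge0; rewrite /cost_fun mulr_ge0 ?powR_ge0. Qed.

Lemma qb_ge0 : 0 <= qb n To p.
Proof.
apply: sumr_ge0 => i _; apply: mulr_ge0; first exact: ler0n.
by case: (ToTa_ge0 HA n0 (@epsk_gt0 R n n0 i)).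
Qed.

Lemma qb_le : qb n To p + qb n To p <= calls_bound C To n delta.
Proof.
rewrite /calls_bound -/D /qb -mulr_sumr.
have H := To_sum.
have {}H : n.+1%:R * \sum_(i < p.+1) To n (epsk R n i) <= n.+1%:R * (kappa%:R * To n D).
  by rewrite ler_wpM2l.
apply: le_trans (lerD H H) _; rewrite mulrA -mulrDl ler_wpM2r //.
by rewrite -!natrM -natrD ler_nat; exact: nat_linear.
Qed.

Definition phase_const (ex : nat) : nat :=
  (n.+1 * (700 * x2 * tau n + 3000 * x3 + 3) + 60 * 100 * x4 +
   (if (0 < ex)%N then 0 else 100 * 100 * x5) + 10)%N.

Lemma tbE ex : tb n To Ta tau ex p =
  n.+1%:R * (\sum_(i < p.+1) Ta n (epsk R n i)) +
  (n.+1 * (600 * x2))%N%:R * (\sum_(i < p.+1) To n (epsk R n i)) +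
  p.+1%:R * (phase_const ex)%:R + (20 * n.+1)%N%:R.
Proof.
rewrite /tb; congr (_ + _).
have -> : p.+1%:R * (phase_const ex)%:R = \sum_(i < p.+1) (phase_const ex)%:R :> R.
  by rewrite sumr_const card_ord mulr_natl.
rewrite !mulr_sumr -!big_split /=.
apply: eq_bigr => i _; rewrite /PT /phase_const.
move: (600 * x2)%N (700 * x2 * tau n)%N (3000 * x3)%N (60 * 100 * x4)%N => a1 a2 a3 a4.
move: (if _ then _ else _) => a5.
rewrite !natrD !natrM !natrD; ring.
Qed.

Lemma tb_ge0 ex : 0 <= tb n To Ta tau ex p.
Proof.
have [g0 g1] := cost_factor_ge0.
rewrite tbE; apply: addr_ge0; last exact: ler0n.
apply: addr_ge0; last by apply: mulr_ge0; exact: ler0n.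
by apply: addr_ge0; (apply: mulr_ge0; first exact: ler0n); apply: sumr_ge0 => i _;
  rewrite /cost_fun mulr_ge0 ?powR_ge0.
Qed.

(** The bound is stated for two runs of [CORE], as the ratio problem needs them; a single run is
    covered since [tb] is nonnegative. *)
Lemma tb_le ex w :
  (10 * phase_const ex + 40 * n.+1 + 1000 * x2 <= 100 * (100 * (100 * 10)) * w)%N ->
  tb n To Ta tau ex p + tb n To Ta tau ex p + (1000 * x2)%N%:R <=
  ops_bound C To Ta w n delta.
Proof.
move=> Hw; rewrite tbE /ops_bound -/D.
have HTa := Ta_sum; have HTo := To_sum.
set sa := \sum_(i < p.+1) Ta n _ in HTa *; set so := \sum_(i < p.+1) To n _ in HTo *.
have lam1 : 1 <= loglog_inv delta by rewrite /loglog_inv /lg le_max lexx.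
set lam := loglog_inv delta in lam1 *.
have E1 : n.+1%:R * sa + n.+1%:R * sa <= C%:R * n%:R * Ta n D.
  have H : n.+1%:R * sa <= n.+1%:R * (kappa%:R * Ta n D) by apply: ler_wpM2l => //; exact: ler0n.
  apply: le_trans (lerD H H) _; rewrite mulrA -mulrDl; apply: ler_wpM2r => //.
  by rewrite -!natrM -natrD ler_nat; exact: nat_linear.
have E2 : (n.+1 * (600 * x2))%N%:R * so + (n.+1 * (600 * x2))%N%:R * so <= C%:R * n%:R ^+ 3 * To n D.
  set b := (n.+1 * _)%N.
  have H : b%:R * so <= b%:R * (kappa%:R * To n D) by apply: ler_wpM2l => //; exact: ler0n.
  apply: le_trans (lerD H H) _; rewrite mulrA -mulrDl; apply: ler_wpM2r => //.
  by rewrite -natrX -!natrM -natrD ler_nat; exact: nat_cubic.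
suff E3 : p.+1%:R * (phase_const ex)%:R + p.+1%:R * (phase_const ex)%:R + ((20 * n.+1)%N%:R + (20 * n.+1)%N%:R)
    + (1000 * x2)%N%:R <= C%:R * w%:R * lam.
  move: E1 E2 E3; move: (C%:R * _ * _) (C%:R * _ * _) (C%:R * _ * _) (n.+1%:R * sa)
    ((n.+1 * (600 * x2))%N%:R * so) (p.+1%:R * _) (20 * n.+1)%N%:R (1000 * x2)%N%:R.
  by move=> *; lra.
have Hp : p.+1%:R * (phase_const ex)%:R <= lam * (5 * phase_const ex)%N%:R.
  rewrite (natrM _ 5) mulrCA mulrA ler_wpM2r // ; lra.
have lamM (k : nat) : k%:R <= lam * k%:R by rewrite ler_peMl.
have {}Hw : (5 * phase_const ex + 5 * phase_const ex + (20 * n.+1 + 20 * n.+1) + 1000 * x2 <= C * w)%N.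
  rewrite -!mulnDl; apply: leq_trans Hw _; rewrite leq_mul2r; apply/orP; right; rewrite /C.
  by move: kappa0; clear; lia.
have := lamM (20 * n.+1)%N; have := lamM (1000 * x2)%N.
move: Hw Hp; move: (5 * phase_const ex)%N (20 * n.+1)%N (1000 * x2)%N (p.+1%:R * _) => a1 a2 a3 a4.
rewrite -[C%:R * _]natrM; move: (C * w)%N => cw.
rewrite -(ler_nat R) !natrD => Hw H1 H2 H3.
have : lam * (a1%:R + a1%:R + (a2%:R + a2%:R) + a3%:R) <= lam * cw%:R.
  by rewrite ler_wpM2l // (le_trans ler01).
rewrite [leRHS]mulrC !mulrDr; lra.
Qed.

(** The inequality [n < tau n] moves the terms of degree 4 into [n^3 tau n]; the summand [n ^ 5]
    pays for trimming and is absent in exact mode. *)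
Lemma phase_const_le ex :
  (10 * phase_const ex + 40 * n.+1 + 1000 * x2 <=
   100 * (100 * (100 * 10)) * ((if 0 < ex then 0 else n ^ 5) + n ^ 3 * tau n))%N.
Proof.
have tn := certificate_size n0 HA; rewrite /phase_const.
have n3 := nat_cube n0; have n5 := nat_fifth n0.
have n4 : (x4 <= x3 * tau n)%N by rewrite leq_mul2l tn orbT.
have x23 : (x2 <= x3)%N by rewrite leq_pmulr.
have x12 : (n.+1 <= x2)%N by rewrite leq_pmulr.
have x34 : (x3 <= x4)%N by rewrite leq_pmulr.
have nt : (x3 * tau n <= 8 * (n ^ 3 * tau n))%N by rewrite mulnA leq_mul2r n3 orbT.
rewrite (_ : n.+1 * _ = 700 * (x3 * tau n) + 3000 * x4 + 3 * n.+1)%N; last by ring.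
move: n3 n5 n4 x23 x12 x34 nt.
move: (x3 * tau n)%N (n ^ 3 * tau n)%N x5 x4 x3 x2 (n ^ 5)%N (n ^ 3)%N => b1 b2 b3 b4 b5 b6 b7 b8.
by clear; case: ifP => _; lia.
Qed.

End Totals.

Theorem theorem1p7 (R : realType) (nu_o nu_a : R)
    (nu_o_ge1 : 1 <= nu_o) (nu_a_ge1 : 1 <= nu_a) :
  exists C k : nat,
  forall (g_o g_a : nat -> R) (tau : nat -> nat) (A : cmd),
    let To := cost_fun g_o nu_o in
    let Ta := cost_fun g_a nu_a in
    poly_bounded g_o -> poly_bounded g_a ->
    solves_approx_conic_dual A To Ta tau ->
    [/\ exists B : cmd, solves_strong_feasibility B C k To Ta tau,
        exists B : cmd, solves_validity B C k To Ta tau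
      & exists B : cmd, solves_min_ratio B C k To Ta tau].
Proof.
(* [kappa] dominates the constants of [cost_sum] for both exponents and depends on nothing else, so
   [C] is uniform in [g_o], [g_a], [tau] and [A]. *)
pose kappa := (Num.truncn (2 * 4%:R `^ nu_o) + Num.truncn (2 * 4%:R `^ nu_a)).+1.
have ko : 2 * 4%:R `^ nu_o <= kappa%:R :> R.
  apply: le_trans (ltW (truncnS_gt _)) _.
  by rewrite ler_nat ltnS leq_addr.
have ka : 2 * 4%:R `^ nu_a <= kappa%:R :> R.
  apply: le_trans (ltW (truncnS_gt _)) _.
  by rewrite ler_nat ltnS leq_addl.
have k0 : (0 < kappa)%N by [].
clearbody kappa; pose C := (100 * (100 * (100 * (10 * kappa))))%N.
have C3 : (3 <= C)%N by rewrite /C; clear -k0; lia.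
(* Output lists have at most [n + 2 <= 3 n] entries, so the exponent 1 is enough. *)
exists C, 1%N => g_o g_a tau A To Ta _ _ HA.
have len n : (0 < n)%N -> (n.+2 <= C * n ^ 1)%N.
  by move=> n0; rewrite expn1; apply: (@leq_trans (3 * n)); [lia | rewrite leq_mul2r C3 orbT].
have bounds m n (M : 'M[R]_(m, n)) (n0 : (0 < n)%N) : exists p,
    [/\ good n (cond_number M) (epsk R n p), 0 <= qb n To p,
      qb n To p + qb n To p <= calls_bound C To n (cond_number M),
      (forall ex, 0 <= tb n To Ta tau ex p)
    & forall ex, tb n To Ta tau ex p + tb n To Ta tau ex p + (1000 * (n.+1 * n.+1))%N%:R <=
      ops_bound C To Ta ((if (0 < ex) then 0 else n ^ 5) + n ^ 3 * tau n)%N n (cond_number M)].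
  have [p [H1 H2 H3]] := phase_exists n0 (cond_number_gt0 M) (cond_number_le1 M).
  exists p; split=> //.
  - exact: (qb_ge0 HA _ n0).
  - exact: (qb_le nu_o_ge1 HA ko k0 n0 H2).
  - by move=> ex; exact: (tb_ge0 HA _ n0).
  - move=> ex; apply: (tb_le nu_o_ge1 nu_a_ge1 HA ko ka k0 n0 H2 H3).
    exact: (phase_const_le HA n0).
split.
- exists (FEAS A) => m n M o s K m1 delta n0 Ho Hn Hm.
  have [p [Hg q0 Hq t0 Ht]] := bounds _ _ M n0.
  have [s' [t [l [He Hl Hto Hpost]]]] := FEAS_spec HA n0 Ho Hn Hm Hg.
  exists s', t, l; split=> //.
  + by apply: le_trans Hl _; apply: le_trans _ Hq; rewrite lerDl.
  + apply: le_trans Hto _; apply: le_trans _ (Ht 1%N); apply: lerD; first by rewrite lerDl; exact: t0.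
    by rewrite ler_nat; apply: leq_mul.
  + case: Hpost => [H|[H1 [H2 H3]]]; [by left | right; split=> //; split=> //].
    exact: leq_trans H2 (len n n0).
- exists (VALID A) => m n M c o s K delta n0 Ho Hn Hc.
  have [p [Hg q0 Hq t0 Ht]] := bounds _ _ M n0.
  have [s' [t [l [He Hl Hto Hpost]]]] := VALID_spec HA n0 Ho Hn Hc Hg.
  exists s', t, l; split=> //.
  + by apply: le_trans Hl _; apply: le_trans _ Hq; rewrite lerDl.
  + apply: le_trans Hto _; apply: le_trans _ (Ht 0%N); apply: lerD; first by rewrite lerDl; exact: t0.
    by rewrite ler_nat; apply: leq_mul.
  + case: Hpost => [H|[H1 [H2 H3]]]; [by left | right; split=> //; split=> //].
    exact: leq_trans H2 (len n n0).
- exists (RATIO A) => m n M c d yd o_d o_eq s delta noS n0 Hyd Hd Hs Hod Hoe Hn Hc Hdd HL Hrep.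
  have [p [Hg q0 Hq t0 Ht]] := bounds _ _ M n0.
  have [s' [t [l [He Hl Hto Hpost]]]] := RATIO_spec HA n0 Hyd Hd Hod Hoe Hs Hn Hc Hdd HL Hrep Hg.
  exists s', t, l; split=> //.
  + exact: le_trans Hl Hq.
  + exact: le_trans Hto (Ht 0%N).
  + case: Hpost => P1 P2 P3; split=> //.
    * move=> gamma /P1 [Q1 Q2 Q3 Q4 Q5]; split=> //; exact: leq_trans Q4 (len n n0).
    * move=> /P2 [Q1 Q2 Q3]; split=> //; exact: leq_trans Q2 (len n n0).
Qed.
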